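(* Let $\rho$ be a two-dimensional irreducible representation of $\Gamma_0(2)$ such that $\rho(T)$ has finite order, $c\in\mathbf{Q}$ and $[\mathbf{Q}(r):\mathbf{Q}]=2$. Let $k\in\mathbf{Z}$ and let $Z$ be a nonzero element of $M_k(\rho')$ all of whose component Fourier coefficients lie in $L=\mathbf{Q}(\sqrt M)$; let $Z_1,Z_2$ be its component functions. If $S$ is infinite, then every sufficiently large prime in $S$ divides the denominator of at least one Fourier coefficient of $Z_1$; in particular the denominators of the Fourier coefficients of $Z_1$ are unbounded. If $\widetilde S$ is infinite, then every sufficiently large prime in $\widetilde S$ divides the denominator of some Fourier coefficient of $Z_2$; in particular the denominators of the Fourier coefficients of $Z_2$ are unbounded.
   Context: $q=e^{2\pi i\tau}$, $q^s=e^{2\pi is\tau}$, $\Gamma_0(2)=\{\gamma\in\mathrm{SL}_2(\mathbf{Z}):\gamma_{21}\equiv0\bmod2\}$, $T=\begin{pmatrix}1&1\\0&1\end{pmatrix}$, $(F|_k\gamma)(\tau)=(c\tau+d)^{-k}F(\frac{a\tau+b}{c\tau+d})$. $M_k(\sigma)$ = holomorphic $F:\mathfrak{H}\to\mathbf{C}^2$ with $F|_k\gamma=\sigma(\gamma)F$ on $\Gamma_0(2)$, holomorphic at all cusps. $E_2=1-24\sum\sigma(n)q^n$, $E_4=1+240\sum\sigma_3(n)q^n$, $G(\tau)=-E_2(\tau)+2E_2(2\tau)$, $D_kA=\frac{1}{2\pi i}A'-\frac{k}{12}E_2A$. For irreducible $\rho$: $k_0$ least with $M_{k_0}(\rho)\ne0$,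 $F\ne0$ in it; $a,b,c$ unique with $D_{k_0+2}D_{k_0}F+aGD_{k_0}F+(bG^2+cE_4)F=0$; $r$ a root of $r^2-(a+\frac13)r+b+4c=0$. Fix $X$ with $X\rho(T)X^{-1}=\mathrm{diag}(e^{2\pi im_1},e^{2\pi im_2})$ ($|m_1|\le|m_2|$); components of $XF$ are $\lambda_iq^{k_0/12+l_i}(1+O(q))$, $\lambda_i\ne0$; $E=\mathrm{diag}(\lambda_1^{-1},\lambda_2^{-1})X$, $F'=EF$, $\rho'=E\rho E^{-1}$. Each component of $Z\in M_k(\rho')$ is $q^\mu\sum_{n\ge0}c_nq^n$; the $c_n$ are its Fourier coefficients. $A=r+l_1$, $B=r+l_2$, $A-B=u/v$ with $u,v\in\mathbf{Z}$, $v>1$, $\gcd(u,v)=1$; $M$ square-free with $\mathbf{Q}(r)=\mathbf{Q}(\sqrt M)$; $S$ (resp. $\widetilde S$) = odd primes $p$ with $M$ a non-residue mod $p$ and $p\equiv u$ (resp. $-u$) $\pmod v$. The denominator of algebraic $\zeta$ is the least positive integer $N$ with $N\zeta$ an algebraic integer. *)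

(* Defs.v *)
From mathcomp Require Import all_boot all_order all_algebra.
From mathcomp Require Import all_classical all_reals all_analysis.
From mathcomp Require Import complex.

Set Implicit Arguments.
Unset Strict Implicit.
Unset Printing Implicit Defensive.

Import Order.TTheory GRing.Theory Num.Theory numFieldNormedType.Exports.

Local Open Scope classical_set_scope.
Local Open Scope ring_scope.

(* The complex numbers over R.  Going through numClosedFieldType gives access
   to the normed-module structure of C over itself, so that [derivable] and
   [derive1] below are complex differentiability and the complex derivative. *)
Definition CC (R : realType) : numClosedFieldType := complex R.

Definition toC (R : realType) (x : R) : CC R := Complex x 0.
Definition re (R : realType) (z : CC R) : R := complex.Re z.
Definition im (R : realType) (z : CC R) : R := complex.Im z.

Definition cexp (R : realType) (z : CC R) : CC R :=
  toC (expR (re z)) * Complex (cos (im z)) (sin (im z)).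

Definition twopii (R : realType) : CC R := Complex 0 (2 * pi).

Definition upper (R : realType) (tau : CC R) : Prop := 0 < im tau.

(* q^s, for an arbitrary complex exponent s *)
Definition qpow (R : realType) (s tau : CC R) : CC R :=
  cexp (twopii R * s * tau).

Definition csum (R : realType) (u : nat -> CC R) : CC R :=
  lim ((fun N : nat => \sum_(0 <= n < N) u n : CC R) @ \oo).

Definition sigmak (k n : nat) : nat := \sum_(d <- divisors n) d ^ k.

Definition E2 (R : realType) (tau : CC R) : CC R :=
  1 - 24%:R * csum (fun n : nat => (sigmak 1 n.+1)%:R * qpow (n.+1)%:R tau).

Definition E4 (R : realType) (tau : CC R) : CC R :=
  1 + 240%:R * csum (fun n : nat => (sigmak 3 n.+1)%:R * qpow (n.+1)%:R tau).

Definition Gform (R : realType) (tau : CC R) : CC R :=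
  - E2 tau + 2%:R * E2 (2%:R * tau).

Definition serreD (R : realType) (k : int) (A : CC R -> CC R) (tau : CC R)
  : CC R :=
  (twopii R)^-1 * derive1 A tau - k%:~R / 12%:R * E2 tau * A tau.

Definition SL2Z : set 'M[int]_2 := [set g | \det g = 1].

Definition Gamma02 : set 'M[int]_2 :=
  [set g : 'M[int]_2 | \det g = 1 /\ (2 %| (g 1 0)%R)%Z].

Definition Tmat : 'M[int]_2 :=
  \matrix_(i < 2, j < 2) (if (i == 1) && (j == 0) then 0 else 1).

Definition moebius (R : realType) (g : 'M[int]_2) (tau : CC R) : CC R :=
  ((g 0 0)%:~R * tau + (g 0 1)%:~R) / ((g 1 0)%:~R * tau + (g 1 1)%:~R).

Definition slash (R : realType) (k : int) (F : CC R -> 'cV[CC R]_2)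
    (g : 'M[int]_2) (tau : CC R) : 'cV[CC R]_2 :=
  ((g 1 0)%:~R * tau + (g 1 1)%:~R) ^ (- k) *: F (moebius g tau).

(* Only the values of rho on Gamma02 matter.  Invertibility of these values
   follows from the two equations. *)
Definition is_rep (R : realType) (rho : 'M[int]_2 -> 'M[CC R]_2) : Prop :=
  rho 1 = 1 /\
  (forall g h, Gamma02 g -> Gamma02 h -> rho (g *m h) = rho g *m rho h).

Definition irreducible_rep (R : realType) (rho : 'M[int]_2 -> 'M[CC R]_2)
  : Prop :=
  is_rep rho /\
  (forall W : {vspace 'cV[CC R]_2},
      (forall g, Gamma02 g -> forall w, w \in W -> rho g *m w \in W) ->
      W = 0%VS \/ W = fullv).

(* Components are indexed by 'I_2: index 0 is the first one, 1 the second. *)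
Definition component (R : realType) (F : CC R -> 'cV[CC R]_2) (i : 'I_2)
  : CC R -> CC R := fun tau => F tau i 0.

Definition holomorphicH (R : realType) (f : CC R -> CC R) : Prop :=
  forall tau, upper tau -> derivable f tau 1.

(* Holomorphy at all cusps, for a representation that need not be unitary:
   for every g in SL_2(Z), F|_k g has moderate growth as Im tau -> +oo in the
   strip |Re tau| <= 1, whose width is the largest cusp width of Gamma_0(2).
   For a solution of the functional equation this says that only exponents of
   nonnegative real part occur in the (possibly logarithmic) expansions of F
   at the cusps. *)
Definition holomorphic_at_cusps (R : realType) (k : int)
    (F : CC R -> 'cV[CC R]_2) : Prop :=
  forall g, SL2Z g -> forall i : 'I_2,
  exists (K y0 : R) (N : nat), 0 < y0 /\
    forall tau : CC R, `|re tau| <= 1 -> y0 <= im tau ->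
      `|component (slash k F g) i tau| <= toC (K * im tau ^+ N).

Definition modform (R : realType) (k : int) (rho : 'M[int]_2 -> 'M[CC R]_2)
    (F : CC R -> 'cV[CC R]_2) : Prop :=
  [/\ forall i, holomorphicH (component F i),
      forall g, Gamma02 g -> forall tau, upper tau ->
        slash k F g tau = rho g *m F tau
    & holomorphic_at_cusps k F].

(* Functions are total on CC R, but only their values on the upper half-plane
   count. *)
Definition nonzeroH (R : realType) (F : CC R -> 'cV[CC R]_2) : Prop :=
  exists tau, upper tau /\ F tau != 0.

Definition minimal_weight (R : realType) (rho : 'M[int]_2 -> 'M[CC R]_2)
    (k0 : int) : Prop :=
  (exists F, modform k0 rho F /\ nonzeroH F) /\
  (forall k F, modform k rho F -> nonzeroH F -> k0 <= k).

Definition modular_ode (R : realType) (k0 : int) (a b c : CC R)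
    (f : CC R -> CC R) : Prop :=
  forall tau, upper tau ->
    serreD (k0 + 2) (serreD k0 f) tau + a * Gform tau * serreD k0 f tau
      + (b * Gform tau ^+ 2 + c * E4 tau) * f tau = 0.

(* f = q^mu * \sum_n c_n q^n on the upper half-plane *)
Definition qexpansion (R : realType) (f : CC R -> CC R) (mu : CC R)
    (c : nat -> CC R) : Prop :=
  forall tau, upper tau ->
    (fun N : nat => qpow mu tau * \sum_(0 <= n < N) c n * qpow n%:R tau : CC R)
      @ \oo --> f tau.

(* f = lambda q^mu (1 + O(q)) with lambda <> 0 *)
Definition leading_term (R : realType) (f : CC R -> CC R) (mu lambda : CC R)
  : Prop :=
  lambda != 0 /\ exists c, qexpansion f mu c /\ c 0%N = lambda.

(* The subfield Q(z) of the complex numbers *)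
Definition Qadj (R : realType) (z : CC R) : set (CC R) :=
  [set x | exists p d : {poly rat},
     (map_poly ratr d).[z] != 0 /\
     x = (map_poly ratr p).[z] / (map_poly ratr d).[z]].

(* V is a rational vector space of dimension n: every element of V, and nothing
   else, is a rational combination of e_1, ..., e_n, in exactly one way *)
Definition Qdim (R : realType) (V : set (CC R)) (n : nat) : Prop :=
  exists e : 'I_n -> CC R,
    (forall x : CC R,
       V x <-> exists t : 'rV[rat]_n, x = \sum_(i < n) ratr (t 0 i) * e i) /\
    (forall t t' : 'rV[rat]_n,
       \sum_(i < n) ratr (t 0 i) * e i = \sum_(i < n) ratr (t' 0 i) * e i ->
       t = t').

Definition squarefree (M : int) : Prop :=
  forall d : int, (d ^+ 2 %| M)%Z -> `|d|%N = 1%N.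

Definition algint (R : realType) (z : CC R) : Prop :=
  integralOver (intr : int -> CC R) z.

Definition is_denominator (R : realType) (z : CC R) (N : nat) : Prop :=
  [/\ (0 < N)%N, algint (N%:R * z)
    & forall N' : nat, (0 < N')%N -> algint (N'%:R * z) -> (N <= N')%N].

Definition Sset (M u v : int) : set nat :=
  [set p | [/\ prime p, odd p,
     ~ (exists x : int, (x ^+ 2 = M %[mod p%:Z])%Z)
     & (p%:Z = u %[mod v])%Z]].

Definition large_primes_divide_denominators (R : realType) (S : set nat)
    (c : nat -> CC R) : Prop :=
  exists P : nat, forall p : nat, S p -> (P < p)%N ->
    exists n N : nat, is_denominator (c n) N /\ (p %| N)%N.

Definition unbounded_denominators (R : realType) (c : nat -> CC R) : Prop :=
  forall K : nat, exists n N : nat, is_denominator (c n) N /\ (K < N)%N.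

(* Main.v *)
(* Let x = Delta(2 tau)/Delta(tau) be the Hauptmodul of Gamma0(2).  In terms of x the
   differential equation of F becomes hypergeometric: up to factors that are integral at
   almost all primes, the components of F' are x^(l_i) g_i(x) with
     n (n + l_i - l_j) g_(i,n) = -64 (n-1 + l_i + r) (n-1 + l_i + r') g_(i,n-1),
   where r' is the other root of the quadratic equation of r.  The l_i are rational, as
   rho(T) has finite order, and r, r' are not, so at a large prime p inert in Q(sqrt M)
   the right-hand factors are units, and p first appears in a denominator at
   n + u/v = p/v, that is n = (p - u)/v.  From there on the coefficients p g_(1,n) repeat,
   modulo p and up to a unit, the coefficients of g_2.
   By Cramer's rule Z = alpha F' + beta D F', where alpha and beta are forms on Gamma0(2)
   with trivial character; multiplied by powers of G and of x/Delta they become polynomials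
   in x over Q(sqrt M).  A coefficient of the second component that is nonzero, hence a
   unit at almost all p, therefore produces a coefficient of the first component with p in
   its denominator. *)

From HB Require Import structures.
Require Import Defs.
From mathcomp Require Import all_boot all_order all_algebra.
From mathcomp Require Import all_classical all_reals all_analysis.
From mathcomp Require Import complex.
From mathcomp Require Import ring lra zify.

Set Implicit Arguments.
Unset Strict Implicit.
Unset Printing Implicit Defensive.

Import Order.TTheory GRing.Theory Num.Theory numFieldNormedType.Exports.

Local Open Scope classical_set_scope.
Local Open Scope ring_scope.

(** * Complex numbers and the exponential *)

(** The hypergeometric shape rests on two identities: G^6 x / Delta = (1 + 64 x)^3 and (1 + 64 x) E4
    = (1 + 256 x) G^2, the latter up to the factor c of the equation. They eliminate theta G and E4,
    the terms in E2 cancel, and the recurrence is read in powers of x; its right-hand quadratic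
    vanishes at n + l_i = -r, which is where the equation of r comes from. Both identities, and the
    polynomials given by Cramer's rule, need a valence argument, reduced here to the vanishing of
    forms of weight -12, so that no contour integral occurs. Its input is growth at the cusp 0,
    invisible on expansions at infinity: for F and D F it comes from a Gronwall estimate on the
    differential equation transported by S. The law of Delta follows from that of E2; that of c E4
    is read off the equation of F. The exponents of Z and F differ only by integers, so Z is
    multiplied by a power of x. Exponentials of p-integral series stay p-integral only below index
    p, so q-series and x-series are compared at p only there. *)

Section Complex.
Variable R : realType.
Local Notation C := (CC R).
Implicit Types (z w : C) (x y : R).

(** The norm of [CC R] takes its values in [CC R]; a real-valued one makes real order and linear
    arithmetic available. *)
Definition nm z : R := Num.sqrt (re z ^+ 2 + im z ^+ 2).

Lemma normE z : `|z| = toC (nm z).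
Proof. exact: normc_def. Qed.

Lemma toC_inj : injective (@toC R). Proof. by move=> x y []. Qed.

Lemma toCD x y : toC (x + y) = toC x + toC y :> C.
Proof. by rewrite /toC /GRing.add /= addr0. Qed.
Lemma toCM x y : toC (x * y) = toC x * toC y :> C.
Proof. by rewrite /toC {2}/GRing.mul /= !mulr0 mul0r subr0 addr0. Qed.
Lemma toCN x : toC (- x) = - toC x :> C.
Proof. by rewrite /toC {2}/GRing.opp /= oppr0. Qed.
Lemma toC0 : toC 0 = 0 :> C. Proof. by []. Qed.
Lemma toC1 : toC 1 = 1 :> C. Proof. by []. Qed.
Lemma toCX x n : toC (x ^+ n) = toC x ^+ n :> C.
Proof. by elim: n => [|n IH]; rewrite ?expr0 // !exprS toCM IH. Qed.
Lemma toC_nat n : toC n%:R = n%:R :> C.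
Proof. by elim: n => [|n IH] //; rewrite !mulrS toCD IH. Qed.
Lemma toCV x : toC x^-1 = (toC x)^-1 :> C.
Proof.
have [->|x0] := eqVneq x 0; first by rewrite invr0 toC0 invr0.
apply: (@mulfI _ (toC x)); first by rewrite -toC0 (inj_eq toC_inj).
by rewrite -toCM !divff // -?toC0 ?(inj_eq toC_inj).
Qed.

Lemma reD z w : re (z + w) = re z + re w. Proof. by case: z w => [a b] [c d]. Qed.
Lemma imD z w : im (z + w) = im z + im w. Proof. by case: z w => [a b] [c d]. Qed.
Lemma reN z : re (- z) = - re z. Proof. by case: z. Qed.
Lemma imN z : im (- z) = - im z. Proof. by case: z. Qed.
Lemma reM z w : re (z * w) = re z * re w - im z * im w.
Proof. by case: z w => [a b] [c d]. Qed.
Lemma imM z w : im (z * w) = re z * im w + im z * re w.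
Proof. by case: z w => [a b] [c d]; rewrite /im /=. Qed.
Lemma re_toC x : re (toC x) = x. Proof. by []. Qed.
Lemma im_toC x : im (toC x) = 0. Proof. by []. Qed.
Lemma ceq z w : re z = re w -> im z = im w -> z = w.
Proof. by case: z w => [a b] [c d]; rewrite /re /im /= => -> ->. Qed.
Lemma re_nat n : re (n%:R : C) = n%:R. Proof. by rewrite -toC_nat. Qed.
Lemma im_nat n : im (n%:R : C) = 0. Proof. by rewrite -toC_nat. Qed.

Lemma re1 : re (1 : C) = 1. Proof. by []. Qed.
Lemma im1 : im (1 : C) = 0. Proof. by []. Qed.

Lemma nm_ge0 z : 0 <= nm z. Proof. exact: sqrtr_ge0. Qed.
Lemma nm2 z : nm z ^+ 2 = re z ^+ 2 + im z ^+ 2.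
Proof. by rewrite sqr_sqrtr // addr_ge0 // sqr_ge0. Qed.
Lemma nmM z w : nm (z * w) = nm z * nm w.
Proof. by apply: toC_inj; rewrite toCM -!normE normrM. Qed.
Lemma nmD z w : nm (z + w) <= nm z + nm w.
Proof. by rewrite -lecR; have := ler_normD z w; rewrite !normE -toCD. Qed.
Lemma nmN z : nm (- z) = nm z.
Proof. by apply: toC_inj; rewrite -!normE normrN. Qed.
Lemma nmB z w : nm (z - w) <= nm z + nm w.
Proof. by rewrite -(nmN w) nmD. Qed.
Lemma nmBC z w : nm (z - w) = nm (w - z).
Proof. by rewrite -nmN opprB. Qed.
Lemma nm_eq0 z : (nm z == 0) = (z == 0).
Proof. by rewrite -(inj_eq toC_inj) -normE normr_eq0. Qed.
Lemma nm0 : nm 0 = 0. Proof. by apply/eqP; rewrite nm_eq0. Qed.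
Lemma nm_toC x : nm (toC x) = `|x|.
Proof. by rewrite /nm /= expr0n addr0 sqrtr_sqr. Qed.
Lemma nm1 : nm 1 = 1. Proof. by rewrite -toC1 nm_toC normr1. Qed.
Lemma nm_nat n : nm n%:R = n%:R. Proof. by rewrite -toC_nat nm_toC normr_nat. Qed.
Lemma nmX z n : nm (z ^+ n) = nm z ^+ n.
Proof. by elim: n => [|n IH]; rewrite ?expr0 ?nm1 // !exprS nmM IH. Qed.
Lemma nmV z : nm z^-1 = (nm z)^-1.
Proof. by apply: toC_inj; rewrite toCV -!normE normfV. Qed.
Lemma nm_gt0 z : (0 < nm z) = (z != 0).
Proof. by rewrite lt_def nm_ge0 nm_eq0 andbT. Qed.
Lemma re_le z : `|re z| <= nm z.
Proof. by rewrite -sqrtr_sqr ler_wsqrtr // lerDl sqr_ge0. Qed.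
Lemma im_le z : `|im z| <= nm z.
Proof. by rewrite -sqrtr_sqr ler_wsqrtr // lerDr sqr_ge0. Qed.
Lemma nm_le_reim z : nm z <= `|re z| + `|im z|.
Proof.
rewrite -(@ler_pXn2r _ 2) ?nnegrE ?nm_ge0 ?addr_ge0 // nm2.
rewrite sqrrD !real_normK ?num_real // lerD2r lerDl.
by rewrite mulrn_wge0 // mulr_ge0.
Qed.
Lemma nm_lerB z w : nm z - nm w <= nm (z - w).
Proof. by rewrite lerBlDr -{1}(subrK w z) nmD. Qed.
Lemma nm_sum (I : Type) (r : seq I) (P : pred I) (F : I -> C) :
  nm (\sum_(i <- r | P i) F i) <= \sum_(i <- r | P i) nm (F i).
Proof.
elim/big_ind2: _ => //; first by rewrite nm0.
by move=> a b c d ab cd; apply: le_trans (nmD _ _) (lerD ab cd).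
Qed.

(* Unification diverges when it unfolds [CC R] to [complex R]. *)
#[global] Opaque CC.

Definition cv (u : nat -> C) (l : C) : Prop :=
  forall e : R, 0 < e -> exists N, forall n, (N <= n)%N -> nm (u n - l) < e.

Lemma gt0C (e : C) : 0 < e -> exists2 x : R, 0 < x & e = toC x.
Proof.
case: e => a b; rewrite ltcE /= => /andP[/eqP -> a0].
by exists a.
Qed.

Lemma cvP (u : nat -> C) (l : C) : (u @ \oo --> l) <-> cv u l.
Proof.
split => [/cvgrPdist_lt H e e0|H].
  have [|N _ HN] := H (toC e); first by rewrite ltcR.
  exists N => n /HN /=; rewrite normE ltcR nmBC //.
apply/cvgrPdist_lt => e /gt0C[x x0 ->].
have [N HN] := H x x0; exists N => // n /= /HN; by rewrite normE ltcR nmBC.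
Qed.

Lemma cv_uniq u l l' : cv u l -> cv u l' -> l = l'.
Proof. by move=> /cvP h /cvP h'; apply: (cvg_unique _ h h'). Qed.
Lemma cvD u v l l' : cv u l -> cv v l' -> cv (fun n => u n + v n) (l + l').
Proof. by move=> /cvP h /cvP h'; apply/cvP; exact: (cvgD h h'). Qed.
Lemma cvB u v l l' : cv u l -> cv v l' -> cv (fun n => u n - v n) (l - l').
Proof. by move=> /cvP h /cvP h'; apply/cvP; exact: (cvgB h h'). Qed.
Lemma cvM u v l l' : cv u l -> cv v l' -> cv (fun n => u n * v n) (l * l').
Proof. by move=> /cvP h /cvP h'; apply/cvP; exact: (cvgM h h'). Qed.
Lemma cvV u l : l != 0 -> cv u l -> cv (fun n => (u n)^-1) (l^-1).
Proof. by move=> l0 /cvP h; apply/cvP; exact: (cvgV l0 h). Qed.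
Lemma cv_cst l : cv (fun=> l) l.
Proof. by move=> e e0; exists 0%N => n _; rewrite subrr nm0. Qed.
Lemma eq_cv u v l : (forall n, u n = v n) -> cv u l -> cv v l.
Proof. by move=> uv h e /h[N HN]; exists N => n; rewrite -uv; apply: HN. Qed.
Lemma cv_near u v l N : (forall n, (N <= n)%N -> u n = v n) -> cv u l -> cv v l.
Proof.
move=> uv h e /h[M HM]; exists (maxn N M) => n; rewrite geq_max => /andP[a b].
by rewrite -uv //; apply: HM.
Qed.
Lemma cv_sub u l (s : nat -> nat) : (forall n, (n <= s n)%N) -> cv u l ->
  cv (fun n => u (s n)) l.
Proof.
move=> hs h e /h[N HN]; exists N => n Nn; apply: HN.
by apply: leq_trans Nn _.
Qed.
Lemma cv_le u l (B : R) : cv u l -> (forall n, nm (u n) <= B) -> nm l <= B.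
Proof.
move=> h hB; apply/ler_addgt0Pr => e /h[N /(_ N (leqnn _)) HN].
have -> : l = u N - (u N - l) by ring.
apply: le_trans (nmB _ _) _; apply: lerD => //; exact: ltW.
Qed.
Lemma cv_squeeze u l (r : nat -> R) :
  (forall n, nm (u n - l) <= r n) -> r @ \oo --> (0 : R) -> cv u l.
Proof.
move=> ur /cvgrPdist_lt h e /h[N _ HN]; exists N => n /HN /=.
rewrite sub0r normrN => hr; apply: le_lt_trans (ur n) _.
by apply: le_lt_trans (ler_norm _) hr.
Qed.

Lemma cv_shift u l k : cv u l -> cv (fun n => u (n + k)%N) l.
Proof. by apply: cv_sub => n; rewrite leq_addr. Qed.

(* complex differentiability, with real epsilon and delta *)
Definition cder (f : C -> C) (z l : C) : Prop :=
  forall e : R, 0 < e -> exists2 d : R, 0 < d &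
    forall h, nm h < d -> nm (f (z + h) - f z - l * h) <= e * nm h.

Lemma cder_cvg f z l :
  cder f z l <-> (h^-1 *: (f (h + z) - f z) @[h --> 0^'] --> l).
Proof.
have key h : h != 0 -> nm (l - h^-1 *: (f (h + z) - f z)) * nm h =
    nm (f (z + h) - f z - l * h).
  move=> h0; rewrite -nmM -nmN; congr nm.
  rewrite -mulrN mulrBl /GRing.scale /= addrC [z + h]addrC.
  by rewrite !mulrN opprK mulrAC mulVf // mul1r.
split => [H|/cvgrPdist_lt H e e0].
  apply/cvgrPdist_lt => e /gt0C[x x0 ->].
  have [d d0 hd] := H (x / 2) ltac:(lra).
  apply/nbhs_ballP; exists (toC d); first by rewrite /= ltcR.
  move=> h /=; rewrite -ball_normE /= sub0r normrN normE ltcR => hh h0.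
  rewrite normE ltcR -(@ltr_pM2r _ (nm h)) ?nm_gt0 // key //.
  apply: le_lt_trans (hd _ hh) _; rewrite ltr_pM2r ?nm_gt0 //; lra.
have /nbhs_ballP[d /= /gt0C[x x0 ->] hd] := H (toC e) ltac:(by rewrite ltcR).
exists x => // h hx; have [->|h0] := eqVneq h 0.
  by rewrite addr0 subrr mulr0 subr0 nm0 mulr0.
have := hd h; rewrite -ball_normE /= sub0r normrN normE ltcR => /(_ hx h0).
by rewrite normE ltcR -key // ler_pM2r ?nm_gt0 // => /ltW.
Qed.

Lemma cder_derive1 f z l : cder f z l -> derive1 f z = l.
Proof. by move=> /cder_cvg h; apply: cvg_lim => //; exact: norm_hausdorff. Qed.

Lemma cderE f z l : cder f z l <-> is_derive z (1 : C) f l.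
Proof.
have E : (fun h : C => h^-1 *: ((f \o shift z) (h *: (1 : C)) - f z)) =
         (fun h : C => h^-1 *: (f (h + z) - f z)).
  by apply/funext => h /=; rewrite /GRing.scale /= mulr1.
split => [H|[H1 H2]].
  have /cder_cvg H' := H.
  split; last by rewrite /derive E; exact: (cder_derive1 H).
  by rewrite /derivable E; apply: (cvgP l).
by apply/cder_cvg; rewrite -H2 /derive E; move: H1; rewrite /derivable E.
Qed.

Lemma eq_cder f g z l (d : R) : 0 < d ->
  (forall h, nm h < d -> f (z + h) = g (z + h)) -> cder f z l -> cder g z l.
Proof.
move=> d0 fg H e /H[d' d'0 hd].
exists (Num.min d d'); first by rewrite lt_min d0.
move=> h; rewrite lt_min => /andP[h1 h2].
by rewrite -fg // -[g z]addr0 -(addr0 z) -?fg ?nm0 // !addr0; apply: hd.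
Qed.

Lemma cder_cst c z : cder (fun=> c) z 0.
Proof. by apply/cderE; apply: is_derive_cst. Qed.
Lemma cder_id z : cder id z 1.
Proof. by apply/cderE; apply: is_derive_id. Qed.
Lemma cderD f g z l l' : cder f z l -> cder g z l' ->
  cder (fun w => f w + g w) z (l + l').
Proof. by move=> /cderE ? /cderE ?; apply/cderE; apply: is_deriveD. Qed.
Lemma cderN f z l : cder f z l -> cder (fun w => - f w) z (- l).
Proof. by move=> /cderE ?; apply/cderE; apply: is_deriveN. Qed.
Lemma cderM f g z l l' : cder f z l -> cder g z l' ->
  cder (fun w => f w * g w) z (l * g z + f z * l').
Proof.
move=> /cderE H /cderE H'; apply/cderE; apply: (is_derive_eq (is_deriveM H H')).
by rewrite /GRing.scale /= addrC [g z * l]mulrC.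
Qed.
Lemma cderZ c f z l : cder f z l -> cder (fun w => c * f w) z (c * l).
Proof. by move=> H; have := cderM (cder_cst c z) H; rewrite mul0r add0r. Qed.
Lemma cderX f n z l : cder f z l ->
  cder (fun w => f w ^+ n) z (n%:R * f z ^+ n.-1 * l).
Proof.
move=> H; elim: n => [|n IH].
  by rewrite !mul0r; exact: cder_cst.
have := cderM H IH; under eq_fun do rewrite -exprS.
congr (cder _ _ _); case: n {IH} => [|n] /=; rewrite ?exprS; ring.
Qed.
Lemma cderV f z l : f z != 0 -> cder f z l ->
  cder (fun w => (f w)^-1) z (- l / f z ^+ 2).
Proof.
move=> f0 /cderE H; apply/cderE; have [H1 H2] := H.
split; first exact: derivableV.
rewrite deriveV // H2 /GRing.scale /=; field; exact: f0.
Qed.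

Lemma cder_continuous f z l : cder f z l ->
  forall e : R, 0 < e -> exists2 d : R, 0 < d &
    forall h, nm h < d -> nm (f (z + h) - f z) < e.
Proof.
move=> H e e0; have [d d0 hd] := H 1 ltac:(lra).
have l0 := nm_ge0 l.
have k0 : 0 < e / (nm l + 2) by rewrite divr_gt0 //; lra.
exists (Num.min d (e / (nm l + 2))); first by rewrite lt_min d0.
move=> h; rewrite lt_min => /andP[/hd h1 h2].
have -> : f (z + h) - f z = (f (z + h) - f z - l * h) + l * h by ring.
apply: le_lt_trans (nmD _ _) _; rewrite nmM.
move: h2; rewrite ltr_pdivlMr; last lra.
have := nm_ge0 h; nra.
Qed.

Lemma cder_comp f g z l l' : cder g z l -> cder f (g z) l' ->
  cder (fun w => f (g w)) z (l' * l).
Proof.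
move=> Hg Hf e e0; have l0 := nm_ge0 l; have l'0 := nm_ge0 l'.
(* Small enough that the two remainders, at most e1 (e1 + |l|) |h| and |l'| e1 |h|, add up to at
   most e |h|. *)
pose e1 := Num.min 1 (e / (nm l + nm l' + 2)).
have e1p : 0 < e1 by rewrite lt_min ltr01 divr_gt0 //; lra.
have e11 : e1 <= 1 by rewrite ge_min lexx.
have e1e : e1 * (nm l + nm l' + 2) <= e.
  by rewrite -ler_pdivlMr ?ge_min ?lexx ?orbT //; lra.
have [d1 d10 h1] := Hf _ e1p.
have [d2 d20 h2] := Hg _ e1p.
have [d3 d30 h3] := cder_continuous Hg d10.
exists (Num.min d2 d3); first by rewrite lt_min d20.
move=> h; rewrite lt_min => /andP[/h2 a2 /h3 a3].
have := h1 _ a3; rewrite [g z + _]addrC subrK => a1.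
have -> : f (g (z + h)) - f (g z) - l' * l * h =
  (f (g (z + h)) - f (g z) - l' * (g (z + h) - g z))
  + l' * (g (z + h) - g z - l * h) by ring.
apply: le_trans (nmD _ _) _; rewrite nmM.
have h0 := nm_ge0 h.
have b : nm (g (z + h) - g z) <= (e1 + nm l) * nm h.
  have -> : g (z + h) - g z = (g (z + h) - g z - l * h) + l * h by ring.
  apply: le_trans (nmD _ _) _; rewrite nmM mulrDl; lra.
have c1 : e1 * nm (g (z + h) - g z) <= e1 * ((e1 + nm l) * nm h).
  by rewrite ler_pM2l.
have c2 : nm l' * nm (g (z + h) - g z - l * h) <= nm l' * (e1 * nm h).
  by rewrite ler_wpM2l.
have c3 : e1 * (e1 + nm l) * nm h <= e1 * (1 + nm l) * nm h.
  by rewrite ler_wpM2r // ler_wpM2l ?lerD //; exact: ltW.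
have c4 : e1 * (nm l + nm l' + 2) * nm h <= e * nm h by rewrite ler_wpM2r.
have c5 : 0 <= e1 * nm h by rewrite mulr_ge0 // ltW.
lra.
Qed.

Lemma cder_sum n (F : 'I_n -> C -> C) (l : 'I_n -> C) z :
  (forall i, cder (F i) z (l i)) ->
  cder (fun w => \sum_(i < n) F i w) z (\sum_(i < n) l i).
Proof.
elim: n F l => [|n IH] F l H.
  under eq_fun do rewrite big_ord0; rewrite big_ord0; exact: cder_cst.
under eq_fun do rewrite big_ord_recr; rewrite big_ord_recr /=.
by have := cderD (IH _ _ (fun i => H (widen_ord (leqnSn n) i))) (H ord_max).
Qed.

Lemma cder_expz f (k : int) z l : f z != 0 -> cder f z l ->
  cder (fun w => f w ^ k) z (k%:~R * f z ^ (k - 1) * l).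
Proof.
move=> f0 H; case: k => [[|n]|n].
- by rewrite !mul0r; exact: cder_cst.
- have -> : (n.+1%:Z - 1 = n%:Z)%R by lia.
  exact: (cderX n.+1 H).
have f0' : f z ^+ n.+1 != 0 by rewrite expf_neq0.
have := @cderV (fun w => f w ^+ n.+1) z _ f0' (cderX n.+1 H).
rewrite /exprz; congr (cder _ _ _).
rewrite NegzE -opprD.
have -> : (- (n.+1%:Z + 1) = Negz n.+1)%R by rewrite NegzE; lia.
rewrite mulrNz -[_.+1%:~R]/(n.+1%:R) /= !exprS expr0.
have X0 : f z ^+ n != 0 by rewrite expf_neq0.
by move: (f z ^+ n) X0 f0 => x x0 y0; field; apply/andP.
Qed.

Lemma cexpD z w : cexp (z + w) = cexp z * cexp w.
Proof.
case: z w => [a b] [c d]; rewrite /cexp /= expRD cosD sinD.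
apply: ceq; rewrite ?(reM, imM) /=; ring.
Qed.
Lemma cexp0 : cexp (0 : C) = 1.
Proof. by rewrite /cexp /= expR0 cos0 sin0 mul1r. Qed.
Lemma cexp_neq0 z : cexp z != 0.
Proof.
have : cexp (z - z) != 0 by rewrite subrr cexp0 oner_eq0.
by rewrite cexpD mulf_eq0 negb_or => /andP[].
Qed.
Lemma cexpN z : cexp (- z) = (cexp z)^-1.
Proof.
apply: (@mulfI _ (cexp z)); first exact: cexp_neq0.
by rewrite -cexpD subrr cexp0 divff // cexp_neq0.
Qed.
Lemma cexpMn z n : cexp (n%:R * z) = cexp z ^+ n.
Proof.
elim: n => [|n IH]; first by rewrite mul0r cexp0.
by rewrite exprS -IH -cexpD -[n.+1]add1n natrD mulrDl mul1r.
Qed.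
Lemma nm_cexp z : nm (cexp z) = expR (re z).
Proof.
rewrite nmM nm_toC ger0_norm ?expR_ge0 //.
by rewrite /nm /= cos2Dsin2 sqrtr1 mulr1.
Qed.

Lemma rderE (f : R -> R) (x l : R) :
  (forall e : R, 0 < e -> exists2 d : R, 0 < d &
    forall h, `|h| < d -> `|f (x + h) - f x - l * h| <= e * `|h|) <->
  is_derive x (1 : R) f l.
Proof.
have key (h : R) : h != 0 -> `|l - h^-1 *: (f (h + x) - f x)| * `|h| =
    `|f (x + h) - f x - l * h|.
  move=> h0; rewrite -normrM -normrN; congr (`|_|).
  rewrite -mulrN mulrBl /GRing.scale /= addrC [x + h]addrC.
  by rewrite !mulrN opprK mulrAC mulVf // mul1r.
have E : (fun h : R => h^-1 *: ((f \o shift x) (h *: (1 : R)) - f x)) =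
         (fun h : R => h^-1 *: (f (h + x) - f x)).
  by apply/funext => h /=; rewrite /GRing.scale /= mulr1.
split => [H|[H1 H2]].
  have H' : h^-1 *: (f (h + x) - f x) @[h --> 0^'] --> l.
    apply/cvgrPdist_lt => e e0.
    have [d d0 hd] := H (e / 2) ltac:(lra).
    apply/nbhs_ballP; exists d => //.
    move=> h /=; rewrite -ball_normE /= sub0r normrN => hh h0.
    rewrite -(@ltr_pM2r _ `|h|) ?normr_gt0 // key //.
    apply: le_lt_trans (hd _ hh) _; rewrite ltr_pM2r ?normr_gt0 //; lra.
  split; first by rewrite /derivable E; apply: (cvgP l).
  by rewrite /derive E; apply: cvg_lim => //; exact: norm_hausdorff.
move=> e e0.
have /cvgrPdist_lt H : h^-1 *: (f (h + x) - f x) @[h --> 0^'] --> l.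
  by rewrite -H2 /derive E; move: H1; rewrite /derivable E.
have /nbhs_ballP[d /= d0 hd] := H _ e0.
exists d => // h hx; have [->|h0] := eqVneq h 0.
  by rewrite addr0 subrr mulr0 subr0 normr0 mulr0.
have := hd h; rewrite -ball_normE /= sub0r normrN => /(_ hx h0).
by rewrite -key // ler_pM2r ?normr_gt0 // => /ltW.
Qed.

(** Assembled from the real derivatives of exp, cos and sin at 0: e^a cos b - 1 - a and e^a sin b -
    b split into real remainders and products of two small factors. The additive law then moves the
    result to any point. *)
Lemma cexp_der0 : cder (@cexp R) 0 1.
Proof.
move=> e e0; pose k := Num.min (e / 16) (1 / 4).
have k0 : 0 < k by rewrite lt_min; apply/andP; split; lra.
have ke : 16 * k <= e by rewrite -ler_pdivlMl // mulrC ge_min lexx.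
have k1 : 4 * k <= 1.
  by rewrite -ler_pdivlMl // mulrC ge_min; apply/orP; right; lra.
clearbody k.
have [d1 d10 h1] := (rderE (@expR R) 0 _).2 (is_derive_expR 0) _ k0.
have [d2 d20 h2] := (rderE (@cos R) 0 _).2 (is_derive_cos 0) _ k0.
have [d3 d30 h3] := (rderE (@sin R) 0 _).2 (is_derive_sin 0) _ k0.
exists (Num.min k (Num.min d1 (Num.min d2 d3))); first by rewrite !lt_min k0 d10 d20.
move=> h; rewrite !lt_min => /and4P[a0 a1 a2 a3].
rewrite add0r cexp0 mul1r.
have ra := re_le h; have ia := im_le h.
have := h1 (re h) (le_lt_trans ra a1).
have := h2 (im h) (le_lt_trans ia a2).
have := h3 (im h) (le_lt_trans ia a3).
rewrite !add0r expR0 sin0 cos0 !mul1r oppr0 mul0r !subr0 ?addr0.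
set a := re h in ra *; set b := im h in ia *; set n := nm h in ra ia a0 *.
have n0 : 0 <= n := nm_ge0 h.
move=> S Cc X.
have -> : cexp h - 1 - h = Complex (expR a * cos b - 1 - a) (expR a * sin b - b).
  by apply: ceq; rewrite ?(reD, imD, reN, imN, reM, imM, re1, im1) /= /a /b; ring.
apply: le_trans (nm_le_reim _) _; rewrite /re /im /=.
have ab := ler_norm; have kn : 0 <= k * n by rewrite mulr_ge0 // ltW.
have B1 : `|expR a - 1 - a| <= k * n by apply: le_trans X _; rewrite ler_pM2l.
have B2 : `|cos b - 1| <= k * n by apply: le_trans Cc _; rewrite ler_pM2l.
have B3 : `|sin b - b| <= k * n by apply: le_trans S _; rewrite ler_pM2l.
have B4 : `|expR a - 1| <= 2 * n.
  have -> : expR a - 1 = (expR a - 1 - a) + a by ring.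
  apply: le_trans (ler_normD _ _) _; nra.
have B5 : `|sin b| <= 2 * n.
  have -> : sin b = (sin b - b) + b by ring.
  apply: le_trans (ler_normD _ _) _; nra.
have B6 : `|expR a - 1| <= 2 * k by apply: le_trans B4 _; rewrite ler_pM2l // ltW.
have -> : expR a * cos b - 1 - a = (expR a - 1 - a) + (expR a - 1) * (cos b - 1) + (cos b - 1) by ring.
have -> : expR a * sin b - b = (sin b - b) + (expR a - 1) * sin b by ring.
have C1 : `|(expR a - 1) * (cos b - 1)| <= 2 * k * (k * n) by rewrite normrM ler_pM.
have C2 : `|(expR a - 1) * sin b| <= 2 * k * (2 * n) by rewrite normrM ler_pM.
have D1 := ler_normD (expR a - 1 - a + (expR a - 1) * (cos b - 1)) (cos b - 1).
have D2 := ler_normD (expR a - 1 - a) ((expR a - 1) * (cos b - 1)).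
have D3 := ler_normD (sin b - b) ((expR a - 1) * sin b).
have C3 : 2 * k * (k * n) <= k * n by rewrite -subr_ge0; nra.
have C4 : 16 * k * n <= e * n by rewrite ler_wpM2r.
lra.
Qed.

Lemma cexp_der z : cder (@cexp R) z (cexp z).
Proof.
move=> e e0; have n0 : 0 < nm (cexp z) by rewrite nm_gt0 cexp_neq0.
have [d d0 hd] := cexp_der0 (divr_gt0 e0 n0).
exists d => // h /hd; rewrite add0r cexp0 mul1r => H.
have -> : cexp (z + h) - cexp z - cexp z * h = cexp z * (cexp h - 1 - h).
  by rewrite cexpD; ring.
by rewrite nmM mulrC -ler_pdivlMr // mulrAC.
Qed.

Lemma cos_2pin (n : nat) : cos (n%:R * (2 * pi)) = 1 :> R.
Proof.
elim: n => [|n IH]; first by rewrite mul0r cos0.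
rewrite -[n.+1]addn1 natrD mulrDl mul1r.
by rewrite (mulr_natl (pi : R) 2) cosD2pi -(mulr_natl (pi : R) 2).
Qed.
Lemma sin_2pin (n : nat) : sin (n%:R * (2 * pi)) = 0 :> R.
Proof.
elim: n => [|n IH]; first by rewrite mul0r sin0.
rewrite -[n.+1]addn1 natrD mulrDl mul1r.
by rewrite (mulr_natl (pi : R) 2) sinD2pi -(mulr_natl (pi : R) 2).
Qed.

Lemma twopiiE (z : C) : twopii R * z = Complex (- (2 * pi * im z)) (2 * pi * re z).
Proof. by apply: ceq; rewrite ?(reM, imM) /re /im /= ?mul0r ?sub0r ?add0r. Qed.

Lemma cexp_nat (n : nat) : cexp (twopii R * n%:R) = 1.
Proof.
rewrite twopiiE re_nat im_nat mulr0 oppr0 /cexp /= expR0.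
by rewrite toC1 mul1r [_ * n%:R]mulrC cos_2pin sin_2pin.
Qed.
Lemma cexp_int (k : int) : cexp (twopii R * k%:~R) = 1.
Proof.
case: k => n; first exact: cexp_nat.
by rewrite NegzE mulrNz mulrN cexpN cexp_nat invr1.
Qed.

(** Reduction modulo 2 pi leaves y in [0, 2 pi); on [0, pi] the cosine is strictly decreasing, and
    beyond pi the same applies to 2 pi - y. *)
Lemma cos_eq1 (x : R) : cos x = 1 -> exists k : int, x = k%:~R * (2 * pi).
Proof.
move=> c1; have p0 := pi_gt0 R; have p1 : 0 < 2 * (pi : R) by lra.
pose k := Num.floor (x / (2 * pi)); exists k.
have /andP[h1 h2] : k%:~R <= x / (2 * pi) < (k + 1)%:~R by apply: Num.Theory.floor_itv.
set y := x - k%:~R * (2 * pi); suff : y = 0 by rewrite /y; lra.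
have y0 : 0 <= y by rewrite subr_ge0 -ler_pdivlMr.
have y1 : y < 2 * pi.
  by rewrite ltrBlDr -[X in X + _]mul1r -mulrDl -ltr_pdivrMr // addrC -[1]/(1%:~R) -intrD.
have cy : cos y = 1.
  rewrite /y; case: (k) => n; last first.
    rewrite NegzE mulrNz mulNr opprK -[_%:~R]/(n.+1%:R).
    by rewrite cosD c1 cos_2pin sin_2pin !mulr1 mulr0 subr0.
  rewrite -[_%:~R]/(n%:R).
  by rewrite cosB c1 cos_2pin sin_2pin !mulr1 mulr0 addr0.
have [yp|yp] := leP y pi.
  apply/eqP; rewrite eq_le y0 andbT leNgt; apply/negP => y00.
  have := @ltr_cos R 0 y; rewrite !in_itv /= lexx y0 yp ltW // => /(_ isT isT).
  by rewrite y00 cy cos0 ltxx.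
have := @ltr_cos R 0 (2 * pi - y); rewrite !in_itv /= lexx ltW // .
have -> : 0 <= 2 * pi - y by lra.
have -> : 2 * pi - y <= pi by lra.
move=> /(_ isT isT); rewrite cos0 -cosN opprB.
have -> : cos (y - 2 * pi) = cos y.
  by rewrite -(cosD2pi (y - 2 * pi)); congr cos; rewrite mulr2n; lra.
by rewrite cy ltxx; lra.
Qed.

Lemma cexp_eq1 (z : C) : cexp (twopii R * z) = 1 -> exists k : int, z = k%:~R.
Proof.
move=> h; have p0 := pi_gt0 R.
have := congr1 nm h; rewrite nm_cexp nm1 twopiiE [re _]/= => /eqP.
rewrite -[X in _ == X]expR0 (inj_eq (@expR_inj R)) /= oppr_eq0 mulf_eq0.
move=> /orP[/eqP|/eqP iz]; first lra.
move: h; rewrite twopiiE iz mulr0 oppr0 /cexp /= expR0 => /(congr1 (@re R)).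
rewrite reM /= mul1r mul0r subr0 => /cos_eq1[k hk]; exists k.
have : re z = k%:~R.
  apply: (@mulfI _ (2 * pi)); [lra|by rewrite hk mulrC].
move=> rz; apply: ceq.
  rewrite rz; case: k {hk rz} => n; first by rewrite re_nat.
  by rewrite NegzE !mulrNz reN re_nat.
rewrite iz; case: k {hk rz} => n; first by rewrite im_nat.
by rewrite NegzE !mulrNz imN im_nat oppr0.
Qed.

End Complex.

(** * Summation *)
Section Sums.
Variable R : realType.
Local Notation C := (CC R).
Implicit Types (u v w : nat -> C) (s t : C) (a b : nat -> R).

Definition hasum u s : Prop := cv (fun N => \sum_(i < N) u i) s.
(** The summable majorants: absolute convergence is always expressed as domination by such a
    sequence. *)
Definition smb a : Prop :=
  (forall i, 0 <= a i) /\ exists B, forall N, \sum_(i < N) a i <= B.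

Lemma sum_ord_nat (V : zmodType) (f : nat -> V) n m : (n <= m)%N ->
  \sum_(i < m) f i = \sum_(i < n) f i + \sum_(n <= i < m) f i.
Proof.
by move=> nm; rewrite -!(big_mkord xpredT) (@big_cat_nat _ _ _ n).
Qed.

Lemma smb_cvg a : smb a -> exists l : R,
  (forall n, \sum_(i < n) a i <= l) /\
  forall e : R, 0 < e -> exists N, forall n, (N <= n)%N ->
    l - e < \sum_(i < n) a i.
Proof.
move=> [a0 [B hB]]; pose S n := \sum_(i < n) a i.
have Snd : nondecreasing_seq S.
  by apply/nondecreasing_seqP => n; rewrite /S big_ord_recr /= lerDl.
have hS : cvgn S.
  apply: nondecreasing_is_cvgn => //; exists B => _ [n _ <-]; exact: hB.
exists (limn S); split; first by move=> n; exact: nondecreasing_cvgn_le.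
move=> e e0; have /cvgrPdist_lt/(_ e e0)[N _ HN] := hS.
exists N => n /HN /= h; rewrite ltrBlDr addrC -ltrBlDr.
exact: le_lt_trans (ler_norm _) h.
Qed.

Lemma smb_tail a : smb a -> forall e : R, 0 < e ->
  exists N, forall n m, (N <= n)%N -> \sum_(n <= i < m) a i < e.
Proof.
move=> h e e0; have [l [h1 h2]] := smb_cvg h; have [N HN] := h2 e e0.
exists N => n m Nn; have [nm_|mn] := leqP n m; last first.
  by rewrite big_geq // ltnW.
have := h1 m; have := HN n Nn; rewrite (sum_ord_nat _ nm_); lra.
Qed.

Lemma smb_le a b : (forall n, 0 <= a n <= b n) -> smb b -> smb a.
Proof.
move=> ab [_ [B hB]]; split => [i|]; first by case/andP: (ab i).
exists B => N; apply: le_trans (hB N); apply: ler_sum => i _.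
by case/andP: (ab i).
Qed.
Lemma smbZ (k : R) a : 0 <= k -> smb a -> smb (fun n => k * a n).
Proof.
move=> k0 [a0 [B hB]]; split => [i|]; first exact: mulr_ge0.
by exists (k * B) => N; rewrite -mulr_sumr ler_wpM2l.
Qed.
Lemma smbD a b : smb a -> smb b -> smb (fun n => a n + b n).
Proof.
move=> [a0 [B hB]] [b0 [B' hB']]; split => [i|]; first exact: addr_ge0.
by exists (B + B') => N; rewrite big_split; apply: lerD.
Qed.
Lemma smb_geom (x : R) : 0 <= x -> x < 1 -> smb (fun n => x ^+ n).
Proof.
move=> x0 x1; split => [i|]; first exact: exprn_ge0.
exists (1 - x)^-1 => N; have : 0 < 1 - x by lra.
move=> h; rewrite -[_^-1]mul1r ler_pdivlMr //.
have := subrX1 x N => E.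
have : 0 <= x ^+ N by apply: exprn_ge0.
lra.
Qed.
Lemma smb_invsq : smb (fun n => (n.+1%:R ^+ 2)^-1).
Proof.
split => [i|]; first by rewrite invr_ge0 exprn_ge0.
(* The bound 2 - 1/(N+1) is what the induction needs: 1/(n+1)^2 is at most 1/n - 1/(n+1). *)
exists 2 => N; suff : \sum_(i < N.+1) (i.+1%:R ^+ 2)^-1 <= 2 - N.+1%:R^-1 :> R.
  move=> h; have : \sum_(i < N) (i.+1%:R ^+ 2)^-1 <= \sum_(i < N.+1) (i.+1%:R ^+ 2)^-1 :> R.
    by rewrite big_ord_recr /= lerDl invr_ge0 exprn_ge0.
  have h1 : 0 <= N.+1%:R^-1 :> R by rewrite invr_ge0.
  by move=> h2; apply: le_trans h2 (le_trans h _); rewrite lerBlDr lerDl.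
elim: N => [|N IH]; first by rewrite big_ord_recr big_ord0 /= expr1n invr1; lra.
rewrite big_ord_recr /=; apply: (@le_trans _ _ (2 - N.+1%:R^-1 + (N.+2%:R ^+ 2)^-1)).
  by rewrite lerD2r.
have : (N.+2%:R ^+ 2)^-1 <= N.+1%:R^-1 - N.+2%:R^-1 :> R.
  have n1 : (0 : R) < N.+1%:R by []. have n2 : (0 : R) < N.+2%:R by [].
  rewrite -[N.+2]addn1 natrD in n2 *; set x := N.+1%:R in n1 n2 *.
  have -> : x^-1 - (x + 1)^-1 = (x * (x + 1))^-1 by field; apply/andP; split; lra.
  rewrite lef_pV2 ?posrE ?mulr_gt0 ?exprn_gt0 //; nra.
move: (_ ^- 2) (N.+1%:R^-1) (N.+2%:R^-1) => x y z; lra.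
Qed.

Lemma eq_hasum u v s : (forall n, u n = v n) -> hasum u s -> hasum v s.
Proof. by move=> uv; apply: eq_cv => n; apply: eq_bigr. Qed.
Lemma hasum_uniq u s t : hasum u s -> hasum u t -> s = t.
Proof. exact: cv_uniq. Qed.
Lemma hasumD u v s t : hasum u s -> hasum v t -> hasum (fun n => u n + v n) (s + t).
Proof. by move=> h h'; apply: eq_cv (cvD h h') => n; rewrite big_split. Qed.
Lemma hasumZ k u s : hasum u s -> hasum (fun n => k * u n) (k * s).
Proof. by move=> h; apply: eq_cv (cvM (cv_cst k) h) => n; rewrite mulr_sumr. Qed.
Lemma hasumN u s : hasum u s -> hasum (fun n => - u n) (- s).
Proof. by move=> /(hasumZ (-1)); rewrite mulN1r; apply: eq_hasum => n; rewrite mulN1r. Qed.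
Lemma hasumB u v s t : hasum u s -> hasum v t -> hasum (fun n => u n - v n) (s - t).
Proof. by move=> h h'; apply: hasumD => //; apply: hasumN. Qed.
Lemma hasum_fin u N : (forall n, (N <= n)%N -> u n = 0) -> hasum u (\sum_(i < N) u i).
Proof.
move=> h; apply: (@cv_near _ (fun=> \sum_(i < N) u i) _ _ N _ (cv_cst _)) => n Nn.
rewrite (sum_ord_nat _ Nn).
rewrite big_nat_cond [X in _ + X]big1 ?addr0 // => i; rewrite andbT => /andP[Ni _].
exact: h.
Qed.
Lemma hasum0 : hasum (fun=> 0) 0.
Proof. by have := @hasum_fin (fun=> 0) 0%N; rewrite big_ord0; apply. Qed.
Lemma hasum_sum n (u : 'I_n -> nat -> C) (s : 'I_n -> C) :
  (forall k, hasum (u k) (s k)) ->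
  hasum (fun i => \sum_(k < n) u k i) (\sum_(k < n) s k).
Proof.
elim: n u s => [|n IH] u s h.
  by rewrite big_ord0; apply: eq_hasum hasum0 => i; rewrite big_ord0.
rewrite big_ord_recr; apply: eq_hasum (hasumD (IH _ _ _) (h ord_max)) => [i|k].
  by rewrite big_ord_recr.
exact: h.
Qed.
Lemma hasum_rec u s : hasum u s <-> hasum (fun n => u n.+1) (s - u 0%N).
Proof.
split => h.
  apply: eq_cv (cvB (cv_shift 1 h) (cv_cst (u 0%N))) => n.
  by rewrite addn1 big_ord_recl /= addrC addKr.
move=> e /h[N HN]; exists N.+1 => [[|n]] // /HN; rewrite big_ord_recl /=.
have E (x y z : C) : x + y - z = y - (z - x) by ring.
by rewrite E.
Qed.

Lemma nm_hasum u s (B : R) : hasum u s ->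
  (forall N, \sum_(i < N) nm (u i) <= B) -> nm s <= B.
Proof.
move=> h hB; apply: (cv_le h) => n; apply: le_trans (hB n); exact: nm_sum.
Qed.

Lemma hasum_tail u s a (e : R) N : hasum u s -> (forall n, nm (u n) <= a n) ->
  (forall m, \sum_(N <= i < m) a i <= e) -> nm (s - \sum_(i < N) u i) <= e.
Proof.
move=> h ua he.
have h' : cv (fun n => \sum_(i < n + N) u i - \sum_(i < N) u i) (s - \sum_(i < N) u i).
  by apply: cvB (cv_cst _); apply: cv_shift h.
apply: (cv_le h') => n; apply: le_trans (he (n + N)%N).
rewrite (sum_ord_nat _ (leq_addl n N)) addrC addKr.
by apply: le_trans (nm_sum _ _ _) _; apply: ler_sum.
Qed.

(** Adding the majorant to the real and to the imaginary part makes the terms nonnegative, so each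
    part is a difference of two bounded monotone sums. *)
Lemma hasum_ex u a : (forall n, nm (u n) <= a n) -> smb a -> exists s, hasum u s.
Proof.
move=> ua sa; have [la [la1 la2]] := smb_cvg sa.
have key (r : nat -> R) : (forall n, `|r n| <= a n) -> exists l : R,
    forall e : R, 0 < e -> exists N, forall n, (N <= n)%N ->
      `|\sum_(i < n) r i - l| < e.
  move=> ra; have : smb (fun n => r n + a n).
    split => [i|].
      by have := ra i; rewrite ler_norml => /andP[h _]; lra.
    have [_ [B hB]] := sa; exists (B + B) => N; rewrite big_split; apply: lerD => //.
    apply: le_trans (hB N); apply: ler_sum => i _.
    exact: le_trans (ler_norm _) (ra i).
  move=> /smb_cvg[lb [lb1 lb2]]; exists (lb - la) => e e0.
  have [N HN] := la2 e e0; have [M HM] := lb2 e e0.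
  exists (maxn N M) => n; rewrite geq_max => /andP[/HN h1 /HM h2].
  have := la1 n; have := lb1 n; move: h2; rewrite big_split /= => h2 h3 h4.
  by rewrite ltr_norml; apply/andP; split; lra.
have [l1 h1] := key (fun n => re (u n)) (fun n => le_trans (re_le _) (ua n)).
have [l2 h2] := key (fun n => im (u n)) (fun n => le_trans (im_le _) (ua n)).
exists (Complex l1 l2) => e e0.
have [N HN] := h1 (e / 2) ltac:(lra); have [M HM] := h2 (e / 2) ltac:(lra).
exists (maxn N M) => n; rewrite geq_max => /andP[/HN g1 /HM g2].
have resum k : re (\sum_(i < k) u i) = \sum_(i < k) re (u i).
  by elim: k => [|k IH]; rewrite ?big_ord0 // !big_ord_recr /= reD IH.
have imsum k : im (\sum_(i < k) u i) = \sum_(i < k) im (u i).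
  by elim: k => [|k IH]; rewrite ?big_ord0 // !big_ord_recr /= imD IH.
apply: le_lt_trans (nm_le_reim _) _; rewrite reD imD reN imN resum imsum.
rewrite [re (Complex _ _)]/= [im (Complex _ _)]/=; lra.
Qed.

Lemma tannery (u : nat -> nat -> C) v a (s : nat -> C) t :
  (forall k j, nm (u k j) <= a j) -> smb a ->
  (forall j, cv (fun k => u k j) (v j)) ->
  (forall k, hasum (u k) (s k)) -> hasum v t -> cv s t.
Proof.
move=> ua sa uv hs ht e e0.
have [N HN] := smb_tail sa (ltac:(lra) : 0 < e / 4).
have va j : nm (v j) <= a j by apply: (cv_le (uv j)) => k.
have [M HM] : exists M, forall k, (M <= k)%N ->
    nm (\sum_(j < N) u k j - \sum_(j < N) v j) < e / 4.
  have h : cv (fun k => \sum_(j < N) u k j) (\sum_(j < N) v j).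
    elim: (N) => [|n IH].
      by apply: eq_cv (cv_cst _) => k; rewrite !big_ord0.
    rewrite big_ord_recr /=; apply: eq_cv (cvD IH (uv n)) => k.
    by rewrite big_ord_recr.
  by apply: h; lra.
exists M => k /HM hk.
have h1 := hasum_tail (hs k) (ua k) (fun m => ltW (HN N m (leqnn _))).
have h2 := hasum_tail ht va (fun m => ltW (HN N m (leqnn _))).
have -> : s k - t = (s k - \sum_(i < N) u k i) +
  ((\sum_(j < N) u k j - \sum_(j < N) v j) - (t - \sum_(i < N) v i)) by ring.
apply: le_lt_trans (nmD _ _) _; have := nmB (\sum_(j < N) u k j - \sum_(j < N) v j) (t - \sum_(i < N) v i).
lra.
Qed.

(** Tannery's theorem for the partial column sums, which row m dominates by [a m * B]. A product
    majorant is asked for because it separates the two indices. *)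
Lemma exchange_hasum (u : nat -> nat -> C) a b (r c : nat -> C) s :
  (forall m n, nm (u m n) <= a m * b n) -> smb a -> smb b ->
  (forall m, hasum (u m) (r m)) -> (forall n, hasum (fun m => u m n) (c n)) ->
  hasum r s -> hasum c s.
Proof.
move=> uab sa sb hr hc hs; have [b0 [B hB]] := sb; have [a0 _] := sa.
apply: (@tannery (fun N m => \sum_(n < N) u m n) r (fun m => a m * B)) => //.
- move=> k m; apply: le_trans (nm_sum _ _ _) _.
  apply: (@le_trans _ _ (\sum_(i < k) a m * b i)); first exact: ler_sum.
  by rewrite -mulr_sumr ler_wpM2l.
- have B0 : 0 <= B by have := hB 0%N; rewrite big_ord0.
  have := smbZ B0 sa; apply: smb_le => n; rewrite mulrC lexx andbT mulr_ge0 //.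
- by move=> N; apply: hasum_sum => k; apply: hc.
Qed.

Lemma mertens u v a b s t :
  (forall n, nm (u n) <= a n) -> (forall n, nm (v n) <= b n) -> smb a -> smb b ->
  hasum u s -> hasum v t ->
  hasum (fun n => \sum_(i < n.+1) u i * v (n - i)%N) (s * t).
Proof.
move=> ua vb sa [b0 [B hB]] hu hv.
(* The triangle of index pairs below N summed by rows: row i is u_i times a truncated sum of v, so
   Tannery's theorem applies in N. *)
pose w N i := if (i < N)%N then u i * \sum_(j < N - i) v j else 0.
have hw N : \sum_(n < N) \sum_(i < n.+1) u i * v (n - i)%N = \sum_(i < N) w N i.
  elim: N => [|N IH]; first by rewrite !big_ord0.
  have wN : w N.+1 N = u N * v 0%N by rewrite /w ltnSn subSnn big_ord1.
  rewrite big_ord_recr /= IH [RHS]big_ord_recr /= wN.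
  rewrite [X in _ + X]big_ord_recr /= subnn addrA; congr (_ + _).
  rewrite -big_split /=; apply: eq_bigr => i _.
  rewrite /w ltn_ord ltnS ltnW // subSn; last exact: ltnW.
  by rewrite big_ord_recr /= mulrDr.
apply: (@tannery w (fun i => u i * t) (fun i => a i * B)).
- move=> k i; rewrite /w; case: ifP => _; last first.
    rewrite nm0 mulr_ge0 //; first by apply: le_trans (nm_ge0 _) (ua i).
    by have := hB 0%N; rewrite big_ord0.
  rewrite nmM; apply: ler_pM (nm_ge0 _) (nm_ge0 _) (ua i) _.
  apply: le_trans (nm_sum _ _ _) _; apply: le_trans (hB (k - i)%N).
  exact: ler_sum.
- have B0 : 0 <= B by have := hB 0%N; rewrite big_ord0.
  have := smbZ B0 sa; apply: smb_le => n; rewrite mulrC lexx andbT mulr_ge0 //.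
  by apply: le_trans (nm_ge0 _) (ua n).
- move=> i; have h : cv (fun k => u i * \sum_(j < k) v j) (u i * t).
    exact: cvM (cv_cst _) hv.
  move=> e /h[N HN]; exists (i + N).+1 => n iNn.
  rewrite /w (leq_ltn_trans _ iNn) ?leq_addr //; apply: HN; lia.
- move=> N; rewrite hw; apply: hasum_fin => n Nn.
  by rewrite /w ltnNge Nn.
- by have := hasumZ t hu; rewrite mulrC; apply: eq_hasum => n; rewrite mulrC.
Qed.

Lemma csumE u s : hasum u s -> csum u = s.
Proof.
move=> h; rewrite /csum; apply: cvg_lim; first exact: norm_hausdorff.
by apply/cvP; apply: eq_cv h => n; rewrite big_mkord.
Qed.

End Sums.

(** * Partial fractions *)
Section ExponentialBounds.
Variable R : realType.
Local Notation C := (CC R).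
Implicit Types (z w s : C) (x y : R).

Definition ee z : C := cexp (twopii R * z).

Lemma ler_sq x y : 0 <= y -> x ^+ 2 <= y ^+ 2 -> x <= y.
Proof.
move=> y0 h; apply: le_trans (ler_norm x) _.
by rewrite -(@ler_pXn2r _ 2) ?nnegrE // real_normK ?num_real.
Qed.

Lemma eeD z w : ee (z + w) = ee z * ee w.
Proof. by rewrite /ee mulrDr cexpD. Qed.
Lemma ee0 : ee 0 = 1. Proof. by rewrite /ee mulr0 cexp0. Qed.
Lemma ee_int (k : int) : ee k%:~R = 1. Proof. exact: cexp_int. Qed.
Lemma ee_nat (k : nat) : ee k%:R = 1. Proof. exact: cexp_nat. Qed.
Lemma eeN z : ee (- z) = (ee z)^-1. Proof. by rewrite /ee mulrN cexpN. Qed.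
Lemma ee_neq0 z : ee z != 0. Proof. exact: cexp_neq0. Qed.
Lemma eeM n z : ee (n%:R * z) = ee z ^+ n.
Proof. by rewrite /ee mulrCA cexpMn. Qed.
Lemma nm_ee z : nm (ee z) = expR (- (2 * pi * im z)).
Proof. by rewrite nm_cexp twopiiE. Qed.
Lemma ee_half : ee 2^-1 = -1.
Proof.
have h : (2^-1 : C) = toC 2^-1 by rewrite toCV toC_nat.
rewrite /ee twopiiE h re_toC im_toC mulr0 oppr0 /cexp /= expR0 mulrAC divff ?pnatr_eq0 // mul1r.
rewrite mul1r sinpi cospi; exact: (toCN 1).
Qed.

Lemma ee_der z : cder ee z (twopii R * ee z).
Proof.
have h : cder (fun w : C => twopii R * w) z (twopii R).
  by have := cderZ (twopii R) (cder_id z); rewrite mulr1.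
have := cder_comp h (cexp_der _); by rewrite mulrC.
Qed.

Lemma twopii_neq0 : twopii R != 0.
Proof.
rewrite -nm_eq0; apply/eqP => h; have := im_le (twopii R).
rewrite h /= normr_le0 mulf_eq0 pnatr_eq0 /= => /eqP p0.
by have := pi_gt0 R; rewrite p0 ltxx.
Qed.

Definition halfpow (k : nat) : C := (2%:R ^+ k)^-1.

Lemma nm_halfpow k : nm (halfpow k) = (2 ^+ k)^-1.
Proof. by rewrite nmV nmX nm_nat. Qed.

Lemma halfpow_cvg w : cv (fun k => w * halfpow k) 0.
Proof.
apply: (@cv_squeeze _ _ _ (fun k => nm w * 2^-1 ^+ k)) => [k|].
  by rewrite subr0 nmM nm_halfpow exprVn.
rewrite -(mulr0 (nm w)); apply: cvgM; first exact: cvg_cst.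
apply: cvg_expr; rewrite ger0_norm ?invr_ge0 //; lra.
Qed.

Lemma ee_halfpow_cvg w : cv (fun k => ee (w * halfpow k)) 1.
Proof.
move=> e /(cder_continuous (ee_der 0))[d d0 hd].
have [N HN] := halfpow_cvg w d0; exists N => n /HN; rewrite subr0 => /hd.
by rewrite add0r ee0.
Qed.

Lemma ee_slope_cvg w :
  cv (fun k => (ee (w * halfpow k) - 1) * 2%:R ^+ k) (twopii R * w).
Proof.
move=> e e0; have n0 := nm_ge0 w.
have [d d0 hd] := ee_der 0 (ltac:(apply: divr_gt0 => //; lra) : 0 < e / (nm w + 1)).
have [N HN] := halfpow_cvg w d0; exists N => n /HN; rewrite subr0 => /hd.
rewrite add0r ee0 mulr1 => H.
have p0 : 2%:R ^+ n != 0 :> C by rewrite expf_neq0 // pnatr_eq0.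
have -> : (ee (w * halfpow n) - 1) * 2%:R ^+ n - twopii R * w =
  (ee (w * halfpow n) - 1 - twopii R * (w * halfpow n)) * 2%:R ^+ n.
  by move: (ee _) => E; rewrite /halfpow; field.
rewrite nmM nmX nm_nat; apply: (@le_lt_trans _ _ (e / (nm w + 1) * nm w)).
  apply: le_trans (ler_wpM2r _ H) _; first exact: exprn_ge0.
  by rewrite nmM nm_halfpow -!mulrA mulVf ?mulr1 // expf_neq0.
rewrite mulrAC ltr_pdivrMr; [nra|lra].
Qed.

(** After k+1 halvings the arguments are (z + j) / 2^(k+1) with 0 <= j < 2^(k+1). The upper half of
    them is reversed and moved down by the period, so that each j is paired with -1-j. *)
Lemma doubling (f : C -> C) (c : C) :
  (forall z, ee z != 1 -> f z = c * (f (z / 2%:R) + f ((z + 1) / 2%:R))) ->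
  (forall z, f (z - 1) = f z) ->
  forall k z, ee z != 1 -> f z = c ^+ k.+1 *
    \sum_(j < 2 ^ k) (f ((z + j%:R) * halfpow k.+1) + f ((z - 1 - j%:R) * halfpow k.+1)).
Proof.
move=> fd fp.
have two0 : 2%:R != 0 :> C by rewrite pnatr_eq0.
have ee2 z n : ee (z * halfpow n) ^+ (2 ^ n) = ee z.
  by rewrite -eeM mulrCA natrX mulfV ?mulr1 // expf_neq0.
have D k z : ee z != 1 -> f z = c ^+ k * \sum_(j < 2 ^ k) f ((z + j%:R) * halfpow k).
  move=> z1; elim: k => [|k IH].
    by rewrite expr0 mul1r big_ord1 addr0 /halfpow expr0 invr1 mulr1.
  rewrite IH exprSr -mulrA; congr (_ * _).
  rewrite expnS mul2n -addnn big_split_ord /= -big_split /= mulr_sumr.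
  apply: eq_bigr => j _; rewrite fd; last first.
    apply: contra z1 => /eqP h; have := ee2 (z + j%:R) k.
    by rewrite h expr1n eeD ee_nat mulr1 => <-.
  have p0 : 2%:R ^+ k != 0 :> C by rewrite expf_neq0.
  congr (c * (f _ + f _)); rewrite /halfpow exprS.
    by field.
  by rewrite natrD natrX; field.
move=> k z z1; rewrite (D k.+1) //; congr (_ * _).
rewrite expnS mul2n -addnn big_split_ord /= big_split /=; congr (_ + _).
rewrite (reindex_inj rev_ord_inj) /=; apply: eq_bigr => j _.
rewrite -[RHS](_ : f ((z - 1 - j%:R) * halfpow k.+1 + 1) = _); last first.
  by rewrite -[LHS]fp addrK.
congr f; have p0 : 2%:R ^+ k != 0 :> C by rewrite expf_neq0.
rewrite addnBA // natrB; last by apply: leq_trans (ltn_ord j) _; rewrite leq_addl.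
by rewrite natrD natrX -[j.+1]addn1 natrD /halfpow exprS; field.
Qed.

(** As 3 pi / 4 exceeds pi / 2, the sine is written 2 sin t cos t at the half angle t <= 3 pi / 8,
    where both cos t and the slope of sin are at least cos (3 pi / 8). *)
Lemma sin_lb : exists2 c : R, 0 < c &
  forall x, `|x| <= 3 / 4 -> c * `|x| <= `|sin (pi * x)|.
Proof.
have p0 := pi_gt0 R.
pose c1 : R := cos (3 * pi / 8).
have c10 : 0 < c1 by apply: cos_gt0_pihalf; apply/andP; split; lra.
have S u : 0 <= u -> u <= 3 * pi / 8 -> c1 * u <= sin u.
  move=> u0 u1; have [|x] := @MVT_segment R sin cos 0 u u0.
    by apply: continuous_subspaceT => x; exact: continuous_sin.
  rewrite in_itv /= => /andP[x0 xu]; rewrite sin0 !subr0 => ->.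
  rewrite ler_wpM2r // /c1.
  have [->|xn] := eqVneq x (3 * pi / 8); first by rewrite lexx.
  rewrite ltW // ltr_cos ?in_itv /=; first by rewrite lt_neqAle xn /=; lra.
    by apply/andP; split; lra.
  by apply/andP; split; lra.
exists (c1 ^+ 2 * pi); first by rewrite mulr_gt0 // exprn_gt0.
move=> x hx.
have -> : `|sin (pi * x)| = `|sin (pi * `|x|)|.
  by have [h|h] := ger0P x => //; rewrite mulrN sinN normrN.
set y := `|x| in hx *; have y0 : 0 <= y by exact: normr_ge0.
apply: le_trans (ler_norm _).
have -> : pi * y = (pi * y / 2) *+ 2 by rewrite mulr2n; lra.
set t := pi * y / 2.
have t0 : 0 <= t by rewrite /t divr_ge0 // mulr_ge0 // ltW.
have t1 : t <= 3 * pi / 8.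
  have := ler_wpM2l (ltW p0) hx; rewrite /t; lra.
have h1 := S t t0 t1.
have h2 : c1 <= cos t.
  rewrite /c1; have [->|xn] := eqVneq t (3 * pi / 8); first by rewrite lexx.
  rewrite ltW // ltr_cos ?in_itv /=; first by rewrite lt_neqAle xn.
    by apply/andP; split; lra.
  by apply/andP; split; lra.
rewrite sin_mulr2n mulr2n.
have h3 : c1 * (c1 * t) <= cos t * sin t.
  by apply: ler_pM => //; [exact: ltW|rewrite mulr_ge0 // ltW].
have -> : c1 ^+ 2 * pi * y = c1 * (c1 * t) + c1 * (c1 * t) by rewrite /t; field.
exact: lerD.
Qed.

(** The distance of e(s) from 1 splits into a radial part, controlling Im s, and an angular part,
    controlling Re s. *)
Lemma nm2_ee_sub1 s : nm (ee s - 1) ^+ 2 =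
  (1 - expR (- (2 * pi * im s))) ^+ 2 +
  4 * expR (- (2 * pi * im s)) * sin (pi * re s) ^+ 2.
Proof.
rewrite nm2 reD imD reN imN re1 im1 /ee twopiiE /cexp reM imM re_toC im_toC.
rewrite /= subr0 !mul0r subr0 addr0.
have -> : 2 * pi * re s = (pi * re s) *+ 2 by rewrite mulr2n; lra.
rewrite cos_mulr2n sin_mulr2n !mulr2n.
have := cos2Dsin2 (pi * re s).
move: (expR _) (cos _) (sin _) => x a b h.
have -> : a ^+ 2 = 1 - b ^+ 2 by lra.
have E : (a * b + a * b) ^+ 2 = 4 * a ^+ 2 * b ^+ 2 by ring.
rewrite exprMn E (_ : a ^+ 2 = 1 - b ^+ 2); last by lra.
ring.
Qed.

(** On |Re s| <= 3/4 the only zero of e(s) - 1 is s = 0. The radial part bounds |Im s| and the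
    angular part |Re s|; half the smaller constant serves for their sum. *)
Lemma ee_lb (Y : R) : exists2 c : R, 0 < c &
  forall s, `|re s| <= 3 / 4 -> `|im s| <= Y -> c * nm s <= nm (ee s - 1).
Proof.
have [Y0|Y0] := ltP Y 0.
  exists 1 => // s _ h; have := normr_ge0 (im s); lra.
have p0 := pi_gt0 R; have [c c0 hc] := sin_lb.
pose r := expR (- (2 * pi * Y)).
have r0 : 0 < r by exact: expR_gt0.
have r1 : r <= 1 by rewrite -[leRHS]expR0 ler_expR oppr_le0 !mulr_ge0 // ltW.
pose A := 2 * pi * r; pose B := r * c.
have A0 : 0 < A by rewrite !mulr_gt0.
have B0 : 0 < B by rewrite mulr_gt0.
exists (Num.min A B / 2); first by rewrite divr_gt0 // lt_min A0.
move=> s hx hy; set n := nm (ee s - 1).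
have n0 : 0 <= n := nm_ge0 _.
have rho : r <= expR (- (2 * pi * im s)).
  rewrite ler_expR lerN2 ler_wpM2l //; first by rewrite mulr_ge0 // ltW.
  exact: le_trans (ler_norm _) hy.
have i1 : A * `|im s| <= n.
  apply: ler_sq => //; rewrite /n nm2_ee_sub1.
  apply: (@le_trans _ _ ((1 - expR (- (2 * pi * im s))) ^+ 2)); last first.
    by rewrite lerDl mulr_ge0 ?sqr_ge0 // mulr_ge0 ?expR_ge0.
  rewrite -[leRHS]real_normK ?num_real // ler_pXn2r ?nnegrE //; last first.
    by rewrite mulr_ge0 // ltW.
  have [h|h] := leP 0 (im s).
    rewrite (ger0_norm h) ger0_norm; last first.
      by rewrite subr_ge0 -[leRHS]expR0 ler_expR oppr_le0 !mulr_ge0 // ltW.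
    have h' : 0 <= 2 * pi * im s by rewrite !mulr_ge0 // ltW.
    have := expR_ge1Dx (2 * pi * im s); have := expRN (2 * pi * im s).
    have := expR_gt0 (2 * pi * im s); have := expR_gt0 (- (2 * pi * im s)).
    move: rho; rewrite /A; move: (expR (- _)) => x rx x0.
    move: (expR _) => y y0 xy hy'.
    have xy1 : x * y = 1 by rewrite xy mulVf // gt_eqF.
    rewrite ger0_norm in hy => //.
    have : x * (1 + 2 * pi * im s) <= x * y by rewrite ler_pM2l.
    rewrite xy1.
    have : 2 * pi * r * im s <= 2 * pi * x * im s.
      by rewrite ler_wpM2r // ler_wpM2l // mulr_ge0 // ltW.
    lra.
  rewrite (ltr0_norm h) distrC ger0_norm; last first.
    by rewrite subr_ge0 -[leLHS]expR0 ler_expR -mulrN !mulr_ge0 ?ltW // oppr_gt0.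
  have := expR_ge1Dx (- (2 * pi * im s)).
  have : A * - im s <= 2 * pi * - im s.
    rewrite ler_pM2r ?oppr_gt0 // /A -[leRHS]mulr1 ler_wpM2l // mulr_ge0 // ltW //.
  lra.
have i2 : B * `|re s| <= n.
  apply: ler_sq => //; rewrite /n nm2_ee_sub1.
  apply: (@le_trans _ _ (4 * expR (- (2 * pi * im s)) * sin (pi * re s) ^+ 2)); last first.
    by rewrite lerDr sqr_ge0.
  have h := hc _ hx; have h' : (c * `|re s|) ^+ 2 <= sin (pi * re s) ^+ 2.
    rewrite -[leRHS]real_normK ?num_real // ler_pXn2r ?nnegrE //.
    by rewrite mulr_ge0 // ltW.
  rewrite /B -mulrA exprMn; apply: ler_pM => //; rewrite ?sqr_ge0 //.
  have : r ^+ 2 <= r * 1 by rewrite expr2 ler_pM2l.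
  lra.
have h1 : Num.min A B / 2 * nm s <= Num.min A B / 2 * (`|re s| + `|im s|).
  rewrite ler_wpM2l ?nm_le_reim // divr_ge0 // le_min !ltW //.
have h2 : Num.min A B * `|re s| <= B * `|re s|.
  by rewrite ler_wpM2r // ge_min lexx orbT.
have h3 : Num.min A B * `|im s| <= A * `|im s|.
  by rewrite ler_wpM2r // ge_min lexx.
lra.
Qed.

Lemma lin_lb z : (forall j : nat, z + j%:R != 0) ->
  exists2 d : R, 0 < d & forall j : nat, d * j.+1%:R <= nm (z + j%:R).
Proof.
move=> hz; have H N : exists2 d : R, 0 < d &
    forall j : nat, (j < N)%N -> d * j.+1%:R <= nm (z + j%:R).
  elim: N => [|N [d d0 IH]]; first by exists 1.
  have n0 : 0 < nm (z + N%:R) by rewrite nm_gt0.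
  have N0 : (0 : R) < N.+1%:R by [].
  exists (Num.min d (nm (z + N%:R) / N.+1%:R)); first by rewrite lt_min d0 divr_gt0.
  move=> j; rewrite ltnS leq_eqVlt => /orP[/eqP ->|/IH h].
    by rewrite -ler_pdivlMr // ge_min lexx orbT.
  by apply: le_trans h; rewrite ler_wpM2r // ge_min lexx.
have n0 := nm_ge0 z.
pose N := (Num.truncn (2 * nm z + 1)).+1.
have hN : 2 * nm z + 1 < N%:R by apply: Num.Theory.real_truncnS_gt; exact: num_real.
have [d d0 hd] := H N; exists (Num.min d (1 / 2)).
  by rewrite lt_min d0; lra.
move=> j; have [jN|Nj] := ltnP j N.
  by apply: le_trans (hd j jN); rewrite ler_wpM2r // ge_min lexx.
have : N%:R <= j%:R :> R by rewrite ler_nat.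
have h : Num.min d (1 / 2) * j.+1%:R <= 1 / 2 * j.+1%:R.
  by rewrite ler_wpM2r // ge_min lexx orbT.
have := nm_lerB j%:R (- z); rewrite nmN nm_nat opprK [z + _]addrC.
move: h; rewrite -[j.+1]addn1 natrD; lra.
Qed.

End ExponentialBounds.

Section PartialFractions.
Variable R : realType.
Local Notation C := (CC R).
Implicit Types (z w s : C) (x y : R).

Lemma cv_bounded (u : nat -> C) l : cv u l -> exists B : R, forall n, nm (u n) <= B.
Proof.
move=> /(_ 1 ltr01)[N HN].
have [B hB] : exists B : R, forall n, (n < N)%N -> nm (u n) <= B.
  elim: (N) => [|n [B hB]]; first by exists 0.
  exists (Num.max B (nm (u n))) => m; rewrite ltnS leq_eqVlt => /orP[/eqP ->|/hB h].
    by rewrite le_max lexx orbT.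
  by rewrite le_max h.
exists (Num.max B (nm l + 1)) => n; rewrite le_max; have [/HN h|/hB ->//] := leqP N n.
have := nm_lerB (u n) l; lra.
Qed.

(* Iterating the functional equation k times writes f z as a sum of 2 ^ k terms, which
   Tannery's theorem turns into a partial fraction expansion; cotangent and 1/sin^2
   satisfy such an equation. *)
Lemma doubling_hasum (f : C -> C) (c : C) (v : nat -> C) (a : nat -> R) k0 z :
  (forall z, ee z != 1 -> f z = c * (f (z / 2%:R) + f ((z + 1) / 2%:R))) ->
  (forall z, f (z - 1) = f z) -> ee z != 1 ->
  (forall j, cv (fun k => c ^+ k.+1 * (f ((z + j%:R) * halfpow R k.+1)
     + f ((z - 1 - j%:R) * halfpow R k.+1))) (v j)) ->
  (forall k j, (k0 <= k)%N -> (j < 2 ^ k)%N ->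
     nm (c ^+ k.+1 * (f ((z + j%:R) * halfpow R k.+1)
     + f ((z - 1 - j%:R) * halfpow R k.+1))) <= a j) -> smb a ->
  hasum v (f z).
Proof.
move=> fd fp z1 hv ha sa.
pose T k j := c ^+ k.+1 * (f ((z + j%:R) * halfpow R k.+1)
     + f ((z - 1 - j%:R) * halfpow R k.+1)).
pose u k j := if (j < 2 ^ (k + k0))%N then T (k + k0)%N j else 0.
have a0 : forall j, 0 <= a j by case: sa.
have ua k j : nm (u k j) <= a j.
  by rewrite /u; case: ifP => h; rewrite ?nm0 // ha // leq_addl.
have uv j : cv (fun k => u k j) (v j).
  apply: (@cv_near _ (fun k => T (k + k0)%N j) _ _ j); last exact: (cv_shift k0 (hv j)).
  move=> k jk; rewrite /u (leq_ltn_trans jk) //.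
  by rewrite (leq_trans (ltn_expl k (ltnSn 1))) // leq_exp2l // leq_addr.
have va j : nm (v j) <= a j by apply: (cv_le (uv j)).
have [t ht] := hasum_ex va sa.
suff : cv (fun=> f z) t by move=> /(cv_uniq (cv_cst (f z))) ->.
apply: (tannery ua sa uv _ ht) => k.
rewrite (doubling fd fp (k + k0) z1) mulr_sumr.
have -> : \sum_(i < 2 ^ (k + k0)) (c ^+ (k + k0).+1 *
    (f ((z + i%:R) * halfpow R (k + k0).+1) + f ((z - 1 - i%:R) * halfpow R (k + k0).+1)))
    = \sum_(i < 2 ^ (k + k0)) u k i.
  by apply: eq_bigr => i _; rewrite /u ltn_ord.
by apply: hasum_fin => n nk; rewrite /u ltnNge nk.
Qed.

Lemma ee_neq1D z j : ee z != 1 -> z + j%:R != 0.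
Proof.
apply: contra => /eqP h; have -> : z = - j%:R by rewrite -[LHS](addrK j%:R) h sub0r.
by rewrite eeN ee_nat invr1.
Qed.
Lemma ee_neq1B z j : ee z != 1 -> z - 1 - j%:R != 0.
Proof.
apply: contra => /eqP h; have -> : z = (z - 1 - j%:R) + j.+1%:R by rewrite -natr1; ring.
by rewrite h add0r ee_nat.
Qed.

Lemma re_halfpow w k : re (w * halfpow R k) = re w / 2 ^+ k.
Proof.
have -> : halfpow R k = toC (2 ^+ k)^-1 by rewrite toCV toCX toC_nat.
by rewrite reM re_toC im_toC mulr0 subr0.
Qed.
Lemma im_halfpow w k : im (w * halfpow R k) = im w / 2 ^+ k.
Proof.
have -> : halfpow R k = toC (2 ^+ k)^-1 by rewrite toCV toCX toC_nat.
by rewrite imM re_toC im_toC mulr0 add0r.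
Qed.

(** Uniformity in k is the point: this lower bound produces the majorants, summable in j, for the
    iterated doubling formulas. *)
Lemma scaled_lb z : ee z != 1 -> exists c E : R, exists k0, 0 < c /\
  forall k j, (k0 <= k)%N -> (j < 2 ^ k)%N -> forall w, w = z + j%:R \/ w = z - 1 - j%:R ->
    c * j.+1%:R <= nm ((ee (w * halfpow R k.+1) - 1) * 2%:R ^+ k.+1) /\
    nm (ee (w * halfpow R k.+1)) <= E.
Proof.
move=> z1; have p0 := pi_gt0 R.
have [c c0 hc] := ee_lb `|im z|.
have [d1 d10 h1] := lin_lb (fun j => ee_neq1D j z1).
have [d2 d20 h2] : exists2 d : R, 0 < d & forall j : nat, d * j.+1%:R <= nm (z - 1 - j%:R).
  have [|d d0 hd] := @lin_lb R (1 - z).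
    move=> j; rewrite -oppr_eq0; have := ee_neq1B j z1; congr (_ != 0); ring.
  exists d => // j; have := hd j; rewrite -nmN; congr (_ <= nm _); ring.
(* With k0 <= 2^k, Re z contributes at most 1/4 and j + 1 <= 2^k at most 1/2 to the real part of w /
   2^(k+1), which therefore stays in the range 3/4 of [ee_lb]. *)
pose k0 := (Num.truncn (2 * `|re z|)).+1.
have hk0 : 2 * `|re z| < k0%:R by apply: Num.Theory.real_truncnS_gt; exact: num_real.
exists (c * Num.min d1 d2), (expR (2 * pi * `|im z|)), k0.
split; first by rewrite mulr_gt0 // lt_min d10.
move=> k j kk jk w hw.
have imw : im w = im z.
  by case: hw => ->; rewrite ?(imD, imN, im1, im_nat) ?subr0 ?addr0.
have pk : (1 : R) <= 2 ^+ k.+1 by rewrite exprn_ege1 // ler1n.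
have pk0 : (0 : R) < 2 ^+ k.+1 by lra.
have ims : `|im (w * halfpow R k.+1)| <= `|im z|.
  rewrite im_halfpow imw normrM normfV (ger0_norm (ltW pk0)).
  by rewrite ler_pdivrMr // ler_peMr.
have res : `|re (w * halfpow R k.+1)| <= 3 / 4.
  rewrite re_halfpow normrM normfV (ger0_norm (ltW pk0)) ler_pdivrMr //.
  have j1 : j%:R + 1 <= 2 ^+ k :> R by rewrite natr1 -natrX ler_nat.
  have k1 : k0%:R <= 2 ^+ k :> R.
    rewrite -natrX ler_nat; apply: leq_trans kk _; exact/ltnW/ltn_expl.
  have : `|re w| <= `|re z| + (j%:R + 1).
    have j0 : 0 <= j%:R :> R by [].
    case: hw => ->; rewrite ?(reD, reN, re1, re_nat).
      by apply: le_trans (ler_normD _ _) _; rewrite (ger0_norm j0); lra.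
    by rewrite -addrA -opprD; apply: le_trans (ler_normB _ _) _; rewrite (@ger0_norm _ (1 + j%:R)); lra.
  rewrite exprS; lra.
split.
  have h := hc _ res ims; rewrite nmM nmX nm_nat.
  apply: le_trans (ler_wpM2r (ltW pk0) h).
  rewrite nmM nm_halfpow -!mulrA mulVf ?mulr1 ?gt_eqF // ler_pM2l //.
  case: hw => ->.
    by apply: le_trans (h1 j); rewrite ler_wpM2r // ge_min lexx.
  by apply: le_trans (h2 j); rewrite ler_wpM2r // ge_min lexx orbT.
rewrite nm_ee ler_expR -mulrN ler_wpM2l //; first by rewrite mulr_ge0 // ltW.
by apply: le_trans ims; rewrite -normrN ler_norm.
Qed.

Lemma cv_scaled w : w != 0 ->
  cv (fun k => (ee (w * halfpow R k.+1) - 1) * 2%:R ^+ k.+1) (twopii R * w) /\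
  cv (fun k => ee (w * halfpow R k.+1)) 1.
Proof.
move=> w0; split.
  by have := cv_shift 1 (@ee_slope_cvg R w); apply: eq_cv => k; rewrite addn1.
by have := cv_shift 1 (@ee_halfpow_cvg R w); apply: eq_cv => k; rewrite addn1.
Qed.

Lemma eeP z : ee (z - 1) = ee z.
Proof. by rewrite eeD eeN (ee_nat R 1) invr1 mulr1. Qed.

Lemma ee_halves z : ee z != 1 -> exists2 w, ee (z / 2%:R) = w /\ ee ((z + 1) / 2%:R) = - w &
  ee z = w ^+ 2 /\ [/\ w - 1 != 0, w + 1 != 0 & w ^+ 2 - 1 != 0].
Proof.
move=> z1; exists (ee (z / 2%:R)); first split => //.
  by rewrite mulrDl mul1r eeD ee_half mulrN1.
have E : ee z = ee (z / 2%:R) ^+ 2.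
  by rewrite -eeM; congr ee; rewrite mulrCA divff ?mulr1 // pnatr_eq0.
move: z1; rewrite E -subr_eq0 => h; split => //.
move: (h); rewrite subr_sqr_1 mulf_eq0 negb_or => /andP[-> h'].
by split.
Qed.

(* sum over all integers n of 1/(z+n)^2, summed as n = j and n = -1-j *)
Lemma lipschitz2 z : ee z != 1 ->
  hasum (fun j => (z + j%:R) ^- 2 + (z - 1 - j%:R) ^- 2)
    (twopii R ^+ 2 * (ee z / (ee z - 1) ^+ 2)).
Proof.
move=> z1; pose f w := ee w / (ee w - 1) ^+ 2.
have t0 := twopii_neq0 R.
suff h : hasum (fun j => (twopii R * (z + j%:R)) ^- 2 + (twopii R * (z - 1 - j%:R)) ^- 2) (f z).
  apply: eq_hasum (hasumZ (twopii R ^+ 2) h) => j.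
  have := ee_neq1D j z1; have := ee_neq1B j z1.
  by move: (z + j%:R) (z - 1 - j%:R) => x y x0 y0; field; apply/and3P.
have [c [E [k0 [c0 H]]]] := scaled_lb z1.
have four : (4%:R : C) = 2%:R ^+ 2 by ring.
have fE k w : 4%:R^-1 ^+ k.+1 * f (w * halfpow R k.+1) =
    ee (w * halfpow R k.+1) / ((ee (w * halfpow R k.+1) - 1) * 2%:R ^+ k.+1) ^+ 2.
  rewrite /f four exprVn -exprM mulnC exprM exprMn !invfM.
  by ring.
apply: (@doubling_hasum f 4%:R^-1 _ (fun j => 2 * E / c ^+ 2 * (j.+1%:R ^+ 2)^-1) k0).
- move=> w w1; have [x [e1 e2] [e3 [n1 n2 n3]]] := ee_halves w1.
  rewrite /f e1 e2 e3; field; apply/and3P; split => //.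
  by rewrite -opprD oppr_eq0.
- by move=> w; rewrite /f eeP.
- exact: z1.
- move=> j; apply: (@eq_cv _ (fun k => 4%:R^-1 ^+ k.+1 * f ((z + j%:R) * halfpow R k.+1)
     + 4%:R^-1 ^+ k.+1 * f ((z - 1 - j%:R) * halfpow R k.+1))).
    by move=> k; rewrite mulrDr.
  have key w : w != 0 -> cv (fun k => 4%:R^-1 ^+ k.+1 * f (w * halfpow R k.+1)) ((twopii R * w) ^- 2).
    move=> w0; have [h1 h2] := cv_scaled w0.
    have n0 : (twopii R * w) * (twopii R * w) != 0 by rewrite !mulf_neq0.
    have := cvM h2 (cvV n0 (cvM h1 h1)); rewrite mul1r -expr2.
    by apply: eq_cv => k; rewrite fE.
  by apply: cvD; apply: key; [exact: ee_neq1D|exact: ee_neq1B].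
- move=> k j kk jk; rewrite mulrDr; apply: le_trans (nmD _ _) _.
  have key w : w = z + j%:R \/ w = z - 1 - j%:R ->
      nm (4%:R^-1 ^+ k.+1 * f (w * halfpow R k.+1)) <= E / c ^+ 2 * (j.+1%:R ^+ 2)^-1.
    move=> hw; have [h1 h2] := H k j kk jk w hw.
    rewrite fE nmM nmV nmX -mulrA -invfM -exprMn.
    have cj : 0 < c * j.+1%:R by rewrite mulr_gt0.
    apply: ler_pM (nm_ge0 _) _ h2 _; first by rewrite invr_ge0 exprn_ge0 // nm_ge0.
    rewrite lef_pV2 ?posrE ?exprn_gt0 //; last by apply: lt_le_trans h1.
    by rewrite ler_pXn2r ?nnegrE ?nm_ge0 // ltW.
  have := key _ (or_introl erefl); have := key _ (or_intror erefl).
  have -> : 2 * E / c ^+ 2 * j.+1%:R ^- 2 = E / c ^+ 2 * j.+1%:R ^- 2 + E / c ^+ 2 * j.+1%:R ^- 2 by ring.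
  by move=> h h'; apply: lerD.
- apply: smbZ (smb_invsq R); rewrite divr_ge0 ?sqr_ge0 // mulr_ge0 //.
  have [_] := H k0 0%N (leqnn _) (expn_gt0 2 k0) _ (or_introl erefl).
  exact: le_trans (nm_ge0 _).
Qed.

Lemma cot_hasum z : ee z != 1 ->
  hasum (fun j => (z + j%:R)^-1 + (z - 1 - j%:R)^-1)
    (twopii R / 2%:R * ((ee z + 1) / (ee z - 1))).
Proof.
move=> z1; pose f w := (ee w + 1) / (ee w - 1).
have t0 := twopii_neq0 R.
have two0 : 2%:R != 0 :> C by rewrite pnatr_eq0.
suff h : hasum (fun j => 2%:R / (twopii R * (z + j%:R)) + 2%:R / (twopii R * (z - 1 - j%:R))) (f z).
  apply: eq_hasum (hasumZ (twopii R / 2%:R) h) => j.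
  have := ee_neq1D j z1; have := ee_neq1B j z1.
  by move: (z + j%:R) (z - 1 - j%:R) => x y x0 y0; field; apply/and3P.
have [c [E [k0 [c0 H]]]] := scaled_lb z1.
have fE k w : 2%:R^-1 ^+ k.+1 * f (w * halfpow R k.+1) =
    (ee (w * halfpow R k.+1) + 1) / ((ee (w * halfpow R k.+1) - 1) * 2%:R ^+ k.+1).
  by rewrite /f exprVn invfM mulrC mulrA.
(* Separately the terms j and -1-j are only of order 1/(j+1). Their sum has numerator 2 (ab - 1),
   where ab = e((2z - 1) / 2^(k+1)) does not depend on j, and D bounds (ab - 1) 2^(k+1). *)
have [D hD] := cv_bounded (@ee_slope_cvg R (z + z - 1)).
have D0 : 0 <= D by apply: le_trans (nm_ge0 _) (hD 0%N).
apply: (@doubling_hasum f 2%:R^-1 _ (fun j => 2 * D / c ^+ 2 * (j.+1%:R ^+ 2)^-1) k0).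
- move=> w w1; have [x [e1 e2] [e3 [n1 n2 n3]]] := ee_halves w1.
  rewrite /f e1 e2 e3; field; apply/and3P; split => //.
  by rewrite -opprD oppr_eq0.
- by move=> w; rewrite /f eeP.
- exact: z1.
- move=> j; apply: (@eq_cv _ (fun k => 2%:R^-1 ^+ k.+1 * f ((z + j%:R) * halfpow R k.+1)
     + 2%:R^-1 ^+ k.+1 * f ((z - 1 - j%:R) * halfpow R k.+1))).
    by move=> k; rewrite mulrDr.
  have key w : w != 0 -> cv (fun k => 2%:R^-1 ^+ k.+1 * f (w * halfpow R k.+1)) (2%:R / (twopii R * w)).
    move=> w0; have [h1 h2] := cv_scaled w0.
    have n0 : twopii R * w != 0 by rewrite mulf_neq0.
    have := cvM (cvD h2 (cv_cst 1)) (cvV n0 h1).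
    by apply: eq_cv => k; rewrite fE.
  by apply: cvD; apply: key; [exact: ee_neq1D|exact: ee_neq1B].
- move=> k j kk jk; rewrite mulrDr !fE.
  have [h1 _] := H k j kk jk _ (or_introl erefl).
  have [h2 _] := H k j kk jk _ (or_intror erefl).
  have h3 := hD k.+1.
  have E3 : ee ((z + z - 1) * halfpow R k.+1) =
    ee ((z + j%:R) * halfpow R k.+1) * ee ((z - 1 - j%:R) * halfpow R k.+1).
    by rewrite -eeD; congr ee; ring.
  rewrite E3 in h3.
  have cj : 0 < c * j.+1%:R by rewrite mulr_gt0.
  have p0 : 2%:R ^+ k.+1 != 0 :> C by rewrite expf_neq0.
  have := lt_le_trans cj h1; have := lt_le_trans cj h2; rewrite !nm_gt0 !mulf_eq0 !negb_or.
  move: (ee ((z + _) * _)) (ee ((z - 1 - _) * _)) (2%:R ^+ k.+1) p0 h1 h2 h3 => a b P P0 h1 h2 h3.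
  move=> /andP[b0 _] /andP[a0 _].
  have -> : (a + 1) / ((a - 1) * P) + (b + 1) / ((b - 1) * P) =
    2%:R * ((a * b - 1) * P) / (((a - 1) * P) * ((b - 1) * P)).
    by field; apply/and3P.
  move: ((a * b - 1) * P) ((a - 1) * P) ((b - 1) * P) h1 h2 h3 => W U V h1 h2 h3.
  rewrite nmM nmV nmM nm_nat nmM.
  have -> : 2 * D / c ^+ 2 * j.+1%:R ^- 2 = 2 * D * (c * j.+1%:R * (c * j.+1%:R))^-1.
    by rewrite -expr2 exprMn [in RHS]invfM mulrA.
  apply: ler_pM.
  + by rewrite mulr_ge0 // nm_ge0.
  + by rewrite invr_ge0 mulr_ge0 // nm_ge0.
  + by rewrite ler_wpM2l.
  rewrite lef_pV2 ?posrE; last 2 first.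
  + by apply: mulr_gt0; [exact: lt_le_trans h1|exact: lt_le_trans h2].
  + by rewrite mulr_gt0.
  by apply: ler_pM => //; exact: ltW.
- by apply: smbZ (smb_invsq R); rewrite divr_ge0 ?sqr_ge0 // mulr_ge0.
Qed.

End PartialFractions.

(** * E2 under inversion *)
Section EisensteinInversion.
Variable R : realType.
Local Notation C := (CC R).
Implicit Types (z w s tau : C) (x y : R).

Lemma im0 : im (0 : C) = 0. Proof. by []. Qed.

Lemma qpowE (n : nat) tau : qpow n%:R tau = ee tau ^+ n.
Proof. by rewrite -eeM /qpow /ee mulrA. Qed.

Lemma nm_ee_lt1 tau : upper tau -> nm (ee tau) < 1.
Proof.
rewrite /upper => h; rewrite nm_ee -[ltRHS]expR0 ltr_expR oppr_lt0.
by rewrite !mulr_gt0 // pi_gt0.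
Qed.

Lemma upper_neq0 tau : upper tau -> tau != 0.
Proof. by rewrite /upper => h; apply: contraTneq h => ->; rewrite im0 ltxx. Qed.

Lemma ee_upper_neq1 tau : upper tau -> ee tau != 1.
Proof. by move=> /nm_ee_lt1; apply: contraTneq => ->; rewrite nm1 ltxx. Qed.

Lemma upperMn tau n : upper tau -> upper (n.+1%:R * tau).
Proof. by rewrite /upper imM re_nat im_nat mul0r addr0 => h; rewrite mulr_gt0. Qed.

Lemma im_inv z : im z^-1 = - im z / nm z ^+ 2.
Proof.
have [->|z0] := eqVneq z 0.
  by rewrite invr0 im0 oppr0 mul0r.
have n0 : nm z ^+ 2 != 0 by rewrite expf_neq0 // nm_eq0.
have -> : z^-1 = Complex (re z / nm z ^+ 2) (- im z / nm z ^+ 2).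
  apply: (@mulfI _ z) => //; rewrite divff //; apply: ceq; rewrite ?(reM, imM) /=.
    by rewrite mulNr mulrN opprK !mulrA -mulrDl -!expr2 -nm2 divff.
  by rewrite im1; ring.
by [].
Qed.

Lemma upperS tau : upper tau -> upper (- tau^-1).
Proof.
move=> h; have t0 := upper_neq0 h; rewrite /upper imN im_inv mulNr opprK divr_gt0 //.
by rewrite exprn_gt0 // nm_gt0.
Qed.

Lemma inv_cv0 z : cv (fun n => (z + n%:R)^-1) 0.
Proof.
move=> e e0; have n0 := nm_ge0 z.
exists (Num.truncn (nm z + e^-1)).+1 => n hn; rewrite subr0 nmV.
have h1 : nm z + e^-1 < n%:R.
  have h0 := Num.Theory.real_truncnS_gt (num_real (nm z + e^-1)).
  by apply: (lt_le_trans h0); rewrite ler_nat.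
have h2 : e^-1 < nm (z + n%:R).
  have := nm_lerB n%:R (- z); rewrite nmN nm_nat opprK [z + _]addrC; lra.
by rewrite -[ltRHS]invrK ltf_pV2 // posrE ?invr_gt0 // (lt_trans _ h2) ?invr_gt0.
Qed.

(** Changes the pairing of j with -1-j into that of n with -n. The partial sums differ by a_n - a_0,
    hence the condition on the limit of a. *)
Lemma sym_hasum (a b : nat -> C) S : hasum (fun j => a j + b j) S -> cv a 0 ->
  hasum (fun j => a j.+1 + b j) (S - a 0%N).
Proof.
move=> h ha; have := cvB (cvD h ha) (cv_cst (a 0%N)); rewrite addr0.
apply: eq_cv => n; elim: n => [|n IH]; first by rewrite !big_ord0 add0r subrr.
by rewrite [RHS]big_ord_recr /= -IH big_ord_recr /=; ring.
Qed.

(** For Im z > 0 this is the sum of n q^n with q = e(z); (2 pi i)^2 times it is the sum of (z +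
    n)^-2 over all integers n. *)
Definition Psi z : C := ee z / (ee z - 1) ^+ 2.

Lemma lipschitz2_sym z : ee z != 1 ->
  hasum (fun n => (z + n.+1%:R) ^- 2 + (z - n.+1%:R) ^- 2)
    (twopii R ^+ 2 * Psi z - z ^- 2).
Proof.
move=> /lipschitz2 h.
have h0 : cv (fun j => (z + j%:R) ^- 2) 0.
  have := cvM (inv_cv0 z) (inv_cv0 z); rewrite mulr0; apply: eq_cv => n.
  by rewrite -expr2 exprVn.
have := sym_hasum h h0; rewrite addr0; apply: eq_hasum => n.
by congr (_ + _ ^- 2); rewrite -natr1; ring.
Qed.

Lemma cot_sym z : ee z != 1 ->
  hasum (fun n => (z + n.+1%:R)^-1 + (z - n.+1%:R)^-1)
    (twopii R / 2%:R * ((ee z + 1) / (ee z - 1)) - z^-1).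
Proof.
move=> /cot_hasum h.
have := sym_hasum h (inv_cv0 z); rewrite addr0; apply: eq_hasum => n.
by congr (_ + _ ^-1); rewrite -natr1; ring.
Qed.

(** The value is pi^2 / 6. The expansion of 1/sin^2 at z = 1/2 gives the sum over odd integers, and
    the even terms are a quarter of the whole sum. *)
Lemma zeta2 : hasum (fun n => (n.+1%:R : C) ^- 2) (- twopii R ^+ 2 / 24%:R).
Proof.
have [s hs] : exists s, hasum (fun n => (n.+1%:R : C) ^- 2) s.
  by apply: hasum_ex (smb_invsq R) => n; rewrite nmV nmX nm_nat.
have two0 : 2%:R != 0 :> C by rewrite pnatr_eq0.
have e1 : ee (2^-1 : C) != 1.
  rewrite ee_half eq_sym -subr_eq0 opprK -[1 + 1]/(2%:R) //.
have h1 := lipschitz2 e1.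
have h2 : hasum (fun j => (j.*2.+1%:R : C) ^- 2) (- twopii R ^+ 2 / 32%:R).
  have := hasumZ (8%:R^-1) h1; rewrite ee_half.
  have -> : 8%:R^-1 * (twopii R ^+ 2 * (-1 / (-1 - 1) ^+ 2)) = - twopii R ^+ 2 / 32%:R by field.
  apply: eq_hasum => j.
  have j0 : j.*2.+1%:R != 0 :> C by rewrite pnatr_eq0.
  have -> : 2^-1 + j%:R = j.*2.+1%:R / 2%:R :> C.
    by rewrite -[j.*2.+1%:R]natr1 -muln2 natrM; field.
  have -> : 2^-1 - 1 - j%:R = - (j.*2.+1%:R / 2%:R) :> C.
    by rewrite -[j.*2.+1%:R]natr1 -muln2 natrM; field.
  by field.
have h3 : hasum (fun j => (j.*2.+1%:R : C) ^- 2 + 4%:R^-1 * (j.+1%:R : C) ^- 2) s.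
  have dbl n : (n <= n.*2)%N by rewrite -addnn leq_addr.
  have h := @cv_sub R _ _ double dbl hs; move=> e /h[N HN]; exists N => n /HN; congr (nm (_ - _) < _).
  elim: n => [|n IH]; first by rewrite !big_ord0.
  rewrite doubleS !big_ord_recr /= IH -addrA; congr (_ + (_ + _)).
  rewrite -doubleS -muln2 natrM exprMn invfM mulrC; congr (_ * _).
  by rewrite expr2; congr (_^-1); ring.
have h4 := hasumD h2 (hasumZ 4%:R^-1 hs).
have E := hasum_uniq h3 h4.
suff <- : s = - twopii R ^+ 2 / 24%:R by [].
have : 3%:R * s = 3%:R * (- twopii R ^+ 2 / 24%:R).
  have E' : 4%:R * s = 4%:R * (- twopii R ^+ 2 / 32%:R + 4%:R^-1 * s) by rewrite -E.
  have E2 : 4%:R * (4%:R^-1 * s) = s by field.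
  rewrite mulrDr E2 in E'.
  have -> : 3%:R * s = 4%:R * s - s by ring.
  by rewrite E'; field.
by apply: mulfI; rewrite pnatr_eq0.
Qed.

Lemma cv_geom (x : C) : nm x < 1 -> cv (fun n => x ^+ n) 0.
Proof.
move=> h; apply: (@cv_squeeze _ _ _ (fun n => nm x ^+ n)) => [n|].
  by rewrite subr0 nmX.
by apply: cvg_expr; rewrite ger0_norm ?nm_ge0.
Qed.

Lemma hasum_geom (x : C) : nm x < 1 -> hasum (fun n => x ^+ n) (1 - x)^-1.
Proof.
move=> h; have x1 : 1 - x != 0.
  by rewrite subr_eq0; apply: contraTneq h => <-; rewrite nm1 ltxx.
have h0 := cv_geom h.
have := cvM (cvB (cv_cst 1) h0) (cv_cst (1 - x)^-1); rewrite subr0 mul1r.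
apply: eq_cv => n; have := subrX1 x n => E.
apply: (@mulIf _ (1 - x)) => //; rewrite divfK //.
by rewrite -[RHS]opprK -mulrN opprB [_ * (x - 1)]mulrC -E opprB.
Qed.

Lemma hasum_dgeom (x : C) : nm x < 1 -> hasum (fun n => n.+1%:R * x ^+ n.+1) (x / (x - 1) ^+ 2).
Proof.
move=> h; have g := hasum_geom h.
have sm : smb (fun n => nm x ^+ n) by apply: smb_geom => //; exact: nm_ge0.
have b n : nm (x ^+ n) <= nm x ^+ n by rewrite nmX.
have := hasumZ x (mertens b b sm sm g g).
have -> : x * ((1 - x)^-1 * (1 - x)^-1) = x / (x - 1) ^+ 2.
  by rewrite -invfM -expr2 -[(x - 1) ^+ 2]sqrrN opprB.
apply: eq_hasum => n; rewrite (eq_bigr (fun=> x ^+ n)); last first.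
  by move=> i _; rewrite -exprD subnKC // -ltnS.
by rewrite sumr_const card_ord -[_ *+ _]mulr_natl exprS; ring.
Qed.

Lemma smb_dgeom (r : R) : 0 <= r -> r < 1 -> smb (fun n => n.+1%:R * r ^+ n).
Proof.
move=> r0 r1; split => [i|]; first by rewrite mulr_ge0 // exprn_ge0.
exists ((1 - r) ^- 2) => N; have h : 0 < (1 - r) ^+ 2 by rewrite exprn_gt0 //; lra.
rewrite -[leRHS]mul1r ler_pdivlMr //.
have -> : (\sum_(i < N) i.+1%:R * r ^+ i) * (1 - r) ^+ 2 =
    1 - N.+1%:R * r ^+ N + N%:R * r ^+ N.+1.
  elim: N => [|N IH]; first by rewrite big_ord0 expr0; ring.
  by rewrite big_ord_recr mulrDl IH /= !exprS -!natr1; ring.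
have p : 0 <= r ^+ N by exact: exprn_ge0.
have n0 : 0 <= N%:R :> R by [].
rewrite exprS -[N.+1%:R]natr1.
have : 0 <= N%:R * r ^+ N * (1 - r) by rewrite !mulr_ge0 //; lra.
lra.
Qed.

Lemma hasum_dvd (f : nat -> C) m s : hasum (fun d => f d.+1) s ->
  hasum (fun n => if (m.+1 %| n.+1)%N then f (n.+1 %/ m.+1)%N else 0) s.
Proof.
move=> h e /h[N HN]; exists (N * m.+1)%N => n Nn.
have -> : \sum_(i < n) (if (m.+1 %| i.+1)%N then f (i.+1 %/ m.+1)%N else 0) =
    \sum_(d < n %/ m.+1) f d.+1.
  elim: (n) => [|k IH]; first by rewrite div0n !big_ord0.
  rewrite big_ord_recr /= IH divnS //.
  by case: (_ %| _)%N; rewrite ?addr0 // add1n big_ord_recr.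
by apply: HN; rewrite leq_divRL.
Qed.

Lemma sum_codivisors n : (\sum_(m < n.+1 | m.+1 %| n.+1) (n.+1 %/ m.+1) = sigmak 1 n.+1)%N.
Proof.
rewrite /sigmak; under [RHS]eq_bigr do rewrite expn1.
have E : perm_eq [seq (n.+1 %/ d)%N | d <- divisors n.+1] (divisors n.+1).
  apply: uniq_perm; rewrite ?divisors_uniq //.
    rewrite map_inj_in_uniq ?divisors_uniq // => a b.
    rewrite -!dvdn_divisors // => ha hb ab.
    have b0 : (0 < n.+1 %/ b)%N by rewrite divn_gt0 ?(dvdn_gt0 _ hb) // dvdn_leq.
    by apply/eqP; rewrite -(eqn_pmul2l b0) -{1}ab !divnK.
  move=> d; apply/mapP/idP => [[e he ->]|hd].
    by rewrite -!dvdn_divisors // in he *; exact: dvdn_div.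
  exists (n.+1 %/ d)%N; rewrite -!dvdn_divisors // in hd *; first exact: dvdn_div.
  by rewrite divnA // mulKn.
rewrite -(perm_big _ E) big_map /=.
rewrite -(big_mkord (fun m => m.+1 %| n.+1)%N (fun m => n.+1 %/ m.+1)%N).
rewrite -(@big_add1 _ _ _ 0%N n.+2 (fun m => m %| n.+1)%N (fun m => n.+1 %/ m)%N).
rewrite /index_iota -big_filter; apply: perm_big; apply: uniq_perm.
- by rewrite filter_uniq // iota_uniq.
- exact: divisors_uniq.
move=> d; rewrite mem_filter mem_iota -dvdn_divisors //.
case: (boolP (d %| n.+1)%N) => // h /=.
by rewrite subn1 /= (dvdn_gt0 _ h) //= add1n ltnS dvdn_leq.
Qed.

Definition lam tau : C := csum (fun n => (sigmak 1 n.+1)%:R * qpow (n.+1)%:R tau).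

Lemma lambert tau : upper tau ->
  hasum (fun n => (sigmak 1 n.+1)%:R * qpow (n.+1)%:R tau) (lam tau) /\
  hasum (fun m => Psi (m.+1%:R * tau)) (lam tau).
Proof.
move=> ht; set q := ee tau; have q1 : nm q < 1 := nm_ee_lt1 ht.
(* The exchange needs a product majorant. If m+1 divides n+1 then m <= n, so |q|^(n+1) = r^(2n+2) is
   at most r^m r^n. *)
pose r := Num.sqrt (nm q); have r0 : 0 <= r by exact: sqrtr_ge0.
have r2 : r ^+ 2 = nm q by rewrite sqr_sqrtr // nm_ge0.
have r1 : r < 1 by rewrite -sqrtr1 ltr_sqrt.
pose u m n := if (m.+1 %| n.+1)%N then (n.+1 %/ m.+1)%N%:R * q ^+ n.+1 else 0 : C.
have ub m n : nm (u m n) <= r ^+ m * (n.+1%:R * r ^+ n).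
  rewrite /u; case: ifP => [h|_]; last by rewrite nm0 mulr_ge0 ?mulr_ge0 ?exprn_ge0.
  rewrite nmM nm_nat nmX -r2 -exprM.
  have mn : (m <= n)%N by rewrite -ltnS dvdn_leq.
  rewrite mulrCA; apply: ler_pM; rewrite ?exprn_ge0 // ?ler_nat ?leq_div //.
  by rewrite -exprD; apply: ler_wiXn2l => //; [exact: ltW|lia].
have sa : smb (fun m => r ^+ m) by exact: smb_geom.
have sb := smb_dgeom r0 r1.
have hr m : hasum (u m) (Psi (m.+1%:R * tau)).
  have := @hasum_dvd (fun d => d%:R * ee (m.+1%:R * tau) ^+ d) m _ (hasum_dgeom (nm_ee_lt1 (upperMn m ht))).
  apply: eq_hasum => n; rewrite /u; case: ifP => // h.
  by rewrite eeM -exprM mulnC divnK.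
have hc n : hasum (fun m => u m n) ((sigmak 1 n.+1)%:R * qpow (n.+1)%:R tau).
  have := @hasum_fin _ (fun m => u m n) n.+1.
  have -> : \sum_(i < n.+1) u i n = (sigmak 1 n.+1)%:R * qpow (n.+1)%:R tau.
    rewrite -sum_codivisors natr_sum mulr_suml [RHS]big_mkcond /=.
    by apply: eq_bigr => i _; rewrite /u qpowE.
  apply=> m nm_; rewrite /u; case: ifP => // /dvdn_leq -/(_ isT).
  by rewrite ltnS leqNgt nm_.
have [B hB] : exists B : R, forall N, \sum_(i < N) i.+1%:R * r ^+ i <= B by case: sb.
have [s hs] : exists s, hasum (fun m => Psi (m.+1%:R * tau)) s.
  apply: (@hasum_ex _ _ (fun m => B * r ^+ m)); last first.
    by apply: smbZ => //; have := hB 0%N; rewrite big_ord0.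
  move=> m; apply: (nm_hasum (hr m)) => N.
  apply: (@le_trans _ _ (\sum_(i < N) r ^+ m * (i.+1%:R * r ^+ i))).
    by apply: ler_sum.
  by rewrite -mulr_sumr mulrC ler_wpM2r ?exprn_ge0.
have hs' := exchange_hasum ub sa sb hr hc hs.
by rewrite /lam (csumE hs').
Qed.

Lemma E2_lam tau : E2 tau = 1 - 24%:R * lam tau. Proof. by []. Qed.

Lemma PsiN z : Psi (- z) = Psi z.
Proof.
rewrite /Psi eeN; have := ee_neq0 z; move: (ee z) => x x0.
have [->|x1] := eqVneq x 1; first by rewrite invr1.
have x10 : x - 1 != 0 by rewrite subr_eq0.
have x10' : 1 - x != 0 by rewrite subr_eq0 eq_sym.
have -> : x - 1 = - (1 - x) by ring.
by rewrite sqrrN; field; rewrite ?x0 ?x10'.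
Qed.

(* Eisenstein's argument: E2 and tau^-2 E2 (-1/tau) are the two iterated sums of the
   same double series, which differs by an absolutely convergent one from a
   comparison series that telescopes; the discrepancy is read off from the latter. *)
Lemma E2_S tau : upper tau ->
  E2 (- tau^-1) = tau ^+ 2 * E2 tau + 12%:R / twopii R * tau.
Proof.
move=> ht; have t0 := upper_neq0 ht; have tp0 := twopii_neq0 R.
pose t := twopii R.
have yp : 0 < im tau by [].
have np : 0 < nm tau by rewrite nm_gt0.
pose W m (k : R) : C := m.+1%:R * tau + toC k.
pose c1 := im tau; pose c2 := im tau / (2 * nm tau).
have c10 : 0 < c1 by [].
have c20 : 0 < c2 by rewrite divr_gt0 // mulr_gt0.
have imW m k : im (W m k) = m.+1%:R * im tau.
  by rewrite imD imM re_nat im_nat im_toC mul0r !addr0.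
have W0 m k : W m k != 0.
  apply/eqP => h; have := imW m k; rewrite h im0 => /esym/eqP.
  by rewrite mulf_eq0 pnatr_eq0 /= gt_eqF.
have m0 m k : m.+1%:R * c1 <= nm (W m k).
  by rewrite /c1 -(imW m k); apply: le_trans (ler_norm _) (im_le _).
(* The growth in n is seen on the imaginary part of w / tau, as that in m is on the imaginary part
   of w. *)
have n0 m n k : n.+1%:R / 2 <= `|k| -> n.+1%:R * c2 <= nm (W m k).
  move=> hk; have E : im (W m k / tau) = k * (- im tau / nm tau ^+ 2).
    by rewrite mulrDl mulfK // imD im_nat add0r imM re_toC im_toC mul0r addr0 im_inv.
  have := im_le (W m k / tau); rewrite E nmM nmV mulNr mulrN normrN normrM.
  have P0 : 0 <= im tau / nm tau ^+ 2 by rewrite divr_ge0 ?exprn_ge0 ?ltW.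
  rewrite (ger0_norm P0).
  rewrite ler_pdivlMr // => h; apply: le_trans h.
  have -> : `|k| * (im tau / nm tau ^+ 2) * nm tau = `|k| * (im tau / nm tau).
    by field; rewrite gt_eqF.
  have -> : n.+1%:R * c2 = n.+1%:R / 2 * (im tau / nm tau).
    by rewrite /c2; field; rewrite gt_eqF.
  by rewrite ler_wpM2r // divr_ge0 // ltW.
clearbody c2.
have quarter m k : W m k ^+ 2 - 4%:R^-1 = W m (k + 2^-1) * W m (k - 2^-1).
  by rewrite /W !toCD toCN toCV toC_nat; field.
(* The comparison series: 1/(w^2 - 1/4) = 1/(w - 1/2) - 1/(w + 1/2) telescopes along n, and it
   differs from 1/w^2 by O(m^-2 n^-2). *)
pose t2 m n : C := (W m n.+1%:R ^+ 2 - 4%:R^-1)^-1 + (W m (- n.+1%:R) ^+ 2 - 4%:R^-1)^-1.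
pose s m n : C := W m n.+1%:R ^- 2 + W m (- n.+1%:R) ^- 2.
have half_le n (k : R) : `|k| = n.+1%:R -> [/\ n.+1%:R / 2 <= `|k|,
    n.+1%:R / 2 <= `|k + 2^-1| & n.+1%:R / 2 <= `|k - 2^-1|].
  move=> hk; have h1 := ler_normD (k + 2^-1) (- 2^-1); have h2 := ler_normD (k - 2^-1) 2^-1.
  have p2 : 0 <= 2^-1 :> R by rewrite invr_ge0.
  rewrite addrK normrN (ger0_norm p2) in h1; rewrite subrK (ger0_norm p2) in h2.
  have h3 : 1 <= n.+1%:R :> R by rewrite ler1n.
  split; lra.
have prod_lb m n k k' : n.+1%:R / 2 <= `|k| -> n.+1%:R / 2 <= `|k'| ->
    (m.+1%:R * c1) * (n.+1%:R * c2) <= nm (W m k) * nm (W m k').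
  move=> h h'; apply: ler_pM => //; last exact: n0.
    by rewrite mulr_ge0 // ltW.
  by rewrite mulr_ge0 // ltW.
have dkey m n k : `|k| = n.+1%:R ->
    nm (W m k ^- 2 - (W m k ^+ 2 - 4%:R^-1)^-1) <=
    4^-1 / (c1 * c2) ^+ 2 * (m.+1%:R ^+ 2)^-1 * (n.+1%:R ^+ 2)^-1.
  move=> hk; have [k1 k2 k3] := half_le _ _ hk.
  have -> : W m k ^- 2 - (W m k ^+ 2 - 4%:R^-1)^-1 =
     - 4%:R^-1 / ((W m k * W m k) * (W m (k + 2^-1) * W m (k - 2^-1))).
    have q0 : W m k ^+ 2 - 4%:R^-1 != 0 by rewrite quarter mulf_neq0.
    rewrite -quarter; have := W0 m k; move: q0.
    have : 4%:R^-1 = W m k ^+ 2 - (W m k ^+ 2 - 4%:R^-1) by rewrite opprB addrC subrK.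
    move: (W m k) (W m k ^+ 2 - _) => w Q; move: (4%:R^-1) => x -> Q0 w0.
    by field; rewrite w0 Q0.
  rewrite nmM nmN nmV nm_nat nmV !nmM -!mulrA ler_pM2l ?invr_gt0 //.
  rewrite -!invfM lef_pV2 ?posrE.
  - have h1 := prod_lb m n k k k1 k1; have h2 := prod_lb m n _ _ k2 k3.
    have p0 : 0 <= m.+1%:R * c1 * (n.+1%:R * c2) by rewrite !mulr_ge0 ?(ltW c10) ?(ltW c20).
    have := ler_pM p0 p0 h1 h2; congr (_ <= _); ring.
  - by rewrite !mulr_gt0 // nm_gt0.
  - by rewrite !mulr_gt0 ?exprn_gt0 ?mulr_gt0.
have ub m n : nm (s m n - t2 m n) <= (2^-1 / (c1 * c2) ^+ 2 * (m.+1%:R ^+ 2)^-1) * (n.+1%:R ^+ 2)^-1.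
  have -> : s m n - t2 m n = (W m n.+1%:R ^- 2 - (W m n.+1%:R ^+ 2 - 4%:R^-1)^-1) +
    (W m (- n.+1%:R) ^- 2 - (W m (- n.+1%:R) ^+ 2 - 4%:R^-1)^-1) by rewrite /s /t2; ring.
  have h1 := dkey m n n.+1%:R (normr_nat _ _).
  have h2 : `|- n.+1%:R| = n.+1%:R :> R by rewrite normrN normr_nat.
  have h3 := dkey m n _ h2.
  apply: le_trans (nmD _ _) _; apply: le_trans (lerD h1 h3) _.
  by rewrite le_eqVlt; apply/orP; left; apply/eqP; field; rewrite !gt_eqF.
have sqb := smb_invsq R.
have sa : smb (fun m => 2^-1 / (c1 * c2) ^+ 2 * (m.+1%:R ^+ 2)^-1).
  by apply: smbZ sqb; rewrite divr_ge0 // ?sqr_ge0 // invr_ge0.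
pose r' m : C := - ((m.+1%:R * tau) ^+ 2 - 4%:R^-1)^-1.
pose cc (N : nat) : R := N%:R + 2^-1.
pose kap m N : C := (W m (- cc N))^-1 - (W m (cc N))^-1.
have tele m N : \sum_(n < N) t2 m n = r' m + kap m N.
  have E k : (W m k ^+ 2 - 4%:R^-1)^-1 = (W m (k - 2^-1))^-1 - (W m (k + 2^-1))^-1.
    have := W0 m (k - 2^-1); have := W0 m (k + 2^-1); rewrite quarter.
    have E1 : W m (k + 2^-1) = W m (k - 2^-1) + 1.
      by rewrite /W !toCD toCN toCV toC_nat; field.
    by rewrite E1; move: (W m (k - _)) => w w0 w1; field; apply/andP.
  elim: N => [|N IH].
    have := E 0; rewrite big_ord0 /r' /kap /cc !add0r {1}/W toC0 addr0 => ->.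
    by rewrite addrC subrr.
  rewrite big_ord_recr /= IH /t2 !E /kap /cc -[N.+1%:R]natr1.
  have -> : N%:R + 1 - 2^-1 = N%:R + 2^-1 :> R by field.
  have -> : - (N%:R + 1) + 2^-1 = - (N%:R + 2^-1) :> R by field.
  have -> : - (N%:R + 1) - 2^-1 = - (N%:R + 1 + 2^-1) :> R by field.
  by ring.
have htr m : hasum (t2 m) (r' m).
  have h1 : cv (fun N => (W m (cc N))^-1) 0.
    apply: eq_cv (inv_cv0 (m.+1%:R * tau + toC 2^-1)) => N.
    by rewrite /W /cc toCD toC_nat -addrA [N%:R + _]addrC.
  have h2 : cv (fun N => (W m (- cc N))^-1) 0.
    have := cvB (cv_cst 0) (inv_cv0 (toC 2^-1 - m.+1%:R * tau)); rewrite subr0.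
    apply: eq_cv => N; rewrite sub0r -invrN; congr (_^-1).
    by rewrite /W /cc toCN toCD toC_nat; ring.
  have := cvD (cv_cst (r' m)) (cvB h2 h1); rewrite subrr addr0.
  by apply: eq_cv => N; rewrite tele.
have tinv m k : nm ((W m k ^+ 2 - 4%:R^-1)^-1) <= c1 ^- 2 * (m.+1%:R ^+ 2)^-1.
  rewrite quarter nmV nmM -invfM lef_pV2 ?posrE ?mulr_gt0 ?nm_gt0 ?exprn_gt0 //.
  rewrite -exprMn expr2 [c1 * _]mulrC; apply: ler_pM => //.
    by rewrite mulr_ge0 // ltW.
  by rewrite mulr_ge0 // ltW.
have sc1 : smb (fun m => c1 ^- 2 * (m.+1%:R ^+ 2)^-1).
  by apply: smbZ sqb; rewrite invr_ge0 sqr_ge0.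
have ex_c' n : exists x : C, hasum (fun m => t2 m n) x.
  apply: (hasum_ex _ (smbD sc1 sc1)) => m.
  by apply: le_trans (nmD _ _) _; apply: lerD; exact: tinv.
have [c' hc'] := choice ex_c'.
have [rho' hrho'] : exists x : C, hasum r' x.
  apply: (hasum_ex _ sc1) => m; rewrite /r' nmN.
  by have := tinv m 0; rewrite /W toC0 addr0.
have ee1 (k : R) : 0 < k -> ee (toC k / tau) != 1.
  move=> k0; have : 1 < nm (ee (toC k / tau)).
    rewrite nm_ee -[ltLHS]expR0 ltr_expR imM re_toC im_toC mul0r addr0 im_inv.
    by rewrite mulNr !mulrN opprK !mulr_gt0 ?pi_gt0 ?invr_gt0 ?exprn_gt0.
  by apply: contraTneq => ->; rewrite nm1 ltxx.
(* The boundary terms of the telescoping sum, summed over m, form a cotangent series at (N + 1/2) /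
   tau. *)
have hkap N : hasum (fun m => kap m N)
    (- tau^-1 * (t / 2%:R * ((ee (toC (cc N) / tau) + 1) / (ee (toC (cc N) / tau) - 1))
      - (toC (cc N) / tau)^-1)).
  have cN0 : 0 < cc N by rewrite /cc ltr_wpDl // invr_gt0.
  apply: eq_hasum (hasumZ (- tau^-1) (cot_sym (ee1 _ cN0))) => m.
  have -> : toC (cc N) / tau + m.+1%:R = W m (cc N) / tau by rewrite /W; field.
  have -> : toC (cc N) / tau - m.+1%:R = - (W m (- cc N) / tau) by rewrite /W toCN; field.
  rewrite /kap; have := W0 m (cc N); have := W0 m (- cc N).
  by move: (W m _) (W m _) => w w' w0 w'0; field; apply/and3P.
pose c n : C := tau ^- 2 * (t ^+ 2 * Psi (n.+1%:R / tau) - (n.+1%:R / tau) ^- 2).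
have hc n : hasum (fun m => s m n) (c n).
  have nn0 : (0 : R) < n.+1%:R by [].
  have := lipschitz2_sym (ee1 _ nn0); rewrite toC_nat => h.
  apply: eq_hasum (hasumZ (tau ^- 2) h) => m.
  have -> : n.+1%:R / tau + m.+1%:R = W m n.+1%:R / tau by rewrite /W toC_nat; field.
  have -> : n.+1%:R / tau - m.+1%:R = - (W m (- n.+1%:R) / tau) by rewrite /W toCN toC_nat; field.
  rewrite /s; have := W0 m n.+1%:R; have := W0 m (- n.+1%:R).
  by move: (W m _) (W m _) => w w' w0 w'0; field; apply/and3P.
pose rr m : C := t ^+ 2 * Psi (m.+1%:R * tau) - (m.+1%:R * tau) ^- 2.
have hrr m : hasum (s m) (rr m).
  have := lipschitz2_sym (ee_upper_neq1 (upperMn m ht)); apply: eq_hasum => n.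
  by rewrite /s /W toCN toC_nat.
have [_ l1] := lambert ht; have [_ l2] := lambert (upperS ht).
have hrho : hasum rr (t ^+ 2 * lam tau - tau ^- 2 * (- t ^+ 2 / 24%:R)).
  apply: eq_hasum (hasumB (hasumZ (t ^+ 2) l1) (hasumZ (tau ^- 2) zeta2)) => m.
  have Ei (x y : C) : (x * y) ^- 2 = y ^- 2 * x ^- 2 by rewrite exprMn [LHS]invfM mulrC.
  by rewrite /rr Ei.
have hsig : hasum c (tau ^- 2 * (t ^+ 2 * lam (- tau^-1) - tau ^+ 2 * (- t ^+ 2 / 24%:R))).
  apply: hasumZ; apply: eq_hasum (hasumB (hasumZ (t ^+ 2) l2) (hasumZ (tau ^+ 2) zeta2)) => m.
  by rewrite mulrN PsiN expr_div_n invf_div.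
have hdr m : hasum (fun n => s m n - t2 m n) (rr m - r' m) by exact: hasumB.
have hdc n : hasum (fun m => s m n - t2 m n) (c n - c' n) by exact: hasumB.
have hex := exchange_hasum ub sa sqb hdr hdc (hasumB hrho hrho').
have hc2 := hasumB hsig hex.
(* The two orders of summation of the comparison series differ by t / (2 tau): as e(-(N + 1/2) /
   tau) tends to 0, the cotangent tends to a nonzero constant. This is the whole anomaly of E2. *)
have hc3 : hasum c' (rho' - t / (2%:R * tau)).
  have ecv : cv (fun N => ee (- (toC (cc N) / tau))) 0.
    have := cvM (cv_geom (nm_ee_lt1 (upperS ht))) (cv_cst (ee (- (toC 2^-1 / tau)))).
    rewrite mul0r; apply: eq_cv => N; rewrite -eeM -eeD; congr ee.
    by rewrite /cc toCD toC_nat; ring.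
  have icv : cv (fun N => (toC (cc N) / tau)^-1) 0.
    have := cvM (cv_cst tau) (inv_cv0 (toC 2^-1)); rewrite mulr0.
    by apply: eq_cv => N; rewrite invf_div /cc toCD toC_nat [toC _ + _]addrC.
  have one0 : (1 : C) - 0 != 0 by rewrite subr0 oner_eq0.
  have kcv := cvM (cvD (cv_cst 1) ecv) (cvV one0 (cvB (cv_cst 1) ecv)).
  have := cvD (cv_cst rho') (cvM (cv_cst (- tau^-1)) (cvB (cvM (cv_cst (t / 2%:R)) kcv) icv)).
  rewrite addr0 !subr0 invr1 !mulr1.
  have -> : - tau^-1 * (t / 2) = - (t / (2%:R * tau)) by field.
  apply: eq_cv => N.
  have -> : (1 + ee (- (toC (cc N) / tau))) / (1 - ee (- (toC (cc N) / tau))) =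
     (ee (toC (cc N) / tau) + 1) / (ee (toC (cc N) / tau) - 1).
    have cN0 : 0 < cc N by rewrite /cc ltr_wpDl // invr_gt0.
    have := ee1 _ cN0; have := ee_neq0 (toC (cc N) / tau); rewrite eeN.
    move: (ee _) => x x0; rewrite -subr_eq0 => x1; field.
    by rewrite x0 x1.
  have h1 : hasum (fun m => \sum_(n < N) t2 m n) (\sum_(n < N) c' n).
    by apply: hasum_sum => k; exact: hc'.
  have h2 := hasumD hrho' (hkap N).
  apply: (hasum_uniq h2); apply: eq_hasum h1 => m; exact: tele.
have hc4 : hasum c' (tau ^- 2 * (t ^+ 2 * lam (- tau^-1) - tau ^+ 2 * (- t ^+ 2 / 24%:R))
   - (t ^+ 2 * lam tau - tau ^- 2 * (- t ^+ 2 / 24%:R) - rho')).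
  by apply: eq_hasum hc2 => n; ring.
have := hasum_uniq hc3 hc4; rewrite !E2_lam.
move: (lam _) (lam _) => L L' EQ.
have EQ' : t / (2%:R * tau) = t ^+ 2 * L - tau ^- 2 * (- t ^+ 2 / 24%:R) -
   tau ^- 2 * (t ^+ 2 * L' - tau ^+ 2 * (- t ^+ 2 / 24%:R)).
  apply/eqP; rewrite -subr_eq0; apply/eqP.
  move/eqP: EQ; rewrite -subr_eq0 => /eqP EQ; rewrite -[RHS]oppr0 -EQ; ring.
have EQ2 : 24%:R * (tau ^+ 2 / t ^+ 2) * (t / (2%:R * tau)) =
  24%:R * (tau ^+ 2 / t ^+ 2) * (t ^+ 2 * L - tau ^- 2 * (- t ^+ 2 / 24%:R) -
   tau ^- 2 * (t ^+ 2 * L' - tau ^+ 2 * (- t ^+ 2 / 24%:R))) by rewrite EQ'.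
have -> : 12%:R / twopii R * tau = 24%:R * (tau ^+ 2 / t ^+ 2) * (t / (2%:R * tau)).
  by rewrite /t; field; rewrite tp0 t0.
by rewrite EQ2; field; rewrite tp0 t0.
Qed.

End EisensteinInversion.

(** * The modular group *)
Section ModularGroup.
Variable R : realType.
Local Notation C := (CC R).
Implicit Types (z w s tau : C) (x y : R) (g h : 'M[int]_2).

Lemma re_int (k : int) : re (k%:~R : C) = k%:~R.
Proof. by case: k => n; [exact: re_nat|rewrite NegzE !mulrNz reN re_nat]. Qed.
Lemma im_int (k : int) : im (k%:~R : C) = 0.
Proof. by case: k => n; [exact: im_nat|rewrite NegzE !mulrNz imN im_nat oppr0]. Qed.

Definition mk2 (a b c d : int) : 'M[int]_2 :=
  \matrix_(i < 2, j < 2) if i == 0 then (if j == 0 then a else b)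
                         else (if j == 0 then c else d).
Lemma mk2_00 a b c d : mk2 a b c d 0 0 = a. Proof. by rewrite mxE. Qed.
Lemma mk2_01 a b c d : mk2 a b c d 0 1 = b. Proof. by rewrite mxE. Qed.
Lemma mk2_10 a b c d : mk2 a b c d 1 0 = c. Proof. by rewrite mxE. Qed.
Lemma mk2_11 a b c d : mk2 a b c d 1 1 = d. Proof. by rewrite mxE. Qed.
Definition mk2E := (mk2_00, mk2_01, mk2_10, mk2_11).

Lemma mul2E g h i j : (g *m h) i j = g i 0 * h 0 j + g i 1 * h 1 j.
Proof.
rewrite mxE !big_ord_recl big_ord0 addr0; congr (g _ _ * h _ _ + g _ _ * h _ _).
all: by apply/val_inj.
Qed.

Lemma det2E g : \det g = g 0 0 * g 1 1 - g 0 1 * g 1 0.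
Proof.
rewrite (expand_det_row _ 0) !big_ord_recl big_ord0 addr0 /cofactor !det_mx11 !mxE /=.
rewrite expr0 expr1 mul1r mulN1r mulrN.
by congr (g _ _ * g _ _ - g _ _ * g _ _); apply/val_inj.
Qed.

Lemma mat2P g h : g 0 0 = h 0 0 -> g 0 1 = h 0 1 -> g 1 0 = h 1 0 -> g 1 1 = h 1 1 -> g = h.
Proof.
move=> e1 e2 e3 e4; apply/matrixP => i j.
have c (k : 'I_2) : k = 0 \/ k = 1.
  by case: k => [[|[|?]] k] //; [left|right]; exact/val_inj.
by case: (c i) => ->; case: (c j) => ->.
Qed.

(** The automorphy factor c tau + d. *)
Definition jj g tau : C := (g 1 0)%:~R * tau + (g 1 1)%:~R.

Lemma jj_neq0 g tau : SL2Z g -> upper tau -> jj g tau != 0.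
Proof.
rewrite /SL2Z /= det2E => dg ht; apply/eqP => h.
have := congr1 (@im R) h; rewrite /jj imD imM re_int !im_int mul0r !addr0 im0.
move=> /eqP; rewrite mulf_eq0 (gt_eqF ht) orbF intr_eq0 => /eqP c0.
move: h; rewrite /jj c0 mul0r add0r => /eqP; rewrite intr_eq0 => /eqP d0.
by move: dg; rewrite c0 d0 !mulr0 subr0.
Qed.

Lemma im_moebius g tau : SL2Z g -> upper tau ->
  im (moebius g tau) = im tau / nm (jj g tau) ^+ 2.
Proof.
move=> dg ht; have j0 := jj_neq0 dg ht; move: dg; rewrite /SL2Z /= det2E => dg.
rewrite /moebius -/(jj g tau) imM im_inv.
have -> : re (jj g tau)^-1 = re (jj g tau) / nm (jj g tau) ^+ 2.
  have n0 : nm (jj g tau) ^+ 2 != 0 by rewrite expf_neq0 // nm_eq0.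
  have := congr1 (@im R) (mulfV j0); have := congr1 (@re R) (mulfV j0).
  rewrite reM imM im_inv re1 im1; move: n0; rewrite nm2.
  move: (re (_^-1)) => x n0 h1 h2; apply: (@mulIf _ _ n0); rewrite divfK //.
  have h3 : re (jj g tau) * (re (jj g tau) * x - im (jj g tau) * (- im (jj g tau) /
      (re (jj g tau) ^+ 2 + im (jj g tau) ^+ 2))) + im (jj g tau) *
    (re (jj g tau) * (- im (jj g tau) / (re (jj g tau) ^+ 2 + im (jj g tau) ^+ 2)) +
     im (jj g tau) * x) = re (jj g tau) by rewrite h1 h2 mulr1 mulr0 addr0.
  by rewrite -[RHS]h3; ring.
rewrite /jj !(reD, imD, reM, imM, re_int, im_int) !mul0r !addr0 !subr0.
have dg' : (g 0 0)%:~R * (g 1 1)%:~R - (g 0 1)%:~R * (g 1 0)%:~R = 1 :> R.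
  by rewrite -!intrM -intrB dg.
have G (a b c d x y D : R) : a * d - b * c = 1 ->
    (a * x + b) * (- (c * y) * D) + a * y * ((c * x + d) * D) = y * D.
  by move=> h; rewrite -[y in RHS]mul1r -h; ring.
exact: G dg'.
Qed.

Lemma upper_moebius g tau : SL2Z g -> upper tau -> upper (moebius g tau).
Proof.
move=> dg ht; rewrite /upper im_moebius // divr_gt0 // exprn_gt0 // nm_gt0.
exact: jj_neq0.
Qed.

Lemma SL2ZM g h : SL2Z g -> SL2Z h -> SL2Z (g *m h).
Proof. by rewrite /SL2Z /= det_mulmx => -> ->. Qed.

Lemma jjM g h tau : SL2Z h -> upper tau ->
  jj (g *m h) tau = jj g (moebius h tau) * jj h tau.
Proof.
move=> dh ht; have j0 := jj_neq0 dh ht.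
rewrite {1 2}/jj mulrDl /moebius -/(jj h tau) -mulrA divfK // !mul2E !intrD !intrM.
by rewrite /jj; ring.
Qed.

Lemma moebiusM g h tau : SL2Z h -> upper tau ->
  moebius (g *m h) tau = moebius g (moebius h tau).
Proof.
move=> dh ht; have j0 := jj_neq0 dh ht.
have -> : moebius (g *m h) tau = (((g *m h) 0 0)%:~R * tau + ((g *m h) 0 1)%:~R) / jj (g *m h) tau by [].
have -> : moebius g (moebius h tau) =
  ((g 0 0)%:~R * moebius h tau + (g 0 1)%:~R) / jj g (moebius h tau) by [].
have -> : ((g *m h) 0 0)%:~R * tau + ((g *m h) 0 1)%:~R =
  ((g 0 0)%:~R * moebius h tau + (g 0 1)%:~R) * jj h tau.
  rewrite mulrDl /moebius -/(jj h tau) -mulrA divfK // !mul2E !intrD !intrM /jj; ring.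
by rewrite jjM // -mulf_div divff // mulr1.
Qed.

Definition Tn (n : int) : 'M[int]_2 := mk2 1 n 0 1.
Definition Smat : 'M[int]_2 := mk2 0 (-1) 1 0.
Definition Sinv : 'M[int]_2 := mk2 0 1 (-1) 0.

Lemma SL2Z_Tn n : SL2Z (Tn n).
Proof. by rewrite /SL2Z /= det2E !mk2E; ring. Qed.
Lemma SL2Z_S : SL2Z Smat.
Proof. by rewrite /SL2Z /= det2E !mk2E; ring. Qed.
Lemma SL2Z_Sinv : SL2Z Sinv.
Proof. by rewrite /SL2Z /= det2E !mk2E; ring. Qed.
Lemma moebius_Tn n tau : moebius (Tn n) tau = tau + n%:~R.
Proof. by rewrite /moebius !mk2E mul0r add0r mul1r divr1. Qed.
Lemma moebius_S tau : moebius Smat tau = - tau^-1.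
Proof. by rewrite /moebius !mk2E mul0r add0r mul1r addr0 mulrNz mulN1r. Qed.
Lemma moebius_Sinv tau : moebius Sinv tau = - tau^-1.
Proof. by rewrite /moebius !mk2E mul0r add0r addr0 mulrNz mulN1r invrN mul1r. Qed.
Lemma jj_S tau : jj Smat tau = tau.
Proof. by rewrite /jj !mk2E mul1r addr0. Qed.

Lemma qpow_period (n : nat) tau (k : int) : qpow n%:R (tau + k%:~R) = qpow n%:R tau.
Proof. by rewrite !qpowE eeD ee_int mulr1. Qed.

Lemma E2_period tau (k : int) : E2 (tau + k%:~R) = E2 tau.
Proof.
rewrite /E2; congr (1 - _ * csum _); apply/funext => n.
by rewrite qpow_period.
Qed.

Definition E2law g : Prop := forall tau, upper tau ->
  E2 (moebius g tau) = jj g tau ^+ 2 * E2 tau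
    + 12%:R / twopii R * (g 1 0)%:~R * jj g tau.

Lemma E2lawM g h : SL2Z g -> SL2Z h -> E2law g -> E2law h -> E2law (g *m h).
Proof.
move=> dg dh Pg Ph tau ht; rewrite moebiusM // Pg ?Ph ?jjM //; last exact: upper_moebius.
have j0 := jj_neq0 dh ht.
set K := 12%:R / _; set J := jj g _.
have key : ((g *m h) 1 0)%:~R * jj h tau = J * (h 1 0)%:~R * jj h tau + (g 1 0)%:~R :> C.
  have -> : J * (h 1 0)%:~R * jj h tau = (h 1 0)%:~R * jj (g *m h) tau by rewrite jjM // -/J; ring.
  have dh' : (h 0 0)%:~R * (h 1 1)%:~R - (h 0 1)%:~R * (h 1 0)%:~R = 1 :> C.
    by rewrite -!intrM -intrB -det2E dh.
  rewrite -[X in _ = _ + X]mulr1 -dh' /jj !mul2E !intrD !intrM; ring.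
have -> : K * ((g *m h) 1 0)%:~R * (J * jj h tau) = K * J * (((g *m h) 1 0)%:~R * jj h tau) by ring.
by rewrite key; ring.
Qed.

(** Euclid's algorithm on the bottom row: multiplying on the right by T^k S replaces the lower left
    entry by the remainder of the lower right one. The case -T^n is reached through S^-2 = -1. *)
Lemma SL2Z_ind (P : 'M[int]_2 -> Prop) :
  (forall g h, SL2Z g -> SL2Z h -> P g -> P h -> P (g *m h)) ->
  (forall k, P (Tn k)) -> P Sinv -> forall g, SL2Z g -> P g.
Proof.
move=> PM PT PS g; have dS := SL2Z_Sinv.
have [n hn] : exists n : nat, (absz (g 1%R 0%R) < n)%N by exists (absz (g 1%R 0%R)).+1.
elim: n g hn => // n IH g hn dg.
have [c0|c0] := eqVneq (g 1 0) 0.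
  have := dg; rewrite /SL2Z /= det2E c0 mulr0 subr0 => ad.
  have [[a1 d1]|[a1 d1]] : (g 0 0 = 1 /\ g 1 1 = 1) \/ (g 0 0 = -1 /\ g 1 1 = -1).
    have := congr1 absz ad; rewrite abszM => /eqP; rewrite muln_eq1 => /andP[/eqP h1 /eqP h2].
    move: ad h1 h2; move: (g 0 0) (g 1 1) => x y xy h1 h2.
    have [hx|hx] : x = 1 \/ x = -1 by lia.
      by left; split => //; subst x; lia.
    by right; split => //; subst x; lia.
  - have -> : g = Tn (g 0 1) by apply: mat2P; rewrite ?mk2E.
    exact: PT.
  - have -> : g = Sinv *m (Sinv *m Tn (- g 0 1)).
      by apply: mat2P; rewrite !mul2E !mk2E ?a1 ?d1 ?c0; ring.
    by have dT := SL2Z_Tn (- g 0 1); exact: (PM _ _ dS (SL2ZM dS dT) PS (PM _ _ dS dT PS (PT _))).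
pose k := - (g 1%R 1%R %/ g 1%R 0%R)%Z; pose g' := g *m (Tn k *m Smat).
have dT := SL2Z_Tn k; have dTS := SL2ZM dT SL2Z_S.
have dg' : SL2Z g' by exact: SL2ZM.
have lt' : (absz (g' 1%R 0%R) < n)%N.
  have -> : g' 1 0 = (g 1%R 1%R %% g 1%R 0%R)%Z.
    rewrite /g' !mul2E !mk2E /k; have := divz_eq (g 1 1) (g 1 0); lia.
  have := ltz_mod (g 1 1) c0; have := modz_ge0 (g 1 1) c0; lia.
have -> : g = g' *m (Sinv *m Tn (- k)).
  by rewrite /g'; apply: mat2P; rewrite !mul2E !mk2E; ring.
have dTk := SL2Z_Tn (- k).
exact: (PM _ _ dg' (SL2ZM dS dTk) (IH _ lt' dg') (PM _ _ dS dTk PS (PT _))).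
Qed.

Lemma jj_Tn k tau : jj (Tn k) tau = 1.
Proof. by rewrite /jj !mk2E mul0r add0r. Qed.
Lemma jj_Sinv tau : jj Sinv tau = - tau.
Proof. by rewrite /jj !mk2E addr0 mulrNz mulN1r. Qed.

Lemma E2law_all g : SL2Z g -> E2law g.
Proof.
apply: SL2Z_ind => [||]; first exact: E2lawM.
  by move=> k tau ht; rewrite moebius_Tn E2_period jj_Tn !mk2E !mulr0 mul0r addr0 expr1n mul1r.
move=> tau ht; rewrite moebius_Sinv E2_S // jj_Sinv !mk2E mulrNz sqrrN.
by ring.
Qed.

Lemma floor_lb x : exists m : int, m%:~R <= x /\ x < m%:~R + 1.
Proof.
exists (Num.floor x); have /andP[h1 h2] := floor_itv x; split => //.
by rewrite intrD in h2.
Qed.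
Lemma round_even x (e : int) : exists m : int, `|x - (2 * m + e)%:~R| <= 1.
Proof.
have [m [h1 h2]] := floor_lb ((x - e%:~R + 1) / 2); exists m.
rewrite intrD intrM; move: (m%:~R) (e%:~R) h1 h2 => {}m f h1 h2.
rewrite -[2%:~R]/(2 : R) ler_norml; apply/andP; split; lra.
Qed.
Lemma round_int x : exists m : int, `|x - m%:~R| <= 1 / 2.
Proof.
have [m [h1 h2]] := floor_lb (x + 1 / 2); exists m.
by rewrite ler_norml; apply/andP; split; lra.
Qed.

(** The height 1/2 suffices later and makes the descent effective: if |Re| <= 1/2 and Im < 1/2 then
    |tau|^2 <= 1/2, so the inversion at least doubles Im. The n with 2^n Im tau >= 1/2 bounds the
    number of steps. *)
Lemma orbit_SL2Z tau : upper tau ->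
  exists g w, [/\ SL2Z g, tau = moebius g w & 1 / 2 <= im w].
Proof.
move=> ht; have [n hn] : exists n : nat, 1 / 2 <= 2 ^+ n * im tau.
  have h : 0 < im tau := ht.
  exists (Num.truncn (im tau)^-1).+1.
  have := Num.Theory.real_truncnS_gt (num_real (im tau)^-1).
  set N := (Num.truncn _).+1 => hN.
  have h2 : N%:R <= 2 ^+ N :> R by rewrite -natrX ler_nat ltnW // ltn_expl.
  have : 1 <= 2 ^+ N * im tau by rewrite -ler_pdivrMr // mul1r ltW // (lt_le_trans hN).
  lra.
elim: n tau ht hn => [|n IH] tau ht hn.
  exists 1%:M, tau; split; last by move: hn; rewrite expr0 [1 * im tau]mul1r.
    by rewrite /SL2Z /= det1.
  by rewrite /moebius !mxE /= mul1r mul0r addr0 add0r divr1.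
have [h|h] := leP (1 / 2) (im tau).
  exists 1%:M, tau; split => //.
    by rewrite /SL2Z /= det1.
  by rewrite /moebius !mxE /= mul1r mul0r addr0 add0r divr1.
have [k hk] := round_int (re tau); pose t' := tau - k%:~R.
have im' : im t' = im tau by rewrite /t' imD imN im_int oppr0 addr0.
have ut' : upper t' by rewrite /upper im'.
have re' : re t' ^+ 2 <= 1 / 4.
  rewrite /t' reD reN re_int -real_normK ?num_real //.
  have := normr_ge0 (re tau - k%:~R); nra.
have i0 : 0 < im tau := ht.
have n2 : nm t' ^+ 2 <= 1 / 2 by rewrite nm2 im'; nra.
have n20 : 0 < nm t' ^+ 2 by rewrite exprn_gt0 // nm_gt0 upper_neq0.
have [|g [w [dg e hw]]] := IH (- t'^-1) (upperS ut').
  rewrite imN im_inv mulNr opprK im' mulrA ler_pdivlMr //.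
  move: hn; rewrite exprS; have : 0 <= 2 ^+ n * im tau by rewrite mulr_ge0 ?exprn_ge0 ?ltW.
  nra.
exists (Tn k *m (Smat *m g)), w.
have uw : upper w by rewrite /upper; lra.
split => //; first by apply: SL2ZM; [exact: SL2Z_Tn|apply: SL2ZM => //; exact: SL2Z_S].
rewrite moebiusM //; last by apply: SL2ZM => //; exact: SL2Z_S.
rewrite moebiusM // -e moebius_S invrN invrK opprK moebius_Tn /t' subrK //.
Qed.

Lemma Gamma02_SL2Z g : Gamma02 g -> SL2Z g. Proof. by case. Qed.

(** The two alternatives are the two cusps. If c is odd, a further T^k S^-1 makes the lower left
    entry -(c k + d), which is even when k has the parity of d; prescribing this parity is why |Re
    w| <= 1 replaces 1/2. *)
Lemma orbit_Gamma02 tau : upper tau -> exists g w,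
  [/\ Gamma02 g, 1 / 2 <= im w, `|re w| <= 1 &
      tau = moebius g w \/ tau = moebius g (- w^-1)].
Proof.
move=> ht; have [g [w [dg e hw]]] := orbit_SL2Z ht.
have uw : upper w by rewrite /upper; lra.
have shift (k : int) : [/\ w = moebius (Tn k) (w - k%:~R), upper (w - k%:~R),
    im (w - k%:~R) = im w & re (w - k%:~R) = re w - k%:~R].
  by rewrite moebius_Tn subrK /upper imD reD imN reN im_int re_int oppr0 addr0.
have [c2|c2] := boolP (2 %| g 1%R 0%R)%Z.
  have [k hk] := round_int (re w); have [e1 u1 i1 r1] := shift k.
  exists (g *m Tn k), (w - k%:~R); split; last 1 first.
  - by left; rewrite moebiusM //; [rewrite -e1|exact: SL2Z_Tn].
  - split; first exact: (SL2ZM dg (SL2Z_Tn k)).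
    by rewrite mul2E !mk2E mulr1 mulr0 addr0.
  - by rewrite i1.
  - by rewrite r1; lra.
have [m hm] := round_even (re w) (g 1 1); set k := (2 * m + g 1 1) in hm *.
have [e1 u1 i1 r1] := shift k.
exists (g *m (Tn k *m Sinv)), (w - k%:~R).
have dTS := SL2ZM (SL2Z_Tn k) SL2Z_Sinv.
split; rewrite ?i1 ?r1 //.
- split; first exact: (SL2ZM dg dTS).
  rewrite !mul2E !mk2E.
  have -> : g 1 0 * (1 * 0 + k * -1) + g 1 1 * (0 * 0 + 1 * -1) = - (g 1 0 * k + g 1 1) by ring.
  have m2 : (g 1%R 0%R %% 2)%Z = 1.
    have := modz_ge0 (g 1 0) (isT : 2 != 0 :> int); have := ltz_pmod (g 1 0) (isT : 0 < 2 :> int).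
    have : (g 1%R 0%R %% 2)%Z != 0 by apply: contra c2 => /eqP h; apply/dvdz_mod0P.
    lia.
  have E := divz_eq (g 1 0) 2; rewrite m2 in E; rewrite /k E; move: (_ %/ _)%Z (g 1 1) => q d.
  apply/dvdzP; exists (- ((q * 2 + 1) * m + q * d + d)); ring.
right; have uS := upperS u1; rewrite !moebiusM //; last exact: SL2Z_Sinv.
by rewrite moebius_Sinv invrN invrK opprK -e1.
Qed.

End ModularGroup.

(** * Formal power series *)
(* A series in q is its sequence of coefficients. *)
Definition fps (K : fieldType) := nat -> K.

Section FpsRing.
Variable K : fieldType.
Implicit Types a b c d p q g : fps K.

HB.instance Definition _ := gen_eqMixin (fps K).
HB.instance Definition _ := gen_choiceMixin (fps K).

Definition fadd a b : fps K := fun n => a n + b n.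
Definition fopp a : fps K := fun n => - a n.
Definition fcst (x : K) : fps K := fun n => if n is 0%N then x else 0.
Definition fmul a b : fps K := fun n => \sum_(i < n.+1) a i * b (n - i)%N.

Fact faddA : associative fadd. Proof. by move=> a b c; apply/funext => n; rewrite /fadd addrA. Qed.
Fact faddC : commutative fadd. Proof. by move=> a b; apply/funext => n; rewrite /fadd addrC. Qed.
Fact fadd0 : left_id (fcst 0) fadd.
Proof. by move=> a; apply/funext => -[|n]; rewrite /fadd add0r. Qed.
Fact faddN : left_inverse (fcst 0) fopp fadd.
Proof. by move=> a; apply/funext => -[|n]; rewrite /fadd /fopp addNr. Qed.
HB.instance Definition _ := GRing.isZmodule.Build (fps K) faddA faddC fadd0 faddN.

(** The laws of multiplication are inherited from polynomials: up to degree n a product depends only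
    on truncations. *)
Definition agree n (p : {poly K}) a := forall k, (k <= n)%N -> p`_k = a k.
Definition trunc n a : {poly K} := \poly_(i < n.+1) a i.
Lemma agree_trunc n a : agree n (trunc n a) a.
Proof. by move=> k kn; rewrite coef_poly ltnS kn. Qed.
Lemma agreeM n (p q : {poly K}) a b : agree n p a -> agree n q b -> agree n (p * q) (fmul a b).
Proof.
move=> pa qb k kn; rewrite coefM /fmul; apply: eq_bigr => i _.
have ik : (i <= k)%N by rewrite -ltnS.
by rewrite pa ?qb // ?(leq_trans _ kn) // leq_subr.
Qed.
Lemma fmulE n (p q : {poly K}) a b : agree n p a -> agree n q b -> fmul a b n = (p * q)`_n.
Proof. by move=> pa qb; rewrite (agreeM pa qb). Qed.

Fact fmulA : associative fmul.
Proof.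
move=> a b c; apply/funext => n.
have ha := @agree_trunc n a; have hb := @agree_trunc n b; have hc := @agree_trunc n c.
by rewrite (fmulE ha (agreeM hb hc)) (fmulE (agreeM ha hb) hc) mulrA.
Qed.
Fact fmulC : commutative fmul.
Proof.
move=> a b; apply/funext => n.
have ha := @agree_trunc n a; have hb := @agree_trunc n b.
by rewrite (fmulE ha hb) (fmulE hb ha) mulrC.
Qed.
Fact fmul1 : left_id (fcst 1) fmul.
Proof.
move=> a; apply/funext => n; rewrite /fmul big_ord_recl /= mul1r subn0 big1 ?addr0 //.
by move=> i _; rewrite mul0r.
Qed.
Fact fmulDl : left_distributive fmul fadd.
Proof.
move=> a b c; apply/funext => n; rewrite /fmul /fadd -big_split /=.
by apply: eq_bigr => i _; rewrite mulrDl.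
Qed.
Fact fone_neq0 : fcst 1 != fcst 0.
Proof. by apply/eqP => /(congr1 (fun f => f 0%N)) /eqP; rewrite oner_eq0. Qed.
HB.instance Definition _ := GRing.Zmodule_isComNzRing.Build (fps K) fmulA fmulC fmul1 fmulDl fone_neq0.

Lemma faddE a b n : (a + b) n = a n + b n. Proof. by []. Qed.
Lemma foppE a n : (- a) n = - a n. Proof. by []. Qed.
Lemma fsubE a b n : (a - b) n = a n - b n. Proof. by []. Qed.
Lemma fmulEn a b n : (a * b) n = \sum_(i < n.+1) a i * b (n - i)%N. Proof. by []. Qed.
Lemma fzeroE n : (0 : fps K) n = 0. Proof. by case: n. Qed.
Lemma foneE n : (1 : fps K) n = (n == 0)%N%:R. Proof. by case: n. Qed.
Lemma fsumE (I : Type) (r : seq I) (P : pred I) (F : I -> fps K) n :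
  (\sum_(i <- r | P i) F i) n = \sum_(i <- r | P i) F i n.
Proof. by elim/big_rec2: _ => [|i x y _ <-]; rewrite ?fzeroE. Qed.

Lemma fcst_is_additive : additive fcst.
Proof. by move=> x y; apply/funext => -[|n] //; rewrite fsubE /= subrr. Qed.
Lemma fcstME x a n : (fcst x * a) n = x * a n.
Proof.
rewrite fmulEn big_ord_recl /= subn0 big1 ?addr0 // => i _; by rewrite mul0r.
Qed.
Lemma fcst_is_multiplicative : multiplicative fcst.
Proof. by split => [x y|//]; apply/funext => n; rewrite fcstME; case: n => //= n; rewrite mulr0. Qed.
HB.instance Definition _ := GRing.isAdditive.Build K (fps K) fcst fcst_is_additive.
HB.instance Definition _ := GRing.isMultiplicative.Build K (fps K) fcst fcst_is_multiplicative.

Lemma fcst_nat (n : nat) : fcst n%:R = n%:R. Proof. exact: rmorph_nat. Qed.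
Lemma fnatE (m n : nat) : (m%:R : fps K) n = if n is 0%N then m%:R else 0.
Proof. by rewrite -fcst_nat. Qed.
Lemma fnatME (m : nat) a n : (m%:R * a) n = m%:R * a n.
Proof. by rewrite -fcst_nat fcstME. Qed.

Lemma fmul0 a b : (a * b) 0%N = a 0%N * b 0%N.
Proof. by rewrite fmulEn big_ord1. Qed.
Lemma fexp0 a n : (a ^+ n) 0%N = a 0%N ^+ n.
Proof. by elim: n => [|n IH]; rewrite ?expr0 ?foneE // !exprS fmul0 IH. Qed.

Definition fX : fps K := fun n => (n == 1)%N%:R.
Lemma fXM0 a : (fX * a) 0%N = 0. Proof. by rewrite fmul0 mul0r. Qed.
Lemma fXMS a n : (fX * a) n.+1 = a n.
Proof.
rewrite fmulEn big_ord_recl mul0r add0r big_ord_recl /= mul1r subn1 big1 ?addr0 //.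
by move=> i _; rewrite mul0r.
Qed.

(* q d/dq *)
Definition theta a : fps K := fun n => n%:R * a n.
Lemma thetaD a b : theta (a + b) = theta a + theta b.
Proof. by apply/funext => n; rewrite /theta !faddE mulrDr. Qed.
Lemma thetaN a : theta (- a) = - theta a.
Proof. by apply/funext => n; rewrite /theta !foppE mulrN. Qed.
Lemma thetaM a b : theta (a * b) = theta a * b + a * theta b.
Proof.
apply/funext => n; rewrite faddE /theta !fmulEn mulr_sumr -big_split /=.
apply: eq_bigr => i _.
have -> : n%:R = i%:R + (n - i)%:R :> K by rewrite -natrD subnKC // -ltnS.
ring.
Qed.
Lemma theta_cst x : theta (fcst x) = 0.
Proof. by apply/funext => -[|n]; rewrite /theta /= ?mul0r ?mulr0. Qed.
Lemma thetaZ x a : theta (fcst x * a) = fcst x * theta a.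
Proof. by rewrite thetaM theta_cst mul0r add0r. Qed.
Lemma theta1 : theta 1 = 0. Proof. exact: (theta_cst 1). Qed.
Lemma theta_fX : theta fX = fX.
Proof. by apply/funext => -[|[|n]]; rewrite /theta /fX /= ?mul1r ?mulr0. Qed.
Lemma thetaX a n : theta (a ^+ n) = n%:R * a ^+ n.-1 * theta a.
Proof.
elim: n => [|n IH]; first by rewrite expr0 theta1 !mul0r.
by rewrite exprS thetaM IH; case: n {IH} => [|n] /=; rewrite ?exprS; ring.
Qed.
Lemma theta_nat (m : nat) a : theta (m%:R * a) = m%:R * theta a.
Proof. by rewrite -fcst_nat thetaZ. Qed.
Lemma theta0E a : theta a 0%N = 0. Proof. by rewrite /theta mul0r. Qed.

(** Course-of-values recursion: [F] receives the list of all earlier coefficients. *)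
Definition course_rec (F : seq K -> K) : nat -> K :=
  fun n => nth 0 (iter n.+1 (fun s => rcons s (F s)) [::]) n.
Lemma course_recE F n : course_rec F n = F (mkseq (course_rec F) n).
Proof.
pose it k := iter k (fun s => rcons s (F s)) [::].
have sz k : size (it k) = k by elim: k => //= k IH; rewrite size_rcons IH.
have nth_it k m : (m < k)%N -> nth 0 (it k) m = course_rec F m.
  elim: k => // k IH; rewrite ltnS leq_eqVlt => /orP[/eqP -> //|mk].
  by rewrite /= nth_rcons sz mk IH.
have -> : mkseq (course_rec F) n = it n.
  apply: (@eq_from_nth _ 0); rewrite ?size_mkseq ?sz // => i ni.
  by rewrite nth_mkseq // nth_it.
by rewrite /course_rec -/(it n.+1) /= nth_rcons sz ltnn eqxx.
Qed.

Hypothesis char0 : forall n, n.+1%:R != 0 :> K.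

(* The solution of theta V = p V, V(0) = 1, that is exp (int p dq/q); only used
   for p without constant term.  Locked because unfolding it blocks unification. *)
Fact fexp_key : unit. Proof. exact: tt. Qed.
Definition fexp : fps K -> fps K := locked_with fexp_key (fun p => course_rec (fun s =>
  if size s is n.+1 then n.+1%:R^-1 * \sum_(k < n.+1) p k.+1 * nth 0 s (n - k)%N else 1)).

Lemma fexp_0 p : fexp p 0%N = 1.
Proof. by rewrite [fexp]unlock course_recE. Qed.
Lemma fexp_S p n : fexp p n.+1 = n.+1%:R^-1 * \sum_(k < n.+1) p k.+1 * fexp p (n - k)%N.
Proof.
rewrite {1}[fexp]unlock course_recE size_mkseq; congr (_ * _); apply: eq_bigr => k _.
by rewrite nth_mkseq ?[fexp]unlock // ltnS leq_subr.
Qed.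

Lemma theta_fexp p : p 0%N = 0 -> theta (fexp p) = p * fexp p.
Proof.
move=> p0; apply/funext => -[|n]; first by rewrite theta0E fmul0 p0 mul0r.
rewrite /theta fexp_S mulrA divff // mul1r fmulEn [RHS]big_ord_recl /= p0 mul0r add0r.
by apply: eq_bigr => i _; rewrite /= subSS.
Qed.

(** As p has no constant term, coefficient n gives n d_n in terms of d_0, ..., d_(n-1). The
    identities between exponentials rest on this. *)
Lemma theta_uniq p d : p 0%N = 0 -> d 0%N = 0 -> theta d = p * d -> d = 0.
Proof.
move=> p0 d0 h; apply/funext => n; rewrite fzeroE.
have [m] := ubnP n; elim: m n => // m IH [|n] // nm; apply: (mulfI (char0 n)).
rewrite mulr0 -[LHS]/(theta d n.+1) h fmulEn big1 // => -[[|i] hi] _ /=; first by rewrite p0 mul0r.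
by rewrite IH ?mulr0 // subSS; apply: leq_ltn_trans (leq_subr _ _) _.
Qed.

Lemma fexp_uniq p a : p 0%N = 0 -> theta a = p * a -> a = fcst (a 0%N) * fexp p.
Proof.
move=> p0 h; apply/eqP; rewrite -subr_eq0; apply/eqP; apply: (theta_uniq p0).
  by rewrite fsubE fcstME fexp_0 mulr1 subrr.
by rewrite thetaD thetaN thetaZ theta_fexp // h; ring.
Qed.

Lemma fexpD p q : p 0%N = 0 -> q 0%N = 0 -> fexp (p + q) = fexp p * fexp q.
Proof.
move=> p0 q0; have pq0 : (p + q) 0%N = 0 by rewrite faddE p0 q0 addr0.
have := @fexp_uniq (p + q) (fexp p * fexp q) pq0.
rewrite fmul0 !fexp_0 mulr1 -[fcst 1]/(1 : fps K) mul1r => -> //.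
by rewrite thetaM !theta_fexp //; ring.
Qed.
Lemma fexp00 : fexp 0 = 1.
Proof.
have := @fexp_uniq 0 1 (fzeroE 0); rewrite mul0r theta1 => /(_ erefl).
by rewrite foneE -[fcst _]/(1 : fps K) mul1r => <-.
Qed.
Lemma fexpN p : p 0%N = 0 -> fexp p * fexp (- p) = 1.
Proof. by move=> p0; rewrite -fexpD ?subrr ?fexp00 // foppE p0 oppr0. Qed.

Lemma fcancel a d : a 0%N != 0 -> a * d = 0 -> d = 0.
Proof.
move=> a0 h; apply/funext => n; rewrite fzeroE.
have [m] := ubnP n; elim: m n => // m IH n nm; apply: (mulfI a0).
have := congr1 (fun f : fps K => f n) h; rewrite /= fmulEn fzeroE big_ord_recl subn0 mulr0 /=.
rewrite big1 ?addr0 // => i _; rewrite IH ?mulr0 //.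
by have := ltn_ord i; rewrite /bump /=; lia.
Qed.
Lemma fcancel_eq a b c : a 0%N != 0 -> a * b = a * c -> b = c.
Proof.
by move=> a0 h; apply/eqP; rewrite -subr_eq0; apply/eqP; apply: (fcancel a0); rewrite mulrBr h subrr.
Qed.

Section Comp.
Variable x : fps K.
Hypothesis x0 : x 0%N = 0.

Lemma fpow_lt i n : (n < i)%N -> (x ^+ i) n = 0.
Proof.
elim: i n => // i IH n ni; rewrite exprS fmulEn big1 // => -[[|k] hk] _ /=; first by rewrite x0 mul0r.
by rewrite IH ?mulr0 //; move: hk; rewrite ltnS; case: n ni => // n ni; rewrite subSS ltnS in ni *; move=> _; apply: leq_ltn_trans (leq_subr _ _) _.
Qed.

(* c(x); meaningful only if x has no constant term *)
Definition fcomp (c : fps K) : fps K := fun n => \sum_(i < n.+1) c i * (x ^+ i) n.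

Lemma fcomp_poly n (p : {poly K}) c : agree n p c ->
  forall k, (k <= n)%N -> (map_poly fcst p).[x] k = fcomp c k.
Proof.
move=> pc k kn; rewrite (@horner_coef_wide _ (maxn n.+1 (size p))); last first.
  by rewrite size_map_poly leq_maxr.
rewrite fsumE; have h (i : 'I_(maxn n.+1 (size p))) : true ->
   ((map_poly fcst p)`_i * x ^+ i) k = if (i < k.+1)%N then c i * (x ^+ i) k else 0.
  move=> _; rewrite coef_map fcstME; case: ltnP => hi; last by rewrite fpow_lt ?mulr0.
  by rewrite pc // (leq_trans _ kn) // -ltnS.
rewrite (eq_bigr _ h) -big_mkcond /= /fcomp.
rewrite (big_ord_widen_cond (maxn n.+1 (size p)) xpredT (fun i => c i * (x ^+ i) k)) //.
by rewrite leq_max ltnS kn.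
Qed.

Lemma fcompM c d : fcomp (c * d) = fcomp c * fcomp d.
Proof.
apply/funext => n; have hc := @agree_trunc n c; have hd := @agree_trunc n d.
rewrite -(fcomp_poly (agreeM hc hd) (leqnn n)) rmorphM hornerM !fmulEn.
apply: eq_bigr => i _; rewrite (fcomp_poly hc) -1?ltnS // (fcomp_poly hd) //.
exact: leq_subr.
Qed.
Lemma fcompD c d : fcomp (c + d) = fcomp c + fcomp d.
Proof.
apply/funext => n; rewrite faddE /fcomp -big_split /=.
by apply: eq_bigr => i _; rewrite faddE mulrDl.
Qed.
Lemma fcomp_cst k : fcomp (fcst k) = fcst k.
Proof.
apply/funext => n; rewrite /fcomp big_ord_recl expr0 foneE big1; last first.
  by move=> i _; rewrite mul0r.
by case: n => [|n] /=; rewrite ?mulr1 ?mulr0 addr0.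
Qed.
Lemma fcompZ k c : fcomp (fcst k * c) = fcst k * fcomp c.
Proof. by rewrite fcompM fcomp_cst. Qed.
Lemma fcompN c : fcomp (- c) = - fcomp c.
Proof.
have -> : - c = fcst (-1) * c by rewrite rmorphN1 mulN1r.
by rewrite fcompZ rmorphN1 mulN1r.
Qed.
Lemma fcomp1 : fcomp 1 = 1. Proof. exact: (fcomp_cst 1). Qed.
Lemma fcomp_fX : fcomp fX = x.
Proof.
apply/funext => -[|n]; first by rewrite /fcomp big_ord1 mul0r x0.
rewrite /fcomp big_ord_recl mul0r add0r big_ord_recl /= mul1r big1 ?addr0 ?expr1 //.
by move=> i _; rewrite mul0r.
Qed.
Lemma fcompX c n : fcomp (c ^+ n) = fcomp c ^+ n.
Proof. by elim: n => [|n IH]; rewrite ?fcomp1 // !exprS fcompM IH. Qed.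

Lemma theta_fcomp g c : theta x = g * x -> theta (fcomp c) = g * fcomp (theta c).
Proof.
move=> hx; apply/funext => n.
have E i k : n%:R * (c i * (x ^+ i) n) = \sum_(j < n.+1) g j * (i%:R * c i * (x ^+ i) (n - j)%N) -> k = 0 -> True by [].
have tx i : theta (x ^+ i) = i%:R * (g * x ^+ i).
  by rewrite thetaX hx; case: i => [|i] /=; rewrite ?mul0r // exprS; ring.
have cut m c' : (m <= n)%N -> fcomp c' m = \sum_(i < n.+1) c' i * (x ^+ i) m.
  move=> mn; rewrite /fcomp (big_ord_widen_cond n.+1 xpredT (fun i => c' i * (x ^+ i) m)) //.
  rewrite big_mkcond /=; apply: eq_bigr => i _; case: ltnP => // h.
  by rewrite fpow_lt ?mulr0.
rewrite /theta -/(theta c) cut // mulr_sumr fmulEn.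
transitivity (\sum_(i < n.+1) c i * theta (x ^+ i) n).
  by apply: eq_bigr => i _; rewrite /theta; ring.
transitivity (\sum_(j < n.+1) \sum_(i < n.+1) g j * (theta c i * (x ^+ i) (n - j)%N)).
  rewrite exchange_big /=; apply: eq_bigr => i _.
  rewrite tx fnatME fmulEn mulrA mulr_sumr; apply: eq_bigr => j _; rewrite /theta; ring.
by apply: eq_bigr => j _; rewrite cut ?leq_subr // mulr_sumr.
Qed.

Hypothesis x1 : x 1%N = 1.

(** Since x = q + O(q^2), composition with x is a unitriangular linear map: it is bijective, and its
    inverse stays within any subring that contains the coefficients of x. *)
Lemma fpow_diag i : (x ^+ i) i = 1.
Proof.
elim: i => [|i IH]; first by rewrite expr0 foneE.
rewrite exprS fmulEn big_ord_recl x0 mul0r add0r big_ord_recl /= x1 mul1r subn1 /= IH.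
by rewrite big1 ?addr0 // => k _; rewrite fpow_lt ?mulr0 // /bump /=; have := ltn_ord k; lia.
Qed.

Lemma fcomp_inj c : fcomp c = 0 -> c = 0.
Proof.
move=> h; apply/funext => n; rewrite fzeroE.
have [m] := ubnP n; elim: m n => // m IH n nm.
have := congr1 (fun f : fps K => f n) h; rewrite /= /fcomp fzeroE big_ord_recr /= fpow_diag mulr1.
by rewrite big1 ?add0r // => i _; rewrite IH ?mul0r // (leq_trans (ltn_ord i)).
Qed.

Lemma fcomp_surj a : exists c, fcomp c = a.
Proof.
exists (course_rec (fun s => a (size s) - \sum_(i < size s) nth 0 s i * (x ^+ i) (size s))).
apply/funext => n; rewrite /fcomp big_ord_recr /= fpow_diag mulr1 [X in _ + X]course_recE size_mkseq.
rewrite addrCA -[RHS]addr0; congr (_ + _); apply/eqP; rewrite subr_eq0; apply/eqP.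
apply: eq_bigr => i _.
by rewrite nth_mkseq.
Qed.
End Comp.

Section Integrality.
Variables (S : K -> Prop) (N : nat).
Hypothesis S0 : S 0.
Hypothesis S1 : S 1.
Hypothesis SD : forall a b : K, S a -> S b -> S (a + b).
Hypothesis SN : forall a : K, S a -> S (- a).
Hypothesis SM : forall a b : K, S a -> S b -> S (a * b).

(** The cutoff N is for [fexp], which divides by n: over the p-integers it preserves integrality
    only for indices below p. The predicate S will be these p-integers, or the field Q(sqrt M). *)
Definition fint a : Prop := forall n, (n < N)%N -> S (a n).

Lemma Ssum (n : nat) (F : 'I_n -> K) : (forall i, S (F i)) -> S (\sum_(i < n) F i).
Proof. by move=> h; elim/big_ind: _. Qed.
Lemma fint_cst k : S k -> fint (fcst k).
Proof. by move=> h [|n] _. Qed.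
Lemma fintD a b : fint a -> fint b -> fint (a + b).
Proof. by move=> ha hb n nN; apply: SD; [exact: ha|exact: hb]. Qed.
Lemma fintN a : fint a -> fint (- a).
Proof. by move=> ha n nN; apply: SN; exact: ha. Qed.
Lemma fintM a b : fint a -> fint b -> fint (a * b).
Proof.
move=> ha hb n nN; rewrite fmulEn; apply: Ssum => i; apply: SM.
  by apply: ha; apply: leq_ltn_trans nN; rewrite -ltnS.
by apply: hb; apply: leq_ltn_trans nN; rewrite leq_subr.
Qed.
Lemma fintX a k : fint a -> fint (a ^+ k).
Proof.
move=> ha; elim: k => [|k IH]; first exact: (fint_cst S1).
by rewrite exprS; apply: fintM.
Qed.
Lemma fint_theta a : fint a -> fint (theta a).
Proof.
move=> ha n nN; rewrite /theta; apply: SM; last exact: ha.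
by elim: (n) => [|k IH] //; rewrite -natr1; apply: SD.
Qed.
Lemma fint_exp p : (forall n, (n.+1 < N)%N -> S n.+1%:R^-1) -> fint p -> fint (fexp p).
Proof.
move=> hn hp n; have [m] := ubnP n; elim: m n => // m IH [|n] nm nN.
  by rewrite fexp_0.
rewrite fexp_S; apply: SM; first exact: hn.
apply: Ssum => k; apply: SM; first by apply: hp; apply: leq_ltn_trans nN; exact: ltn_ord.
apply: IH; first by apply: leq_ltn_trans (leq_subr _ _) _.
by apply: leq_ltn_trans (leq_subr _ _) (ltnW nN).
Qed.
Lemma fint_decomp (x : fps K) c : x 0%N = 0 -> x 1%N = 1 -> fint x -> fint (fcomp x c) -> fint c.
Proof.
move=> x0 x1 hx hc n; have [m] := ubnP n; elim: m n => // m IH n nm nN.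
have := hc n nN; rewrite /fcomp big_ord_recr /= fpow_diag // mulr1 => h.
have -> : c n = \sum_(i < n) c i * (x ^+ i) n + c n + - \sum_(i < n) c i * (x ^+ i) n by ring.
apply: SD => //; apply: SN; apply: Ssum => i; apply: SM; last exact: fintX.
by apply: IH; [exact: leq_trans (ltn_ord i) nm|exact: ltn_trans (ltn_ord i) nN].
Qed.
End Integrality.
End FpsRing.

(** * Convergent q-series *)
Section Evaluation.
Variable R : realType.
Local Notation C := (CC R).
Implicit Types (z w tau : C) (x y : R) (a b c d p : fps C).

Lemma char0C n : n.+1%:R != 0 :> C. Proof. by rewrite pnatr_eq0. Qed.

(** Radius of convergence at least 1, so that the series converges on the whole half-plane. *)
Definition conv c : Prop := forall x, 0 < x -> x < 1 ->
  exists B : R, forall n, nm (c n) * x ^+ n <= B.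

Lemma conv_geom c x : conv c -> 0 <= x -> x < 1 ->
  exists B r : R, [/\ 0 <= B, 0 <= r < 1 & forall n, nm (c n) * x ^+ n <= B * r ^+ n].
Proof.
move=> hc x0 x1; pose z := (1 + x) / 2.
have z0 : 0 < z by rewrite /z; lra.
have z1 : z < 1 by rewrite /z; lra.
have [B hB] := hc z z0 z1; exists B, (x / z).
have B0 : 0 <= B by apply: le_trans (hB 0%N); rewrite mulr_ge0 ?nm_ge0 // exprn_ge0 // ltW.
have r0 : 0 <= x / z by rewrite divr_ge0 // ltW.
split => //; first by rewrite r0 ltr_pdivrMr // mul1r /z; lra.
move=> n; have -> : nm (c n) * x ^+ n = nm (c n) * z ^+ n * (x / z) ^+ n.
  by rewrite -mulrA -exprMn mulrCA divff ?mulr1 // gt_eqF.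
by rewrite ler_wpM2r // exprn_ge0.
Qed.

Lemma conv_smb c x : conv c -> 0 <= x -> x < 1 -> smb (fun n => nm (c n) * x ^+ n).
Proof.
move=> hc x0 x1; have [B [r [B0 /andP[r0 r1] h]]] := conv_geom hc x0 x1.
apply: smb_le (smbZ B0 (smb_geom r0 r1)) => n.
by rewrite h mulr_ge0 ?nm_ge0 // exprn_ge0.
Qed.

Lemma conv_bound c x : conv c -> 0 <= x -> x < 1 ->
  exists2 B : R, 0 <= B & forall N, \sum_(n < N) nm (c n) * x ^+ n <= B.
Proof.
move=> hc x0 x1; have [_ [B hB]] := conv_smb hc x0 x1; exists B => //.
by have := hB 0%N; rewrite big_ord0.
Qed.

Lemma conv_le c (h : nat -> R) : (forall x, 0 < x -> x < 1 -> exists B : R, forall n, h n * x ^+ n <= B) ->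
  (forall n, nm (c n) <= h n) -> conv c.
Proof.
move=> hh ch x x0 x1; have [B hB] := hh x x0 x1; exists B => n; apply: le_trans (hB n).
by rewrite ler_wpM2r // exprn_ge0 // ltW.
Qed.

Lemma convD a b : conv a -> conv b -> conv (a + b).
Proof.
move=> ha hb x x0 x1; have [A hA] := ha x x0 x1; have [B hB] := hb x x0 x1.
exists (A + B) => n; have := lerD (hA n) (hB n); apply: le_trans.
by rewrite -mulrDl ler_wpM2r ?nmD // exprn_ge0 // ltW.
Qed.
Lemma convN a : conv a -> conv (- a).
Proof. by move=> ha x x0 x1; have [A hA] := ha x x0 x1; exists A => n; rewrite foppE nmN. Qed.
Lemma convB a b : conv a -> conv b -> conv (a - b).
Proof. by move=> ha hb; apply: convD => //; exact: convN. Qed.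
Lemma conv_fin c N : (forall n, (N <= n)%N -> c n = 0) -> conv c.
Proof.
move=> h x x0 x1; exists (\sum_(n < N) nm (c n)) => n.
have [nN|Nn] := ltnP n N; last by rewrite h // nm0 mul0r sumr_ge0 // => i _; exact: nm_ge0.
rewrite (bigD1 (Ordinal nN)) //=; apply: (@le_trans _ _ (nm (c n))).
  by rewrite -[leRHS]mulr1 ler_wpM2l ?nm_ge0 // exprn_ile1 // ltW.
by rewrite lerDl sumr_ge0 // => i _; exact: nm_ge0.
Qed.
Lemma conv_cst z : conv (fcst z). Proof. by apply: (@conv_fin _ 1%N) => -[]. Qed.
Lemma conv_nat (n : nat) : conv n%:R. Proof. by rewrite -fcst_nat; exact: conv_cst. Qed.
Lemma conv1 : conv 1. Proof. exact: (conv_nat 1). Qed.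
Lemma conv_fX : conv (fX C). Proof. by apply: (@conv_fin _ 2%N) => -[|[]]. Qed.
Lemma convM a b : conv a -> conv b -> conv (a * b).
Proof.
move=> ha hb x x0 x1; have [A A0 hA] := conv_bound ha (ltW x0) x1; have [B hB] := hb x x0 x1.
exists (A * B) => n; rewrite fmulEn.
apply: (@le_trans _ _ (\sum_(i < n.+1) (nm (a i) * x ^+ i) * B)); last first.
  have B0 : 0 <= B by apply: le_trans (hB 0%N); rewrite mulr_ge0 ?nm_ge0 // exprn_ge0 // ltW.
  by rewrite -mulr_suml ler_wpM2r.
apply: le_trans (ler_wpM2r _ (nm_sum _ _ _)) _; first by rewrite exprn_ge0 // ltW.
rewrite mulr_suml; apply: ler_sum => i _; rewrite nmM.
have -> : x ^+ n = x ^+ i * x ^+ (n - i) by rewrite -exprD subnKC // -ltnS.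
rewrite mulrACA; apply: ler_wpM2l => //; by rewrite mulr_ge0 ?nm_ge0 // exprn_ge0 // ltW.
Qed.
Lemma convZ z a : conv a -> conv (fcst z * a).
Proof. by move=> h; apply: convM => //; exact: conv_cst. Qed.
Lemma convX a n : conv a -> conv (a ^+ n).
Proof. by move=> ha; elim: n => [|n IH]; [exact: conv1|rewrite exprS; exact: convM]. Qed.
Lemma conv_theta a : conv a -> conv (theta a).
Proof.
move=> ha x x0 x1; have [B [r [B0 /andP[r0 r1] h]]] := conv_geom ha (ltW x0) x1.
have [r00|rn0] := eqVneq r 0.
  exists B => -[|n]; first by rewrite theta0E nm0 mul0r.
  by rewrite /theta nmM -mulrA; have := h n.+1; rewrite r00 expr0n mulr0 => h'; rewrite (le_trans _ B0) // mulr_ge0_le0 // nm_ge0.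
have [_ [D hD]] := smb_dgeom r0 r1; exists (B * D) => n.
rewrite /theta nmM nm_nat -mulrA; apply: (@le_trans _ _ (n%:R * (B * r ^+ n))).
  by rewrite ler_wpM2l.
rewrite mulrCA ler_wpM2l //; apply: le_trans (hD n.+1); rewrite big_ord_recr /=.
apply: (@le_trans _ _ (n.+1%:R * r ^+ n)); first by rewrite ler_wpM2r ?exprn_ge0 // ler_nat.
by rewrite lerDr sumr_ge0 // => i _; rewrite mulr_ge0 // exprn_ge0.
Qed.
(** Let P bound the sum of |p_k| x^k. In n e_n = p_1 e_(n-1) + ... + p_n e_0 a common bound for the
    earlier terms passes to e_n as soon as n >= P, so only finitely many terms need a bound of their
    own. *)
Lemma conv_fexp p : conv p -> conv (fexp p).
Proof.
move=> hp x x0 x1; have [P P0 hP] := conv_bound hp (ltW x0) x1.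
pose N := (Num.truncn P).+1.
have hN : P < N%:R := Num.Theory.real_truncnS_gt (num_real P).
have [B B0 hB] : exists2 B : R, 0 <= B & forall n, (n < N)%N -> nm (fexp p n) * x ^+ n <= B.
  elim: (N) => [|k [B B0 IH]]; first by exists 0.
  exists (B + nm (fexp p k) * x ^+ k).
    by rewrite addr_ge0 // mulr_ge0 ?nm_ge0 // exprn_ge0 // ltW.
  move=> n; rewrite ltnS leq_eqVlt => /orP[/eqP ->|/IH h]; first by rewrite lerDr.
  by apply: le_trans h _; rewrite lerDl mulr_ge0 ?nm_ge0 // exprn_ge0 // ltW.
exists B => n; have [m] := ubnP n; elim: m n => // m IH n nm_.
have [nN|Nn] := ltnP n N; first exact: hB.
case: n nm_ Nn => [|n] nm_ Nn //; rewrite fexp_S nmM nmV nm_nat -mulrA.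
have n0 : (0 : R) < n.+1%:R by [].
rewrite mulrC ler_pdivrMr //; apply: le_trans (ler_wpM2r _ (nm_sum _ _ _)) _.
  by rewrite exprn_ge0 // ltW.
apply: (@le_trans _ _ (\sum_(k < n.+1) nm (p k.+1) * x ^+ k.+1 * B)).
  rewrite mulr_suml; apply: ler_sum => k _; rewrite nmM.
  have -> : x ^+ n.+1 = x ^+ k.+1 * x ^+ (n - k) by rewrite -exprD addSn subnKC // -ltnS.
  rewrite mulrACA ler_wpM2l //; first by rewrite mulr_ge0 ?nm_ge0 // exprn_ge0 // ltW.
  by apply: IH; apply: leq_ltn_trans (leq_subr _ _) _.
rewrite -mulr_suml mulrC ler_wpM2l //; apply: le_trans (_ : P <= _); last first.
  by apply: le_trans (ltW hN) _; rewrite ler_nat.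
apply: le_trans (hP n.+2); rewrite [leRHS]big_ord_recl lerDr.
by rewrite mulr_ge0 ?nm_ge0 // exprn_ge0 // ltW.
Qed.

Fact ev_key : unit. Proof. exact: tt. Qed.
Definition ev : fps C -> C -> C := locked_with ev_key (fun c tau => csum (fun n => c n * ee tau ^+ n)).
Lemma evE c tau : ev c tau = csum (fun n => c n * ee tau ^+ n).
Proof. by rewrite [ev]unlock. Qed.

Lemma smb_ev c tau : conv c -> upper tau -> smb (fun n => nm (c n) * nm (ee tau) ^+ n).
Proof. by move=> hc ht; apply: conv_smb => //; [exact: nm_ge0|exact: nm_ee_lt1]. Qed.
Lemma nm_term c tau n : nm (c n * ee tau ^+ n) <= nm (c n) * nm (ee tau) ^+ n.
Proof. by rewrite nmM nmX. Qed.
Lemma evP c tau : conv c -> upper tau -> hasum (fun n => c n * ee tau ^+ n) (ev c tau).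
Proof.
move=> hc ht; have [s hs] := hasum_ex (nm_term c tau) (smb_ev hc ht).
by rewrite evE (csumE hs).
Qed.

Lemma ev_fin c N tau : (forall n, (N <= n)%N -> c n = 0) ->
  ev c tau = \sum_(n < N) c n * ee tau ^+ n.
Proof.
move=> h; rewrite evE; apply: csumE.
by apply: (@hasum_fin _ (fun n => c n * ee tau ^+ n)) => n /h ->; rewrite mul0r.
Qed.
Lemma ev_cst z tau : ev (fcst z) tau = z.
Proof. by rewrite (@ev_fin _ 1%N) ?big_ord1 ?mulr1 // => -[]. Qed.
Lemma ev0 tau : ev 0 tau = 0. Proof. exact: (ev_cst 0). Qed.
Lemma ev1 tau : ev 1 tau = 1. Proof. exact: (ev_cst 1). Qed.
Lemma ev_fX tau : ev (fX C) tau = ee tau.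
Proof.
rewrite (@ev_fin _ 2%N) => [|[|[]] //]; rewrite !big_ord_recl big_ord0 /fX /=.
by rewrite mul0r add0r addr0 mul1r expr1.
Qed.
Lemma evD a b tau : conv a -> conv b -> upper tau -> ev (a + b) tau = ev a tau + ev b tau.
Proof.
move=> ha hb ht; rewrite evE; apply: csumE; apply: eq_hasum (hasumD (evP ha ht) (evP hb ht)) => n.
by rewrite faddE mulrDl.
Qed.
Lemma evN a tau : conv a -> upper tau -> ev (- a) tau = - ev a tau.
Proof.
move=> ha ht; rewrite evE; apply: csumE; apply: eq_hasum (hasumN (evP ha ht)) => n.
by rewrite foppE mulNr.
Qed.
Lemma evB a b tau : conv a -> conv b -> upper tau -> ev (a - b) tau = ev a tau - ev b tau.
Proof. by move=> ha hb ht; rewrite evD ?evN //; exact: convN. Qed.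
Lemma evM a b tau : conv a -> conv b -> upper tau -> ev (a * b) tau = ev a tau * ev b tau.
Proof.
move=> ha hb ht; rewrite evE; apply: csumE.
have := mertens (nm_term a tau) (nm_term b tau) (smb_ev ha ht) (smb_ev hb ht) (evP ha ht) (evP hb ht).
apply: eq_hasum => n; rewrite fmulEn mulr_suml; apply: eq_bigr => i _.
by rewrite mulrACA -exprD subnKC // -ltnS.
Qed.
Lemma evZ z a tau : conv a -> upper tau -> ev (fcst z * a) tau = z * ev a tau.
Proof. by move=> ha ht; rewrite evM ?ev_cst //; exact: conv_cst. Qed.
Lemma evX a n tau : conv a -> upper tau -> ev (a ^+ n) tau = ev a tau ^+ n.
Proof.
move=> ha ht; elim: n => [|n IH]; first by rewrite !expr0 ev1.
by rewrite !exprS evM ?IH //; exact: convX.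
Qed.

Lemma ev_period c tau (k : int) : ev c (tau + k%:~R) = ev c tau.
Proof. by rewrite !evE eeD ee_int mulr1. Qed.

Lemma ev_bound c y0 : conv c -> 0 < y0 ->
  exists2 B : R, 0 <= B & forall tau, y0 <= im tau -> nm (ev c tau) <= B.
Proof.
move=> hc y00; have x1 : expR (- (2 * pi * y0)) < 1 :> R.
  by rewrite -[ltRHS]expR0 ltr_expR oppr_lt0 !mulr_gt0 // pi_gt0.
have [B B0 hB] := conv_bound hc (expR_ge0 _) x1; exists B => // tau ht.
have ut : upper tau by apply: lt_le_trans ht.
apply: (nm_hasum (evP hc ut)) => N; apply: le_trans (hB N); apply: ler_sum => i _.
rewrite nmM nmX ler_wpM2l ?nm_ge0 // lerXn2r ?nnegrE ?nm_ge0 ?expR_ge0 //.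
by rewrite nm_ee ler_expR lerN2 ler_wpM2l // mulr_ge0 // pi_ge0.
Qed.

Definition ps c w : C := csum (fun n => c n * w ^+ n).

Lemma psP c w : conv c -> nm w < 1 -> hasum (fun n => c n * w ^+ n) (ps c w).
Proof.
move=> hc hw; have b n : nm (c n * w ^+ n) <= nm (c n) * nm w ^+ n by rewrite nmM nmX.
have [s hs] := hasum_ex b (conv_smb hc (nm_ge0 w) hw).
by rewrite /ps (csumE hs).
Qed.

(** The n^2 in the remainder is absorbed by two applications of [theta], so the remainder can be
    summed against any convergent series. *)
Lemma pow_taylor (w h : C) (r : R) n : nm w <= r -> nm (w + h) <= r -> 0 < r ->
  nm ((w + h) ^+ n - w ^+ n - n%:R * w ^+ n.-1 * h) <= n%:R ^+ 2 * r ^+ n * (nm h / r) ^+ 2.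
Proof.
move=> wr whr r0; have rn k : 0 <= r ^+ k by rewrite exprn_ge0 // ltW.
elim: n => [|n IH]; first by rewrite !expr0 !mul0r subrr subr0 nm0 expr0n !mul0r.
have -> : (w + h) ^+ n.+1 - w ^+ n.+1 - n.+1%:R * w ^+ n.+1.-1 * h =
   (w + h) * ((w + h) ^+ n - w ^+ n - n%:R * w ^+ n.-1 * h) + n%:R * w ^+ n.-1 * h ^+ 2.
  by case: n {IH} => [|n] /=; rewrite ?exprS -!natr1; ring.
apply: le_trans (nmD _ _) _; rewrite nmM.
have hr0 : 0 <= (nm h / r) ^+ 2 by exact: sqr_ge0.
have h1 : nm (w + h) * nm ((w + h) ^+ n - w ^+ n - n%:R * w ^+ n.-1 * h) <=
   r * (n%:R ^+ 2 * r ^+ n * (nm h / r) ^+ 2) by apply: ler_pM; rewrite ?nm_ge0.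
have h2 : nm (n%:R * w ^+ n.-1 * h ^+ 2) <= n%:R * r ^+ n.+1 * (nm h / r) ^+ 2.
  rewrite !nmM !nmX nm_nat; case: n {IH h1} => [|n]; first by rewrite !mul0r.
  have -> : n.+1%:R * r ^+ n.+2 * (nm h / r) ^+ 2 = n.+1%:R * r ^+ n * nm h ^+ 2.
    by rewrite !exprS; field; rewrite gt_eqF.
  by rewrite /= ler_wpM2r ?sqr_ge0 // ler_wpM2l // lerXn2r ?nnegrE ?nm_ge0 // ltW.
apply: le_trans (lerD h1 h2) _.
have -> : r * (n%:R ^+ 2 * r ^+ n * (nm h / r) ^+ 2) + n%:R * r ^+ n.+1 * (nm h / r) ^+ 2 =
   (n%:R ^+ 2 + n%:R) * (r ^+ n.+1 * (nm h / r) ^+ 2).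
  by rewrite [r ^+ n.+1]exprS; move: ((nm h / r) ^+ 2) (r ^+ n) => X P; ring.
rewrite -[leRHS]mulrA; apply: ler_wpM2r; first by rewrite mulr_ge0.
rewrite -natr1; have : 0 <= n%:R :> R by []; nra.
Qed.

Lemma ps_der c w : conv c -> nm w < 1 ->
  exists2 l, cder (ps c) w l & hasum (fun n => c n * (n%:R * w ^+ n.-1)) l.
Proof.
move=> hc hw; have w0 := nm_ge0 w; pose r := (1 + nm w) / 2.
have r0 : 0 < r by rewrite /r; lra.
have r1 : r < 1 by rewrite /r; lra.
have wr : nm w < r by rewrite /r; lra.
have [S S0 hS] := conv_bound (conv_theta (conv_theta hc)) (ltW r0) r1.
have [S1 S10 hS1] := conv_bound (conv_theta hc) (ltW r0) r1.
have [l hl] : exists l, hasum (fun n => c n * (n%:R * w ^+ n.-1)) l.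
  apply: (@hasum_ex _ _ (fun n => r^-1 * (nm (theta c n) * r ^+ n))); last first.
    by apply: smbZ; [rewrite invr_ge0 ltW|apply: conv_smb => //; [exact: conv_theta|exact: ltW]].
  move=> [|n]; first by rewrite mul0r mulr0 nm0 !mulr_ge0 ?invr_ge0 ?nm_ge0 // ltW.
  rewrite /theta !nmM nmX nm_nat exprS.
  have -> : r^-1 * (n.+1%:R * nm (c n.+1) * (r * r ^+ n)) = nm (c n.+1) * (n.+1%:R * r ^+ n).
    by field; rewrite gt_eqF.
  rewrite ler_wpM2l ?nm_ge0 // ler_wpM2l // lerXn2r ?nnegrE ?nm_ge0 // ?ltW //.
exists l => // e e0.
pose d := Num.min (r - nm w) (e * r ^+ 2 / (S + 1)).
have d0 : 0 < d by rewrite lt_min subr_gt0 wr divr_gt0 ?mulr_gt0 ?exprn_gt0 //; lra.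
exists d => // h; rewrite lt_min => /andP[h1 h2].
have whr : nm (w + h) < r by apply: le_lt_trans (nmD _ _) _; lra.
have hs := hasumB (hasumB (psP hc (lt_trans whr r1)) (psP hc hw)) (hasumZ h hl).
have -> : l * h = h * l by rewrite mulrC.
have S2 : nm (ps c (w + h) - ps c w - h * l) <= S * (nm h / r) ^+ 2.
  apply: (nm_hasum hs) => N; apply: le_trans (ler_wpM2r (sqr_ge0 _) (hS N)).
  rewrite mulr_suml; apply: ler_sum => i _.
  have -> : c i * (w + h) ^+ i - c i * w ^+ i - h * (c i * (i%:R * w ^+ i.-1)) =
    c i * ((w + h) ^+ i - w ^+ i - i%:R * w ^+ i.-1 * h) by ring.
  rewrite nmM /theta !nmM nm_nat.
  have := ler_wpM2l (nm_ge0 (c i)) (pow_taylor i (ltW wr) (ltW whr) r0).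
  by congr (_ <= _); ring.
apply: le_trans S2 _; rewrite expr_div_n expr2 !mulrA.
move: h2; rewrite ltr_pdivlMr; last lra.
move=> h2; have n0 := nm_ge0 h; rewrite mulrAC ler_wpM2r //.
rewrite ler_pdivrMr ?exprn_gt0 //; nra.
Qed.

Lemma ev_der c tau : conv c -> upper tau ->
  cder (ev c) tau (twopii R * ev (theta c) tau).
Proof.
move=> hc ht; have [l hl hs] := ps_der hc (nm_ee_lt1 ht).
have -> : twopii R * ev (theta c) tau = l * (twopii R * ee tau); last first.
  have -> : ev c = (fun w => ps c (ee w)) by apply/funext => w; rewrite evE.
  exact: (cder_comp (ee_der tau) hl).
rewrite mulrCA; congr (_ * _); rewrite evE; apply: csumE; rewrite mulrC.
apply: eq_hasum (hasumZ (ee tau) hs) => -[|n]; rewrite /theta; first by rewrite !mul0r !mulr0.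
by rewrite /= exprS; ring.
Qed.

Lemma ev_split c tau : conv c -> upper tau ->
  conv (fun n => c n.+1) /\ ev c tau = c 0%N + ee tau * ev (fun n => c n.+1) tau.
Proof.
move=> hc ht; have hc' : conv (fun n => c n.+1).
  move=> x x0 x1; have [B hB] := hc x x0 x1; exists (B / x) => n.
  by rewrite ler_pdivlMr // -mulrA -exprSr.
split => //; have E : c = fcst (c 0%N) + fX C * (fun n => c n.+1).
  by apply/funext => -[|n]; rewrite faddE ?fXM0 ?fXMS /= ?addr0 ?add0r.
rewrite {1}E evD ?ev_cst ?evM ?ev_fX //; [exact: conv_fX|exact: conv_cst|].
by apply: convM => //; exact: conv_fX.
Qed.

(* The constant term is a mean value over a horizontal period.  The mean is reached
   by averaging over tau and tau + 1/2 repeatedly, which avoids integration. *)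
Lemma ev_dec c tau : conv c -> upper tau -> conv (fun n => c n.*2) /\
  ev (fun n => c n.*2) (2%:R * tau) = 2%:R^-1 * (ev c tau + ev c (tau + 2%:R^-1)).
Proof.
move=> hc ht; split.
  move=> x x0 x1; pose s := Num.sqrt x.
  have s0 : 0 < s by rewrite sqrtr_gt0.
  have s1 : s < 1 by rewrite -sqrtr1 ltr_sqrt.
  have [B hB] := hc s s0 s1; exists B => n; have := hB n.*2.
  by rewrite -muln2 mulnC exprM sqr_sqrtr // ltW.
have ht' : upper (tau + 2%:R^-1).
  have -> : 2%:R^-1 = toC 2^-1 :> C by rewrite toCV toC_nat.
  by rewrite /upper imD im_toC addr0.
have h := hasumZ 2%:R^-1 (hasumD (evP hc ht) (evP hc ht')).
have dbl n : (n <= n.*2)%N by rewrite -addnn leq_addr.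
have h2 := @cv_sub R _ _ double dbl h.
rewrite evE; apply: csumE; apply: eq_cv h2 => n; elim: n => [|n IH]; first by rewrite !big_ord0.
rewrite doubleS !big_ord_recr /= IH -addrA; congr (_ + _).
rewrite eeD ee_half mulrN1 eeM !exprS -muln2 mulnC !exprM sqrrN expr0 mulr1.
by field.
Qed.

Lemma ev_c0 c y (B : R) : conv c -> 0 < y ->
  (forall tau, im tau = y -> nm (ev c tau) <= B) -> nm (c 0%N) <= B.
Proof.
move=> hc y0 hB.
have step k : conv (fun n => c (2 ^ k * n)%N) /\
   forall tau, im tau = 2 ^+ k * y -> nm (ev (fun n => c (2 ^ k * n)%N) tau) <= B.
  elim: k => [|k [IH1 IH2]].
    have -> : (fun n => c (2 ^ 0 * n)%N) = c by apply/funext => n; rewrite mul1n.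
    by split => // tau; rewrite mul1r; exact: hB.
  have E : (fun n => c (2 ^ k.+1 * n)%N) = (fun n => c (2 ^ k * n.*2)%N).
    by apply/funext => n; rewrite expnS -muln2 [(2 * _)%N]mulnC -mulnA [(2 * n)%N]mulnC.
  have ui : upper (Complex 0 1 : C) by exact: ltr01.
  rewrite E; split; first by case: (ev_dec IH1 ui).
  move=> tau ht; pose t' := 2%:R^-1 * tau.
  have i2 : 2%:R^-1 = toC 2^-1 :> C by rewrite toCV toC_nat.
  have it' : im t' = 2 ^+ k * y.
    by rewrite /t' i2 imM re_toC im_toC mul0r addr0 ht exprS; field.
  have ut' : upper t' by rewrite /upper it' mulr_gt0 // exprn_gt0.
  have tE : tau = 2%:R * t' by rewrite /t' mulrA divff ?mul1r // pnatr_eq0.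
  have [_] := ev_dec IH1 ut'; rewrite -tE => ->.
  have h1 := IH2 t' it'; have h2 : nm (ev (fun n => c (2 ^ k * n)%N) (t' + 2%:R^-1)) <= B.
    by apply: IH2; rewrite imD i2 im_toC addr0.
  rewrite nmM nmV nm_nat mulrC ler_pdivrMr // mulr_natr mulr2n.
  by apply: le_trans (nmD _ _) (lerD h1 h2).
apply/ler_addgt0Pr => e e0.
have x1 : expR (- (2 * pi * y)) < 1 :> R.
  by rewrite -[ltRHS]expR0 ltr_expR oppr_lt0 !mulr_gt0 // pi_gt0.
(* After k halvings the bound B still holds, while the series at height 2^k y is c_0 with an error
   of at most 2 D r^(2^k). *)
have [D [r [D0 /andP[r0 r1] hD]]] := conv_geom hc (expR_ge0 _) x1.
have /cvgrPdist_lt/(_ (Num.min (1 / 2) (e / (2 * D + 1)))) : (fun n => r ^+ n) @ \oo --> 0.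
  by apply: cvg_expr; rewrite ger0_norm.
case; first by rewrite lt_min; apply/andP; split; [lra|apply: divr_gt0 => //; lra].
move=> k _ Hk; have k2 : (k <= 2 ^ k)%N by rewrite ltnW // ltn_expl.
have := Hk _ k2; rewrite sub0r normrN ger0_norm ?exprn_ge0 // lt_min => /andP[]; set x := r ^+ _ => x2 xe.
have x0 : 0 <= x by rewrite exprn_ge0.
pose tau : C := Complex 0 (2 ^+ k * y).
have ut : upper tau by rewrite /upper /= mulr_gt0 // exprn_gt0.
have [hk1 hk2] := step k; have [hk3 evE] := ev_split hk1 ut.
set E := ev (fun n => c (2 ^ k * n.+1)%N) tau in evE.
have h1 := hk2 tau erefl.
have nmq : nm (ee tau) = expR (- (2 * pi * y)) ^+ (2 ^ k).
  by rewrite nm_ee -expRM_natl; congr expR; rewrite /= natrX; ring.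
have h2 : nm (ee tau * E) <= 2 * D * x.
  apply: (nm_hasum (hasumZ (ee tau) (evP hk3 ut))) => N.
  apply: (@le_trans _ _ (\sum_(i < N) D * x * (1 / 2) ^+ i)).
    apply: ler_sum => i _; rewrite mulrCA -exprS nmM nmX nmq -exprM.
    apply: le_trans (hD _) _; rewrite -mulrA ler_wpM2l // exprM -/x exprS.
    by rewrite ler_wpM2l // lerXn2r ?nnegrE ?(ltW x2) //; lra.
  rewrite -mulr_sumr [2 * D * x](_ : _ = D * x * 2); last by ring.
  apply: ler_wpM2l; first by rewrite mulr_ge0.
  have := subrX1 (1 / 2 : R) N => S; have p0 : 0 <= (1 / 2 : R) ^+ N by rewrite exprn_ge0 //; lra.
  lra.
have -> : c 0%N = ev (fun n => c (2 ^ k * n)%N) tau - ee tau * E.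
  by rewrite evE muln0 addrK.
apply: le_trans (nmB _ _) _; apply: lerD => //; apply: le_trans h2 _.
move: xe; rewrite ltr_pdivlMr; last lra.
nra.
Qed.

Lemma ev_uniq c (y0 : R) : conv c -> 0 <= y0 ->
  (forall tau, y0 < im tau -> ev c tau = 0) -> c = 0.
Proof.
move=> hc y00 h; apply/funext => n; rewrite fzeroE.
elim: n c hc h => [|n IH] c hc h; have c00 : c 0%N = 0.
- have : nm (c 0%N) <= 0.
    by apply: (@ev_c0 _ (y0 + 1)) => // [|tau ht]; [lra|rewrite h ?nm0 // ht; lra].
  by move=> h0; apply/eqP; rewrite -nm_eq0 eq_le h0 nm_ge0.
- by [].
- have : nm (c 0%N) <= 0.
    by apply: (@ev_c0 _ (y0 + 1)) => // [|tau ht]; [lra|rewrite h ?nm0 // ht; lra].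
  by move=> h0; apply/eqP; rewrite -nm_eq0 eq_le h0 nm_ge0.
have ui : upper (Complex 0 1 : C) by exact: ltr01.
have [hc' _] := ev_split hc ui.
apply: (IH (fun n => c n.+1)) => // tau ht.
have ut : upper tau by apply: le_lt_trans ht.
have [_] := ev_split hc ut.
by rewrite h // c00 add0r => /esym/eqP; rewrite mulf_eq0 (negbTE (ee_neq0 _)) => /eqP.
Qed.

Lemma ev_inj a b : conv a -> conv b -> (forall tau, upper tau -> ev a tau = ev b tau) -> a = b.
Proof.
move=> ha hb h; apply/eqP; rewrite -subr_eq0; apply/eqP.
apply: (@ev_uniq _ 0) => //; first exact: convB.
by move=> tau ht; rewrite evB // h ?subrr.
Qed.

(** Every radius x in (0, 1) is |q| at a point of the imaginary axis, and the terms of a convergent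
    series are bounded. *)
Lemma conv_of_cv c : (forall tau, upper tau -> exists l, hasum (fun n => c n * ee tau ^+ n) l) -> conv c.
Proof.
move=> h x x0 x1; have p0 := pi_gt0 R.
pose tau : C := Complex 0 (- ln x / (2 * pi)).
have lx : ln x < 0 by rewrite ln_lt0 // x0.
have ut : upper tau by rewrite /upper /= divr_gt0 ?oppr_gt0 // mulr_gt0.
have nx : nm (ee tau) = x.
  rewrite nm_ee /= -[RHS](@lnK R) ?posrE //; congr expR.
  by rewrite mulrC divfK ?opprK // mulf_neq0 // gt_eqF.
have [l hl] := h tau ut; have [B hB] := cv_bounded hl.
exists (B + B) => n; rewrite -nx -nmX -nmM.
have -> : c n * ee tau ^+ n = \sum_(i < n.+1) c i * ee tau ^+ i - \sum_(i < n) c i * ee tau ^+ i.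
  by rewrite big_ord_recr /= [X in X - _]addrC addrK.
by apply: le_trans (nmB _ _) _; apply: lerD; exact: hB.
Qed.

Lemma qpow_neq0 mu tau : qpow mu tau != 0. Proof. exact: cexp_neq0. Qed.

Lemma qexpansionP f mu c : qexpansion f mu c ->
  conv c /\ forall tau, upper tau -> f tau = qpow mu tau * ev c tau.
Proof.
move=> H; have H' tau : upper tau -> hasum (fun n => c n * ee tau ^+ n) ((qpow mu tau)^-1 * f tau).
  move=> ht; have /cvP h := H tau ht.
  apply: eq_cv (cvM (cv_cst (qpow mu tau)^-1) h) => n.
  rewrite mulrA mulVf ?qpow_neq0 // mul1r big_mkord.
  by apply: eq_bigr => i _; rewrite qpowE.
have hc : conv c by apply: conv_of_cv => tau ht; exists ((qpow mu tau)^-1 * f tau); exact: H'.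
split => // tau ht; rewrite (hasum_uniq (evP hc ht) (H' tau ht)).
by rewrite mulrA divff ?mul1r // qpow_neq0.
Qed.

Lemma qpowD mu nu tau : qpow (mu + nu) tau = qpow mu tau * qpow nu tau.
Proof. by rewrite /qpow mulrDr mulrDl cexpD. Qed.
Lemma qpow0 tau : qpow 0 tau = 1. Proof. by rewrite /qpow mulr0 mul0r cexp0. Qed.
Lemma qpow_der mu tau : cder (qpow mu) tau (twopii R * mu * qpow mu tau).
Proof.
have h : cder (fun w : C => twopii R * mu * w) tau (twopii R * mu).
  by have := cderZ (twopii R * mu) (cder_id tau); rewrite mulr1.
by rewrite mulrC; exact: (cder_comp h (cexp_der _)).
Qed.

End Evaluation.

(** * Eisenstein series and the Hauptmodul *)
Section Series.
Variable R : realType.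
Local Notation C := (CC R).
Implicit Types (z w tau : C) (a b c d p : fps C).
Local Notation fexp := (@fexp C).

Lemma sigmak_le (k n : nat) : (sigmak k n.+1 <= n.+1 ^ k.+1)%N.
Proof.
rewrite /sigmak expnS; apply: (@leq_trans (\sum_(d <- divisors n.+1) n.+1 ^ k)).
  rewrite !big_seq; apply: leq_sum => d hd; case: k => [|k] //.
  by rewrite leq_exp2r // dvdn_leq // dvdn_divisors.
rewrite big_const_seq count_predT iter_addn_0 mulnC leq_mul2r; apply/orP; right.
rewrite -[leqRHS](size_iota 1 n.+1); apply: uniq_leq_size; first exact: divisors_uniq.
by move=> d; rewrite -dvdn_divisors // mem_iota => hd; rewrite (dvdn_gt0 _ hd) //= add1n ltnS dvdn_leq.
Qed.

Lemma conv_pow k : conv (fun n => (n%:R : C) ^+ k : C).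
Proof.
elim: k => [|k IH].
  by move=> x x0 x1; exists 1 => n; rewrite nm1 mul1r exprn_ile1 // ltW.
by have := conv_theta IH; congr conv; apply/funext => n; rewrite /theta exprS.
Qed.

Definition eis (k : nat) (y : C) : fps C :=
  fun n => if n is m.+1 then y * (sigmak k m.+1)%:R else 1.

Lemma conv_eis k y : conv (eis k y).
Proof.
apply: (@conv_le _ _ (fun n => nm (1 : C) + nm y * nm ((n%:R : C) ^+ k.+1))).
  move=> x x0 x1; have [U hU] := @conv1 R x x0 x1; have [V hV] := conv_pow k.+1 x0 x1.
  have [W hW] := @conv_pow 0 x x0 x1.
  exists (W + nm y * V) => n; rewrite mulrDl -mulrA; apply: lerD; last by rewrite ler_wpM2l ?nm_ge0.
  exact: (hW n).
case=> [|n]; first by rewrite /= lerDl mulr_ge0 ?nm_ge0.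
rewrite /= nmM nm_nat nmX nm_nat nm1 -natrX; apply: (@le_trans _ _ (nm y * (n.+1 ^ k.+1)%:R)).
  by apply: ler_wpM2l; [exact: nm_ge0|rewrite ler_nat sigmak_le].
by rewrite lerDr.
Qed.

Lemma ev_eis k y tau : y != 0 -> upper tau ->
  ev (eis k y) tau = 1 + y * csum (fun n => (sigmak k n.+1)%:R * qpow n.+1%:R tau).
Proof.
move=> y0 ht; have /hasum_rec h := evP (conv_eis k y) ht.
have -> : csum (fun n => (sigmak k n.+1)%:R * qpow n.+1%:R tau) = y^-1 * (ev (eis k y) tau - 1).
  apply: csumE; have := hasumZ y^-1 h; rewrite expr0 mulr1 /=; apply: eq_hasum => n.
  by rewrite qpowE !mulrA mulVf // mul1r.
by rewrite mulrA divff // mul1r addrC subrK.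
Qed.

Definition e2 : fps C := eis 1 (- 24%:R).
Definition e4 : fps C := eis 3 240%:R.

Lemma conv_e2 : conv e2. Proof. exact: conv_eis. Qed.
Lemma conv_e4 : conv e4. Proof. exact: conv_eis. Qed.
Lemma ev_e2 tau : upper tau -> ev e2 tau = E2 tau.
Proof. by move=> ht; rewrite ev_eis ?oppr_eq0 ?pnatr_eq0 // mulNr. Qed.
Lemma ev_e4 tau : upper tau -> ev e4 tau = E4 tau.
Proof. by move=> ht; rewrite ev_eis ?pnatr_eq0. Qed.

(** The series c(q^2), which is the value at 2 tau. *)
Definition dbl c : fps C := fun n => if odd n then 0 else c n./2.

Lemma conv_dbl c : conv c -> conv (dbl c).
Proof.
move=> hc x x0 x1; have [|B hB] := hc (x ^+ 2) (exprn_gt0 _ x0); first by rewrite exprn_ilt1 // ltW.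
exists B => n; rewrite /dbl; case: ifP => on.
  by rewrite nm0 mul0r; apply: le_trans (hB 0%N); rewrite expr0 mulr1 nm_ge0.
by have := hB n./2; rewrite -exprM mul2n -[X in _ -> _ * x ^+ X <= _](odd_double_half n) on add0n.
Qed.

Lemma upper2 tau : upper tau -> upper (2%:R * tau).
Proof. exact: (@upperMn _ _ 1%N). Qed.

Lemma sum_double (f : nat -> C) n :
  \sum_(i < n.*2) f i = \sum_(i < n) (f i.*2 + f i.*2.+1).
Proof.
elim: n => [|n IH]; first by rewrite !big_ord0.
by rewrite doubleS !big_ord_recr /= IH addrA.
Qed.

Lemma ev_dbl c tau : conv c -> upper tau -> ev (dbl c) tau = ev c (2%:R * tau).
Proof.
move=> hc ht; apply: cv_uniq (evP hc (upper2 ht)).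
have h : forall n : nat, (n <= n.*2)%N by move=> n; rewrite -addnn leq_addr.
apply: eq_cv (cv_sub h (evP (conv_dbl hc) ht)) => n; rewrite (sum_double (fun i => dbl c i * ee tau ^+ i)).
apply: eq_bigr => i _; rewrite /dbl /= odd_double /= mul0r addr0 doubleK.
by rewrite eeM -exprM mul2n.
Qed.

Lemma dblD a b : dbl (a + b) = dbl a + dbl b.
Proof. by apply/funext => n; rewrite faddE /dbl; case: ifP => //; rewrite addr0. Qed.
Lemma dblN a : dbl (- a) = - dbl a.
Proof. by apply/funext => n; rewrite foppE /dbl; case: ifP => //; rewrite oppr0. Qed.
Lemma dbl_nat (n : nat) : dbl n%:R = n%:R.
Proof.
by rewrite -fcst_nat; apply/funext => -[|[|k]]; rewrite /dbl //=; case: ifP.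
Qed.
Lemma theta_dbl a : theta (dbl a) = 2%:R * dbl (theta a).
Proof.
apply/funext => n; rewrite fnatME /theta /dbl; case: ifP => on; first by rewrite !mulr0.
by rewrite mulrA -natrM mul2n -{1}(odd_double_half n) on add0n.
Qed.
(** Shown on values rather than on coefficients: both sides represent the same function of 2 tau. *)
Lemma dblM a b : conv a -> conv b -> dbl (a * b) = dbl a * dbl b.
Proof.
move=> ha hb; apply: ev_inj => [||tau ht]; [exact: conv_dbl (convM ha hb)|exact: (convM (conv_dbl ha) (conv_dbl hb))|].
have hu := upper2 ht.
by rewrite evM ?ev_dbl ?evM //; [exact: convM|exact: conv_dbl|exact: conv_dbl].
Qed.
Lemma dbl_fX : dbl (fX C) = fX C ^+ 2.
Proof.
apply/funext => -[|[|[|n]]]; rewrite expr2 ?fXM0 ?fXMS /dbl /fX //=.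
by case: ifP => //; case: n => [|[|n]] //=.
Qed.

Definition gs : fps C := - e2 + 2%:R * dbl e2.
Lemma conv_gs : conv gs.
Proof. exact: (convD (convN conv_e2) (convM (@conv_nat R 2) (conv_dbl conv_e2))). Qed.
Lemma ev_gs tau : upper tau -> ev gs tau = Gform tau.
Proof.
move=> ht; have h2 := conv_dbl conv_e2; have h3 := convN conv_e2.
have h4 := @conv_nat R 2.
rewrite evD //; last exact: convM.
rewrite evN ?evM ?ev_dbl ?ev_e2 //; try exact: upper2; try exact: conv_e2.
by rewrite /Gform -fcst_nat ev_cst.
Qed.
Lemma e2_0 : e2 0%N = 1. Proof. by []. Qed.
Lemma gs_0 : gs 0%N = 1.
Proof. by rewrite /gs faddE foppE fnatME /dbl /= -[2%:R]/(1 + 1 : C) mulr1 addKr. Qed.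

(** Delta enters through theta Delta = E2 Delta instead of its product: Delta / q is the exponential
    of the integral of (E2 - 1) dq / q. It is thus invertible as a series and has no zero in the
    half-plane. *)
Definition us : fps C := fexp (e2 - 1).
(* dl is Delta, xs = Delta(2 tau) / Delta(tau) is the Hauptmodul and hs = xs / q,
   gs is G, and ys = xs / Delta has weight -12. *)
Definition dl : fps C := fX C * us.
Definition hs : fps C := fexp (gs - 1).
Definition xs : fps C := fX C * hs.
Definition ys : fps C := fexp (gs - e2).

Lemma e2B0 : (e2 - 1) 0%N = 0. Proof. by rewrite fsubE subrr. Qed.
Lemma gsB0 : (gs - 1) 0%N = 0. Proof. by rewrite fsubE gs_0 subrr. Qed.
Lemma ysB0 : (gs - e2) 0%N = 0. Proof. by rewrite fsubE gs_0 e2_0 subrr. Qed.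
Lemma conv_e2B : conv (e2 - 1). Proof. exact: (convB conv_e2 (@conv1 R)). Qed.
Lemma conv_gsB : conv (gs - 1). Proof. exact: (convB conv_gs (@conv1 R)). Qed.
Lemma conv_ysB : conv (gs - e2). Proof. exact: (convB conv_gs conv_e2). Qed.
Lemma conv_us : conv us. Proof. exact: conv_fexp conv_e2B. Qed.
Lemma conv_hs : conv hs. Proof. exact: conv_fexp conv_gsB. Qed.
Lemma conv_ys : conv ys. Proof. exact: conv_fexp conv_ysB. Qed.
Lemma conv_dl : conv dl. Proof. exact: (convM (@conv_fX R) conv_us). Qed.
Lemma conv_xs : conv xs. Proof. exact: (convM (@conv_fX R) conv_hs). Qed.

Lemma xs_0 : xs 0%N = 0. Proof. exact: fXM0. Qed.
Lemma xs_1 : xs 1%N = 1. Proof. by rewrite /xs fXMS /hs fexp_0. Qed.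

Lemma theta_fXexp p : p 0%N = 1 -> theta (fX C * fexp (p - 1)) = p * (fX C * fexp (p - 1)).
Proof.
move=> p0; rewrite thetaM theta_fX theta_fexp; [|exact: (@char0C R)|by rewrite fsubE p0 subrr].
by ring.
Qed.
Lemma theta_dl : theta dl = e2 * dl. Proof. exact: theta_fXexp. Qed.
Lemma theta_xs : theta xs = gs * xs. Proof. exact: theta_fXexp gs_0. Qed.
Lemma theta_ys : theta ys = (gs - e2) * ys.
Proof. exact: (theta_fexp (@char0C R) ysB0). Qed.

Lemma xs_ys : xs = ys * dl.
Proof.
rewrite /xs /ys /dl mulrCA /hs /us -fexpD; [|exact: (@char0C R)|exact: ysB0|exact: e2B0].
by congr (_ * fexp _); ring.
Qed.

(** Both sides have logarithmic derivative 2 E2(2 tau) = G + E2 and leading term q^2. *)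
Lemma dbl_dl : dbl dl = xs * dl.
Proof.
rewrite /dl dblM; [|exact: conv_fX|exact: conv_us].
have -> : dbl us = hs * us.
  rewrite -fexpD; [|exact: (@char0C R)|exact: gsB0|exact: e2B0].
  have -> : gs - 1 + (e2 - 1) = 2%:R * dbl (e2 - 1).
    by rewrite dblD dblN (dbl_nat 1) /gs; ring.
  have h0 : (2%:R * dbl (e2 - 1)) 0%N = 0 by rewrite fnatME /dbl /= fsubE e2_0 subrr mulr0.
  rewrite [LHS](fexp_uniq (@char0C R) h0).
    by rewrite [dbl us 0%N]fexp_0 rmorph1 mul1r.
  rewrite theta_dbl theta_fexp; [|exact: (@char0C R)|exact: e2B0].
  by rewrite dblM ?mulrA //; [exact: conv_e2B|exact: conv_us].
by rewrite dbl_fX /xs; ring.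
Qed.

Lemma ev_fexp_neq0 p tau : conv p -> p 0%N = 0 -> upper tau -> ev (fexp p) tau != 0.
Proof.
move=> hp p0 ht; have := congr1 (fun s : fps C => ev s tau) (fexpN (@char0C R) p0).
rewrite ev1 evM //; [|exact: conv_fexp|exact: (conv_fexp (convN hp))].
by move=> h; apply: contra_neq (oner_neq0 C) => h0; exact: (etrans (esym h) (etrans (congr1 (fun u => u * _) h0) (mul0r _))).
Qed.
Lemma ev_fexpN p tau : conv p -> p 0%N = 0 -> upper tau -> ev (fexp (- p)) tau = (ev (fexp p) tau)^-1.
Proof.
move=> hp p0 ht; have := congr1 (fun s : fps C => ev s tau) (fexpN (@char0C R) p0).
rewrite ev1 evM //; [|exact: conv_fexp|exact: (conv_fexp (convN hp))].
have h := ev_fexp_neq0 hp p0 ht => h1; apply: (mulfI h); by rewrite h1 mulfV.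
Qed.
Lemma ev_us_neq0 tau : upper tau -> ev us tau != 0.
Proof. exact: ev_fexp_neq0 conv_e2B e2B0. Qed.
Lemma ev_hs_neq0 tau : upper tau -> ev hs tau != 0.
Proof. exact: ev_fexp_neq0 conv_gsB gsB0. Qed.
Lemma ev_dlE tau : upper tau -> ev dl tau = ee tau * ev us tau.
Proof. by move=> ht; rewrite evM // ?ev_fX //; [exact: conv_fX|exact: conv_us]. Qed.
Lemma ev_xsE tau : upper tau -> ev xs tau = ee tau * ev hs tau.
Proof. by move=> ht; rewrite evM // ?ev_fX //; [exact: conv_fX|exact: conv_hs]. Qed.
Lemma ev_dl_neq0 tau : upper tau -> ev dl tau != 0.
Proof. by move=> ht; rewrite ev_dlE // mulf_neq0 ?ee_neq0 ?ev_us_neq0. Qed.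
Lemma ev_xs_neq0 tau : upper tau -> ev xs tau != 0.
Proof. by move=> ht; rewrite ev_xsE // mulf_neq0 ?ee_neq0 ?ev_hs_neq0. Qed.
Lemma ev_xs_ys tau : upper tau -> ev xs tau = ev ys tau * ev dl tau.
Proof. by move=> ht; rewrite xs_ys evM //; [exact: conv_ys|exact: conv_dl]. Qed.
Lemma ev_dl2 tau : upper tau -> ev dl (2%:R * tau) = ev xs tau * ev dl tau.
Proof.
move=> ht; apply: etrans (esym (ev_dbl conv_dl ht)) _.
exact: etrans (congr1 (fun s : fps C => ev s tau) dbl_dl) (evM conv_xs conv_dl ht).
Qed.
Lemma dl_der tau : upper tau -> cder (ev dl) tau (twopii R * E2 tau * ev dl tau).
Proof.
move=> ht; have := ev_der conv_dl ht; rewrite theta_dl evM ?ev_e2 ?mulrA //.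
  exact: conv_e2.
exact: conv_dl.
Qed.
End Series.

(** * Linear differential equations *)
Section Gronwall.
Variable R : realType.
Local Notation C := (CC R).
Implicit Types (z w t d tau : C) (x y s : R).

Lemma seg_der (f : C -> C) t d s l : cder f (t + toC s * d) l ->
  is_derive s (1 : R) (fun x => re (f (t + toC x * d))) (re (l * d)) /\
  is_derive s (1 : R) (fun x => im (f (t + toC x * d))) (im (l * d)).
Proof.
move=> h; have key e : 0 < e -> exists2 r : R, 0 < r & forall x, `|x| < r ->
    nm (f (t + toC (s + x) * d) - f (t + toC s * d) - l * d * toC x) <= e * `|x|.
  move=> e0; have p0 : 0 < nm d + 1 by rewrite ltr_wpDl // nm_ge0.
  have [r r0 hr] := h (e / (nm d + 1)) (divr_gt0 e0 p0).
  exists (r / (nm d + 1)); first exact: divr_gt0.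
  move=> x hx; have E1 : nm (toC x * d) <= `|x| * (nm d + 1).
    by rewrite nmM nm_toC ler_wpM2l // lerDl.
  have -> : t + toC (s + x) * d = t + toC s * d + toC x * d by rewrite toCD; ring.
  have -> : l * d * toC x = l * (toC x * d) by ring.
  apply: le_trans (hr _ _) _; first by apply: le_lt_trans E1 _; rewrite -ltr_pdivlMr.
  apply: (@le_trans _ _ (e / (nm d + 1) * (`|x| * (nm d + 1)))).
    by rewrite ler_wpM2l // ltW // divr_gt0.
  by rewrite [`|x| * _]mulrC mulrA divfK // gt_eqF.
split; apply/rderE => e e0; have [r r0 hr] := key e e0; exists r => // x hx; apply: le_trans (hr x hx).
  have -> : re (l * d) * x = re (l * d * toC x) by rewrite [RHS]reM re_toC im_toC mulr0 subr0.
  by rewrite -!reN -!reD re_le.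
have -> : im (l * d) * x = im (l * d * toC x) by rewrite [RHS]imM re_toC im_toC mulr0 add0r.
by rewrite -!imN -!imD im_le.
Qed.

Lemma nincr_of_der (f f' : R -> R) :
  (forall s, 0 <= s -> s <= 1 -> is_derive s (1 : R) f (f' s)) ->
  (forall s, 0 <= s -> s <= 1 -> f' s <= 0) -> f 1 <= f 0.
Proof.
move=> h h0; apply: (@ler0_derive1_nincr _ f 0 1) => //.
- by move=> x; rewrite in_itv /= => /andP[/ltW a /ltW b]; have := h x a b => -[].
- move=> x; rewrite in_itv /= => /andP[/ltW a /ltW b]; have hx := h x a b.
  by rewrite derive1E derive_val h0.
- by apply: derivable_within_continuous => x; rewrite in_itv /= => /andP[a b]; have := h x a b => -[].
Qed.

(** Along the segment the sum N of squares satisfies N' <= 2 K |d| N, so N(s) e^(-2 K |d| s) does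
    not increase. The derivative is taken on real and imaginary parts. *)
Lemma gronwall n (u u' : 'I_n -> C -> C) t d K :
  (forall s, 0 <= s -> s <= 1 -> forall k, cder (u k) (t + toC s * d) (u' k (t + toC s * d))) ->
  (forall s, 0 <= s -> s <= 1 ->
    \sum_(k < n) nm (u k (t + toC s * d)) * nm (u' k (t + toC s * d))
      <= K * \sum_(k < n) nm (u k (t + toC s * d)) ^+ 2) ->
  \sum_(k < n) nm (u k (t + d)) ^+ 2
    <= expR (2 * K * nm d) * \sum_(k < n) nm (u k t) ^+ 2.
Proof.
move=> hd hK; pose p s := t + toC s * d; pose L := 2 * K * nm d.
pose N s := \sum_(k < n) nm (u k (p s)) ^+ 2.
pose N' s := \sum_(k < n) (2 * (re (u k (p s)) * re (u' k (p s) * d) +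
    im (u k (p s)) * im (u' k (p s) * d))).
have dN s : 0 <= s -> s <= 1 -> is_derive s (1 : R) N (N' s).
  move=> s0 s1.
  have -> : N = \sum_(k < n) (fun x => nm (u k (p x)) ^+ 2).
    by apply/funext => x; rewrite fct_sumE.
  apply: is_derive_sum => k.
  have [h1 h2] := seg_der (hd s s0 s1 k).
  have -> : (fun x => nm (u k (p x)) ^+ 2) =
    (fun x => re (u k (p x))) ^+ 2 + (fun x => im (u k (p x))) ^+ 2.
    by apply/funext => x; rewrite nm2.
  have := is_deriveD (is_deriveX 2 h1) (is_deriveX 2 h2).
  by congr is_derive; rewrite /GRing.scale /= !expr1 -/(p s); ring.
have dE s : is_derive s (1 : R) (fun x => expR (- L * x)) (expR (- L * s) * - L).
  have h1 : is_derive s (1 : R) (fun x => - L * x) (- L).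
    apply/rderE => e e0; exists 1 => // x _.
    have -> : - L * (s + x) - - L * s - - L * x = 0 by ring.
    by rewrite normr0 mulr_ge0 // ltW.
  have := @is_derive1_comp _ expR (fun x => - L * x) s _ _ (is_derive_expR _) h1.
  by [].
have := @nincr_of_der (fun x => N x * expR (- L * x))
  (fun x => N x * (expR (- L * x) * - L) + expR (- L * x) * N' x).
have -> : N 1 = \sum_(k < n) nm (u k (t + d)) ^+ 2 by rewrite /N /p toC1 mul1r.
have -> : N 0 = \sum_(k < n) nm (u k t) ^+ 2 by rewrite /N /p toC0 mul0r addr0.
rewrite mulr1 mulr0 expR0 mulr1 expRN ler_pdivrMr ?expR_gt0 // [_ * expR L]mulrC; apply.
  by move=> s s0 s1; exact: is_deriveM (dN s s0 s1) (dE s).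
move=> s s0 s1.
suff h : N' s <= L * N s.
  have -> : N s * (expR (- L * s) * - L) + expR (- L * s) * N' s =
    expR (- L * s) * (N' s - L * N s) by ring.
  by apply: mulr_ge0_le0; [exact: expR_ge0|rewrite subr_le0].
have -> : L * N s = 2 * nm d * (K * N s) by rewrite /L; ring.
apply: (@le_trans _ _ (2 * nm d * \sum_(k < n) nm (u k (p s)) * nm (u' k (p s)))); last first.
  by apply: ler_wpM2l; [rewrite mulr_ge0 ?nm_ge0|exact: hK].
rewrite mulr_sumr; apply: ler_sum => k _.
rewrite -!mulrA ler_pM2l //.
move: (u k (p s)) (u' k (p s)) => a b.
have -> : re a * re (b * d) + im a * im (b * d) = re (Complex (re a) (- im a) * (b * d)).
  by rewrite [in RHS]reM /re /im /=; ring.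
apply: le_trans (ler_norm _) _; apply: le_trans (re_le _) _; rewrite !nmM.
have -> : nm (Complex (re a) (- im a)) = nm a by rewrite /nm /re /im /= sqrrN.
by rewrite le_eqVlt; apply/orP; left; apply/eqP; ring.
Qed.

Lemma upper_seg t d s : upper t -> upper (t + d) -> 0 <= s -> s <= 1 -> upper (t + toC s * d).
Proof.
rewrite /upper !imD imM re_toC im_toC mul0r addr0 => h1 h2 s0 s1.
have -> : im t + s * im d = (1 - s) * im t + s * (im t + im d) by ring.
have [->|s1'] := eqVneq s 1; first by rewrite subrr mul0r add0r mul1r.
apply: ltr_pwDl; last by rewrite mulr_ge0 // ltW.
by rewrite mulr_gt0 // subr_gt0 lt_neqAle s1' s1.
Qed.

(** Gronwall's inequality with K = 0 on the segment from t to tau. *)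
Lemma cder0_const (f : C -> C) t tau : (forall w, upper w -> cder f w 0) ->
  upper t -> upper tau -> f tau = f t.
Proof.
move=> hf ht htau.
have := @gronwall 1 (fun _ w => f w - f t) (fun _ _ => 0) t (tau - t) 0.
rewrite !big_ord1 [t + _]addrC subrK subrr nm0 expr0n /= mulr0 => h.
apply/eqP; rewrite -subr_eq0 -nm_eq0 -sqrf_eq0 eq_le sqr_ge0 andbT; apply: h => s s0 s1.
  move=> _; have hs : upper (t + toC s * (tau - t)) by apply: upper_seg; rewrite // addrC subrK.
  by have := cderD (hf _ hs) (cder_cst (- f t) (t + toC s * (tau - t))); rewrite addr0.
by rewrite big_ord1 mulr0 mul0r.
Qed.

Lemma lin_ode_prop (f h p : C -> C) t tau :
  (forall w, upper w -> cder f w (p w * f w)) ->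
  (forall w, upper w -> cder h w (p w * h w)) -> (forall w, upper w -> h w != 0) ->
  upper t -> upper tau -> f tau = f t / h t * h tau.
Proof.
move=> hf hh h0 ht htau.
have := @cder0_const (fun w => f w * (h w)^-1) t tau; rewrite -!/(_ / _).
move=> H; rewrite -H //; first by rewrite divfK // h0.
move=> w hw; have := cderM (hf _ hw) (cderV (h0 _ hw) (hh _ hw)).
by congr cder; have := h0 _ hw; move: (f w) (h w) (p w) => a b c b0; field.
Qed.
End Gronwall.

(** * Modular behaviour of the basic series *)
Section Modularity.
Variable R : realType.
Local Notation C := (CC R).
Implicit Types (z w t d tau : C) (g : 'M[int]_2).
Local Notation e2 := (e2 R).
Local Notation dl := (dl R).
Local Notation xs := (xs R).
Local Notation ys := (ys R).
Local Notation gs := (gs R).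

Lemma jj_der g tau : cder (jj g) tau (g 1 0)%:~R.
Proof.
have := cderD (cderZ (g 1 0)%:~R (cder_id tau)) (cder_cst (g 1 1)%:~R tau).
by rewrite mulr1 addr0.
Qed.

Lemma det_intr g : SL2Z g -> (g 0 0)%:~R * (g 1 1)%:~R - (g 0 1)%:~R * (g 1 0)%:~R = 1 :> C.
Proof. by rewrite /SL2Z /= det2E => /(congr1 (fun m : int => m%:~R : C)); rewrite intrB !intrM. Qed.

Lemma moebius_der g tau : SL2Z g -> upper tau -> cder (@moebius R g) tau ((jj g tau)^-1 ^+ 2).
Proof.
move=> hg ht; have j0 := jj_neq0 hg ht.
have h := cderD (cderZ (g 0 0)%:~R (cder_id tau)) (cder_cst (g 0 1)%:~R tau).
have := cderM h (cderV j0 (jj_der g tau)).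
congr cder; have := det_intr hg; move: j0; rewrite /jj.
move: ((g 0 0)%:~R : C) ((g 0 1)%:~R : C) ((g 1 0)%:~R : C) ((g 1 1)%:~R : C) => p q r s j0 E.
transitivity ((p * s - q * r) * (r * tau + s)^-1 ^+ 2); first by field.
by rewrite E mul1r.
Qed.

Lemma inv_der tau : tau != 0 -> cder (fun w : C => - w^-1) tau (tau^-1 ^+ 2).
Proof.
move=> t0; have := cderN (cderV t0 (cder_id tau)); congr cder.
by field.
Qed.

Lemma upper_i : upper (Complex 0 1 : C). Proof. by rewrite /upper /im /= ltr01. Qed.
Lemma invi : - (Complex 0 1 : C)^-1 = Complex 0 1.
Proof.
have i2 : (Complex 0 1 : C) * Complex 0 1 = -1.
  by apply: ceq; rewrite ?reM ?imM ?reN ?imN ?re1 ?im1 /re /im /=; ring.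
have i0 := upper_neq0 upper_i; apply: (mulfI i0).
by rewrite i2 mulrN mulfV.
Qed.

(** By the law of E2 both sides solve the same linear equation of order one. They are proportional,
    and the factor is 1 at the fixed point i, where i^12 = 1. *)
Lemma dl_S tau : upper tau -> ev dl (- tau^-1) = tau ^+ 12 * ev dl tau.
Proof.
move=> ht; have i0 := upper_neq0 upper_i.
have := @lin_ode_prop R (fun w => ev dl (- w^-1)) (fun w => w ^+ 12 * ev dl w)
  (fun w => twopii R * E2 w + 12%:R / w) (Complex 0 1) tau.
move=> -> //; last exact: upper_i.
- rewrite invi; have -> : (Complex 0 1 : C) ^+ 12 = 1.
    have i2 : (Complex 0 1 : C) ^+ 2 = -1.
      by rewrite expr2; apply: ceq; rewrite ?reM ?imM ?reN ?imN ?re1 ?im1 /re /im /=; ring.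
    by rewrite (exprM _ 2 6) i2; ring.
  by rewrite mul1r divff ?mul1r // ev_dl_neq0 //; exact: upper_i.
- move=> w hw; have w0 := upper_neq0 hw; have := cder_comp (inv_der w0) (dl_der (upperS hw)).
  congr cder; rewrite E2_S //; move: (twopii_neq0 R) (ev dl _) (E2 _) => p0 a b.
  by move: (twopii R) p0 => p p0; field; rewrite w0.
- move=> w hw; have w0 := upper_neq0 hw; have := cderM (cderX 12 (cder_id w)) (dl_der hw).
  by congr cder; move: (ev dl w) (E2 w) (twopii R) => a b p; field.
by move=> w hw; have w0 := upper_neq0 hw; have d0 := ev_dl_neq0 hw; rewrite mulf_neq0 // expf_neq0.
Qed.

Lemma dl_law g : SL2Z g -> forall tau, upper tau -> ev dl (moebius g tau) = jj g tau ^+ 12 * ev dl tau.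
Proof.
move: g; apply: SL2Z_ind => [g h hg hh Pg Ph tau ht|k tau ht|tau ht].
- have hm := upper_moebius hh ht.
  rewrite moebiusM // jjM // exprMn -mulrA; exact: etrans (Pg _ hm) (congr1 _ (Ph _ ht)).
- by rewrite moebius_Tn ev_period jj_Tn expr1n mul1r.
rewrite moebius_Sinv jj_Sinv dl_S //; have -> : (- tau) ^+ 12 = tau ^+ 12 by ring.
by [].
Qed.

(* conjugation by diag(2, 1): it acts on 2 tau as g acts on tau *)
Definition halfmat g : 'M[int]_2 := mk2 (g 0 0) (2 * g 0 1) (g 1%R 0%R %/ 2)%Z (g 1 1).

Lemma halfmat10 g : Gamma02 g -> g 1 0 = (g 1%R 0%R %/ 2)%Z * 2.
Proof. by case=> _ h; rewrite divzK. Qed.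
Lemma SL2Z_half g : Gamma02 g -> SL2Z (halfmat g).
Proof.
move=> hg; have := Gamma02_SL2Z hg; rewrite /SL2Z /= !det2E !mk2E => E.
rewrite -[RHS]E [in RHS](halfmat10 hg); ring.
Qed.
Lemma jj_half g tau : Gamma02 g -> jj (halfmat g) (2%:R * tau) = jj g tau.
Proof.
move=> hg; rewrite /jj !mk2E [in RHS](halfmat10 hg) intrM mulrA.
by congr (_ * _ + _).
Qed.
Lemma moebius_half g tau : Gamma02 g -> moebius (halfmat g) (2%:R * tau) = 2%:R * moebius g tau.
Proof.
move=> hg; rewrite /moebius -/(jj (halfmat g) (2%:R * tau)) jj_half // !mk2E intrM -/(jj g tau).
by rewrite -[2%:~R]/(2%:R : C); ring.
Qed.

Lemma xs_dl tau : upper tau -> ev xs tau = ev dl (2%:R * tau) / ev dl tau.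
Proof. by move=> ht; rewrite ev_dl2 // mulfK // ev_dl_neq0. Qed.

Lemma xs_law g tau : Gamma02 g -> upper tau -> ev xs (moebius g tau) = ev xs tau.
Proof.
move=> hg ht; have hs := Gamma02_SL2Z hg; have hm := upper_moebius hs ht.
rewrite !xs_dl // -moebius_half // (dl_law (SL2Z_half hg) (upper2 ht)) jj_half //.
rewrite (dl_law hs ht) -mulf_div divff ?mul1r //.
by rewrite expf_neq0 // jj_neq0.
Qed.

Lemma gs_law g tau : Gamma02 g -> upper tau -> ev gs (moebius g tau) = jj g tau ^+ 2 * ev gs tau.
Proof.
move=> hg ht; have hs := Gamma02_SL2Z hg; have hm := upper_moebius hs ht.
rewrite !ev_gs // /Gform -moebius_half // (E2law_all (SL2Z_half hg) (upper2 ht)) jj_half //.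
rewrite (E2law_all hs ht) !mk2E [in X in - X](halfmat10 hg) intrM.
rewrite -[(2%:~R : C)]/(2%:R).
by move: (E2 tau) (E2 _) (_ / _) (_%:~R) (jj _ _) => a b c k j; ring.
Qed.

Lemma ys_law g tau : Gamma02 g -> upper tau -> jj g tau ^+ 12 * ev ys (moebius g tau) = ev ys tau.
Proof.
move=> hg ht; have hs := Gamma02_SL2Z hg; have hm := upper_moebius hs ht.
have := xs_law hg ht; rewrite !ev_xs_ys // (dl_law hs ht) mulrA.
by move/(mulIf (ev_dl_neq0 ht)) => <-; rewrite mulrC.
Qed.

Lemma upper_half w : upper w -> upper (w / 2%:R).
Proof.
rewrite /upper => h; have -> : w / 2%:R = toC 2^-1 * w by rewrite toCV toC_nat mulrC.
by rewrite imM re_toC im_toC mul0r addr0 mulr_gt0 // invr_gt0.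
Qed.
Lemma two_invS w : 2%:R * - w^-1 = - (w / 2%:R)^-1 :> C.
Proof. by rewrite invfM invrK mulrN mulrC. Qed.

(** This shows the pole of x at the cusp 0: Delta(w/2) / Delta(w) grows like q^(-1/2). *)
Lemma xs_S w : upper w -> ev xs (- w^-1) = (2%:R ^- 12) * ev dl (w / 2%:R) / ev dl w.
Proof.
move=> hw; have h2 := upper_half hw; have w0 := upper_neq0 hw.
rewrite xs_dl; last exact: upperS.
rewrite two_invS !dl_S //; have := ev_dl_neq0 hw; move: (ev dl w) (ev dl (w / 2%:R)) => a b a0.
by field; rewrite ?w0 ?a0.
Qed.

Lemma ys_S w : upper w -> w ^+ 12 * ev ys (- w^-1) = ev xs (- w^-1) / ev dl w.
Proof.
move=> hw; have w0 := upper_neq0 hw; rewrite (ev_xs_ys (upperS hw)) dl_S //.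
have := ev_dl_neq0 hw; move: (ev dl w) (ev ys _) => a b a0.
by field.
Qed.

Lemma gs_S w : upper w -> ev gs (- w^-1) = w ^+ 2 * (2%:R^-1 * E2 (w / 2%:R) - E2 w).
Proof.
move=> hw; have h2 := upper_half hw.
rewrite ev_gs; last exact: upperS.
rewrite /Gform two_invS !E2_S //; move: (E2 w) (E2 _) (_ / twopii R) => a b c.
by field.
Qed.

Definition sl (k : int) g (f : C -> C) tau : C := jj g tau ^ (- k) * f (moebius g tau).

Lemma sl_der k g f tau l : SL2Z g -> upper tau -> cder f (moebius g tau) l ->
  cder (sl k g f) tau (jj g tau ^ (- k) * (l / jj g tau ^+ 2 - k%:~R * (g 1 0)%:~R / jj g tau * f (moebius g tau))).
Proof.
move=> hg ht hl; have j0 := jj_neq0 hg ht.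
have := cderM (cder_expz (- k) j0 (jj_der g tau)) (cder_comp (moebius_der hg ht) hl).
congr cder; rewrite expfzDr // -[jj g tau ^ (-1)]/((jj g tau)^-1) mulrNz.
move: (jj g tau) j0 (f _) (jj g tau ^ _) (k%:~R : C) ((g 1 0)%:~R : C) => j j0 v p kk cc; by field.
Qed.

Lemma serre_cder k (f : C -> C) tau l : cder f tau l ->
  serreD k f tau = (twopii R)^-1 * l - k%:~R / 12%:R * E2 tau * f tau.
Proof. by move=> h; rewrite /serreD (cder_derive1 h). Qed.

(** The derivative of the factor (c tau + d)^-k cancels against the anomaly of E2. *)
Lemma serre_sl k g f tau l : SL2Z g -> upper tau -> cder f (moebius g tau) l ->
  serreD k (sl k g f) tau = sl (k + 2) g (serreD k f) tau.
Proof.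
move=> hg ht hl; have j0 := jj_neq0 hg ht.
rewrite (serre_cder _ (sl_der k hg ht hl)) /sl (serre_cder _ hl) (E2law_all hg ht).
rewrite opprD expfzDr // -[jj g tau ^ (-2)]/((jj g tau ^+ 2)^-1).
move: (jj g tau) j0 (f _) (jj g tau ^ _) (E2 tau) (twopii R) (twopii_neq0 R) (k%:~R : C) ((g 1 0)%:~R : C) => j j0 v p e t t0 kk cc.
by field; rewrite j0 t0.
Qed.
End Modularity.

(** * Gamma0(2)-invariant functions *)
Section Valence.
Variable R : realType.
Local Notation C := (CC R).
Implicit Types (z w t d tau : C) (g : 'M[int]_2) (a b c : fps C).
Local Notation e2 := (e2 R).
Local Notation us := (us R).
Local Notation hs := (hs R).
Local Notation dl := (dl R).
Local Notation xs := (xs R).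
Local Notation ys := (ys R).
Local Notation gs := (gs R).

Lemma fXnE (K : fieldType) k (a : fps K) n : (fX K ^+ k * a) n = if (n < k)%N then 0 else a (n - k)%N.
Proof.
elim: k n => [|k IH] n; first by rewrite expr0 mul1r subn0.
rewrite exprS -mulrA; case: n => [|n]; first by rewrite fXM0.
by rewrite fXMS IH ltnS subSS.
Qed.

Lemma fX_split (K : fieldType) k (a : fps K) : (forall j, (j < k)%N -> a j = 0) ->
  a = fX K ^+ k * (fun n => a (n + k)%N : K).
Proof.
move=> h; apply/funext => n; rewrite fXnE; case: ltnP => hk; first exact: h.
by rewrite subnK.
Qed.

Lemma conv_fXn k a : conv (fX C ^+ k * a) -> conv a.
Proof.
move=> h x x0 x1; have [B hB] := h x x0 x1.
exists (B / x ^+ k) => n; rewrite ler_pdivlMr ?exprn_gt0 // -mulrA -exprD.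
by have := hB (n + k)%N; rewrite fXnE ltnNge leq_addl addnK.
Qed.

Lemma ev_fXn k a tau : conv a -> upper tau -> ev (fX C ^+ k * a) tau = ee tau ^+ k * ev a tau.
Proof.
move=> ha ht; rewrite evM // ?evX ?ev_fX //; first exact: conv_fX.
exact: convX (@conv_fX R).
Qed.

Lemma fexp_bound p (y0 : R) : conv p -> p 0%N = 0 -> 0 < y0 ->
  exists2 B : R, 0 < B & forall w, y0 <= im w -> nm (ev (fexp p) w) <= B /\ B^-1 <= nm (ev (fexp p) w).
Proof.
move=> hp p0 y00; have [B1 B10 h1] := ev_bound (conv_fexp hp) y00.
have [B2 B20 h2] := ev_bound (conv_fexp (convN hp)) y00.
have B0 : 0 < B1 + B2 + 1 by lra.
exists (B1 + B2 + 1) => // w hw; have hu : upper w by apply: lt_le_trans hw.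
split; first by apply: le_trans (h1 w hw) _; lra.
have := h2 w hw; rewrite ev_fexpN // nmV => h.
have n0 : 0 < nm (ev (fexp p) w) by rewrite nm_gt0 ev_fexp_neq0.
rewrite -[leRHS]invrK lef_pV2 ?posrE ?invr_gt0 //; lra.
Qed.

Lemma nm_ee_half w : nm (ee (w / 2%:R)) = expR (- (pi * im w)).
Proof.
rewrite nm_ee; have -> : w / 2%:R = toC 2^-1 * w by rewrite toCV toC_nat mulrC.
by rewrite imM re_toC im_toC mul0r addr0; congr expR; field.
Qed.

(** At -1/w, x is 2^-12 Delta(w/2) / Delta(w), of size e^(pi Im w). In the third bound w^12 ys(-1/w)
    = x(-1/w) / Delta(w), and 1/Delta(w) is of size e^(2 pi Im w), hence of size x^2. *)
Lemma xs_S_bounds : exists k K : R, [/\ 0 < k, 0 < K & forall w, 1 / 2 <= im w ->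
  [/\ k * expR (pi * im w) <= nm (ev xs (- w^-1)),
      nm (ev xs (- w^-1)) <= K * expR (pi * im w) &
      nm w ^+ 12 * nm (ev ys (- w^-1)) <= K * nm (ev xs (- w^-1)) ^+ 3]].
Proof.
have [|B B0 hB] := fexp_bound (@conv_e2B R) (e2B0 R) (y0 := 1 / 4); first by lra.
pose k : R := 2 ^- 12 * B^-1 ^+ 2; have k0 : 0 < k by rewrite mulr_gt0 // ?invr_gt0 ?exprn_gt0 ?invr_gt0.
pose K : R := 2 ^- 12 * B ^+ 2; have K0 : 0 < K by rewrite mulr_gt0 // ?invr_gt0 ?exprn_gt0.
exists k, (K + B / k ^+ 2); split => //.
  by rewrite addr_gt0 // divr_gt0 // exprn_gt0.
move=> w hw; have hu : upper w by apply: lt_le_trans hw; lra.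
have [u1 u2] : nm (ev us w) <= B /\ B^-1 <= nm (ev us w) by apply: hB; lra.
have [u3 u4] : nm (ev us (w / 2%:R)) <= B /\ B^-1 <= nm (ev us (w / 2%:R)).
  apply: hB; have -> : w / 2%:R = toC 2^-1 * w by rewrite toCV toC_nat mulrC.
  by rewrite imM re_toC im_toC; lra.
have eE : expR (- (2 * pi * im w)) = (expR (pi * im w))^-1 ^+ 2.
  by rewrite -expRN expr2 -expRD; congr expR; ring.
have x1 : nm (ev xs (- w^-1)) = 2 ^- 12 * expR (pi * im w) * nm (ev us (w / 2%:R)) / nm (ev us w).
  rewrite xs_S // !ev_dlE //; last exact: upper_half.
  have := nm_ee w; have := nm_ee_half w; rewrite eE expRN; move: (ee _) (ee _) => p q hp hq.
  have e0 : expR (pi * im w) != 0 by rewrite gt_eqF ?expR_gt0.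
  rewrite !(nmM, nmV, nmX) nm_nat hp hq.
  have := ev_us_neq0 hu; rewrite -nm_eq0 => h.
  by field; rewrite e0 h.
have := expR_gt0 (pi * im w); set t := expR _ in x1 eE * => t0.
have n0 : 0 < nm (ev us w) by rewrite nm_gt0 ev_us_neq0.
have Bi : 0 < B^-1 by rewrite invr_gt0.
have v1 : (nm (ev us w))^-1 <= B by rewrite -[leRHS]invrK lef_pV2 ?posrE.
have v2 : B^-1 <= (nm (ev us w))^-1 by rewrite lef_pV2 ?posrE.
have v0 : 0 < (nm (ev us w))^-1 by rewrite invr_gt0.
have p1 : nm (ev us (w / 2%:R)) * (nm (ev us w))^-1 <= B * B by apply: ler_pM; rewrite ?nm_ge0 // ltW.
have p2 : B^-1 * B^-1 <= nm (ev us (w / 2%:R)) * (nm (ev us w))^-1 by apply: ler_pM; rewrite // ltW.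
have c0 : 0 < 2 ^- 12 * t :> R by rewrite mulr_gt0 // invr_gt0 exprn_gt0.
have x2 : k * t <= nm (ev xs (- w^-1)).
  rewrite x1 -mulrA; have -> : k * t = 2 ^- 12 * t * (B^-1 * B^-1) by rewrite /k expr2; ring.
  by rewrite ler_pM2l.
split => //.
  apply: (@le_trans _ _ (K * t)); last by rewrite ler_pM2r // lerDl divr_ge0 ?ltW // exprn_gt0.
  rewrite x1 -mulrA; have -> : K * t = 2 ^- 12 * t * (B * B) by rewrite /K expr2; ring.
  by rewrite ler_pM2l.
rewrite -nmX -nmM ys_S // nmM nmV ev_dlE // nmM nm_ee eE.
have X0 : 0 < nm (ev xs (- w^-1)) by rewrite nm_gt0 ev_xs_neq0 //; exact: upperS.
move: x2 X0; move: (nm (ev xs _)) => X x2 X0; clear x1.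
have tX : t ^+ 2 <= (X / k) ^+ 2.
  by rewrite lerXn2r ?nnegrE ?divr_ge0 ?(ltW t0) ?(ltW k0) ?(ltW X0) // ler_pdivlMr // mulrC.
rewrite invfM exprVn invrK [X ^+ 3]exprS.
have h3 : t ^+ 2 * (nm (ev us w))^-1 <= (X / k) ^+ 2 * B.
  by apply: ler_pM => //; rewrite ?exprn_ge0 ?invr_ge0 ?ltW.
apply: (@le_trans _ _ (X * ((X / k) ^+ 2 * B))); first by rewrite ler_pM2l.
have -> : X * ((X / k) ^+ 2 * B) = B / k ^+ 2 * (X * X ^+ 2) by rewrite expr_div_n; ring.
by rewrite ler_pM2r ?mulr_gt0 ?exprn_gt0 // lerDr ltW.
Qed.

(** The invariant |a| Im^-6 is bounded on a fundamental domain, hence everywhere. If the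
    coefficients before the k-th vanish, the k-th is at most a constant times e^(2 pi k y) y^6 for
    all y > 0, and y tends to 0. *)
Lemma negative_weight a : conv a ->
  (forall g tau, Gamma02 g -> upper tau -> jj g tau ^+ 12 * ev a (moebius g tau) = ev a tau) ->
  (exists K : R, forall w, 1 / 2 <= im w -> `|re w| <= 1 -> nm w ^+ 12 * nm (ev a (- w^-1)) <= K) ->
  a = 0.
Proof.
move=> ha hmod [K hK]; have [|B B0 hB] := ev_bound ha (y0 := 1 / 2); first by lra.
pose K' := 64 * (B + Num.max K 0).
have K0 : 0 <= Num.max K 0 by rewrite le_max lexx orbT.
have K1 : K <= Num.max K 0 by rewrite le_max lexx.
have K'0 : 0 <= K' by rewrite mulr_ge0 // addr_ge0.
have y6 (y : R) : 1 / 2 <= y -> 1 / 64 <= y ^+ 6.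
  move=> hy; have -> : 1 / 64 = (1 / 2) ^+ 6 :> R by field.
  by rewrite lerXn2r // ?nnegrE; lra.
have bd tau : upper tau -> nm (ev a tau) <= K' * im tau ^+ 6.
  move=> ht; have [g [w [hg hw hr hgw]]] := orbit_Gamma02 ht.
  have hu : upper w by apply: lt_le_trans hw; lra.
  have red z : upper z -> nm (ev a z) <= K' * im z ^+ 6 -> nm (ev a (moebius g z)) <= K' * im (moebius g z) ^+ 6.
    move=> hz; have hs := Gamma02_SL2Z hg; have j0 : 0 < nm (jj g z) by rewrite nm_gt0 jj_neq0.
    rewrite -(hmod _ _ hg hz) im_moebius // nmM nmX expr_div_n -exprM [K' * (_ / _)]mulrA.
    by rewrite ler_pdivlMr ?exprn_gt0 // mulrC.
  have := y6 _ hw; move: (im w ^+ 6) => Y hY.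
  case: hgw => ->; apply: red => //.
  - apply: le_trans (hB w hw) _; move: (hY); have := y6 _ hw; rewrite /K'; nra.
  - exact: upperS.
  have w0 : 0 < nm w by rewrite nm_gt0 upper_neq0.
  rewrite imN im_inv mulNr opprK expr_div_n -exprM [K' * (_ / _)]mulrA ler_pdivlMr ?exprn_gt0 // mulrC.
  apply: le_trans (hK w hw hr) _; have := y6 _ hw; rewrite /K'; nra.
apply/funext => n; rewrite fzeroE; elim/ltn_ind: n => k IH.
pose b : fps C := fun n => a (n + k)%N.
have ab : a = fX C ^+ k * b := fX_split IH.
have hb : conv b by apply: (@conv_fXn k); rewrite -ab.
apply/eqP; rewrite -nm_eq0; have -> : nm (a k) = nm (b 0%N) by rewrite /b add0n.
pose L := K' * expR (2 * pi) ^+ k.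
have L0 : 0 <= L by rewrite mulr_ge0 // exprn_ge0 // expR_ge0.
have key (y : R) : 0 < y -> y <= 1 -> nm (b 0%N) <= L * y.
  move=> y0 y1; apply: (ev_c0 hb y0) => tau ity.
  have ht : upper tau by rewrite /upper ity.
  have := bd _ ht; rewrite {1}ab ev_fXn // nmM nmX nm_ee ity => h.
  have e0 := expR_gt0 (2 * pi * y); rewrite expRN exprVn ler_pdivrMl ?exprn_gt0 // in h.
  apply: le_trans h _; rewrite mulrCA; have -> : L * y = K' * (expR (2 * pi) ^+ k * y) by rewrite /L mulrA.
  apply: ler_wpM2l => //; apply: ler_pM.
  - by rewrite exprn_ge0 // ltW.
  - by rewrite exprn_ge0 // ltW.
  - by rewrite lerXn2r ?nnegrE ?expR_ge0 // ler_expR ler_piMr // mulr_ge0 // pi_ge0.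
  - rewrite exprS -[leRHS]mulr1; apply: ler_wpM2l; first exact: ltW.
    by apply: exprn_ile1 => //; exact: ltW.
apply/eqP/le_anti; rewrite nm_ge0 andbT leNgt; apply/negP => b0.
have L1 : 0 < L + 1 by lra.
have := key (Num.min 1 (nm (b 0%N) / (L + 1) / 2)) _ _.
have d0 : 0 < nm (b 0%N) / (L + 1) / 2 by rewrite !divr_gt0.
rewrite lt_min ltr01 d0 ge_min lexx => /(_ isT isT) h.
have : nm (b 0%N) <= L * (nm (b 0%N) / (L + 1) / 2).
  by apply: le_trans h _; rewrite ler_wpM2l // ge_min lexx orbT.
have : (L + 1) * (nm (b 0%N) / (L + 1)) = nm (b 0%N) by field; lra.
move: d0; move: (nm (b 0%N) / (L + 1)) (nm _) b0 => q m m0 q0 qm; nra.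
Qed.

Lemma fcomp_fin (K : fieldType) (x c : fps K) n : x 0%N = 0 -> (forall i, (n < i)%N -> c i = 0) ->
  fcomp x c = \sum_(i < n.+1) fcst (c i) * x ^+ i.
Proof.
move=> x0 h; apply/funext => m; rewrite fsumE /fcomp.
under [RHS]eq_bigr do rewrite fcstME.
have [mn|nm_] := leqP m n.
  rewrite [RHS](@sum_ord_nat _ (fun i => c i * (x ^+ i) m) m.+1) //.
  rewrite [X in _ + X]big_nat [X in _ + X]big1 ?addr0 // => i /andP[hi _].
  by rewrite fpow_lt // mulr0.
rewrite (@sum_ord_nat _ (fun i => c i * (x ^+ i) m) n.+1 m.+1) 1?ltnW //.
rewrite [X in _ + X]big_nat [X in _ + X]big1 ?addr0 // => i /andP[hi _].
by rewrite h // mul0r.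
Qed.

Lemma conv_sum n (f : 'I_n -> fps C) : (forall i, conv (f i)) -> conv (\sum_i f i).
Proof. by move=> h; elim/big_rec: _ => [|i a _ ha]; [exact: (conv_nat 0)|exact: convD]. Qed.
Lemma ev_sum n (f : 'I_n -> fps C) tau : (forall i, conv (f i)) -> upper tau ->
  ev (\sum_i f i) tau = \sum_i ev (f i) tau.
Proof.
elim: n f => [|n IH] f h ht; first by rewrite !big_ord0 ev0.
have hs : conv (\sum_(i < n) f (widen_ord (leqnSn n) i)) by exact: conv_sum.
by rewrite !big_ord_recr evD ?IH.
Qed.

Definition gamma02_inv a : Prop :=
  forall g tau, Gamma02 g -> upper tau -> ev a (moebius g tau) = ev a tau.
Definition cusp0_bound n a : Prop :=
  exists K : R, forall w, 1 / 2 <= im w -> `|re w| <= 1 ->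
    nm (ev a (- w^-1)) <= K * nm (ev xs (- w^-1)) ^+ n.

(* Subtract from a the polynomial in x matching its first coefficients: the remainder
   is x^(n+1) e.  Then ys e^3 has weight -12 and is bounded at both cusps, so it is 0. *)
Theorem poly_in_hauptmodul a n : conv a -> gamma02_inv a -> cusp0_bound n a ->
  exists c, (forall i, (n < i)%N -> c i = 0) /\ a = fcomp xs c.
Proof.
move=> ha ainv [K hK].
have [c hc] := fcomp_surj (xs_0 R) (xs_1 R) a.
pose cl : fps C := fun i => if (i < n.+1)%N then c i else 0.
pose ch : fps C := fun i => c (i + n.+1)%N.
have cE : c = cl + fX C ^+ n.+1 * ch.
  apply/funext => i; rewrite faddE fXnE /cl /ch; case: ltnP => hi; first by rewrite addr0.
  by rewrite add0r subnK.
have cl0 i : (n < i)%N -> cl i = 0 by move=> h; rewrite /cl ltnS leqNgt h.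
pose e := fcomp xs ch.
have aE : a = fcomp xs cl + xs ^+ n.+1 * e.
  by rewrite -hc {1}cE fcompD fcompM ?fcompX ?fcomp_fX //; exact: xs_0.
have lowE := fcomp_fin (xs_0 R) cl0.
have conv_low : conv (fcomp xs cl).
  by rewrite lowE; apply: conv_sum => i; apply: convZ; exact: convX (@conv_xs R).
have he : conv e.
  have h1 : conv (hs ^+ n.+1 * e).
    apply: (@conv_fXn n.+1); have := convB ha conv_low.
    by rewrite {1}aE addrC addKr /xs exprMn -mulrA.
  have := convM (convX n.+1 (conv_fexp (convN (@conv_gsB R)))) h1.
  have -> : fexp (- (gs - 1)) ^+ n.+1 * (hs ^+ n.+1 * e) = e.
    by rewrite mulrA -exprMn [_ * hs]mulrC (fexpN (@char0C R) (gsB0 R)) expr1n mul1r.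
  by [].
have evl tau : upper tau -> ev (fcomp xs cl) tau = \sum_(i < n.+1) cl i * ev xs tau ^+ i.
  move=> ht; rewrite lowE ev_sum //; last by move=> i; apply: convZ; exact: convX (@conv_xs R).
  by apply: eq_bigr => i _; rewrite evZ ?evX //; [exact: conv_xs|exact: convX (@conv_xs R)].
have eva tau : upper tau -> ev a tau = \sum_(i < n.+1) cl i * ev xs tau ^+ i + ev xs tau ^+ n.+1 * ev e tau.
  move=> ht; have h2 := convX n.+1 (@conv_xs R); have h1 := convM h2 he.
  by rewrite {1}aE evD // evl // evM // evX //; exact: conv_xs.
have einv : gamma02_inv e.
  move=> g tau hg ht; have hs := Gamma02_SL2Z hg; have hm := upper_moebius hs ht.
  have := ainv g tau hg ht; rewrite !eva // !xs_law // => /addrI; apply: mulfI.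
  by rewrite expf_neq0 // ev_xs_neq0.
have [k [K1 [k0 K10 hx]]] := xs_S_bounds.
(* The exponent 3 balances the growth at the cusp 0: there w^12 ys is O(x^3), while e is O(1/x). *)
suff e0 : ys * e ^+ 3 = 0.
  have e3 : e ^+ 3 = 0 by apply: fcancel e0; rewrite /ys fexp_0 oner_neq0.
  exists cl; split => //; rewrite {1}aE; suff -> : e = 0 by rewrite mulr0 addr0.
  apply: ev_inj => // [|tau ht]; first exact: (conv_nat 0).
  have := congr1 (fun s => ev s tau) e3; rewrite evX // ev0 => /eqP.
  by rewrite expf_eq0 => /andP[_ /eqP].
apply: negative_weight; first exact: convM (@conv_ys R) (convX 3 he).
  move=> g tau hg ht; have hs := Gamma02_SL2Z hg; have hm := upper_moebius hs ht.
  have h3 := convX 3 he.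
  by rewrite !(evM (@conv_ys R) h3) // mulrA ys_law // !evX // einv.
pose S := \sum_(i < n.+1) nm (cl i) / k ^+ (n - i).
exists (K1 * (K + S) ^+ 3) => w hw hr; have hu : upper w by apply: lt_le_trans hw; lra.
have hS := upperS hu; have [x1 _ x3] := hx w hw.
rewrite (evM (@conv_ys R) (convX 3 he)) // nmM mulrA evX // nmX.
have := eva _ hS; have := hK w hw hr; have x0 : 0 < nm (ev xs (- w^-1)) by rewrite nm_gt0 ev_xs_neq0.
have kx : k <= nm (ev xs (- w^-1)).
  apply: le_trans x1; rewrite ler_peMr ?(ltW k0) // -expR0 ler_expR mulr_ge0 ?pi_ge0 //; lra.
move: x1 x3 x0 kx; move: (ev xs _) (ev a _) (ev e _) (ev ys _) => x A E Y x1 x3 x0 kx hA EE.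
have h1 : nm x * nm E <= K + S.
  rewrite -(@ler_pM2l _ (nm x ^+ n)) ?exprn_gt0 // mulrA -exprSr -(nmX x n.+1) -(nmM (x ^+ n.+1)).
  have -> : x ^+ n.+1 * E = A - \sum_(i < n.+1) cl i * x ^+ i by rewrite EE addrC addKr.
  apply: le_trans (nmB _ _) _; rewrite mulrDr [_ * K]mulrC; apply: lerD => //.
  apply: le_trans (nm_sum _ _ _) _; rewrite mulr_sumr; apply: ler_sum => i _.
  rewrite nmM nmX mulrCA ler_wpM2l ?nm_ge0 // ler_pdivlMr ?exprn_gt0 //.
  have hi : (i <= n)%N by rewrite -ltnS.
  rewrite -[in leRHS](subnKC hi) exprD ler_pM2l ?exprn_gt0 //.
  by rewrite lerXn2r ?nnegrE ?nm_ge0 // ltW.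
apply: (@le_trans _ _ (K1 * nm x ^+ 3 * nm E ^+ 3)); first by rewrite ler_wpM2r // exprn_ge0 // nm_ge0.
rewrite -mulrA -exprMn ler_pM2l // lerXn2r ?nnegrE ?mulr_ge0 ?nm_ge0 //.
by apply: le_trans h1; rewrite mulr_ge0 // nm_ge0.
Qed.
End Valence.

(** * Initial coefficients of the weight 0 combinations *)

Section Coefficients.
Variable R : realType.
Local Notation C := (CC R).
Implicit Types (z w t d tau : C) (a b c : fps C).
Local Notation e2 := (e2 R).
Local Notation e4 := (e4 R).
Local Notation xs := (xs R).
Local Notation ys := (ys R).
Local Notation gs := (gs R).

(** Five coefficients determine a polynomial in x of degree at most 4. Constants above 1000 are
    spelled in base 100 to avoid large unary numerals. *)
Definition tr5 a (v : C * C * C * C * C) : Prop :=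
  let: (x0, x1, x2, x3, x4) := v in
  [/\ a 0%N = x0, a 1%N = x1, a 2%N = x2, a 3%N = x3 & a 4%N = x4].

Lemma tr5M a b x0 x1 x2 x3 x4 y0 y1 y2 y3 y4 z0 z1 z2 z3 z4 :
  tr5 a (x0, x1, x2, x3, x4) -> tr5 b (y0, y1, y2, y3, y4) ->
  [/\ x0 * y0 = z0, x0 * y1 + x1 * y0 = z1, x0 * y2 + x1 * y1 + x2 * y0 = z2,
      x0 * y3 + x1 * y2 + x2 * y1 + x3 * y0 = z3 &
      x0 * y4 + x1 * y3 + x2 * y2 + x3 * y1 + x4 * y0 = z4] ->
  tr5 (a * b) (z0, z1, z2, z3, z4).
Proof.
move=> [<- <- <- <- <-] [<- <- <- <- <-] [<- <- <- <- <-].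
by split; rewrite fmulEn !big_ord_recr big_ord0 /= add0r.
Qed.

Lemma tr5_eis k y : tr5 (eis k y)
  (1, y * (sigmak k 1)%:R, y * (sigmak k 2)%:R, y * (sigmak k 3)%:R, y * (sigmak k 4)%:R).
Proof. by []. Qed.

Lemma sigma_vals : [/\ sigmak 1 1 = 1, sigmak 1 2 = 3, sigmak 1 3 = 4 & sigmak 1 4 = 7]%N /\
  [/\ sigmak 3 1 = 1, sigmak 3 2 = 9, sigmak 3 3 = 28 & sigmak 3 4 = 73]%N.
Proof. by rewrite /sigmak unlock. Qed.

Lemma tr5_e4 : tr5 e4 (1, 240, (21 * 100 + 60), (67 * 100 + 20), ((1 * 100 + 75) * 100 + 20)).
Proof.
have [_ [s1 s2 s3 s4]] := sigma_vals; have : tr5 e4 _ := tr5_eis 3 240.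
by rewrite s1 s2 s3 s4 => -[h0 h1 h2 h3 h4]; split; rewrite ?h0 ?h1 ?h2 ?h3 ?h4; ring.
Qed.
Lemma tr5_e2 : tr5 e2 (1, - 24, - 72, - 96, - 168).
Proof.
have [[s1 s2 s3 s4] _] := sigma_vals; have : tr5 e2 _ := tr5_eis 1 (- 24%:R).
by rewrite s1 s2 s3 s4 => -[h0 h1 h2 h3 h4]; split; rewrite ?h0 ?h1 ?h2 ?h3 ?h4; ring.
Qed.
Lemma tr5_gs : tr5 gs (1, 24, 24, 96, 24).
Proof.
have [h0 h1 h2 h3 h4] := tr5_e2.
have [d0 d1 d2 d3 d4] : tr5 (dbl e2) (e2 0%N, 0, e2 1%N, 0, e2 2%N) by [].
by split; rewrite /gs faddE foppE fnatME ?(d0, d1, d2, d3, d4) ?h0 ?h1 ?h2 ?h3 ?h4; ring.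
Qed.
Lemma tr5_ys : tr5 ys (1, 48, (12 * 100), ((2 * 100 + 8) * 100), ((28 * 100 + 7) * 100 + 52)).
Proof.
have [h0 h1 h2 h3 h4] := tr5_e2; have [g0 g1 g2 g3 g4] := tr5_gs.
have E0 : ys 0%N = 1 by rewrite /ys fexp_0.
have E1 : ys 1%N = 48.
  by rewrite /ys fexp_S !big_ord_recr big_ord0 /= -/ys !subnn E0 !fsubE h1 g1; field.
have E2 : ys 2%N = (12 * 100).
  by rewrite /ys fexp_S !big_ord_recr big_ord0 /= -/ys ?subnn ?subn0 ?E0 ?E1 !fsubE ?h1 ?g1 ?h2 ?g2; field.
have E3 : ys 3%N = ((2 * 100 + 8) * 100).
  by rewrite /ys fexp_S !big_ord_recr big_ord0 /= -/ys ?subnn ?subn0 -?[(2 - 1)%N]/1%N ?E0 ?E1 ?E2 !fsubE ?h1 ?g1 ?h2 ?g2 ?h3 ?g3; field.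
by split=> //; rewrite /ys fexp_S !big_ord_recr big_ord0 /= -/ys ?subnn ?subn0 -?[(3 - 1)%N]/2%N -?[(3 - 2)%N]/1%N ?E0 ?E1 ?E2 ?E3 !fsubE ?h1 ?g1 ?h2 ?g2 ?h3 ?g3 ?h4 ?g4; field.
Qed.
Lemma tr5_xs : tr5 xs (0, 1, 24, 300, (26 * 100 + 24)).
Proof.
have [g0 g1 g2 g3 g4] := tr5_gs; pose h := hs R.
have hE n : h n.+1 = n.+1%:R^-1 * \sum_(k < n.+1) gs k.+1 * h (n - k)%N.
  rewrite {1}/h /hs fexp_S; congr (_ * _); apply: eq_bigr => k _.
  by rewrite fsubE foneE subr0.
have E0 : h 0%N = 1 by rewrite /h /hs fexp_0.
have E1 : h 1%N = 24.
  by rewrite hE !big_ord_recr big_ord0 /= !subnn E0 g1; field.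
have E2 : h 2%N = 300.
  by rewrite hE !big_ord_recr big_ord0 /= ?subnn ?subn0 ?E0 ?E1 ?g1 ?g2; field.
have E3 : h 3%N = (26 * 100 + 24).
  by rewrite hE !big_ord_recr big_ord0 /= ?subnn ?subn0 -?[(2 - 1)%N]/1%N ?E0 ?E1 ?E2 ?g1 ?g2 ?g3; field.
by split; rewrite /xs ?fXM0 ?fXMS.
Qed.
Lemma tr5_aff (k : nat) : tr5 (1 + k%:R * xs) (1, k%:R, k%:R * 24, k%:R * 300, k%:R * (26 * 100 + 24)).
Proof.
have [x0 x1 x2 x3 x4] := tr5_xs.
by split; rewrite faddE foneE fnatME ?x0 ?x1 ?x2 ?x3 ?x4 /= ?mulr0 ?mulr1 ?addr0 ?add0r.
Qed.

(** [g6y] and [e4g4y] are G^6 and E4 G^4 brought to weight 0 by x / Delta, of weight -12; the bounds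
    at the cusp 0 will allow degree 3 and 4 in x. *)
Definition g6y : fps C := gs * gs * (gs * gs) * (gs * gs) * ys.
Definition e4g4y : fps C := e4 * (gs * gs * (gs * gs) * ys).
(** G vanishes where x = -1/64, and E4 where x = -1/256. *)
Definition u64 : fps C := 1 + 64%:R * xs.
Definition u256 : fps C := 1 + 256%:R * xs.

Lemma tr5_g6y : tr5 g6y (1, 192, ((1 * 100 + 68) * 100 + 96), ((90 * 100 + 95) * 100 + 68), (((33 * 100 + 82) * 100 + 88) * 100 + 64)).
Proof.
have g2 : tr5 (gs * gs) (1, 48, 624, (13 * 100 + 44), (52 * 100 + 32)).
  by apply: (tr5M tr5_gs tr5_gs); split; ring.
have g4 : tr5 (gs * gs * (gs * gs)) (1, 96, (35 * 100 + 52), ((6 * 100 + 25) * 100 + 92), ((52 * 100 + 88) * 100 + 64)).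
  by apply: (tr5M g2 g2); split; ring.
have g6 : tr5 (gs * gs * (gs * gs) * (gs * gs)) (1, 144, (87 * 100 + 84), ((29 * 100 + 43) * 100 + 36), (((5 * 100 + 88) * 100 + 39) * 100 + 84)).
  by apply: (tr5M g4 g2); split; ring.
by apply: (tr5M g6 tr5_ys); split; ring.
Qed.
Lemma tr5_e4g4y : tr5 e4g4y (1, 384, ((4 * 100 + 60) * 100 + 80), (((2 * 100 + 93) * 100 + 32) * 100 + 48), ((((1 * 100 + 19) * 100 + 85) * 100 + 71) * 100 + 52)).
Proof.
have g2 : tr5 (gs * gs) (1, 48, 624, (13 * 100 + 44), (52 * 100 + 32)).
  by apply: (tr5M tr5_gs tr5_gs); split; ring.
have g4 : tr5 (gs * gs * (gs * gs)) (1, 96, (35 * 100 + 52), ((6 * 100 + 25) * 100 + 92), ((52 * 100 + 88) * 100 + 64)).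
  by apply: (tr5M g2 g2); split; ring.
have gy : tr5 (gs * gs * (gs * gs) * ys) (1, 144, (93 * 100 + 60), ((36 * 100 + 90) * 100 + 88), (((10 * 100 + 7) * 100 + 32) * 100 + 32)).
  by apply: (tr5M g4 tr5_ys); split; ring.
by apply: (tr5M tr5_e4 gy); split; ring.
Qed.
Lemma tr5_u3 : tr5 (u64 ^+ 3) (1, 192, ((1 * 100 + 68) * 100 + 96), ((90 * 100 + 95) * 100 + 68), (((33 * 100 + 82) * 100 + 88) * 100 + 64)).
Proof.
have u2 : tr5 (u64 * u64) (1, 128, (71 * 100 + 68), ((23 * 100 + 50) * 100 + 8), (((5 * 100 + 15) * 100 + 27) * 100 + 68)).
  by apply: (tr5M (tr5_aff 64) (tr5_aff 64)); split; ring.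
have -> : u64 ^+ 3 = u64 * u64 * u64 by ring.
by apply: (tr5M u2 (tr5_aff 64)); split; ring.
Qed.
Lemma tr5_u2w : tr5 (u64 ^+ 2 * u256) (1, 384, ((4 * 100 + 60) * 100 + 80), (((2 * 100 + 93) * 100 + 32) * 100 + 48), ((((1 * 100 + 19) * 100 + 85) * 100 + 71) * 100 + 52)).
Proof.
have u2 : tr5 (u64 ^+ 2) (1, 128, (71 * 100 + 68), ((23 * 100 + 50) * 100 + 8), (((5 * 100 + 15) * 100 + 27) * 100 + 68)).
  by apply: (tr5M (tr5_aff 64) (tr5_aff 64)); split; ring.
by apply: (tr5M u2 (tr5_aff 256)); split; ring.
Qed.

Lemma fcomp_agree c (b : fps C) n : (forall i, (n < i)%N -> c i = 0) -> (forall i, (n < i)%N -> b i = 0) ->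
  (forall i, (i <= n)%N -> fcomp xs c i = fcomp xs b i) -> fcomp xs c = fcomp xs b.
Proof.
move=> hc hd h; suff -> : c = b by [].
apply/funext => i; elim/ltn_ind: i => i IH.
have [/h|/[dup]/hc -> /hd ->//] := leqP i n.
rewrite /fcomp !big_ord_recr /= fpow_diag ?mulr1; [|exact: xs_0|exact: xs_1].
under eq_bigr => k _ do rewrite IH //.
by move/addrI.
Qed.
End Coefficients.

(** * G and E4 in terms of the Hauptmodul *)

Section Identities.
Variable R : realType.
Local Notation C := (CC R).
Implicit Types (z w t tau : C) (a b c d : fps C).
Local Notation e2 := (e2 R).
Local Notation e4 := (e4 R).
Local Notation xs := (xs R).
Local Notation ys := (ys R).
Local Notation gs := (gs R).

Definition deg_le n c : Prop := forall i, (n < i)%N -> c i = 0.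
Lemma deg_leM m n a b : deg_le m a -> deg_le n b -> deg_le (m + n) (a * b).
Proof.
move=> ha hb i hi; rewrite fmulEn big1 // => k _.
have [h|h] := ltnP m k; first by rewrite ha // mul0r.
by rewrite hb ?mulr0 // ltn_subRL (leq_ltn_trans _ hi) // leq_add2r.
Qed.
Lemma deg_leZ n z a : deg_le n a -> deg_le n (fcst z * a).
Proof. by move=> ha i hi; rewrite fcstME ha ?mulr0. Qed.
Lemma deg_le_aff (k : nat) : deg_le 1 (1 + k%:R * fX C).
Proof. by case=> [|[|i]] // _; rewrite faddE fnatME foneE /= mulr0 addr0. Qed.
Lemma fcomp_aff (k : nat) : fcomp xs (1 + k%:R * fX C) = 1 + k%:R * xs.
Proof.
have x0 := xs_0 R; have x1 := xs_1 R.
by rewrite fcompD // fcomp1 // fcompM // fcomp_fX // -fcst_nat fcomp_cst.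
Qed.

Definition p64 : fps C := 1 + 64%:R * fX C.
Definition p256 : fps C := 1 + 256%:R * fX C.

Lemma g6y_identity : gamma02_inv (g6y R) -> cusp0_bound 3 (g6y R) -> conv (g6y R) ->
  g6y R = u64 R ^+ 3.
Proof.
move=> h1 h2 h3; have [c [hc E]] := poly_in_hauptmodul h3 h1 h2.
have Eu : u64 R ^+ 3 = fcomp xs (p64 ^+ 3).
  by rewrite fcompX ?fcomp_aff //; exact: xs_0.
rewrite Eu E; apply: (fcomp_agree (n := 3)) => //.
  have d := deg_le_aff 64; have -> : p64 ^+ 3 = p64 * p64 * p64 by ring.
  exact: (deg_leM (deg_leM d d) d).
move=> i; rewrite -Eu -E; have [a0 a1 a2 a3 _] := tr5_g6y R; have [b0 b1 b2 b3 _] := tr5_u3 R.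
by case: i => [|[|[|[|i]]]] //; rewrite ?a0 ?a1 ?a2 ?a3.
Qed.

(** The factor z will be the coefficient c of the differential equation: the modularity of E4 is
    obtained only for this multiple, which may be zero. *)
Lemma e4g4y_identity z : gamma02_inv (fcst z * e4g4y R) -> cusp0_bound 4 (fcst z * e4g4y R) ->
  conv (fcst z * e4g4y R) -> fcst z * e4g4y R = fcst z * (u64 R ^+ 2 * u256 R).
Proof.
move=> h1 h2 h3; have [c [hc E]] := poly_in_hauptmodul h3 h1 h2.
have x0 := xs_0 R.
have Eu : fcst z * (u64 R ^+ 2 * u256 R) = fcomp xs (fcst z * (p64 ^+ 2 * p256)).
  by rewrite fcompZ // fcompM // fcompX // !fcomp_aff.
rewrite Eu E; apply: (fcomp_agree (n := 4)) => //.
  have d := deg_le_aff 64; have d' := deg_le_aff 256; apply: deg_leZ => i hi.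
  by apply: (deg_leM (deg_leM d d) d'); exact: ltnW.
move=> i; rewrite -Eu -E; have [a0 a1 a2 a3 a4] := tr5_e4g4y R; have [b0 b1 b2 b3 b4] := tr5_u2w R.
rewrite !fcstME; case: i => [|[|[|[|[|i]]]]] // _; congr (_ * _).
- by rewrite a0 b0.
- by rewrite a1 b1.
- by rewrite a2 b2.
- by rewrite a3 b3.
by rewrite a4 b4.
Qed.

Lemma eis_le k (y : C) : exists2 m : R, 0 <= m & forall n, nm (eis k y n) <= 1 + m * n%:R ^+ k.+1.
Proof.
exists (nm y); first exact: nm_ge0.
case=> [|n]; first by rewrite /= nm1 lerDl mulr_ge0 ?nm_ge0 // exprn_ge0.
rewrite /= nmM nm_nat -natrX; apply: (@le_trans _ _ (nm y * (n.+1 ^ k.+1)%:R)).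
  by rewrite ler_wpM2l ?nm_ge0 // ler_nat sigmak_le.
by rewrite lerDr.
Qed.

(** No inversion formula for E4 is used; its coefficients are O(n^4). Half of the decay e^(-2sn), s
    = pi Im tau, pays for n^4 and the other half sums geometrically, which leaves a polynomial in
    1/s = O(Im w), well below e^(pi Im w). *)
Lemma e4_cusp0 : exists K : R, forall w, 1 / 2 <= im w -> `|re w| <= 1 ->
  nm (ev e4 (- w^-1)) <= K * expR (pi * im w).
Proof.
have [m m0 e4_le] := eis_le 3 240%:R.
pose q : R := 25 ^+ 4; have qE : 25 ^+ 4 = q by []; have q0 : 0 <= q by rewrite -qE exprn_ge0.
clearbody q; exists ((1 + m * q) * 26) => w hw hr; have hu : upper w by apply: lt_le_trans hw; lra.
have hS := upperS hu; have := evP (@conv_e4 R) hS; set tau := - w^-1 in hS *.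
have p2 := pi_ge2 R; set y := im w in hw *; have y0 : 0 < y by lra.
have y'0 : 0 < im tau := hS; pose s : R := pi * im tau; have s0 : 0 < s by rewrite mulr_gt0 //; lra.
have w2 : nm w ^+ 2 <= 5 * y ^+ 2.
  have : re w ^+ 2 <= 1 by rewrite -real_normK ?num_real // exprn_ile1.
  rewrite nm2 -/y; nra.
have n20 : 0 < nm w ^+ 2 by rewrite exprn_gt0 // nm_gt0 upper_neq0.
have ity : im tau * nm w ^+ 2 = y.
  by rewrite /tau imN im_inv !mulNr opprK divfK // gt_eqF.
(* 4/s is the constant in n^4 e^(-sn) <= D^4, obtained from y <= e^y at y = sn/4. *)
pose D := 4 / s; have D0 : 0 < D by rewrite divr_gt0.
have Ds : D * s = 4 by rewrite divfK // gt_eqF.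
clearbody D; have sE : s = pi * im tau by []; clearbody s.
have Dy : D <= 10 * y.
  rewrite -(@ler_pM2r _ s) // Ds sE; have : 1 <= 5 * y * im tau.
    rewrite -(@ler_pM2r _ y) // mul1r -{1}ity; nra.
  nra.
(* A fifth root of the target: the bound (1 + m D^4) (1 + D) has degree 5 in D, and D is O(t5). *)
pose t5 := expR (pi * y / 5).
have t5E : t5 ^+ 5 = expR (pi * y) by rewrite -expRM_natl; congr expR; field.
have yt : y <= 5 / 2 * t5.
  have := expR_ge1Dx (pi * y / 5); rewrite -/t5; nra.
have t51 : 1 <= t5 by rewrite -expR0 ler_expR divr_ge0 // mulr_ge0 //; lra.
have Dt : D <= 25 * t5 by nra.
pose rho := expR (- s); have r0 : 0 < rho := expR_gt0 _.
have r1 : rho < 1 by rewrite -expR0 ltr_expR; lra.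
have geo : (1 - rho)^-1 <= 1 + D.
  rewrite -[leRHS]invrK lef_pV2 ?posrE ?invr_gt0; [|lra|lra].
  have h := expR_ge1Dx s; have h2 : rho * expR s = 1 by rewrite -expRD addNr expR0.
  rewrite -div1r ler_pdivrMr; last by lra.
  have : rho * (1 + s) <= rho * expR s by rewrite ler_pM2l.
  rewrite h2.
  nra.
have pw n : n%:R ^+ 4 * rho ^+ n <= D ^+ 4.
  have h : n%:R <= D * expR (s * n%:R / 4).
    have := expR_ge1Dx (s * n%:R / 4) => h.
    apply: (@le_trans _ _ (D * (s * n%:R / 4))); last by rewrite ler_pM2l //; lra.
    by rewrite !mulrA Ds mulrAC divff ?mul1r // pnatr_eq0.
  have h4 : n%:R ^+ 4 <= D ^+ 4 * expR (s * n%:R).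
    have -> : expR (s * n%:R) = expR (s * n%:R / 4) ^+ 4 by rewrite -expRM_natl; congr expR; field.
    by rewrite -exprMn lerXn2r ?nnegrE // mulr_ge0 ?expR_ge0 // ltW.
  rewrite -expRM_natl mulrN expRN -ler_pdivlMr ?invr_gt0 ?expR_gt0 // invrK.
  by rewrite [n%:R * s]mulrC.
move=> hs; apply: le_trans (nm_hasum (B := (1 + m * D ^+ 4) * (1 + D)) hs _) _; last first.
  rewrite -t5E; have h4 : D ^+ 4 <= q * t5 ^+ 4.
    rewrite -qE -exprMn lerXn2r ?nnegrE //; first exact: ltW.
    by rewrite mulr_ge0 //; lra.
  have t4 : 1 <= t5 ^+ 4 by rewrite exprn_ege1.
  have -> : (1 + m * q) * 26 * t5 ^+ 5 = ((1 + m * q) * t5 ^+ 4) * (26 * t5) by ring.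
  apply: ler_pM.
  - by rewrite addr_ge0 // mulr_ge0 // exprn_ge0 // ltW.
  - lra.
  - have -> : (1 + m * q) * t5 ^+ 4 = t5 ^+ 4 + m * (q * t5 ^+ 4) by ring.
    by apply: lerD => //; rewrite ler_wpM2l.
  - lra.
move=> N; apply: (@le_trans _ _ (\sum_(i < N) (1 + m * D ^+ 4) * rho ^+ i)).
  apply: ler_sum => i _; rewrite nmM nmX nm_ee.
  have -> : expR (- (2 * pi * im tau)) = rho * rho by rewrite -expRD; congr expR; rewrite sE; ring.
  rewrite exprMn mulrA ler_wpM2r ?exprn_ge0 ?(ltW r0) //.
  apply: (@le_trans _ _ ((1 + m * i%:R ^+ 4) * rho ^+ i)).
    by rewrite ler_wpM2r ?exprn_ge0 ?(ltW r0) //; exact: e4_le.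
  rewrite mulrDl mul1r -mulrA; apply: lerD; last by rewrite ler_wpM2l.
  by rewrite exprn_ile1 // ltW.
rewrite -mulr_sumr ler_wpM2l //; first by rewrite addr_ge0 // mulr_ge0 // exprn_ge0 // ltW.
apply: le_trans geo; rewrite -[leRHS]mul1r ler_pdivlMr; last by lra.
have := subrX1 rho N; have : 0 <= rho ^+ N by rewrite exprn_ge0 // ltW.
rewrite -/(rho ^+ N); move: (rho ^+ N) (\sum_(i < N) _) => a b a0 E; nra.
Qed.
End Identities.

(** * The hypergeometric recurrence *)
Section FormalODE.
Variable R : realType.
Local Notation C := (CC R).
Implicit Types (z w t tau : C) (a b c d p y : fps C).
Local Notation e2 := (e2 R).
Local Notation e4 := (e4 R).
Local Notation xs := (xs R).
Local Notation ys := (ys R).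
Local Notation gs := (gs R).

(* the Serre derivative of q^nu a, divided by q^nu *)
Definition Dk (k : int) (nu : C) a : fps C :=
  theta a + fcst nu * a - fcst (k%:~R / 12%:R) * (e2 * a).

Definition formal_ode (k : int) (nu A B c0 : C) a : Prop :=
  Dk (k + 2) nu (Dk k nu a) + fcst A * (gs * Dk k nu a)
    + (fcst B * gs ^+ 2 + fcst c0 * e4) * a = 0.

(* phi k = (Delta/q)^(k/12) and psi l = (x/q)^l; the suffix V marks inverses *)
Definition phi (k : int) : fps C := fexp (fcst (k%:~R / 12%:R) * (e2 - 1)).
Definition phiV (k : int) : fps C := fexp (- (fcst (k%:~R / 12%:R) * (e2 - 1))).
Definition psi (l : C) : fps C := fexp (fcst l * (gs - 1)).
Definition psiV (l : C) : fps C := fexp (- (fcst l * (gs - 1))).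
(** The derivation theta on q^l b, divided by q^l. *)
Definition Tl (l : C) b : fps C := theta b + fcst l * b.

Lemma fcstD z w : fcst (z + w) = fcst z + fcst w. Proof. exact: rmorphD. Qed.
Lemma phi00 k : (fcst (k%:~R / 12%:R) * (e2 - 1)) 0%N = 0 :> C.
Proof. by rewrite fcstME e2B0 mulr0. Qed.
Lemma psi00 l : (fcst l * (gs - 1)) 0%N = 0 :> C.
Proof. by rewrite fcstME gsB0 mulr0. Qed.
Lemma conv_phi0 k : conv (fcst (k%:~R / 12%:R) * (e2 - 1)). Proof. by apply: convZ; exact: conv_e2B. Qed.
Lemma conv_phi k : conv (phi k). Proof. exact: conv_fexp (conv_phi0 k). Qed.
Lemma conv_phiV k : conv (phiV k). Proof. exact: (conv_fexp (convN (conv_phi0 k))). Qed.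
Lemma phiK k : phi k * phiV k = 1. Proof. exact: (fexpN (@char0C R) (phi00 k)). Qed.
Lemma psiK l : psi l * psiV l = 1. Proof. exact: (fexpN (@char0C R) (psi00 l)). Qed.
Lemma theta_phi k : theta (phi k) = fcst (k%:~R / 12%:R) * (e2 - 1) * phi k.
Proof. exact: (theta_fexp (@char0C R) (phi00 k)). Qed.
Lemma theta_psi l : theta (psi l) = fcst l * (gs - 1) * psi l.
Proof. exact: (theta_fexp (@char0C R) (psi00 l)). Qed.
Lemma phi_0 k : phi k 0%N = 1. Proof. exact: fexp_0. Qed.
Lemma psi_0 l : psi l 0%N = 1. Proof. exact: fexp_0. Qed.

(** Factoring out Delta^(k/12), which the Serre derivative of weight k kills, removes E2 from the
    first derivative. *)
Lemma Dk_phi k l b : Dk k (k%:~R / 12%:R + l) (phi k * b) = phi k * Tl l b.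
Proof.
rewrite /Dk /Tl thetaM theta_phi fcstD.
by move: (fcst _) (fcst l) (phi k) (theta b) e2 => s u f t e; ring.
Qed.
Lemma Dk2_phi k l b : Dk (k + 2) (k%:~R / 12%:R + l) (phi k * b) =
  phi k * (Tl l b - fcst (6%:R^-1) * (e2 * b)).
Proof.
have -> : Dk (k + 2) (k%:~R / 12%:R + l) (phi k * b) =
    Dk k (k%:~R / 12%:R + l) (phi k * b) - fcst (6%:R^-1) * (e2 * (phi k * b)).
  rewrite /Dk; have -> : (k + 2)%:~R / 12%:R = k%:~R / 12%:R + 6%:R^-1 :> C.
    by rewrite intrD -[2%:~R]/(2%:R : C); field.
  by rewrite fcstD; ring.
by rewrite Dk_phi; ring.
Qed.

Section One.
Variables (k : int) (l A B c0 : C) (a : fps C).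
Hypothesis ode : formal_ode k (k%:~R / 12%:R + l) A B c0 a.
Let b := phiV k * a.
Let ab : a = phi k * b. Proof. by rewrite /b mulrA phiK mul1r. Qed.

(** The only E2 left, with factor 1/6 = 2/12, comes from the weight k + 2 of the outer
    derivative. *)
Lemma reduced_ode : Tl l (Tl l b) - fcst (6%:R^-1) * (e2 * Tl l b) + fcst A * (gs * Tl l b)
  + (fcst B * gs ^+ 2 + fcst c0 * e4) * b = 0.
Proof.
move: ode; rewrite /formal_ode ab Dk_phi Dk2_phi => h.
apply: (@fcancel _ (phi k)); first by rewrite phi_0 oner_neq0.
by rewrite -h; ring.
Qed.

Hypothesis id1 : g6y R = u64 R ^+ 3.
Hypothesis id2 : fcst c0 * e4g4y R = fcst c0 * (u64 R ^+ 2 * u256 R).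

Lemma u64_0 : u64 R 0%N = 1.
Proof. by rewrite /u64 faddE foneE fnatME xs_0 mulr0 addr0. Qed.

(** The logarithmic derivative of G^6 ys = (1 + 64 x)^3, which gives theta G. *)
Lemma dlog_gs : u64 R * (6%:R * theta gs + gs * (gs - e2)) = 192%:R * (gs ^+ 2 * xs).
Proof.
apply: (@fcancel_eq _ (u64 R ^+ 3)); first by rewrite fexp0 u64_0 expr1n oner_neq0.
have := congr1 (@theta C) id1; rewrite thetaX => h.
have tu : theta (u64 R) = 64%:R * (gs * xs).
  by rewrite /u64 thetaD theta1 add0r theta_nat theta_xs.
have tg : gs * theta (g6y R) = (6%:R * theta gs + gs * (gs - e2)) * g6y R.
  by rewrite /g6y !thetaM theta_ys; ring.
have : gs * (3%:R * u64 R ^+ 2 * theta (u64 R)) = (6%:R * theta gs + gs * (gs - e2)) * u64 R ^+ 3.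
  by rewrite -[u64 R ^+ 3]id1 -tg h.
rewrite tu; move: (u64 R) (6%:R * theta gs + _) => u v E.
have -> : u ^+ 3 * (u * v) = u * (v * u ^+ 3) by ring.
by rewrite -E; ring.
Qed.

(** The quotient of the two identities: G^4 ys cancels. *)
Lemma e4_gs : fcst c0 * (u64 R * e4) = fcst c0 * (u256 R * gs ^+ 2).
Proof.
apply: (@fcancel_eq _ (u64 R ^+ 2)); first by rewrite fexp0 u64_0 expr1n oner_neq0.
have -> : u64 R ^+ 2 * (fcst c0 * (u64 R * e4)) = fcst c0 * e4 * u64 R ^+ 3 by ring.
rewrite -id1; have -> : fcst c0 * e4 * g6y R = gs ^+ 2 * (fcst c0 * e4g4y R) by rewrite /g6y /e4g4y; ring.
by rewrite id2; ring.
Qed.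

Variable gam : fps C.
Hypothesis gamE : phiV k * a * psiV l = fcomp xs gam.

Lemma aE : a = phi k * psi l * fcomp xs gam.
Proof.
rewrite -gamE; have -> : phi k * psi l * (phiV k * a * psiV l) = (phi k * phiV k) * (psi l * psiV l) * a by ring.
by rewrite phiK psiK !mul1r.
Qed.
Let del := theta gam + fcst l * gam.
Let del2 := theta del + fcst l * del.
Let x0 := xs_0 R. Let x1 := xs_1 R.
Let F c := fcomp xs c.

Lemma bE : b = psi l * F gam.
Proof.
have : b * psiV l * psi l = b by rewrite -mulrA [psiV _ * _]mulrC psiK mulr1.
by rewrite /b gamE mulrC => ->.
Qed.
Lemma theta_F c : theta (F c) = gs * F (theta c).
Proof. exact: (theta_fcomp x0 _ (theta_xs R)). Qed.
Lemma Tb : Tl l b = psi l * (gs * F del).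
Proof.
rewrite bE /Tl thetaM theta_psi theta_F /del /F fcompD // fcompZ //.
by move: (psi l) (fcst l) gs (fcomp _ _) (fcomp _ _) => p m g s t; ring.
Qed.
Lemma TTb : Tl l (Tl l b) = psi l * (theta gs * F del + gs ^+ 2 * F del2).
Proof.
rewrite Tb /Tl !thetaM theta_psi theta_F /del2 /F fcompD // fcompZ //.
by move: (psi l) (fcst l) gs (theta _) (fcomp _ _) (fcomp _ _) => p m g s t v; ring.
Qed.

(** As theta x = G x, each theta on a series in x produces a factor G, and G^2 divides out at the
    end. Multiplied by 6 (1 + 64 x), the terms in theta G and E4 become polynomials in x times G^2,
    and the two terms in E2 cancel. *)
Lemma hypergeom_eq : (192%:R * fX C - (p64 R)) * del
   + 6%:R * p64 R * (del2 + fcst A * del + fcst B * gam) + 6%:R * fcst c0 * (p256 R * gam) = 0.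
Proof.
apply: (fcomp_inj x0 x1); rewrite -/(F _).
have FM c d : F (c * d) = F c * F d by exact: fcompM.
have FD c d : F (c + d) = F c + F d by exact: fcompD.
have FZ z c : F (fcst z * c) = fcst z * F c by exact: fcompZ.
have Fn (n : nat) c : F (n%:R * c) = n%:R * F c by rewrite -fcst_nat FZ.
have F64 : F (p64 R) = u64 R by exact: fcomp_aff.
have F256 : F (p256 R) = u256 R by exact: fcomp_aff.
have FX : F (fX C) = xs by exact: fcomp_fX.
have FN c : F (- c) = - F c by exact: fcompN.
have -> : 6%:R * p64 R * (del2 + fcst A * del + fcst B * gam) = 6%:R * (p64 R * (del2 + fcst A * del + fcst B * gam)) by ring.
have -> : 6%:R * fcst c0 * (p256 R * gam) = 6%:R * (fcst c0 * (p256 R * gam)) by ring.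
rewrite FD FD FM FD FN Fn FX F64 Fn FM F64 (FD (del2 + _)) (FD del2) !FZ Fn FZ FM F256.
apply: (@fcancel _ (psi l * gs ^+ 2)).
  by rewrite fmul0 psi_0 mul1r fexp0 gs_0 expr1n oner_neq0.
have := reduced_ode; rewrite TTb Tb bE.
have s6 : 6%:R * fcst (6%:R^-1) = 1 :> fps C.
  by rewrite -(fcst_nat _ 6) -rmorphM divff ?pnatr_eq0 // rmorph1.
have := dlog_gs; have := e4_gs.
move: (F gam) (F del) (F del2) (u64 R) (u256 R) (psi l) gs e2 e4 xs (theta _) (fcst c0) (fcst A) (fcst B) (fcst _) s6.
move=> G0 G1 G2 u w p g f2 f4 x tg c A' B' s s6 h4 hg h.
have : 6%:R * u * (p * (tg * G1 + g ^+ 2 * G2) - s * (f2 * (p * (g * G1))) + A' * (g * (p * (g * G1))) + (B' * g ^+ 2 + c * f4) * (p * G0)) = 0.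
  by rewrite h mulr0.
have -> : 6%:R * u * (p * (tg * G1 + g ^+ 2 * G2) - s * (f2 * (p * (g * G1))) + A' * (g * (p * (g * G1))) + (B' * g ^+ 2 + c * f4) * (p * G0)) =
  p * ((u * (6%:R * tg + g * (g - f2)) - u * g * (g - f2) - (6%:R * s) * u * f2 * g) * G1
     + 6%:R * u * g ^+ 2 * (G2 + A' * G1 + B' * G0) + 6%:R * (c * (u * f4)) * G0) by ring.
rewrite hg h4 s6 => h'; rewrite -h'; ring.
Qed.

(** The indicial equation at x = 0. *)
Lemma hyp_rec0 : (l ^+ 2 + (A - 6%:R^-1) * l + B + c0) * gam 0%N = 0.
Proof.
have := congr1 (fun s : fps C => s 0%N) hypergeom_eq.
rewrite /p64 /p256 /del2 /del /theta.
rewrite !(faddE, fmul0, foppE, fcstME, fnatE, foneE, fzeroE) /= => h.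
have -> : (l ^+ 2 + (A - 6%:R^-1) * l + B + c0) * gam 0%N = 6%:R^-1 * (6%:R * (l ^+ 2 + (A - 6%:R^-1) * l + B + c0) * gam 0%N) by field.
rewrite -(mulr0 6%:R^-1) -h; congr (_ * _).
by rewrite /fX /fcst /=; field.
Qed.

(** The coefficient of x^(n+1). On the right A - 1/6 becomes A + 1/3, from (192 - 64) / (6 * 64),
    and c0 becomes 4 c0, from 256 / 64; so that quadratic in n + l vanishes exactly at the negatives
    of r and of the other root. *)
Lemma hyp_recS n : ((n.+1%:R + l) ^+ 2 + (A - 6%:R^-1) * (n.+1%:R + l) + B + c0) * gam n.+1
  = - 64%:R * ((n%:R + l) ^+ 2 + (A + 3%:R^-1) * (n%:R + l) + B + 4%:R * c0) * gam n.
Proof.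
have := congr1 (fun s : fps C => s n.+1) hypergeom_eq.
have E1 (m : nat) c : (m%:R * fX C * c) n.+1 = m%:R * c n by rewrite -mulrA fnatME fXMS.
have E2 (m : nat) c : ((1 + m%:R * fX C) * c) n.+1 = c n.+1 + m%:R * c n.
  by rewrite mulrDl mul1r faddE E1.
have -> : 6%:R * p64 R * (del2 + fcst A * del + fcst B * gam) = 6%:R * (p64 R * (del2 + fcst A * del + fcst B * gam)) by ring.
have -> : 6%:R * fcst c0 * (p256 R * gam) = 6%:R * (fcst c0 * (p256 R * gam)) by ring.
rewrite mulrBl /p64 /p256 !faddE foppE E1 E2 !fnatME fcstME !E2 fzeroE.
rewrite /del2 /del /theta !(faddE, fcstME) => h.
apply/eqP; rewrite -subr_eq0; apply/eqP; apply: (@mulfI _ 6%:R); first by rewrite pnatr_eq0.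
rewrite mulr0 -h; move: (n.+1%:R : C) (n%:R : C) (gam n.+1) (gam n) => N m g g'.
by field.
Qed.
End One.
End FormalODE.

(** * Vector-valued forms *)
Section Families.
Variable R : realType.
Local Notation C := (CC R).
Implicit Types (z w t tau : C) (b c d p y : fps C) (g : 'M[int]_2).
Local Notation e2 := (e2 R).
Local Notation e4 := (e4 R).
Local Notation xs := (xs R).
Local Notation ys := (ys R).
Local Notation gs := (gs R).
Local Notation phi := (phi R).
Local Notation phiV := (phiV R).

Definition qev (nu : C) b tau : C := qpow nu tau * ev b tau.

Lemma conv_Dk k nu b : conv b -> conv (Dk k nu b).
Proof.
move=> hb; have h := conv_e2 (R := R).
apply: convB; last by apply: convZ; exact: convM.
by apply: convD; [exact: conv_theta|exact: convZ].
Qed.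

Lemma qev_der nu b tau : conv b -> upper tau ->
  cder (qev nu b) tau (twopii R * qev nu (theta b + fcst nu * b) tau).
Proof.
move=> hb ht; have := cderM (qpow_der nu tau) (ev_der hb ht).
congr cder; rewrite /qev evD ?evZ //; [ring|exact: conv_theta|exact: convZ].
Qed.

Lemma qev_Dk k nu b tau : conv b -> upper tau -> qev nu (Dk k nu b) tau =
  qev nu (theta b + fcst nu * b) tau - k%:~R / 12%:R * E2 tau * qev nu b tau.
Proof.
move=> hb ht; have h := conv_e2 (R := R); have h2 := convM h hb.
have h3 : conv (theta b + fcst nu * b) by apply: convD; [exact: conv_theta|exact: convZ].
have h4 : conv (fcst (k%:~R / 12%:R) * (e2 * b)) by exact: convZ.
rewrite /qev /Dk (evB h3 h4) // evZ // evM // ev_e2 //.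
by move: (k%:~R / _) => kk; ring.
Qed.

Section Comb.
Variables (n : nat) (P nu : 'I_n -> C) (a : 'I_n -> fps C) (h : C -> C).
Hypothesis ha : forall i, conv (a i).
Hypothesis hE : forall w, upper w -> h w = \sum_i P i * qev (nu i) (a i) w.

Lemma comb_der tau : upper tau ->
  cder h tau (\sum_i P i * (twopii R * qev (nu i) (theta (a i) + fcst (nu i) * a i) tau)).
Proof.
move=> ht; have H : cder (fun w => \sum_i P i * qev (nu i) (a i) w) tau
    (\sum_i P i * (twopii R * qev (nu i) (theta (a i) + fcst (nu i) * a i) tau)).
  by apply: cder_sum => i; apply: cderZ; exact: qev_der.
apply: (@eq_cder R _ h _ _ (im tau)) H => // d hd; rewrite hE // /upper imD.
by have := le_lt_trans (im_le d) hd; rewrite ltr_norml => /andP[]; lra.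
Qed.

Lemma serre_comb k tau : upper tau ->
  serreD k h tau = \sum_i P i * qev (nu i) (Dk k (nu i) (a i)) tau.
Proof.
move=> ht; rewrite (serre_cder _ (comb_der ht)) hE // !mulr_sumr -sumrB.
apply: eq_bigr => i _; rewrite qev_Dk //.
have := twopii_neq0 R; move: (twopii R) (P i) (qev _ _ _) (qev _ _ _) (k%:~R / _) (E2 _) => t p u v kk e t0.
by field.
Qed.
End Comb.

Lemma serre_qev k nu b tau : conv b -> upper tau ->
  serreD k (qev nu b) tau = qev nu (Dk k nu b) tau.
Proof.
move=> hb ht; rewrite (@serre_comb 1 (fun=> 1) (fun=> nu) (fun=> b)) //.
  by rewrite big_ord1 mul1r.
by move=> w _; rewrite big_ord1 mul1r.
Qed.

Section Law.
Variables (rho : 'M[int]_2 -> 'M[C]_2) (nu : 'I_2 -> C).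

(* the vector of the q^nu_i a_i satisfies the functional equation of weight k for rho *)
Definition fam_law (k : int) (a : 'I_2 -> fps C) : Prop :=
  forall g tau, Gamma02 g -> upper tau -> forall i,
    jj g tau ^ (- k) * qev (nu i) (a i) (moebius g tau)
      = \sum_j rho g i j * qev (nu j) (a j) tau.

Lemma law_D k a : (forall i, conv (a i)) -> fam_law k a ->
  fam_law (k + 2) (fun i => Dk k (nu i) (a i)).
Proof.
move=> ha hl g tau hg ht i; have hs := Gamma02_SL2Z hg; have hm := upper_moebius hs ht.
rewrite -serre_qev // -[LHS]/(sl (k + 2) g (serreD k (qev (nu i) (a i))) tau).
rewrite -(serre_sl k hs ht (qev_der (nu i) (ha i) hm)).
rewrite (@serre_comb 2 (rho g i) nu a) // => w hw; exact: hl.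
Qed.

Lemma law_gs k a : (forall i, conv (a i)) -> fam_law k a -> fam_law (k + 2) (fun i => gs * a i).
Proof.
move=> ha hl g tau hg ht i; have hs := Gamma02_SL2Z hg; have hm := upper_moebius hs ht.
have hgs := conv_gs (R := R); have j0 := jj_neq0 hs ht.
have E w (j : 'I_2) : upper w -> qev (nu j) (gs * a j) w = ev gs w * qev (nu j) (a j) w.
  by move=> hw; rewrite /qev evM // mulrCA.
rewrite E // gs_law // opprD expfzDr // -[jj g tau ^ (-2)]/((jj g tau ^+ 2)^-1).
under eq_bigr => j _ do rewrite E // mulrCA.
rewrite -mulr_sumr -(hl g tau hg ht i).
move: (jj g tau) j0 (jj g tau ^ _) (ev gs tau) (qev _ _ _) => j j0 u v q.
by field.
Qed.

Lemma law_Z k a z : (forall i, conv (a i)) -> fam_law k a -> fam_law k (fun i => fcst z * a i).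
Proof.
move=> ha hl g tau hg ht i; have hs := Gamma02_SL2Z hg; have hm := upper_moebius hs ht.
have E w (j : 'I_2) : upper w -> qev (nu j) (fcst z * a j) w = z * qev (nu j) (a j) w.
  by move=> hw; rewrite /qev evZ // mulrCA.
rewrite E // mulrCA hl // mulr_sumr; apply: eq_bigr => j _; by rewrite E // mulrCA.
Qed.

Lemma law_Dadd k a (b : 'I_2 -> fps C) : (forall i, conv (a i)) -> (forall i, conv (b i)) ->
  fam_law k a -> fam_law k b -> fam_law k (fun i => a i + b i).
Proof.
move=> ha hb hl hl' g tau hg ht i; have hs := Gamma02_SL2Z hg; have hm := upper_moebius hs ht.
have E w (j : 'I_2) : upper w -> qev (nu j) (a j + b j) w = qev (nu j) (a j) w + qev (nu j) (b j) w.
  by move=> hw; rewrite /qev evD // mulrDr.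
rewrite E // mulrDr hl // hl' // -big_split; apply: eq_bigr => j _; by rewrite E // mulrDr.
Qed.
End Law.

Section Two.
Variables (rho : 'M[int]_2 -> 'M[C]_2) (k : int) (l : 'I_2 -> C) (a : 'I_2 -> fps C) (A B c0 : C).
Local Notation nu := (fun i : 'I_2 => k%:~R / 12%:R + l i).
Hypothesis ode : forall i, formal_ode k (nu i) A B c0 (a i).
Hypothesis ha : forall i, conv (a i).
Hypothesis a_0 : forall i, a i 0%N = 1.
Hypothesis l01 : l 0 != l 1.

Definition Dser (i : 'I_2) : fps C := Dk k (nu i) (a i).
(* om is the Wronskian W without its power of q *)
Definition om : fps C := a 0 * Dser 1 - a 1 * Dser 0.
Let p := fcst (6%:R^-1) * e2 - fcst A * gs - fcst (l 0 + l 1).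

Lemma om_fexp : p 0%N = 0 /\ om = fcst (l 1 - l 0) * (phi k ^+ 2 * fexp p).
Proof.
pose b i := phiV k * a i; pose T i := Tl (l i) (b i).
have aE i : a i = phi k * b i by rewrite /b mulrA phiK mul1r.
have DE i : Dser i = phi k * T i by rewrite /Dser aE Dk_phi.
pose w := b 0 * T 1 - b 1 * T 0.
have omE : om = phi k ^+ 2 * w by rewrite /om !DE !aE /w; ring.
have b00 i : b i 0%N = 1 by rewrite /b fmul0 a_0 mulr1 /phiV fexp_0.
have T0 i : T i 0%N = l i by rewrite /T /Tl faddE theta0E fcstME b00 mulr1 add0r.
have w0 : w 0%N = l 1 - l 0 by rewrite /w fsubE !fmul0 !b00 !T0 !mul1r.
have tb i : theta (b i) = T i - fcst (l i) * b i by rewrite /T /Tl addrK.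
have tT i : theta (T i) = fcst (6%:R^-1) * (e2 * T i) - fcst A * (gs * T i)
    - (fcst B * gs ^+ 2 + fcst c0 * e4) * b i - fcst (l i) * T i.
  have := reduced_ode (ode i); rewrite -/(b i) -/(T i) {1}/Tl => /eqP.
  rewrite -!addrA addr_eq0 => /eqP ->; ring.
have tw : theta w = p * w.
  have -> : theta w = theta (b 0) * T 1 + b 0 * theta (T 1) - (theta (b 1) * T 0 + b 1 * theta (T 0)).
    by rewrite /w thetaD thetaN (thetaM (b 0)) (thetaM (b 1)).
  rewrite !tT !tb /p fcstD /w.
  move: (fcst (l 0)) (fcst (l 1)) (b 0) (b 1) (T 0) (T 1) (fcst A) (fcst B) (fcst c0) (fcst _) e2 e4 gs.
  by move=> l0 l1 b0 b1 t0 t1 A' B' c s f2 f4 g; ring.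
have p0 : p 0%N = 0.
  have := congr1 (fun s : fps C => s 0%N) tw; rewrite theta0E fmul0 w0 => /esym/eqP.
  move: (p 0%N) => q; rewrite mulf_eq0 subr_eq0 => /orP[/eqP ->//|h].
  by move: l01; rewrite (eqP h) eqxx.
split => //; rewrite omE; have := fexp_uniq (@char0C R) p0 tw; rewrite w0 => ->; ring.
Qed.

Lemma A_val : A = 6%:R^-1 - l 0 - l 1.
Proof.
have [p0 _] := om_fexp; move: p0.
rewrite /p !fsubE !fcstME e2_0 gs_0 !mulr1 -[fcst (l 0 + l 1) 0%N]/(l 0 + l 1) => /eqP.
by rewrite subr_eq0 => /eqP h; rewrite -addrA -opprD -h; ring.
Qed.

Lemma om_neq0 tau : upper tau -> ev om tau != 0.
Proof.
move=> ht; have [p0 ->] := om_fexp.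
have hp : conv p.
  have h1 := conv_e2 (R := R); have h2 := conv_gs (R := R).
  by apply: convB; [apply: convB; exact: convZ|exact: conv_cst].
have h3 := conv_phi (R := R) k; have h4 := conv_fexp hp.
rewrite evZ ?evM ?evX //; [|exact: convX|by apply: convM => //; exact: convX].
have h5 : ev (phi k) tau != 0 := ev_fexp_neq0 (conv_phi0 k) (phi00 R k) ht.
have h6 := ev_fexp_neq0 hp p0 ht.
by apply: mulf_neq0; [rewrite subr_eq0 eq_sym|rewrite !mulf_neq0].
Qed.

Definition W tau : C := qev (nu 0) (a 0) tau * qev (nu 1) (Dser 1) tau
  - qev (nu 1) (a 1) tau * qev (nu 0) (Dser 0) tau.
Lemma WE tau : upper tau -> W tau = qpow (nu 0) tau * qpow (nu 1) tau * ev om tau.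
Proof.
move=> ht; have hD i := conv_Dk k (nu i) (ha i).
have h1 := convM (ha 0) (hD 1); have h2 := convM (ha 1) (hD 0).
by rewrite /W /qev /om (evB h1 h2) // (evM (ha 0) (hD 1)) // (evM (ha 1) (hD 0)) //; ring.
Qed.
Lemma W_neq0 tau : upper tau -> W tau != 0.
Proof. move=> ht; have h := om_neq0 ht; rewrite WE //; apply: mulf_neq0 => //.
by apply: mulf_neq0; exact: qpow_neq0. Qed.

Lemma fam_neq0 tau : upper tau -> exists i, qev (nu i) (a i) tau != 0.
Proof.
move=> ht; apply: contrapT => h; have z i : qev (nu i) (a i) tau = 0.
  by apply/eqP; apply: contrapT => h'; apply: h; exists i; apply/negP.
by have := W_neq0 ht; rewrite /W !z !mul0r subrr eqxx.
Qed.

Hypothesis law : fam_law rho nu k a.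

(** The modularity of c0 E4 is read off the differential equation: -c0 E4 f = D D f + A G D f + B
    G^2 f obeys the law of weight k + 4, f that of weight k, and some component of f is not zero at
    the given point. *)
Lemma e4_law g tau : Gamma02 g -> upper tau ->
  c0 * ev e4 (moebius g tau) = jj g tau ^+ 4 * (c0 * ev e4 tau).
Proof.
move=> hg ht; have hs := Gamma02_SL2Z hg; have hm := upper_moebius hs ht.
have j0 := jj_neq0 hs ht; have hgs := conv_gs (R := R); have he4 := conv_e4 (R := R).
have hD i := conv_Dk k (nu i) (ha i).
have hDD i := conv_Dk (k + 2) (nu i) (hD i).
have lD := law_D ha law; have lDD := law_D hD lD.
have hgD i : conv (gs * Dk k (nu i) (a i)) by exact: convM.
have hga i : conv (gs * a i) by exact: convM.
have hgga i : conv (gs * (gs * a i)) by exact: convM.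
have lgD := law_gs hD lD; have lgg := law_gs hga (law_gs ha law).
have L := law_Dadd hDD (fun i => convZ A (hgD i)) lDD (law_Z A hgD lgD).
have hs1 i : conv (Dk (k + 2) (nu i) (Dk k (nu i) (a i)) + fcst A * (gs * Dk k (nu i) (a i))).
  by apply: convD => //; exact: convZ.
have {}L := law_Dadd hs1 (fun i => convZ B (hgga i)) L (law_Z B hgga lgg).
have Ei i : Dk (k + 2) (nu i) (Dk k (nu i) (a i)) + fcst A * (gs * Dk k (nu i) (a i))
     + fcst B * (gs * (gs * a i)) = fcst (- c0) * (e4 * a i).
  apply/eqP; rewrite -subr_eq0; apply/eqP; rewrite -(ode i) [fcst (- c0)]rmorphN -/(fcst c0); ring.
have [i fi] := fam_neq0 hm.
have qE w j : upper w -> qev (nu j) (fcst (- c0) * (e4 * a j)) w = - (c0 * ev e4 w) * qev (nu j) (a j) w.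
  move=> hw; rewrite /qev evZ ?evM //; [ring|exact: convM].
have := L g tau hg ht i; rewrite Ei qE //.
under eq_bigr => j _ do rewrite Ei qE // mulrCA.
rewrite -mulr_sumr -(law hg ht i) !mulNr !mulrN => /oppr_inj.
have -> : - (k + 2 + 2) = - k + - 4 :> int by ring.
rewrite expfzDr // -[jj g tau ^ (-4)]/((jj g tau ^+ 4)^-1).
have := expfz_neq0 (- k) j0; move: (jj g tau) j0 (jj g tau ^ (- k)) fi => j j0 u.
move: (qev _ _ _) (c0 * ev e4 (moebius g tau)) (c0 * ev e4 tau) => f x y f0 u0 e.
have -> : x = u / j ^+ 4 * (x * f) * (j ^+ 4 / (u * f)) by field; rewrite f0 j0 u0.
by rewrite e; field; rewrite f0 u0.
Qed.

Lemma gs_cusp0 : exists2 K : R, 0 < K & forall w, 1 / 2 <= im w -> nm (ev gs (- w^-1)) <= nm w ^+ 2 * K.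
Proof.
have [|K K0 hK] := ev_bound (conv_e2 (R := R)) (y0 := 1 / 4); first by lra.
exists (K + K + 1); first by lra.
move=> w hw; have hu : upper w by apply: lt_le_trans hw; lra.
have hu2 := upper_half hu; rewrite gs_S // nmM nmX ler_wpM2l ?exprn_ge0 ?nm_ge0 //.
rewrite -!ev_e2 //; apply: le_trans (nmB _ _) _; rewrite nmM nmV nm_nat.
have h1 : nm (ev e2 w) <= K by apply: hK; lra.
have h2 : nm (ev e2 (w / 2%:R)) <= K.
  apply: hK; have -> : w / 2%:R = toC 2^-1 * w by rewrite toCV toC_nat mulrC.
  by rewrite imM re_toC im_toC; lra.
have := nm_ge0 (ev e2 (w / 2%:R)); lra.
Qed.

Lemma g6y_id : g6y R = u64 R ^+ 3.
Proof.
have hg := conv_gs (R := R); have hy := conv_ys (R := R).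
have c2 := convM hg hg; have c4 := convM c2 c2; have c6 := convM c4 c2.
have evE tau : upper tau -> ev (g6y R) tau = ev gs tau ^+ 6 * ev ys tau.
  by move=> ht; rewrite /g6y !evM //; ring.
apply: g6y_identity; last exact: convM.
  move=> g tau hg' ht; have hs := Gamma02_SL2Z hg'; have hm := upper_moebius hs ht.
  rewrite !evE // gs_law // -(ys_law hg' ht); ring.
have [K K0 hK] := gs_cusp0; have [k1 [K1 [k10 K10 hx]]] := xs_S_bounds R.
exists (K ^+ 6 * K1) => w hw _; have hu : upper w by apply: lt_le_trans hw; lra.
rewrite evE; last exact: upperS.
have [_ _ h] := hx w hw; rewrite nmM nmX.
have h6 : nm (ev gs (- w^-1)) ^+ 6 <= (nm w ^+ 2 * K) ^+ 6.
  by rewrite lerXn2r ?nnegrE ?nm_ge0 ?mulr_ge0 ?exprn_ge0 ?nm_ge0 ?(ltW K0) //; exact: hK.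
apply: (@le_trans _ _ ((nm w ^+ 2 * K) ^+ 6 * nm (ev ys (- w^-1)))).
  by rewrite ler_wpM2r ?nm_ge0.
have -> : (nm w ^+ 2 * K) ^+ 6 * nm (ev ys (- w^-1)) = K ^+ 6 * (nm w ^+ 12 * nm (ev ys (- w^-1))) by ring.
by rewrite -mulrA ler_pM2l ?exprn_gt0.
Qed.

(** The order 4 at the cusp 0 consists of one power of x for E4 and three for G^4 ys. *)
Lemma e4g4y_id : fcst c0 * e4g4y R = fcst c0 * (u64 R ^+ 2 * u256 R).
Proof.
have hg := conv_gs (R := R); have hy := conv_ys (R := R); have he := conv_e4 (R := R).
have c2 := convM hg hg; have c4 := convM c2 c2; have c5 := convM c4 hy; have c6 := convM he c5.
have evE tau : upper tau -> ev (fcst c0 * e4g4y R) tau = c0 * ev e4 tau * ev gs tau ^+ 4 * ev ys tau.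
  by move=> ht; rewrite /e4g4y evZ ?evM //; ring.
apply: e4g4y_identity; last exact: convZ.
  move=> g tau hg' ht; have hs := Gamma02_SL2Z hg'; have hm := upper_moebius hs ht.
  rewrite !evE // gs_law // e4_law // -(ys_law hg' ht); ring.
have [K K0 hK] := gs_cusp0; have [k1 [K1 [k10 K10 hx]]] := xs_S_bounds R.
have [K2 hK2] := e4_cusp0 R.
exists (nm c0 * K2 / k1 * (K ^+ 4 * 16 * K1)) => w hw hr; have hu : upper w by apply: lt_le_trans hw; lra.
rewrite evE; last exact: upperS.
have [hx1 _ h] := hx w hw; rewrite (nmM _ (ev ys _)) (nmM _ (ev gs _ ^+ 4)) (nmM c0) nmX.
have := hK2 w hw hr; have t0 := expR_gt0 (pi * im w); move: (expR _) hx1 t0 => t hx1 t0 h4.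
have h6 : nm (ev gs (- w^-1)) ^+ 4 <= (nm w ^+ 2 * K) ^+ 4.
  by rewrite lerXn2r ?nnegrE ?nm_ge0 ?mulr_ge0 ?exprn_ge0 ?nm_ge0 ?(ltW K0) //; exact: hK.
have w1 : 1 <= 16 * nm w ^+ 4.
  have : 1 / 2 <= nm w by apply: le_trans hw _; apply: le_trans (ler_norm _) (im_le _).
  move: (nm w) => x hx'; have : (1 / 2) ^+ 4 <= x ^+ 4 by rewrite lerXn2r ?nnegrE //; lra.
  have -> : (1 / 2) ^+ 4 = 1 / 16 :> R by field.
  lra.
move: h h6 h4 hx1 w1; have y0 := nm_ge0 (ev ys (- w^-1)); have x0 := nm_ge0 (ev xs (- w^-1)).
have n0 := nm_ge0 c0; have g0 := nm_ge0 (ev gs (- w^-1)); have f0 := nm_ge0 (ev e4 (- w^-1)); have w0 := nm_ge0 w.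
move: y0 x0 n0 g0 f0 w0; move: (nm (ev e4 _)) (nm (ev gs _)) (nm (ev ys _)) (nm (ev xs _)) (nm c0) (nm w).
move=> f4 G Y X c w' y0 x0 n0 g0 f0 w0 h h6 h4 hx1 w1.
have K20 : 0 <= K2 by rewrite -(pmulr_lge0 _ t0) (le_trans f0).
have s1 : G ^+ 4 * Y <= K ^+ 4 * 16 * K1 * X ^+ 3.
  apply: (@le_trans _ _ ((w' ^+ 2 * K) ^+ 4 * Y)); first by rewrite ler_wpM2r.
  have e0 : 0 <= K ^+ 4 by rewrite exprn_ge0 // ltW.
  have -> : (w' ^+ 2 * K) ^+ 4 * Y = K ^+ 4 * (w' ^+ 8 * Y) by ring.
  have -> : K ^+ 4 * 16 * K1 * X ^+ 3 = K ^+ 4 * (16 * (K1 * X ^+ 3)) by ring.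
  rewrite ler_wpM2l //; apply: (@le_trans _ _ (16 * (w' ^+ 12 * Y))); last by rewrite ler_pM2l.
  have -> : 16 * (w' ^+ 12 * Y) = 16 * w' ^+ 4 * (w' ^+ 8 * Y) by ring.
  by rewrite ler_peMl // mulr_ge0 // exprn_ge0.
have s2 : c * f4 <= c * K2 / k1 * X.
  rewrite -!mulrA ler_wpM2l //; apply: le_trans h4 _; rewrite ler_wpM2l //.
  by rewrite ler_pdivlMl.
have -> : c * K2 / k1 * (K ^+ 4 * 16 * K1) * X ^+ 4 = (c * K2 / k1 * X) * (K ^+ 4 * 16 * K1 * X ^+ 3) by ring.
rewrite -mulrA; apply: ler_pM => //; first exact: mulr_ge0.
by rewrite mulr_ge0 // exprn_ge0.
Qed.
End Two.
End Families.

(** * Growth at the cusp 0 *)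
Section CuspGrowth.
Variable R : realType.
Local Notation C := (CC R).
Implicit Types (z w t tau : C) (b c d p y : fps C) (g : 'M[int]_2).
Local Notation e2 := (e2 R).
Local Notation e4 := (e4 R).
Local Notation xs := (xs R).
Local Notation ys := (ys R).
Local Notation gs := (gs R).
Local Notation phi := (phi R).
Local Notation phiV := (phiV R).

(* S maps this half-strip onto a neighbourhood of the cusp 0; together with the
   half-plane im w >= 1/2 it contains a fundamental domain of Gamma0(2). *)
Definition cuspg (h : C -> C) : Prop := exists K s : R, [/\ 0 <= K, 0 <= s &
  forall w, 1 / 2 <= im w -> `|re w| <= 1 -> nm (h (- w^-1)) <= K * expR (s * im w)].

Lemma cuspgM h1 h2 : cuspg h1 -> cuspg h2 -> cuspg (fun w => h1 w * h2 w).
Proof.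
move=> [K1 [s1 [K10 s10 H1]]] [K2 [s2 [K20 s20 H2]]].
exists (K1 * K2), (s1 + s2); split; [exact: mulr_ge0|exact: addr_ge0|move=> w hw hr].
have -> : K1 * K2 * expR ((s1 + s2) * im w) = K1 * expR (s1 * im w) * (K2 * expR (s2 * im w)).
  by rewrite mulrDl expRD; ring.
by rewrite nmM; apply: ler_pM; rewrite ?nm_ge0 ?H1 ?H2.
Qed.
Lemma cuspgD h1 h2 : cuspg h1 -> cuspg h2 -> cuspg (fun w => h1 w + h2 w).
Proof.
move=> [K1 [s1 [K10 s10 H1]]] [K2 [s2 [K20 s20 H2]]].
exists (K1 + K2), (s1 + s2); split; [exact: addr_ge0|exact: addr_ge0|move=> w hw hr].
have y0 : 0 <= im w by lra.
apply: le_trans (nmD _ _) _; rewrite mulrDl; apply: lerD.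
  apply: le_trans (H1 w hw hr) _; rewrite ler_wpM2l // ler_expR mulrDl lerDl.
  exact: mulr_ge0.
apply: le_trans (H2 w hw hr) _; rewrite ler_wpM2l // ler_expR mulrDl lerDr.
exact: mulr_ge0.
Qed.
Lemma eq_cuspg h1 h2 : (forall tau, upper tau -> h1 tau = h2 tau) -> cuspg h1 -> cuspg h2.
Proof.
move=> e [K [s [K0 s0 H]]]; exists K, s; split=> // w hw hr.
by rewrite -e ?H //; apply: upperS; apply: lt_le_trans hw; lra.
Qed.
Lemma cuspg_cst z : cuspg (fun=> z).
Proof. by exists (nm z), 0; split=> [||w _ _]; rewrite ?nm_ge0 // mul0r expR0 mulr1. Qed.

Lemma nm_strip w : 1 / 2 <= im w -> `|re w| <= 1 -> nm w ^+ 2 <= 5 * im w ^+ 2.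
Proof.
move=> hw hr; have : re w ^+ 2 <= 1 by rewrite -real_normK ?num_real // exprn_ile1.
rewrite nm2; nra.
Qed.
Lemma nm_lb w : 1 / 2 <= im w -> 1 / 2 <= nm w.
Proof. by move=> hw; apply: le_trans hw _; apply: le_trans (ler_norm _) (im_le _). Qed.

Lemma le_expR (y : R) : y <= expR y.
Proof. by apply: le_trans (expR_ge1Dx y); rewrite lerDr. Qed.

(** While Im w stays bounded in the strip, Im(-1/w) is bounded below and the series is bounded; only
    large Im w has to be examined. *)
Lemma cuspg_far b : conv b -> (exists K s t0 : R, forall w, t0 <= im w -> `|re w| <= 1 ->
    nm (ev b (- w^-1)) <= K * expR (s * im w)) -> cuspg (ev b).
Proof.
move=> hb [K [s [t0 H]]]; pose t1 := `|t0| + 1.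
have t10 : 0 < t1 by rewrite ltr_pwDr.
have d0 : 0 < 1 / 2 / (1 + t1 ^+ 2) by rewrite divr_gt0 // addr_gt0 // exprn_gt0.
have [B B0 hB] := ev_bound hb d0.
exists (`|K| + B), `|s|; split => //; first by rewrite addr_ge0.
move=> w hw hr; have y0 : 0 <= im w by lra.
have e1 : 1 <= expR (`|s| * im w) by rewrite -expR0 ler_expR mulr_ge0.
have [hy|hy] := leP t1 (im w).
  have h0 : t0 <= im w by apply: le_trans hy; apply: le_trans (ler_norm _) _; rewrite lerDl.
  apply: le_trans (H w h0 hr) _; apply: (@le_trans _ _ (`|K| * expR (s * im w))).
    by rewrite ler_wpM2r ?expR_ge0 // ler_norm.
  apply: ler_pM; rewrite ?expR_ge0 //; first by rewrite lerDl.
  by rewrite ler_expR ler_wpM2r // ler_norm.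
apply: (@le_trans _ _ B).
  have n0 : 0 < nm w ^+ 2 by rewrite exprn_gt0 // nm_gt0 upper_neq0 //; apply: lt_le_trans hw; lra.
  apply: hB; rewrite imN im_inv mulNr opprK ler_pdivlMr // mulrAC ler_pdivrMr ?addr_gt0 ?exprn_gt0 //.
  have : re w ^+ 2 <= 1 by rewrite -real_normK ?num_real // exprn_ile1.
  rewrite nm2; have : im w ^+ 2 <= t1 ^+ 2 by rewrite lerXn2r ?nnegrE // ltW.
  nra.
rewrite mulrDl ler_wpDl ?mulr_ge0 ?expR_ge0 //; nra.
Qed.

(** Turns exponential growth into growth by powers of x, since |x(-1/w)| is at least k e^(pi Im
    w). *)
Lemma cuspg_bound b : cuspg (ev b) -> exists n, cusp0_bound n b.
Proof.
move=> [K [s [K0 s0 H]]]; have [k [K1 [k0 K10 hx]]] := xs_S_bounds R.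
pose n := (Num.truncn s).+1; have sn : s <= n%:R by apply: ltW; exact: Num.Theory.real_truncnS_gt (num_real s).
exists n, (K / k ^+ n) => w hw hr; have [h1 _ _] := hx w hw.
apply: le_trans (H w hw hr) _; rewrite -mulrA ler_wpM2l // ler_pdivlMl ?exprn_gt0 //.
apply: (@le_trans _ _ ((k * expR (pi * im w)) ^+ n)); last first.
  by rewrite lerXn2r ?nnegrE ?nm_ge0 // mulr_ge0 ?expR_ge0 // ltW.
rewrite exprMn ler_pM2l ?exprn_gt0 // -expRM_natl ler_expR mulrA ler_wpM2r //; first lra.
apply: le_trans sn _; have := pi_ge2 R; have : 0 <= n%:R :> R by []; nra.
Qed.

Lemma gronwall_cusp n (u u' : 'I_n -> C -> C) (t0 K : R) : 0 <= K -> 1 / 2 <= t0 ->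
  (forall w, t0 <= im w -> forall k, cder (u k) w (u' k w)) ->
  (forall w, t0 <= im w -> \sum_k nm (u k w) * nm (u' k w) <= K * \sum_k nm (u k w) ^+ 2) ->
  exists M s : R, forall w, t0 <= im w -> `|re w| <= 1 -> forall k, nm (u k w) <= M * expR (s * im w).
Proof.
move=> K0 t00 hd hb; pose t : C := Complex 0 t0; pose N := \sum_k nm (u k t) ^+ 2.
have N0 : 0 <= N by apply: sumr_ge0 => k _; rewrite exprn_ge0 // nm_ge0.
have y0 (w : C) : t0 <= im w -> 0 <= im w by move=> ?; lra.
exists (1 + N * expR (2 * K)), (2 * K) => w hw hr k.
have := @gronwall R n u u' t (w - t) K; rewrite [t + _]addrC subrK => G.
have seg s : 0 <= s -> s <= 1 -> t0 <= im (t + toC s * (w - t)).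
  move=> s0 s1; rewrite imD imM re_toC im_toC mul0r addr0 imD imN -[im t]/t0.
  have : 0 <= s * (im w - t0) by rewrite mulr_ge0 // subr_ge0.
  lra.
have {}G := G (fun s s0 s1 => hd _ (seg s s0 s1)) (fun s s0 s1 => hb _ (seg s s0 s1)).
have h1 : nm (u k w) ^+ 2 <= \sum_j nm (u j w) ^+ 2.
  by rewrite (bigD1 k) //= lerDl; apply: sumr_ge0 => j _; rewrite exprn_ge0 // nm_ge0.
have h2 : nm (w - t) <= 1 + im w.
  apply: le_trans (nm_le_reim _) _; rewrite reD imD reN imN -[re t]/(0 : R) -[im t]/t0 subr0.
  by apply: lerD => //; rewrite ger0_norm ?subr_ge0 //; lra.
have h3 : expR (2 * K * nm (w - t)) <= expR (2 * K) * expR (2 * K * im w).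
  have E : 2 * K + 2 * K * im w = 2 * K * (1 + im w) by ring.
  by rewrite -expRD ler_expR E ler_wpM2l // mulr_ge0.
have e1 : 1 <= expR (2 * K * im w) by rewrite -expR0 ler_expR !mulr_ge0 // y0.
have h4 : nm (u k w) ^+ 2 <= N * expR (2 * K) * expR (2 * K * im w).
  apply: le_trans h1 _; apply: le_trans G _; rewrite -/N [_ * N]mulrC -[leRHS]mulrA ler_wpM2l //.
have := nm_ge0 (u k w); move: (nm (u k w)) h4 => x; nra.
Qed.

(** The growth of a quasimodular form of weight 2. It is what keeps p(-1/w) w^-2, a coefficient of
    the equation transported by S, bounded. *)
Definition cuspw2 p : Prop := conv p /\ exists2 K : R, 0 <= K &
  forall w, 1 / 2 <= im w -> nm (ev p (- w^-1)) <= K * nm w ^+ 2.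

Lemma cuspw2D b c : cuspw2 b -> cuspw2 c -> cuspw2 (b + c).
Proof.
move=> [hb [K K0 H]] [hc [L L0 H']]; split; first exact: convD.
exists (K + L); first exact: addr_ge0.
move=> w hw; have hS : upper (- w^-1) by apply: upperS; apply: lt_le_trans hw; lra.
by rewrite evD // mulrDl; apply: le_trans (nmD _ _) _; apply: lerD; [exact: H|exact: H'].
Qed.
Lemma cuspw2Z z b : cuspw2 b -> cuspw2 (fcst z * b).
Proof.
move=> [hb [K K0 H]]; split; first exact: convZ.
exists (nm z * K); first by rewrite mulr_ge0 ?nm_ge0.
move=> w hw; have hS : upper (- w^-1) by apply: upperS; apply: lt_le_trans hw; lra.
by rewrite evZ // nmM -mulrA ler_wpM2l ?nm_ge0 //; exact: H.
Qed.
Lemma cuspw2N b : cuspw2 b -> cuspw2 (- b).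
Proof.
move=> [hb [K K0 H]]; split; first exact: convN.
exists K => // w hw; have hS : upper (- w^-1) by apply: upperS; apply: lt_le_trans hw; lra.
by rewrite evN // nmN H.
Qed.
Lemma cuspw2_cst z : cuspw2 (fcst z).
Proof.
split; first exact: conv_cst.
exists (4 * nm z); first by rewrite mulr_ge0 ?nm_ge0.
move=> w hw; rewrite ev_cst; have := nm_lb hw; move: (nm w) (nm z) (nm_ge0 z) => x Z Z0 hx.
have h : 1 <= 4 * x ^+ 2 by nra.
by have := ler_wpM2l Z0 h; rewrite mulr1 mulrCA mulrA.
Qed.
Lemma cuspw2_gs : cuspw2 gs.
Proof.
split; first exact: conv_gs.
have [K K0 H] := gs_cusp0 R; exists K; first exact: ltW.
by move=> w hw; rewrite mulrC H.
Qed.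
Lemma cuspw2_e2 : cuspw2 e2.
Proof.
split; first exact: conv_e2.
have [|K K0 hK] := ev_bound (conv_e2 (R := R)) (y0 := 1 / 2); first by lra.
pose L := nm (12%:R / twopii R); have L0 : 0 <= L by exact: nm_ge0.
exists (K + 2 * L); first by rewrite addr_ge0 // mulr_ge0.
move=> w hw; have hu : upper w by apply: lt_le_trans hw; lra.
rewrite ev_e2; last exact: upperS.
rewrite E2_S //; apply: le_trans (nmD _ _) _; rewrite (nmM (w ^+ 2)) (nmM (12%:R / twopii R)) (nmX w 2) -/L mulrDl; apply: lerD.
  by rewrite mulrC ler_wpM2r ?exprn_ge0 ?nm_ge0 // -ev_e2 // hK.
have := nm_lb hw; clearbody L; move: (nm w) => x hx.
have h : x <= 2 * x ^+ 2 by nra.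
by have := ler_wpM2l L0 h; rewrite mulrCA mulrA.
Qed.
Lemma cuspw2_1 : cuspw2 1. Proof. exact: (cuspw2_cst 1). Qed.

Lemma inv_strip w : 1 / 2 <= im w -> nm (w^-1) <= 2.
Proof.
move=> hw; have h := nm_lb hw; rewrite nmV -[2]invrK lef_pV2 ?posrE ?invr_gt0 //; lra.
Qed.

(** The function f(w) = exp-series at -1/w satisfies f' = 2 pi i p(-1/w) w^-2 f, with a bounded
    coefficient. *)
Lemma cuspg_fexp p : cuspw2 p -> p 0%N = 0 -> cuspg (ev (fexp p)).
Proof.
move=> [hp [K K0 H]] p0; have he := conv_fexp hp.
pose f w := ev (fexp p) (- w^-1); pose f' w := twopii R * ev p (- w^-1) * f w * w^-1 ^+ 2.
have [||w hw k|w hw|M [s G]] := @gronwall_cusp 1 (fun=> f) (fun=> f') (1 / 2) (nm (twopii R) * K).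
- by rewrite mulr_ge0 ?nm_ge0.
- exact: lexx.
- have hu : upper w by apply: lt_le_trans hw; lra.
  have := cder_comp (inv_der (upper_neq0 hu)) (ev_der he (upperS hu)).
  by rewrite (theta_fexp (@char0C R) p0) (evM hp he (upperS hu)) mulrA.
- have hu : upper w by apply: lt_le_trans hw; lra.
  have -> : \sum_(k < 1) nm (f w) * nm (f' w) = nm (f w) * (nm (twopii R) * nm (ev p (- w^-1)) * nm (f w) * (nm w)^-1 ^+ 2).
    by rewrite big_ord1 /f' (nmM _ (w^-1 ^+ 2)) nmX nmV (nmM _ (f w)) nmM.
  rewrite big_ord1; have := H w hw.
  have n0 : 0 < nm w by rewrite nm_gt0 upper_neq0.
  have := nm_ge0 (f w); have := nm_ge0 (twopii R); move: (nm (twopii R)) (nm (f w)) (nm (ev p _)) => T a q T0 a0 hq.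
  have h : q * (nm w)^-1 ^+ 2 <= K by rewrite exprVn ler_pdivrMr // exprn_gt0.
  have -> : a * (T * q * a * (nm w)^-1 ^+ 2) = T * (q * (nm w)^-1 ^+ 2) * a ^+ 2 by ring.
  by rewrite ler_wpM2r ?exprn_ge0 // ler_wpM2l.
apply: cuspg_far => //; exists M, s, (1 / 2) => w hw hr.
exact: (G w hw hr ord0).
Qed.

Lemma cuspg_phi k : cuspg (ev (phi k)).
Proof.
apply: cuspg_fexp; last exact: phi00.
by apply: cuspw2Z; apply: cuspw2D cuspw2_e2 (cuspw2N cuspw2_1).
Qed.
Lemma cuspg_phiV k : cuspg (ev (phiV k)).
Proof.
apply: cuspg_fexp; last by rewrite foppE phi00 oppr0.
by apply: cuspw2N; apply: cuspw2Z; apply: cuspw2D cuspw2_e2 (cuspw2N cuspw2_1).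
Qed.

Section System.
Variables (l A B c0 : C) (b : fps C).
Let T := Tl l b.
Hypothesis ode : Tl l T - fcst (6%:R^-1) * (e2 * T) + fcst A * (gs * T)
  + (fcst B * gs ^+ 2 + fcst c0 * e4) * b = 0.
Hypothesis hb : conv b.
Hypothesis he4 : fcst c0 * (u64 R * e4) = fcst c0 * (u256 R * gs ^+ 2).

(** From (1 + 64 x) E4 = (1 + 256 x) G^2: above the height 1/2 + 1/k one has |x| >= 1, so the ratio
    of the two factors is at most 257/63 < 5. *)
Lemma e4_far : exists K t0 : R, [/\ 0 <= K, 1 / 2 <= t0 & forall w, t0 <= im w ->
  nm (c0 * ev e4 (- w^-1)) <= K * nm w ^+ 4].
Proof.
have [Kg Kg0 hg] := gs_cusp0 R; have [k [K1 [k0 K10 hx]]] := xs_S_bounds R.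
exists (nm c0 * 5 * Kg ^+ 2), (1 / 2 + k^-1); split.
- by rewrite !mulr_ge0 ?nm_ge0 ?exprn_ge0 // ltW.
- by rewrite lerDl invr_ge0 ltW.
move=> w hw; have ki : 0 < k^-1 by rewrite invr_gt0.
have hw2 : 1 / 2 <= im w by lra.
have hu : upper w by apply: lt_le_trans hw2; lra.
have hS := upperS hu; have hc1 := conv_e4 (R := R); have hc2 := conv_gs (R := R).
have hc3 := conv_xs (R := R).
have hcu (m : nat) : conv (1 + m%:R * xs) by apply: convD; [exact: conv1|apply: convM => //; exact: conv_nat].
have evu (m : nat) : ev (1 + m%:R * xs) (- w^-1) = 1 + m%:R * ev xs (- w^-1).
  have hm := conv_nat (R := R) m; have h1 := conv1 (R := R); have h2 := convM hm hc3.
  by rewrite evD // evM // ev1 -fcst_nat ev_cst.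
have := congr1 (fun s : fps C => ev s (- w^-1)) he4; have h2 := convX 2 hc2.
have h3 := convM (hcu 64) hc1; have h4 := convM (hcu 256) h2.
rewrite !evZ // (evM (hcu 64) hc1) // (evM (hcu 256) h2) // !evu evX //.
have [hx1 _ _] := hx w hw2; have := hg w hw2.
have x1 : 1 <= nm (ev xs (- w^-1)).
  apply: le_trans hx1; have e1 := expR_ge1Dx (pi * im w); have := pi_ge2 R.
  move=> p2; apply: (@le_trans _ _ (k * k^-1)); first by rewrite divff // gt_eqF.
  rewrite ler_pM2l //; apply: le_trans e1; nra.
move: x1; move: (ev xs _) (ev e4 _) (ev gs _) => x f g x1 hgg E.
have u1 : 63 * nm x <= nm (1 + 64%:R * x).
  have := nm_lerB (64%:R * x) (- 1); rewrite opprK [_ + 1]addrC nmM nm_nat nmN nm1; lra.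
have u2 : nm (1 + 256%:R * x) <= 257 * nm x.
  apply: le_trans (nmD _ _) _; rewrite nmM nm_nat nm1; lra.
have E' : nm (c0 * f) * nm (1 + 64%:R * x) = nm c0 * nm (1 + 256%:R * x) * nm g ^+ 2.
  rewrite -nmM -nmX -!nmM; congr nm; rewrite -mulrA [f * _]mulrC E; ring.
have g2 : nm g ^+ 2 <= nm w ^+ 4 * Kg ^+ 2.
  have -> : nm w ^+ 4 * Kg ^+ 2 = (nm w ^+ 2 * Kg) ^+ 2 by ring.
  by rewrite lerXn2r ?nnegrE ?nm_ge0 ?mulr_ge0 ?exprn_ge0 ?nm_ge0 ?(ltW Kg0).
have g20 : 0 <= nm g ^+ 2 by rewrite exprn_ge0 // nm_ge0.
have q0 : 0 <= nm c0 * nm g ^+ 2 by rewrite mulr_ge0 ?nm_ge0.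
have s1 : nm (c0 * f) * 63 <= 257 * (nm c0 * nm g ^+ 2).
  have X0 : 0 < nm x by lra.
  rewrite -(@ler_pM2r _ (nm x)) //; apply: (@le_trans _ _ (nm (c0 * f) * nm (1 + 64%:R * x))).
    by rewrite -mulrA ler_wpM2l ?nm_ge0.
  rewrite E'; have -> : 257 * (nm c0 * nm g ^+ 2) * nm x = (257 * nm x) * (nm c0 * nm g ^+ 2) by ring.
  by rewrite mulrAC mulrC ler_wpM2r.
have s2 : nm c0 * nm g ^+ 2 <= nm c0 * (nm w ^+ 4 * Kg ^+ 2) by rewrite ler_wpM2l ?nm_ge0.
have -> : nm c0 * 5 * Kg ^+ 2 * nm w ^+ 4 = 5 * (nm c0 * (nm w ^+ 4 * Kg ^+ 2)) by ring.
lra.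
Qed.

Lemma lin2_bound (p q r s K a a' : R) : 0 <= p -> 0 <= q -> 0 <= r -> 0 <= s -> 0 <= a -> 0 <= a' ->
  p <= K -> q <= K -> r <= K -> s <= K ->
  a * (p * a + q * a') + a' * (r * a + s * a') <= 2 * K * (a ^+ 2 + a' ^+ 2).
Proof.
move=> p0 q0 r0 s0 a0 a'0 pK qK rK sK.
have h1 : p * a ^+ 2 <= K * a ^+ 2 by rewrite ler_wpM2r ?exprn_ge0.
have h2 : q * (a * a') <= K * (a * a') by rewrite ler_wpM2r ?mulr_ge0.
have h3 : r * (a * a') <= K * (a * a') by rewrite ler_wpM2r ?mulr_ge0.
have h4 : s * a' ^+ 2 <= K * a' ^+ 2 by rewrite ler_wpM2r ?exprn_ge0.
have h5 : 0 <= K * (a - a') ^+ 2 by rewrite mulr_ge0 ?sqr_ge0 // (le_trans p0).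
nra.
Qed.

Lemma cuspg_system : cuspg (ev b) /\ cuspg (ev T).
Proof.
have [Ke [t0 [Ke0 t00 hE]]] := e4_far.
have [_ [K2 K20 hK2]] := cuspw2_e2; have [_ [Kg Kg0 hKg]] := cuspw2_gs.
have hT : conv T by apply: convD; [exact: conv_theta|exact: convZ].
have ce := conv_e2 (R := R); have cg := conv_gs (R := R); have c4 := conv_e4 (R := R).
have tb : theta b = T - fcst l * b by rewrite /T /Tl addrK.
have tT : theta T = (fcst (6%:R^-1) * e2 - fcst A * gs - fcst l) * T - (fcst B * gs ^+ 2 + fcst c0 * e4) * b.
  apply/eqP; rewrite -subr_eq0; apply/eqP; rewrite -ode /Tl -/T; ring.
pose S w : C := - w^-1.
(* The factor w^-2 in v makes all coefficients of the system for (u, v) bounded: P appears with w^-2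
   and Q with w^-4, matching their growth. *)
pose u w := ev b (S w); pose v w := ev T (S w) * w^-1 ^+ 2.
pose P w := 6%:R^-1 * ev e2 (S w) - A * ev gs (S w) - l.
pose Q w := B * ev gs (S w) ^+ 2 + c0 * ev e4 (S w).
pose u' w := twopii R * (v w - l * w^-1 ^+ 2 * u w).
pose v' w := - (2%:R * w^-1) * v w + twopii R * (P w * w^-1 ^+ 2 * v w - Q w * w^-1 ^+ 4 * u w).
have du w : upper w -> cder u w (u' w).
  move=> hu; have w0 := upper_neq0 hu; have hS := upperS hu.
  have := cder_comp (inv_der w0) (ev_der hb hS); congr cder.
  have := congr1 (fun s : fps C => ev s (S w)) tb; rewrite (evB hT (convZ l hb) hS) evZ // -/(u w) => ->.
  by rewrite /u' /v; ring.
have dv w : upper w -> cder v w (v' w).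
  move=> hu; have w0 := upper_neq0 hu; have hS := upperS hu.
  have h1 := cder_comp (inv_der w0) (ev_der hT hS).
  have h2 := cderX 2 (cderV w0 (cder_id w)).
  have := cderM h1 h2; congr cder.
  have := congr1 (fun s : fps C => ev s (S w)) tT.
  have c1 : conv (fcst (6%:R^-1) * e2 - fcst A * gs) by apply: convB; exact: convZ.
  have c2 : conv (fcst (6%:R^-1) * e2 - fcst A * gs - fcst l) by apply: convB => //; exact: conv_cst.
  have c3 : conv (fcst B * gs ^+ 2 + fcst c0 * e4) by apply: convD; apply: convZ => //; exact: convX.
  have c5 := convX 2 cg.
  rewrite (evB (convM c2 hT) (convM c3 hb) hS) (evM c2 hT hS) (evM c3 hb hS).
  rewrite (evB c1 (conv_cst l) hS) (evB (convZ _ ce) (convZ _ cg) hS) !evZ // ev_cst.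
  rewrite (evD (convZ B c5) (convZ c0 c4) hS) !evZ // evX // -/(P w) -/(Q w) -/(u w) => E.
  rewrite -/(S w) E /v' /v /=; move: (ev T _) (P w) (Q w) (u w) (twopii R) => a p q x tt.
  by field.
pose K' := nm (twopii R) * (1 + 4 * nm l + K2 + nm A * Kg + nm B * Kg ^+ 2 + Ke) + 4.
have K'0 : 0 <= K'.
  by rewrite addr_ge0 // mulr_ge0 ?nm_ge0 // !addr_ge0 ?mulr_ge0 ?nm_ge0 ?exprn_ge0.
have bd w : t0 <= im w -> nm (u w) * nm (u' w) + nm (v w) * nm (v' w) <= 2 * K' * (nm (u w) ^+ 2 + nm (v w) ^+ 2).
  move=> hw; have hw2 : 1 / 2 <= im w by apply: le_trans hw.
  have hu : upper w by apply: lt_le_trans hw2; lra.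
  have n0 : 0 < nm w by rewrite nm_gt0 upper_neq0.
  have wi : nm w^-1 <= 2 := inv_strip hw2.
  have wi0 := nm_ge0 w^-1.
  have w2 : nm (w^-1 ^+ 2) <= 4 by rewrite nmX; nra.
  have T0 := nm_ge0 (twopii R).
  have e2b : nm (ev e2 (S w)) * nm (w^-1 ^+ 2) <= K2.
    by rewrite nmX nmV exprVn ler_pdivrMr ?exprn_gt0 //; exact: hK2.
  have gsb : nm (ev gs (S w)) * nm (w^-1 ^+ 2) <= Kg.
    by rewrite nmX nmV exprVn ler_pdivrMr ?exprn_gt0 //; exact: hKg.
  have e4b : nm (c0 * ev e4 (S w)) * nm (w^-1 ^+ 4) <= Ke.
    by rewrite (nmX _ 4) nmV exprVn ler_pdivrMr ?exprn_gt0 //; exact: hE.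
  have Pb : nm (P w * w^-1 ^+ 2) <= K2 + nm A * Kg + 4 * nm l.
    rewrite /P mulrBl mulrBl; apply: le_trans (nmB _ _) _; apply: lerD; last first.
      by rewrite nmM mulrC ler_wpM2r ?nm_ge0.
    apply: le_trans (nmB _ _) _; apply: lerD.
      rewrite nmM nmM nmV nm_nat -mulrA; apply: le_trans e2b.
      have : 0 <= nm (ev e2 (S w)) * nm (w^-1 ^+ 2) by rewrite mulr_ge0 ?nm_ge0.
      lra.
    by rewrite -mulrA nmM ler_wpM2l ?nm_ge0 // nmM.
  have Qb : nm (Q w * w^-1 ^+ 4) <= nm B * Kg ^+ 2 + Ke.
    rewrite /Q mulrDl; apply: le_trans (nmD _ _) _; apply: lerD; last by rewrite nmM.
    rewrite -mulrA nmM ler_wpM2l ?nm_ge0 //.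
    have -> : ev gs (S w) ^+ 2 * w^-1 ^+ 4 = (ev gs (S w) * w^-1 ^+ 2) ^+ 2 by ring.
    by rewrite nmX lerXn2r ?nnegrE ?nm_ge0 // nmM.
  have lb : nm (l * w^-1 ^+ 2) <= 4 * nm l by rewrite nmM mulrC ler_wpM2r ?nm_ge0.
  have z1 := nm_ge0 l; have z2 : 0 <= nm A * Kg by rewrite mulr_ge0 ?nm_ge0.
  have z3 : 0 <= nm B * Kg ^+ 2 by rewrite mulr_ge0 ?nm_ge0 ?exprn_ge0.
  have hu' : nm (u' w) <= nm (twopii R) * (4 * nm l) * nm (u w) + nm (twopii R) * nm (v w).
    have -> : nm (twopii R) * (4 * nm l) * nm (u w) + nm (twopii R) * nm (v w) = nm (twopii R) * (nm (v w) + 4 * nm l * nm (u w)) by ring.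
    rewrite /u' nmM ler_wpM2l //; apply: le_trans (nmB _ _) _; apply: lerD => //.
    by rewrite nmM ler_wpM2r ?nm_ge0.
  have hv' : nm (v' w) <= nm (twopii R) * (nm B * Kg ^+ 2 + Ke) * nm (u w) + (4 + nm (twopii R) * (K2 + nm A * Kg + 4 * nm l)) * nm (v w).
    set TT := nm (twopii R) in T0 *.
    have -> : TT * (nm B * Kg ^+ 2 + Ke) * nm (u w) + (4 + TT * (K2 + nm A * Kg + 4 * nm l)) * nm (v w)
      = 4 * nm (v w) + TT * ((K2 + nm A * Kg + 4 * nm l) * nm (v w) + (nm B * Kg ^+ 2 + Ke) * nm (u w)) by ring.
    rewrite /v'; apply: le_trans (nmD _ _) _; apply: lerD.
      by rewrite nmM ler_wpM2r ?nm_ge0 // nmN nmM nm_nat; lra.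
    rewrite nmM ler_wpM2l //; apply: le_trans (nmB _ _) _; apply: lerD.
      by rewrite nmM ler_wpM2r ?nm_ge0.
    by rewrite nmM ler_wpM2r ?nm_ge0.
  apply: (@le_trans _ _ (nm (u w) * (nm (twopii R) * (4 * nm l) * nm (u w) + nm (twopii R) * nm (v w))
    + nm (v w) * (nm (twopii R) * (nm B * Kg ^+ 2 + Ke) * nm (u w) + (4 + nm (twopii R) * (K2 + nm A * Kg + 4 * nm l)) * nm (v w)))).
    by apply: lerD; rewrite ler_wpM2l ?nm_ge0.
  clear hu' hv' Pb Qb lb e2b gsb e4b; rewrite /K'; clear K'0.
  move: z1 z2 z3 T0; move: (nm l) (nm A * Kg) (nm B * Kg ^+ 2) (nm (twopii R)) => L X Y TT z1 z2 z3 T0.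
  apply: lin2_bound; rewrite ?nm_ge0 ?mulr_ge0 ?addr_ge0 //; rewrite ?mulr_ge0 ?addr_ge0 ?mulr_ge0 //; nra.
pose U (k : 'I_2) := if k == 0 then u else v; pose U' (k : 'I_2) := if k == 0 then u' else v'.
have [||w hw k|w hw|M [s G]] := @gronwall_cusp 2 U U' t0 (2 * K').
- by rewrite mulr_ge0.
- by [].
- have hu : upper w by apply: lt_le_trans hw; lra.
  by rewrite /U /U'; case: ifP => _; [exact: du|exact: dv].
- by rewrite !big_ord_recl !big_ord0 !addr0; exact: bd.
have cb : cuspg (ev b).
  by apply: cuspg_far => //; exists M, s, t0 => w hw hr; exact: (G w hw hr 0).
split => //; apply: cuspg_far => //; exists (5 * M), (s + 2), t0 => w hw hr.
have hw2 : 1 / 2 <= im w by apply: le_trans hw.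
have hu : upper w by apply: lt_le_trans hw2; lra.
have := G w hw hr 1; rewrite /U /= => hv.
have -> : ev T (- w^-1) = w ^+ 2 * v w by rewrite /v /S; have := upper_neq0 hu; move=> w0; field.
rewrite nmM nmX; have := nm_strip hw2 hr; have := le_expR (im w); have e0 := expR_gt0 (im w).
have -> : 5 * M * expR ((s + 2) * im w) = 5 * expR (im w) ^+ 2 * (M * expR (s * im w)).
  have -> : (s + 2) * im w = s * im w + (im w + im w) by ring.
  rewrite !expRD; ring.
move=> h1 h2; apply: ler_pM; rewrite ?exprn_ge0 ?nm_ge0 //; apply: le_trans h2 _.
by rewrite ler_pM2l // lerXn2r ?nnegrE ?(ltW e0) //; lra.
Qed.
End System.
End CuspGrowth.

(** * Coordinates of a form over F and its derivative *)
Section Decomposition.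
Variable R : realType.
Local Notation C := (CC R).
Implicit Types (z w t tau : C) (d p y : fps C) (g : 'M[int]_2).
Local Notation e2 := (e2 R).
Local Notation e4 := (e4 R).
Local Notation xs := (xs R).
Local Notation ys := (ys R).
Local Notation gs := (gs R).
Local Notation phi := (phi R).
Local Notation phiV := (phiV R).

Definition wt_law (k : int) p : Prop := forall g tau, Gamma02 g -> upper tau ->
  ev p (moebius g tau) = jj g tau ^ k * ev p tau.

Lemma wt_lawM k k' p d : conv p -> conv d -> wt_law k p -> wt_law k' d -> wt_law (k + k') (p * d).
Proof.
move=> hp hd h h' g tau hg ht; have hs := Gamma02_SL2Z hg; have hm := upper_moebius hs ht.
by rewrite !evM // h // h' // expfzDr ?(jj_neq0 hs ht) //; ring.
Qed.
Lemma wt_lawX k p n : conv p -> wt_law k p -> wt_law (n%:Z * k) (p ^+ n).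
Proof.
move=> hp h; elim: n => [|n IH].
  by move=> g tau hg ht; rewrite mul0r expr0z mul1r expr0 !ev1.
rewrite exprS; have -> : (n.+1%:Z * k = k + n%:Z * k)%R by rewrite -addn1 PoszD mulrDl mul1r addrC.
by apply: wt_lawM => //; exact: convX.
Qed.
Lemma wt_law_gs : wt_law 2 gs. Proof. by move=> g tau hg ht; rewrite gs_law. Qed.
Lemma wt_law_ys : wt_law (- 12) ys.
Proof.
move=> g tau hg ht; have hs := Gamma02_SL2Z hg; have j0 := jj_neq0 hs ht.
rewrite -(ys_law hg ht) -[_ ^ (-12)]/((jj g tau ^+ 12)^-1) mulKf //.
by rewrite expf_neq0.
Qed.
Lemma wt_law0 p : wt_law 0 p -> gamma02_inv p.
Proof. by move=> h g tau hg ht; rewrite h // expr0z mul1r. Qed.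

Lemma negI_Gamma02 : Gamma02 (mk2 (-1) 0 0 (-1)).
Proof. by split; rewrite ?det2E !mk2E. Qed.
(** The matrix -1 acts trivially on the half-plane, so in odd weight p = -p. *)
Lemma wt_even k p : conv p -> wt_law k p -> p != 0 -> exists m : int, k = m * 2.
Proof.
move=> hp h p0.
have h1 tau : upper tau -> ev p tau = (-1) ^ k * ev p tau.
  move=> ht; have := h _ tau negI_Gamma02 ht.
  by rewrite /moebius /jj !mk2E !mulrNz !mul0r !addr0 !add0r mulN1r invrN1 mulrN1 opprK.
exists (k %/ 2)%Z; have := divz_eq k 2; have := ltz_mod k (isT : 2 != 0 :> int); have := modz_ge0 k (isT : 2 != 0 :> int).
move: (k %% 2)%Z (k %/ 2)%Z => r q r0 r2 kE.
have [r00|r1] : r = 0 \/ r = 1 by lia.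
  by rewrite kE r00 addr0.
case/negP: p0; apply/eqP; apply: ev_inj => // [|tau ht]; first exact: (conv_nat 0).
have := h1 tau ht; rewrite kE r1 expfzDr ?oppr_eq0 ?oner_neq0 // mulrC.
rewrite [q * 2]mulrC -exprz_exp.
have -> : ((-1 : C) ^ 2) ^ q = 1 by rewrite -[(-1) ^ 2]/((-1 : C) ^+ 2) sqrrN expr1n exp1rz.
rewrite -[(-1) ^ 1]/(-1 : C) mul1r mulrN1 ev0 => /eqP; rewrite -subr_eq0 opprK -mulr2n mulrn_eq0 /=.
by move/eqP.
Qed.

Section Two.
Variables (rho : 'M[int]_2 -> 'M[C]_2) (k : int) (l : 'I_2 -> C) (a : 'I_2 -> fps C) (A B c0 : C).
Local Notation nu := (fun i : 'I_2 => k%:~R / 12%:R + l i).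
Hypothesis ode : forall i, formal_ode k (nu i) A B c0 (a i).
Hypothesis ha : forall i, conv (a i).
Hypothesis a_0 : forall i, a i 0%N = 1.
Hypothesis l01 : l 0 != l 1.
Hypothesis law : fam_law rho nu k a.

Local Notation om := (om k l a).
Local Notation Dser := (Dser k l a).
Let pp := fcst (6%:R^-1) * e2 - fcst A * gs - fcst (l 0 + l 1).

Definition omV : fps C := fcst ((l 1 - l 0)^-1) * (phiV k ^+ 2 * fexp (- pp)).

Lemma pp0 : pp 0%N = 0.
Proof. by have [] := om_fexp ode a_0 l01. Qed.
Lemma cuspw2_pp : cuspw2 pp.
Proof.
apply: cuspw2D; last by apply: cuspw2N; exact: cuspw2_cst.
apply: cuspw2D; first by apply: cuspw2Z; exact: cuspw2_e2.
by apply: cuspw2N; apply: cuspw2Z; exact: cuspw2_gs.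
Qed.
Lemma conv_pp : conv pp. Proof. by have [] := cuspw2_pp. Qed.
Lemma omK : om * omV = 1.
Proof.
have [p0 ->] := om_fexp ode a_0 l01; rewrite -/pp /omV.
have h1 : fcst (l 1 - l 0) * fcst ((l 1 - l 0)^-1) = 1 :> fps C.
  by rewrite -rmorphM divff ?rmorph1 // subr_eq0 eq_sym.
have h3 := phiK R k.
have -> : fcst (l 1 - l 0) * (phi k ^+ 2 * fexp pp) * (fcst ((l 1 - l 0)^-1) * (phiV k ^+ 2 * fexp (- pp)))
  = fcst (l 1 - l 0) * fcst ((l 1 - l 0)^-1) * (phi k * phiV k) ^+ 2 * (fexp pp * fexp (- pp)) by ring.
by rewrite h1 h3 (fexpN (@char0C R) pp0) mulr1 mul1r expr1n.
Qed.
Lemma conv_omV : conv omV.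
Proof.
apply: convZ; apply: convM; first by apply: convX; exact: conv_phiV.
exact: conv_fexp (convN conv_pp).
Qed.
Lemma ev_omV tau : upper tau -> ev omV tau = (ev om tau)^-1.
Proof.
move=> ht; have o0 := om_neq0 ode a_0 l01 ht; apply: (mulfI o0).
have hD i : conv (Dser i) := conv_Dk k _ (ha i).
have ho : conv om by apply: convB; exact: convM.
rewrite mulfV //; have := congr1 (fun s : fps C => ev s tau) omK.
by rewrite ev1 (evM ho conv_omV ht).
Qed.

Definition det2s (b d : 'I_2 -> fps C) : fps C := b 0 * d 1 - b 1 * d 0.

(** Every such determinant acquires the same det rho(g) and the same powers of q, so that quotients
    of two of them are forms with trivial character. *)
Lemma det_law k1 k2 (b d : 'I_2 -> fps C) g tau : (forall i, conv (b i)) -> (forall i, conv (d i)) ->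
  fam_law rho nu k1 b -> fam_law rho nu k2 d -> Gamma02 g -> upper tau ->
  jj g tau ^ (- (k1 + k2)) * (qpow (nu 0) (moebius g tau) * qpow (nu 1) (moebius g tau)) * ev (det2s b d) (moebius g tau)
  = (rho g 0 0 * rho g 1 1 - rho g 0 1 * rho g 1 0) * (qpow (nu 0) tau * qpow (nu 1) tau) * ev (det2s b d) tau.
Proof.
move=> hb hd lb ld hg ht; have hs := Gamma02_SL2Z hg; have hm := upper_moebius hs ht.
have E w : upper w -> ev (det2s b d) w = ev (b 0) w * ev (d 1) w - ev (b 1) w * ev (d 0) w.
  move=> hw; have h1 := convM (hb 0) (hd 1); have h2 := convM (hb 1) (hd 0).
  by rewrite /det2s (evB h1 h2) // !evM.
have two (F : 'I_2 -> C) : \sum_j F j = F 0 + F 1.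
  by rewrite !big_ord_recl big_ord0 addr0; congr (F _ + F _); exact/val_inj.
have b0 := lb g tau hg ht 0; have b1 := lb g tau hg ht 1.
have d0 := ld g tau hg ht 0; have d1 := ld g tau hg ht 1.
rewrite !two /qev in b0 b1 d0 d1; rewrite !E // opprD expfzDr ?(jj_neq0 hs ht) //.
move: b0 b1 d0 d1; move: (jj g tau ^ _) (jj g tau ^ _) => j1 j2.
move: (qpow _ (moebius g tau)) (qpow _ (moebius g tau)) (qpow _ tau) (qpow _ tau).
move: (ev _ (moebius g tau)) (ev _ (moebius g tau)) (ev _ (moebius g tau)) (ev _ (moebius g tau)).
move: (ev _ tau) (ev _ tau) (ev _ tau) (ev _ tau) (rho g 0 0) (rho g 0 1) (rho g 1 0) (rho g 1 1).
move=> x1 x2 x3 x4 r00 r01 r10 r11 y1 y2 y3 y4 q1 q2 q3 q4 b0 b1 d0 d1.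
transitivity ((j2 * (q2 * y4)) * (j1 * (q1 * y1)) - (j2 * (q1 * y3)) * (j1 * (q2 * y2))); first by ring.
by rewrite b0 b1 d0 d1; ring.
Qed.

Lemma om_law k1 k2 (b d : 'I_2 -> fps C) : (forall i, conv (b i)) -> (forall i, conv (d i)) ->
  fam_law rho nu k1 b -> fam_law rho nu k2 d ->
  wt_law (k1 + k2 - (k + (k + 2))) (det2s b d * omV).
Proof.
move=> hb hd lb ld g tau hg ht; have hs := Gamma02_SL2Z hg; have hm := upper_moebius hs ht.
have hD i : conv (Dser i) := conv_Dk k _ (ha i).
have hN : conv (det2s b d) by apply: convB; exact: convM.
have := det_law hb hd lb ld hg ht; have := det_law ha hD law (law_D ha law) hg ht.
rewrite -[det2s a Dser]/om !(evM hN conv_omV) // !ev_omV //.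
have := om_neq0 ode a_0 l01 ht; have := om_neq0 ode a_0 l01 hm.
have := qpow_neq0 (nu 0) tau; have := qpow_neq0 (nu 1) tau.
have := qpow_neq0 (nu 0) (moebius g tau); have := qpow_neq0 (nu 1) (moebius g tau).
have j0 := jj_neq0 hs ht.
have -> : jj g tau ^ (k1 + k2 - (k + (k + 2))) = (jj g tau ^ (- (k1 + k2)))^-1 * jj g tau ^ (- (k + (k + 2))).
  by rewrite invr_expz opprK -expfzDr.
have := expfz_neq0 (- (k1 + k2)) j0; have := expfz_neq0 (- (k + (k + 2))) j0.
move: (jj g tau ^ (- (k1 + k2))) (jj g tau ^ (- (k + (k + 2)))) => s t t0 s0.
move: (qpow _ (moebius g tau)) (qpow _ (moebius g tau)) (qpow _ tau) (qpow _ tau).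
move: (ev om (moebius g tau)) (ev om tau) (ev (det2s b d) (moebius g tau)) (ev (det2s b d) tau) (_ - _).
move=> w' w n' n dt q1 q2 q3 q4 q10 q20 q30 q40 w'0 w0 h1 h2.
have key : n' * s * w = w' * t * n.
  apply: (@mulfI _ (q1 * q2)); first by rewrite mulf_neq0.
  transitivity ((s * (q1 * q2) * n') * w); first by ring.
  rewrite h2; transitivity ((dt * (q3 * q4) * w) * n); first by ring.
  by rewrite -h1; ring.
have -> : n' / w' = (n' * s * w) / (w' * s * w) by field; rewrite w'0 s0 w0.
by rewrite key; field; rewrite w'0 s0 w0.
Qed.

Variables (kz : int) (zeta : 'I_2 -> fps C).
Hypothesis hz : forall i, conv (zeta i).
Hypothesis lawz : fam_law rho nu kz zeta.
Hypothesis gz : forall i, cuspg (ev (zeta i)).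
Hypothesis z0 : exists i, zeta i != 0.

Let hDs i : conv (Dser i). Proof. exact: conv_Dk. Qed.

(* Cramer's rule: zeta = al f + be D f *)
Definition al : fps C := det2s zeta Dser * omV.
Definition be : fps C := det2s a zeta * omV.

Lemma zeta_decomp i : zeta i = al * a i + be * Dser i.
Proof.
have key (s : fps C) : om * omV * s = s by rewrite omK mul1r.
have h : zeta i * om = det2s zeta Dser * a i + det2s a zeta * Dser i.
  have [->|->] : i = 0 \/ i = 1 by case: i => -[|[|//]] hi; [left|right]; exact/val_inj.
    by rewrite /det2s /om; ring.
  by rewrite /det2s /om; ring.
rewrite -[LHS]key; have -> : om * omV * zeta i = zeta i * om * omV by ring.
by rewrite h /al /be; ring.
Qed.

Lemma conv_det (b d : 'I_2 -> fps C) : (forall i : 'I_2, conv (b i)) -> (forall i : 'I_2, conv (d i)) -> conv (det2s b d).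
Proof. by move=> hb hd; apply: convB; exact: convM. Qed.
Lemma conv_al : conv al. Proof. exact: convM (conv_det hz hDs) conv_omV. Qed.
Lemma conv_be : conv be. Proof. exact: convM (conv_det ha hz) conv_omV. Qed.

Lemma wt_al : wt_law (kz - k) al.
Proof.
have := om_law hz hDs lawz (law_D ha law); congr (wt_law _ _); ring.
Qed.
Lemma wt_be : wt_law (kz - k - 2) be.
Proof.
have := om_law ha hz law lawz; congr (wt_law _ _); ring.
Qed.

Lemma even_wt : exists m : int, kz - k = m * 2.
Proof.
have [al0|/eqP al0] := pselect (al = 0); last exact: (wt_even conv_al wt_al al0).
have [be0|/eqP be0] := pselect (be = 0).
  have [i /eqP zi] := z0; case: zi; by rewrite zeta_decomp al0 be0 !mul0r addr0.
have [m hm] := wt_even conv_be wt_be be0; exists (m + 1); lia.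
Qed.

Lemma id2 : fcst c0 * e4g4y R = fcst c0 * (u64 R ^+ 2 * u256 R).
Proof. exact: (e4g4y_id ode ha a_0 l01 law). Qed.
Lemma he4 : fcst c0 * (u64 R * e4) = fcst c0 * (u256 R * gs ^+ 2).
Proof. exact: (e4_gs (g6y_id R) id2). Qed.

Lemma cuspg_ev_mul (b d : fps C) : conv b -> conv d -> cuspg (ev b) -> cuspg (ev d) -> cuspg (ev (b * d)).
Proof.
move=> hb hd h1 h2; apply: (@eq_cuspg _ (fun t => ev b t * ev d t)); last exact: cuspgM.
by move=> tau ht; rewrite evM.
Qed.
Lemma cuspg_ev_X (b : fps C) n : conv b -> cuspg (ev b) -> cuspg (ev (b ^+ n)).
Proof.
move=> hb h; elim: n => [|n IH].
  apply: (@eq_cuspg _ (fun=> 1)); last exact: cuspg_cst.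
  by move=> tau ht; rewrite expr0 ev1.
by rewrite exprS; apply: cuspg_ev_mul => //; exact: convX.
Qed.
Lemma cuspg_ev_sub (b d : fps C) : conv b -> conv d -> cuspg (ev b) -> cuspg (ev d) -> cuspg (ev (b - d)).
Proof.
move=> hb hd h1 h2; apply: (@eq_cuspg _ (fun t => ev b t + (-1) * ev d t)).
  by move=> tau ht; rewrite evB // mulN1r.
by apply: cuspgD => //; apply: cuspgM => //; exact: cuspg_cst.
Qed.

Lemma cuspg_a i : cuspg (ev (a i)) /\ cuspg (ev (Dser i)).
Proof.
have hb : conv (phiV k * a i) by apply: convM => //; exact: conv_phiV.
have hT : conv (Tl (l i) (phiV k * a i)) by apply: convD; [exact: conv_theta|exact: convZ].
have [h1 h2] := cuspg_system (reduced_ode (ode i)) hb he4.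
have aE : a i = phi k * (phiV k * a i) by rewrite mulrA phiK mul1r.
have DE : Dser i = phi k * Tl (l i) (phiV k * a i) by rewrite /Dser {1}aE Dk_phi.
split; first by rewrite aE; apply: cuspg_ev_mul h1 => //; [exact: conv_phi|exact: cuspg_phi].
by rewrite DE; apply: cuspg_ev_mul h2 => //; [exact: conv_phi|exact: cuspg_phi].
Qed.
Lemma cuspg_omV : cuspg (ev omV).
Proof.
have h1 := conv_phiV (R := R) k; have h2 := conv_fexp (convN conv_pp).
have h3 : conv (phiV k ^+ 2) by exact: convX.
apply: (@eq_cuspg _ (fun t => (l 1 - l 0)^-1 * (ev (phiV k ^+ 2) t * ev (fexp (- pp)) t))).
  by move=> tau ht; rewrite /omV evZ ?evM //; exact: convM.
apply: cuspgM; first exact: cuspg_cst.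
apply: cuspgM; first by apply: cuspg_ev_X => //; exact: cuspg_phiV.
apply: cuspg_fexp; first by apply: cuspw2N; exact: cuspw2_pp.
by rewrite foppE pp0 oppr0.
Qed.
Lemma cuspg_det (b d : 'I_2 -> fps C) : (forall i : 'I_2, conv (b i)) -> (forall i : 'I_2, conv (d i)) ->
  (forall i : 'I_2, cuspg (ev (b i))) -> (forall i : 'I_2, cuspg (ev (d i))) -> cuspg (ev (det2s b d)).
Proof.
by move=> hb hd gb gd; apply: cuspg_ev_sub; [exact: convM|exact: convM|apply: cuspg_ev_mul|apply: cuspg_ev_mul].
Qed.
Lemma cuspg_al : cuspg (ev al).
Proof.
apply: cuspg_ev_mul; [exact: conv_det|exact: conv_omV| |exact: cuspg_omV].
by apply: cuspg_det => // i; have [] := cuspg_a i.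
Qed.
Lemma cuspg_be : cuspg (ev be).
Proof.
apply: cuspg_ev_mul; [exact: conv_det|exact: conv_omV| |exact: cuspg_omV].
by apply: cuspg_det => // i; have [] := cuspg_a i.
Qed.
Lemma cuspg_ys : cuspg (ev ys).
Proof.
apply: cuspg_fexp; last exact: ysB0.
exact: (cuspw2D (@cuspw2_gs R) (cuspw2N (@cuspw2_e2 R))).
Qed.
Lemma cuspg_gs : cuspg (ev gs).
Proof.
have [K K0 hK] := gs_cusp0 R; exists (K * 5), 2; split=> // [|w hw hr]; first by rewrite mulr_ge0 // ltW.
apply: le_trans (hK w hw) _; rewrite mulrC -mulrA ler_pM2l //; apply: le_trans (nm_strip hw hr) _.
rewrite ler_pM2l //; have -> : expR (2 * im w) = expR (im w) ^+ 2 by rewrite -expRM_natl.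
by rewrite lerXn2r ?nnegrE ?expR_ge0 ?le_expR //; lra.
Qed.

Lemma hauptmodul_decomp : exists (i s n : nat) (P1 P2 : fps C),
  [/\ deg_le n P1, deg_le n P2, al * gs ^+ i * ys ^+ s = fcomp xs P1 &
      be * gs ^+ i.+1 * ys ^+ s = fcomp xs P2].
Proof.
(* The weights are 2m for [al] and 2m - 2 for [be]; G^i ys^s adds 2i - 12s. Hence i = 6s - m, one
   more G for [be], and s = |m| makes i nonnegative. *)
have [m hm] := even_wt; pose s := `|m|%N; pose i := absz (6 * s%:Z - m)%R.
have iE : i%:Z = 6 * s%:Z - m by rewrite /i /s; lia.
have cg := conv_gs (R := R); have cy := conv_ys (R := R); have ca := conv_al; have cb := conv_be.
have c1 : conv (al * gs ^+ i) by apply: convM => //; exact: convX.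
have c2 : conv (ys ^+ s) by exact: convX.
have c3 : conv (be * gs ^+ i.+1) by apply: convM => //; exact: convX.
have [n1 b1] : exists n, cusp0_bound n (al * gs ^+ i * ys ^+ s).
  apply: cuspg_bound; apply: cuspg_ev_mul => //; last by apply: cuspg_ev_X => //; exact: cuspg_ys.
  apply: cuspg_ev_mul => //; [exact: convX|exact: cuspg_al|].
  by apply: cuspg_ev_X => //; exact: cuspg_gs.
have [n2 b2] : exists n, cusp0_bound n (be * gs ^+ i.+1 * ys ^+ s).
  apply: cuspg_bound; apply: cuspg_ev_mul => //; last by apply: cuspg_ev_X => //; exact: cuspg_ys.
  apply: cuspg_ev_mul => //; [exact: convX|exact: cuspg_be|].
  by apply: cuspg_ev_X => //; exact: cuspg_gs.
have w1 : wt_law 0 (al * gs ^+ i * ys ^+ s).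
  have := wt_lawM c1 c2 (wt_lawM ca (convX i cg) wt_al (wt_lawX i cg wt_law_gs)) (wt_lawX s cy wt_law_ys).
  by congr (wt_law _ _); rewrite hm iE; ring.
have w2 : wt_law 0 (be * gs ^+ i.+1 * ys ^+ s).
  have := wt_lawM c3 c2 (wt_lawM cb (convX i.+1 cg) wt_be (wt_lawX i.+1 cg wt_law_gs)) (wt_lawX s cy wt_law_ys).
  congr (wt_law _ _); have -> : Posz i.+1 = Posz i + 1 by rewrite -addn1 PoszD.
  by rewrite hm iE; ring.
have [P1 [d1 E1]] := poly_in_hauptmodul (convM c1 c2) (wt_law0 w1) b1.
have [P2 [d2 E2]] := poly_in_hauptmodul (convM c3 c2) (wt_law0 w2) b2.
exists i, s, (n1 + n2)%N, P1, P2; split => // j hj.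
  by apply: d1; apply: leq_ltn_trans hj; exact: leq_addr.
by apply: d2; apply: leq_ltn_trans hj; exact: leq_addl.
Qed.

(** Here D F contributes one factor G per component, which completes the power i + 1 required by
    [be]. *)
Lemma component_decomp (i s : nat) (P1 P2 : fps C) (gam : 'I_2 -> fps C) j :
  al * gs ^+ i * ys ^+ s = fcomp xs P1 -> be * gs ^+ i.+1 * ys ^+ s = fcomp xs P2 ->
  phiV k * a j * psiV (l j) = fcomp xs (gam j) ->
  zeta j * gs ^+ i * ys ^+ s * (phiV k * psiV (l j))
    = fcomp xs (P1 * gam j + P2 * (theta (gam j) + fcst (l j) * gam j)).
Proof.
move=> E1 E2 gE; have x0 := xs_0 R.
have aE := aE gE; have TE := Tb gE.
have DE : Dser j = phi k * (psi (l j) * (gs * fcomp xs (theta (gam j) + fcst (l j) * gam j))).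
  rewrite -TE /Dser; have {1}-> : a j = phi k * (phiV k * a j) by rewrite mulrA phiK mul1r.
  exact: Dk_phi.
rewrite fcompD // !fcompM // -E1 -E2 zeta_decomp DE {1}aE.
have h1 := phiK R k; have h2 := psiK (l j).
move: (fcomp xs (gam j)) (fcomp xs (theta (gam j) + _)) => G D.
transitivity ((phi k * phiV k) * (psi (l j) * psiV (l j)) * (al * gs ^+ i * ys ^+ s * G + be * gs ^+ i.+1 * ys ^+ s * D)).
  by rewrite [gs ^+ i.+1]exprS; ring.
by rewrite h1 h2 !mul1r.
Qed.
End Two.
End Decomposition.

(** * Integrality at inert primes *)
Section Arithmetic.
Variable R : realType.
Local Notation C := (CC R).
Implicit Types (x y z : C).
Variables (M : int) (sq : C).
Hypothesis sqE : sq ^+ 2 = M%:~R.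

(** Elements of Q(sqrt M) over a positive denominator; no uniqueness of a, b, d is implied. *)
Definition LL x : Prop := exists (a b : int) (d : nat),
  (0 < d)%N /\ x = (a%:~R + b%:~R * sq) / d%:R.
Definition nonres (p : nat) : Prop := ~ exists x : int, (x ^+ 2 = M %[mod p%:Z])%Z.

(** If p did not divide b, then a / b would be a square root of M modulo p. *)
Lemma nonres_norm p (a b : int) : prime p -> nonres p ->
  (p%:Z %| a ^+ 2 - M * b ^+ 2)%Z -> (p%:Z %| a)%Z /\ (p%:Z %| b)%Z.
Proof.
move=> pp nr h; have [pb|pb] := boolP (p%:Z %| b)%Z.
  split=> //; have : (p%:Z %| a ^+ 2)%Z.
    rewrite -[a ^+ 2](subrK (M * b ^+ 2)); apply: rpredD => //.
    by rewrite dvdz_mull // expr2 dvdz_mulr.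
  by rewrite !dvdzE /= abszX Euclid_dvdX // andbT.
case: nr; have /coprimezP[[x y] /= e] : coprimez b p%:Z.
  by rewrite coprimez_sym coprimezE /= prime_coprime // -dvdzE.
exists (a * x); apply/eqP; rewrite eqz_mod_dvd.
have -> : (a * x) ^+ 2 - M = x ^+ 2 * (a ^+ 2 - M * b ^+ 2) + M * ((x * b) ^+ 2 - 1) by ring.
apply: rpredD; first exact: dvdz_mull.
apply: dvdz_mull; have -> : x * b = 1 - y * p%:Z by rewrite -e addrK.
have -> : (1 - y * p%:Z) ^+ 2 - 1 = (y * (y * p%:Z - 2)) * p%:Z by ring.
exact: dvdz_mull.
Qed.

(** Infinite descent by division by p. One inert prime thus already shows that sqrt M is
    irrational. *)
Lemma norm_neq0 p (a b : int) : prime p -> nonres p ->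
  a ^+ 2 = M * b ^+ 2 -> a = 0 /\ b = 0.
Proof.
move=> pp nr; have [n] := ubnP (absz a + absz b); elim: n a b => // n IH a b hn e.
have [a0|a0] := eqVneq a 0.
  split=> //; move: e; rewrite a0 expr0n /= => /esym/eqP; rewrite mulf_eq0 expf_eq0 /=.
  case/orP => /eqP // M0; case: nr; exists 0; by rewrite M0.
have : (p%:Z %| a ^+ 2 - M * b ^+ 2)%Z by rewrite e subrr dvdz0.
case/(nonres_norm pp nr)=> /dvdzP[a' ea] /dvdzP[b' eb].
have p0 : p%:Z != 0 by have := prime_gt1 pp; lia.
have [] := IH a' b'.
- have := prime_gt1 pp; rewrite ea eb !abszM in hn *.
  have a'0 : (0 < absz a')%N by move: a0; rewrite ea mulf_eq0 => /norP[]; lia.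
  move: hn; rewrite !absz_nat; nia.
- apply: (@mulIf _ (p%:Z ^+ 2)); first by rewrite expf_neq0.
  by rewrite -exprMn -ea e eb; ring.
by move=> a1 b1; move: a0; rewrite ea a1 mul0r eqxx.
Qed.

Section Fixed.
Variable p : nat.
Hypothesis pp : prime p.
Hypothesis nr : nonres p.

(* For p inert in Q(sq), Op is a discrete valuation ring, with maximal ideal Ip and
   group of units Up. *)
Definition Op x : Prop := exists (a b : int) (d : nat),
  ~~ (p %| d)%N /\ x = (a%:~R + b%:~R * sq) / d%:R.
Definition Ip x : Prop := exists2 y, Op y & x = p%:R * y.
Definition Up x : Prop := Op x /\ exists2 y, Op y & x * y = 1.

Let p0 : p%:R != 0 :> C. Proof. by rewrite pnatr_eq0 -lt0n prime_gt0. Qed.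
Lemma ndvd_neq0 d : ~~ (p %| d)%N -> d%:R != 0 :> C.
Proof. by move=> h; rewrite pnatr_eq0; apply: contraNneq h => ->; rewrite dvdn0. Qed.
Lemma OpD x y : Op x -> Op y -> Op (x + y).
Proof.
move=> [a [b [d [hd ->]]]] [a' [b' [d' [hd' ->]]]].
exists (a * d'%:Z + a' * d%:Z), (b * d'%:Z + b' * d%:Z), (d * d')%N; split.
  by rewrite Euclid_dvdM // negb_or hd.
have := ndvd_neq0 hd; have := ndvd_neq0 hd'.
rewrite !intrD !intrM natrM -[(d%:Z)%:~R]/(d%:R : C) -[(d'%:Z)%:~R]/(d'%:R : C).
by move=> h1 h2; field; rewrite h1 h2.
Qed.
Lemma OpN x : Op x -> Op (- x).
Proof.
move=> [a [b [d [hd ->]]]]; exists (- a), (- b), d; split => //.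
by rewrite !mulrNz mulNr -opprD mulNr.
Qed.
Lemma OpB x y : Op x -> Op y -> Op (x - y).
Proof. by move=> hx hy; apply: OpD => //; exact: OpN. Qed.
Lemma OpM x y : Op x -> Op y -> Op (x * y).
Proof.
move=> [a [b [d [hd ->]]]] [a' [b' [d' [hd' ->]]]].
exists (a * a' + M * b * b'), (a * b' + a' * b), (d * d')%N; split.
  by rewrite Euclid_dvdM // negb_or hd.
have := ndvd_neq0 hd; have := ndvd_neq0 hd'.
rewrite !intrD !intrM natrM -sqE => h1 h2; field; by rewrite h1 h2.
Qed.
Lemma Op_int (n : int) : Op n%:~R.
Proof.
exists n, 0, 1%N; split; first by rewrite dvdn1 neq_ltn prime_gt1 ?orbT.
by rewrite mul0r addr0 divr1.
Qed.
Lemma Op_nat (n : nat) : Op n%:R. Proof. exact: (Op_int n). Qed.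
Lemma Op0 : Op 0. Proof. exact: (Op_int 0). Qed.
Lemma Op1 : Op 1. Proof. exact: (Op_int 1). Qed.
Lemma Op_sq : Op sq.
Proof.
exists 0, 1, 1%N; split; first by rewrite dvdn1 neq_ltn prime_gt1 ?orbT.
by rewrite add0r mul1r divr1.
Qed.
Lemma Op_invn (d : nat) : ~~ (p %| d)%N -> Op d%:R^-1.
Proof. by move=> hd; exists 1, 0, d; split => //; rewrite mul0r addr0 mul1r. Qed.
Lemma Op_invz (n : int) : ~~ (p%:Z %| n)%Z -> Op (n%:~R)^-1.
Proof.
rewrite dvdzE /= => h; have [e|e] : n = (absz n)%:Z \/ n = - (absz n)%:Z by lia.
  by rewrite e; exact: Op_invn.
by rewrite e mulrNz invrN; apply: OpN; exact: Op_invn.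
Qed.

Lemma Op_invp : ~ Op p%:R^-1.
Proof.
move=> [a [b [d [hd e]]]]; have d0 := ndvd_neq0 hd.
have e1 : d%:R - p%:R * a%:~R = p%:R * b%:~R * sq :> C.
  have -> : d%:R = (d%:R * p%:R) * p%:R^-1 :> C by rewrite (mulfK p0).
  by rewrite e; field.
have e2 : (d%:Z - p%:Z * a) ^+ 2 = M * (p%:Z * b) ^+ 2.
  apply: (@intr_inj C); rewrite !expr2 !intrM intrB !intrM.
  rewrite -[(d%:Z)%:~R]/(d%:R : C) -[(p%:Z)%:~R]/(p%:R : C) e1 -sqE; ring.
have [h _] := norm_neq0 pp nr e2; case/negP: hd.
have {}h : d%:Z = p%:Z * a by lia.
have : (p%:Z %| d%:Z)%Z by rewrite h dvdz_mulr.
by rewrite dvdzE.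
Qed.

Lemma norm_inv (a b : int) (d : nat) : ~~ (p%:Z %| a ^+ 2 - M * b ^+ 2)%Z -> (0 < d)%N ->
  (a%:~R + b%:~R * sq) / d%:R * (d%:R * ((a%:~R - b%:~R * sq) * ((a ^+ 2 - M * b ^+ 2)%:~R)^-1)) = 1 :> C.
Proof.
move=> h d0; have n0 : (a ^+ 2 - M * b ^+ 2)%:~R != 0 :> C.
  by rewrite intr_eq0; apply: contraNneq h => ->; rewrite dvdz0.
have d0' : d%:R != 0 :> C by rewrite pnatr_eq0 -lt0n.
apply: (mulIf n0); rewrite mul1r.
transitivity (a%:~R ^+ 2 - sq ^+ 2 * b%:~R ^+ 2 : C).
  by move: ((_ - _)%:~R : C) n0 => n n0; field; rewrite n0.
by rewrite sqE intrB intrM -!(rmorphXn (intr : int -> C)).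
Qed.

(** In a fraction with smallest denominator d, divisible by p, the integers a and b are not both
    divisible by p; so the norm is prime to p and 1/x is p times a p-integer. *)
Lemma val x : LL x -> ~ Op x -> exists2 y, Op y & x * (p%:R * y) = 1.
Proof.
move=> [a [b [d [d0 e]]]] nO.
pose Q d := `[< exists a b : int, (0 < d)%N /\ x = (a%:~R + b%:~R * sq) / d%:R >].
have exQ : exists d, Q d by exists d; apply/asboolP; exists a, b.
case: (ex_minnP exQ) => {}d /asboolP[{}a [{}b [{}d0 {}e]]] dmin.
have [hd|hd] := boolP (p %| d)%N; last by case: nO; exists a, b, d.
have [m ed] := dvdnP hd; have m0 : (0 < m)%N by move: d0; rewrite ed; case: (m).
have hn : ~~ (p%:Z %| a ^+ 2 - M * b ^+ 2)%Z.
  apply/negP => /(nonres_norm pp nr)[/dvdzP[a' ea] /dvdzP[b' eb]].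
  have : Q m.
    apply/asboolP; exists a', b'; split => //; rewrite e ea eb ed !intrM natrM.
    have m0' : m%:R != 0 :> C by rewrite pnatr_eq0 -lt0n.
    rewrite -[(p%:Z)%:~R]/(p%:R : C); field; by rewrite m0' p0.
  by move/dmin; rewrite ed; have := prime_gt1 pp; nia.
exists (m%:R * ((a%:~R - b%:~R * sq) * ((a ^+ 2 - M * b ^+ 2)%:~R)^-1)).
  apply: OpM; first exact: Op_nat.
  apply: OpM; last exact: Op_invz.
  by apply: OpB; [exact: Op_int|apply: OpM; [exact: Op_int|exact: Op_sq]].
transitivity (x * (d%:R * ((a%:~R - b%:~R * sq) * ((a ^+ 2 - M * b ^+ 2)%:~R)^-1))).
  by rewrite ed natrM; ring.
by rewrite e; exact: norm_inv.
Qed.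

Lemma Ip_Op x : Ip x -> Op x.
Proof. by move=> [y hy ->]; apply: OpM => //; exact: Op_nat. Qed.
Lemma IpD x y : Ip x -> Ip y -> Ip (x + y).
Proof. by move=> [x' hx ->] [y' hy ->]; exists (x' + y'); [exact: OpD|rewrite mulrDr]. Qed.
Lemma IpM x y : Op x -> Ip y -> Ip (x * y).
Proof. by move=> hx [y' hy ->]; exists (x * y'); [exact: OpM|rewrite mulrCA]. Qed.
Lemma IpN x : Ip x -> Ip (- x).
Proof. by move=> [x' hx ->]; exists (- x'); [exact: OpN|rewrite mulrN]. Qed.
Lemma Ip0 : Ip 0. Proof. by exists 0; [exact: Op0|rewrite mulr0]. Qed.
Lemma Ip_sum n (F : 'I_n -> C) : (forall i, Ip (F i)) -> Ip (\sum_i F i).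
Proof. by move=> h; elim/big_rec: _ => [|i x _ hx]; [exact: Ip0|exact: IpD]. Qed.
Lemma Ip_p x : Op x -> Ip (p%:R * x). Proof. by move=> hx; exists x. Qed.

Lemma Up_Ip x : Up x -> ~ Ip x.
Proof.
move=> [hx [y hy e]] [z hz e']; apply: Op_invp.
have -> : p%:R^-1 = z * y.
  by apply: (mulfI p0); rewrite mulfV // mulrA -e' e.
exact: OpM.
Qed.
Lemma UpM x y : Up x -> Up y -> Up (x * y).
Proof.
move=> [hx [x' hx' e]] [hy [y' hy' e']]; split; first exact: OpM.
by exists (x' * y'); [exact: OpM|rewrite mulrACA e e' mul1r].
Qed.
Lemma Up_div x y z : Up x -> Ip y -> x * z = y -> Ip z.
Proof.
move=> [hx [x' hx' e]] hy ez; have -> : z = x' * y by rewrite -ez mulrA [x' * x]mulrC e mul1r.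
exact: IpM.
Qed.
Lemma Up_divO x y z : Up x -> Op y -> x * z = y -> Op z.
Proof.
move=> [hx [x' hx' e]] hy ez; have -> : z = x' * y by rewrite -ez mulrA [x' * x]mulrC e mul1r.
exact: OpM.
Qed.
Lemma Up_divU x y z : Up x -> Up y -> x * z = y -> Up z.
Proof.
move=> [hx [x' hx' e]] hy ez; have -> : z = x' * y by rewrite -ez mulrA [x' * x]mulrC e mul1r.
by apply: UpM => //; split => //; exists x => //; rewrite mulrC.
Qed.
Lemma Up_int (n : int) : ~~ (p%:Z %| n)%Z -> Up n%:~R.
Proof.
move=> h; split; first exact: Op_int.
exists (n%:~R)^-1; first exact: Op_invz.
by rewrite divff // intr_eq0; apply: contraNneq h => ->; rewrite dvdz0.
Qed.
Lemma Up_nat (n : nat) : (0 < n < p)%N -> Up n%:R.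
Proof.
move=> /andP[n0 np]; apply: (Up_int (n := n)); rewrite dvdzE /=.
by rewrite gtnNdvd.
Qed.
Lemma Up1 : Up 1. Proof. by split; [exact: Op1|exists 1; [exact: Op1|rewrite mulr1]]. Qed.
Lemma UpV x : Up x -> Up x^-1.
Proof.
move=> hx; have [h1 [y hy e]] := hx; apply: (Up_divU hx Up1); rewrite divff //.
by apply: contra_eq_neq e => ->; rewrite mul0r eq_sym oner_neq0.
Qed.
Lemma UpN x : Up x -> Up (- x).
Proof. by move=> [hx [y hy e]]; split; [exact: OpN|exists (- y); [exact: OpN|rewrite mulrNN]]. Qed.

(** A valuation ring is integrally closed: otherwise 1/x lies in the maximal ideal, and the monic
    equation divided by the right power of x places 1 there. *)
Lemma integral_Op x : LL x -> integralOver (intr : int -> C) x -> Op x.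
Proof.
move=> hL [P Pm Px]; apply: contrapT => nO; have [y hy e] := val hL nO.
have y0 : y != 0 by apply: contra_eq_neq e => ->; rewrite !mulr0 eq_sym oner_neq0.
pose q := size P; have q0 : (0 < q)%N by rewrite lt0n size_poly_eq0 monic_neq0.
apply: (@Up_Ip 1 Up1); have : root (map_poly intr P) x := Px.
rewrite rootE horner_coef size_map_poly_id0; last first.
  by rewrite (monicP Pm) intr_eq0 oner_eq0.
rewrite -/q -(prednK q0) big_ord_recr /= => /eqP E.
have lead : (map_poly (intr : int -> C) P)`_q.-1 = 1.
  by rewrite coef_map /= -[_`_q.-1]/(lead_coef P) (monicP Pm).
rewrite lead mul1r in E.
have {E} : (p%:R * y) ^+ q.-1 * (\sum_(i < q.-1) (map_poly (intr : int -> C) P)`_i * x ^+ i + x ^+ q.-1) = 0.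
  by rewrite E mulr0.
rewrite mulrDr -exprMn [p%:R * y * x]mulrC e expr1n addrC => /eqP; rewrite addr_eq0 => /eqP ->.
apply: IpN; rewrite mulr_sumr; apply: Ip_sum => i.
have -> : (p%:R * y) ^+ q.-1 * ((map_poly (intr : int -> C) P)`_i * x ^+ i)
   = (map_poly (intr : int -> C) P)`_i * (p%:R * y) ^+ (q.-1 - i).-1 * (p%:R * y).
  rewrite -{1}(subnK (ltnW (ltn_ord i))) exprD -{1}(prednK (n := (q.-1 - i)%N)) ?subn_gt0 //.
  rewrite exprSr; have -> : forall c : C, (p%:R * y) ^+ (q.-1 - i).-1 * (p%:R * y) * (p%:R * y) ^+ i * (c * x ^+ i)
    = c * (p%:R * y) ^+ (q.-1 - i).-1 * (p%:R * y) * (x * (p%:R * y)) ^+ i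
    by move=> c; rewrite [(x * _) ^+ i]exprMn; move: (p%:R * y) => w; move: (w ^+ _) (w ^+ i) (x ^+ i) => w1 w2 w3; ring.
  by rewrite e expr1n mulr1.
have hpy : Op (p%:R * y) by apply: OpM => //; exact: Op_nat.
apply: IpM; last exact: Ip_p.
apply: OpM; first by rewrite coef_map; exact: Op_int.
by elim: (_.-1) => [|n IH]; [exact: Op1|rewrite exprS; exact: OpM].
Qed.
End Fixed.
End Arithmetic.

(** * The first denominators of the hypergeometric coefficients *)
(** Since v > 1 is prime to u, u/v is not an integer, and no factor n + u/v of the recurrences is
    zero. *)
Lemma uv_ndvd (u v n : int) : 1 < v -> coprimez u v -> n * v + u != 0.
Proof.
move=> v1 uv; apply/eqP => e; have : (v %| u)%Z by apply/dvdzP; exists (- n); lia.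
move=> h; have : (v %| gcdz u v)%Z by rewrite dvdz_gcd h dvdzz.
by move/eqP: uv => ->; rewrite dvdz1; lia.
Qed.

Section Hypergeometric.
Variable R : realType.
Local Notation C := (CC R).
Implicit Types (x y z : C).
Variables (M : int) (sq : C).
Hypothesis sqE : sq ^+ 2 = M%:~R.
Variable p : nat.
Hypothesis pp : prime p.
Hypothesis nr : nonres M p.
Hypothesis podd : odd p.
Local Notation Op := (Op sq p).
Local Notation Ip := (Ip sq p).
Local Notation Up := (Up sq p).
Variables (u v : int) (X Xb l0 l1 : C) (g g' P1 P2 : fps C) (j t : nat).
Let w : C := u%:~R / v%:~R.
Hypothesis v1 : 1 < v.
Hypothesis uv : coprimez u v.
Hypothesis l01 : l0 - l1 = w.
Hypothesis g_0 : g 0%N = 1.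
Hypothesis g_S : forall n, n.+1%:R * (n.+1%:R + w) * g n.+1 = - 64%:R * ((n%:R + X) * (n%:R + Xb)) * g n.
Hypothesis g'_0 : g' 0%N = 1.
Hypothesis g'_S : forall n, n.+1%:R * (n.+1%:R - w) * g' n.+1
  = - 64%:R * ((n%:R + (X - w)) * (n%:R + (Xb - w))) * g' n.
Hypothesis jv : j%:Z * v + u = p%:Z.
Hypothesis pbig : (2 * `|u| + v + (t%:Z + 2) * v < p%:Z)%R.
Hypothesis UX : forall m : nat, Up (m%:R + X).
Hypothesis UXb : forall m : nat, Up (m%:R + Xb).
Hypothesis Ol0 : Op l0.
Hypothesis Ol1 : Op l1.
Hypothesis OP1 : forall i, Op (P1 i).
Hypothesis OP2 : forall i, Op (P2 i).

Let p1 := prime_gt1 pp.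
Let v0 : v%:~R != 0 :> C. Proof. by rewrite intr_eq0; lia. Qed.
Let Uv : Up v%:~R.
Proof. by apply: Up_int => //; rewrite dvdzE /= gtnNdvd //; lia. Qed.
Let OD := @OpD R sq p pp. Let OM := OpM sqE pp. Let ON := @OpN R sq p. Let OB := @OpB R sq p pp.
Let On := Op_nat sq pp.
Let UM := UpM sqE pp.

(** The index t is that of a nonzero coefficient for the other component. As j + t < p, the factors
    n of the recurrence remain units throughout, and p enters only through n + u/v at n = j. *)
Lemma j_bounds : (0 < j)%N /\ (j + t < p)%N.
Proof.
have hj : (0 : int) < j%:Z by nia.
split; first by lia.
suff : j%:Z + t%:Z < p%:Z by lia.
nia.
Qed.
Lemma small_Up (n : int) : n != 0 -> `|n| < p%:Z -> Up n%:~R.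
Proof. by move=> n0 np; apply: Up_int => //; rewrite dvdzE /= gtnNdvd //; lia. Qed.

Lemma U64 : Up (- 64%:R).
Proof.
apply: UpN; have -> : 64%:R = 2%:R ^+ 6 :> C by ring.
have h2 : Up 2%:R by apply: Up_nat => //; move: podd p1; case: (p) => [|[|[|]]].
by rewrite !exprS expr0; repeat (apply: UM => //); exact: Up1.
Qed.

Lemma wE (n : int) : v%:~R * (n%:~R + w) = (n * v + u)%:~R :> C.
Proof. by rewrite /w intrD intrM; field. Qed.

(** For 0 < n < j the integer n v + u is nonzero and smaller than p in absolute value. *)
Lemma g_unit n : (n < j)%N -> Up (g n).
Proof.
have [j0 jt] := j_bounds.
elim: n => [|n IH] hn; first by rewrite g_0; exact: Up1.
have h1 : Up n.+1%:R by apply: Up_nat => //; lia.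
have h2 : Up (n.+1%:Z * v + u)%:~R.
  by apply: small_Up; [exact: (uv_ndvd _ v1 uv)|nia].
apply: (Up_divU sqE pp (UM h1 h2) (y := v%:~R * (- 64%:R * ((n%:R + X) * (n%:R + Xb)) * g n))).
  by apply: UM => //; apply: UM; [apply: UM; [exact: U64|exact: UM]|apply: IH; lia].
by rewrite -g_S -wE -[(n.+1%:Z)%:~R]/(n.+1%:R : C); ring.
Qed.

(** One factor p is cleared from index j on, and [pv] is the value p/v of n + u/v at n = j. *)
Let G s : C := p%:R * g (j + s)%N.
Let pv : C := p%:R / v%:~R.

Lemma jE : j%:R + w = pv.
Proof.
apply: (mulfI v0); rewrite (wE j) jv /pv mulrCA mulfV // mulr1; by [].
Qed.
Lemma Ipv : Ip pv.
Proof. by apply: Ip_p; have [] := UpV sqE pp Uv. Qed.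

Lemma G0_unit : Up (G 0%N).
Proof.
have [j0 jt] := j_bounds; rewrite /G addn0.
have h1 : Up j%:R by apply: Up_nat => //; lia.
apply: (Up_divU sqE pp h1 (y := v%:~R * (- 64%:R * ((j.-1%:R + X) * (j.-1%:R + Xb)) * g j.-1))).
  by apply: UM => //; apply: UM; [apply: UM; [exact: U64|exact: UM]|apply: g_unit; lia].
rewrite -g_S (prednK j0) jE /pv; by field.
Qed.

Let Ev s : C := G s - G 0%N * g' s.

Lemma G_rec s : (j + s.+1)%:R * (s.+1%:R + pv) * G s.+1
  = - 64%:R * ((s%:R + (X - w) + pv) * (s%:R + (Xb - w) + pv)) * G s.
Proof.
rewrite /G addnS; have := g_S (j + s)%N.
have e1 : (j + s).+1%:R + w = s.+1%:R + pv by rewrite -addn1 -(addn1 s) !natrD -jE; ring.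
have e2 : (j + s)%:R + X = s%:R + (X - w) + pv by rewrite natrD -jE; ring.
have e3 : (j + s)%:R + Xb = s%:R + (Xb - w) + pv by rewrite natrD -jE; ring.
by rewrite e1 e2 e3 => e; rewrite mulrCA e; ring.
Qed.

(** Modulo p, j is -w. Shifting the index by j therefore exchanges the two left factors n and n + w
    for n - w and n, and replaces X by X - w: the recurrence of G becomes that of g'. *)
Lemma G_congr s : (s <= t)%N -> Op (G s) /\ Ip (Ev s).
Proof.
have [j0 jt] := j_bounds; have [Opv Upv] := (Ip_Op sqE pp Ipv, Ipv).
have OX m : Op (m%:R + (X - w) + pv).
  have -> : m%:R + (X - w) + pv = (j + m)%:R + X by rewrite natrD -jE; ring.
  by have [] := UX (j + m).
have OXb m : Op (m%:R + (Xb - w) + pv).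
  have -> : m%:R + (Xb - w) + pv = (j + m)%:R + Xb by rewrite natrD -jE; ring.
  by have [] := UXb (j + m).
have Ow : Op w.
  apply: OM; first exact: Op_int.
  by have [] := UpV sqE pp Uv.
elim: s => [|s IH] st; first by split; [have [] := G0_unit|rewrite /Ev g'_0 mulr1 subrr; exact: Ip0].
have [OG IE] := IH (ltnW st).
have h1 : Up (j + s.+1)%:R by apply: Up_nat => //; lia.
have h2 : Up (s.+1%:Z * v + p%:Z)%:~R.
  apply: Up_int => //; rewrite rpredDr; last by rewrite dvdzz.
  by rewrite dvdzE /= gtnNdvd //; nia.
have OGS : Op (G s.+1).
  apply: (Up_divO sqE pp (UM h1 h2) (y := v%:~R * (- 64%:R * ((s%:R + (X - w) + pv) * (s%:R + (Xb - w) + pv)) * G s))).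
    apply: OM; first exact: Op_int.
    by apply: OM => //; apply: OM; [have [] := U64|exact: OM].
  rewrite -G_rec /pv intrD intrM -[(s.+1%:Z)%:~R]/(s.+1%:R : C) -[(p%:Z)%:~R]/(p%:R : C); by field.
split => //.
have h3 : Up (s.+1%:Z * v + (- u))%:~R.
  apply: small_Up; last nia.
  by apply/eqP => e; have := uv_ndvd (- s.+1%:Z) v1 uv; rewrite mulNr; lia.
have h4 : Up s.+1%:R by apply: Up_nat => //; lia.
have E1 : (j + s.+1)%:R = s.+1%:R - w + pv by rewrite natrD -jE; ring.
have vw : v%:~R * w = u%:~R by rewrite /w; field.
apply: (Up_div sqE pp (UM h4 h3) (y := v%:~R * (- 64%:R * ((s%:R + (X - w) + pv - pv) * (s%:R + (Xb - w) + pv - pv)) * Ev s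
   + (- 64%:R * ((s%:R + (X - w) + pv - pv) + (s%:R + (Xb - w) + pv - pv) + pv) * G s
      - (2%:R * s.+1%:R - w + pv) * G s.+1) * pv))).
  apply: (IpM sqE pp); first exact: Op_int.
  have O64 : Op (- 64%:R) by have [] := U64.
  apply: (IpD pp).
    by apply: (IpM sqE pp) => //; repeat (first [exact: OX|exact: OXb|exact: Opv|exact: O64|apply: OM|apply: OB]).
  apply: (IpM sqE pp); last exact: Ipv.
  apply: OB; first by repeat (first [exact: OX|exact: OXb|exact: Opv|exact: O64|exact: OG|apply: OM|apply: OB|apply: OD]).
  apply: OM => //; apply: OD => //; apply: OB => //; apply: OM; exact: On.
have := G_rec s; have := g'_S s; rewrite E1 intrD intrM mulrNz -vw /Ev -[(s.+1%:Z)%:~R]/(s.+1%:R : C).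
move: (s.+1%:R : C) (s%:R : C) (G s.+1) (G s) (g' s.+1) (g' s) (G 0%N) => N n a b c d U e1 e2.
transitivity (v%:~R * ((N * (N - w)) * a - U * (N * (N - w) * c))); first by ring.
have -> : (N * (N - w)) * a = (N - w + pv) * (N + pv) * a - pv * (2%:R * N - w + pv) * a by ring.
by rewrite e1 e2; ring.
Qed.

(** The x-series of a component of the form, when P1 and P2 are the polynomials of Cramer's rule and
    h is its hypergeometric series. *)
Definition Ysum (h : fps C) (l : C) : fps C := P1 * h + P2 * (theta h + fcst l * h).
Lemma YsumE h l n : Ysum h l n = \sum_(i < n.+1) (P1 i + P2 i * ((n - i)%N%:R + l)) * h (n - i)%N.
Proof.
rewrite /Ysum faddE !fmulEn -big_split; apply: eq_bigr => i _.
by rewrite faddE fcstME /theta /=; ring.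
Qed.

(* p g_(j+s) is congruent to (p g_j) g'_s modulo p, where p g_j is a unit; so the
   coefficient of index j + t in Ysum g is 1/p times a unit if the coefficient of
   index t in Ysum g' is a unit. *)
Lemma nonintegral : Up (Ysum g' l1 t) -> ~ Op (Ysum g l0 (j + t)%N).
Proof.
have [j0 jt] := j_bounds.
move=> hU hO; have := UM G0_unit hU => /(Up_Ip sqE pp nr); apply.
have IpY : Ip (p%:R * Ysum g l0 (j + t)%N) by exact: Ip_p.
have -> : G 0%N * Ysum g' l1 t = p%:R * Ysum g l0 (j + t)%N - (p%:R * Ysum g l0 (j + t)%N - G 0%N * Ysum g' l1 t).
  by rewrite opprB addrC subrK.
apply: (IpD pp) => //; apply: IpN; rewrite !YsumE.
rewrite (@sum_ord_nat _ (fun i => (P1 i + P2 i * ((j + t - i)%N%:R + l0)) * g (j + t - i)%N) t.+1 (j + t).+1) ?leq_addl //.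
  rewrite mulrDr !mulr_sumr addrAC -sumrB; apply: (IpD pp).
    apply: Ip_sum => // i; have hi : (i <= t)%N by rewrite -ltnS.
    have [OG IE] := G_congr (leq_subr i t).
    have e : (j + t - i = j + (t - i))%N by rewrite addnBA.
    rewrite e; have -> : p%:R * ((P1 i + P2 i * ((j + (t - i))%N%:R + l0)) * g (j + (t - i))%N)
       - G 0%N * ((P1 i + P2 i * ((t - i)%N%:R + l1)) * g' (t - i)%N)
      = (P1 i + P2 i * ((t - i)%N%:R + l1)) * Ev (t - i)%N + P2 i * G (t - i)%N * pv.
      rewrite /Ev /G -jE natrD -l01; ring.
    have Ot : Op (P1 i + P2 i * ((t - i)%N%:R + l1)).
      by apply: OD => //; apply: OM => //; apply: OD => //; exact: On.
    apply: (IpD pp); first exact: (IpM sqE pp).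
    by apply: (IpM sqE pp); [exact: OM|exact: Ipv].
  rewrite big_nat; elim/big_rec: _ => [|i x /andP[h1 h2] hx]; first exact: Ip0.
  apply: (IpD pp) => //; apply: Ip_p.
  apply: OM; last by have [] := @g_unit (j + t - i)%N ltac:(lia).
  by apply: OD => //; apply: OM => //; apply: OD => //; exact: On.
by rewrite ltnS leq_addl.
Qed.
End Hypergeometric.

(** * Denominators, and units at almost all inert primes *)

Section Eventually.
Variable R : realType.
Local Notation C := (CC R).
Implicit Types (x y z : C).
Variables (M : int) (sq : C).
Hypothesis sqE : sq ^+ 2 = M%:~R.
Local Notation LL := (LL sq).

Lemma LLD x y : LL x -> LL y -> LL (x + y).
Proof.
move=> [a [b [d [d0 ->]]]] [a' [b' [d' [d0' ->]]]].
exists (a * d'%:Z + a' * d%:Z), (b * d'%:Z + b' * d%:Z), (d * d')%N; split; first by rewrite muln_gt0 d0.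
have h1 : d%:R != 0 :> C by rewrite pnatr_eq0 -lt0n.
have h2 : d'%:R != 0 :> C by rewrite pnatr_eq0 -lt0n.
rewrite !intrD !intrM natrM -[(d%:Z)%:~R]/(d%:R : C) -[(d'%:Z)%:~R]/(d'%:R : C).
by field; rewrite h1 h2.
Qed.
Lemma LLN x : LL x -> LL (- x).
Proof.
move=> [a [b [d [hd ->]]]]; exists (- a), (- b), d; split => //.
by rewrite !mulrNz mulNr -opprD mulNr.
Qed.
Lemma LLM x y : LL x -> LL y -> LL (x * y).
Proof.
move=> [a [b [d [d0 ->]]]] [a' [b' [d' [d0' ->]]]].
exists (a * a' + M * b * b'), (a * b' + a' * b), (d * d')%N; split; first by rewrite muln_gt0 d0.
have h1 : d%:R != 0 :> C by rewrite pnatr_eq0 -lt0n.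
have h2 : d'%:R != 0 :> C by rewrite pnatr_eq0 -lt0n.
by rewrite !intrD !intrM natrM -sqE; field; rewrite h1 h2.
Qed.
Lemma LL_int (n : int) : LL n%:~R.
Proof. by exists n, 0, 1%N; split => //; rewrite mul0r addr0 divr1. Qed.
Lemma LL_nat (n : nat) : LL n%:R. Proof. exact: (LL_int n). Qed.
Lemma LL0 : LL 0. Proof. exact: (LL_int 0). Qed.
Lemma LL1 : LL 1. Proof. exact: (LL_int 1). Qed.
Lemma LL_sq : LL sq.
Proof. by exists 0, 1, 1%N; split => //; rewrite add0r mul1r divr1. Qed.
Lemma LL_rat (s : rat) : LL (ratr s).
Proof.
exists (numq s), 0, (absz (denq s)); split; first by rewrite absz_gt0 denq_neq0.
rewrite mul0r addr0 /ratr; congr (_ / _).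
by rewrite -[RHS]/(((absz (denq s))%:Z)%:~R) absz_denq.
Qed.

(** Rationalizing by the conjugate; the inert prime guarantees a nonzero norm, and [sg] keeps the
    denominator positive. *)
Lemma LLV p x : prime p -> nonres M p -> LL x -> LL x^-1.
Proof.
move=> pp nr [a [b [d [d0 ->]]]]; have [->|x0] := eqVneq (a%:~R + b%:~R * sq) 0.
  by rewrite mul0r invr0; exact: LL0.
have h1 : d%:R != 0 :> C by rewrite pnatr_eq0 -lt0n.
have n0 : (a ^+ 2 - M * b ^+ 2)%:~R != 0 :> C.
  rewrite intr_eq0 subr_eq0; apply: contraNneq x0 => /(norm_neq0 pp nr)[-> ->].
  by rewrite mul0r addr0.
have nE : (a ^+ 2 - M * b ^+ 2)%:~R = a%:~R ^+ 2 - sq ^+ 2 * b%:~R ^+ 2 :> C.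
  by rewrite sqE intrB intrM !(rmorphXn (intr : int -> C)).
pose n := a ^+ 2 - M * b ^+ 2; pose sg : int := if 0 <= n then 1 else -1.
have en : n = sg * (absz n)%:Z by rewrite /sg; case: ifP; lia.
have an0 : (0 < absz n)%N by rewrite absz_gt0 -(@intr_eq0 C).
exists (sg * d%:Z * a), (- (sg * d%:Z * b)), (absz n); split => //.
have eC : n%:~R = sg%:~R * (absz n)%:R :> C by rewrite {1}en intrM.
have sg2 : sg%:~R * sg%:~R = 1 :> C by rewrite -intrM /sg; case: ifP.
have a0 : (absz n)%:R != 0 :> C by rewrite pnatr_eq0 -lt0n.
have -> : ((absz n)%:R : C)^-1 = sg%:~R / n%:~R.
  rewrite eC; apply: (mulfI a0); rewrite mulfV // invfM mulrCA.
  have s0 : sg%:~R != 0 :> C by apply: contra_eq_neq sg2 => ->; rewrite mul0r eq_sym oner_neq0.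
  by field; rewrite a0 s0.
rewrite mulrNz !intrM -[(d%:Z)%:~R]/(d%:R : C).
rewrite -/n in n0 nE.
apply: (mulIf n0); rewrite invfM invrK {1}nE.
transitivity ((sg%:~R * sg%:~R) * (d%:R * (a%:~R - b%:~R * sq)) : C); last by field.
by rewrite sg2; field.
Qed.

Lemma algint_sq : algint sq.
Proof.
exists ('X^2 - M%:P); first exact: (monicXnsubC _ (n := 2)).
by rewrite rmorphB /= map_polyXn map_polyC /= /root hornerD hornerN hornerC hornerXn sqE subrr.
Qed.
Lemma algint_int (n : int) : algint (n%:~R : C). Proof. exact: integral_id. Qed.

Lemma denominator_ex x : LL x -> exists N, is_denominator x N.
Proof.
move=> [a [b [d [d0 e]]]].
have exN : exists N, `[< (0 < N)%N /\ algint (N%:R * x) >].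
  exists d; apply/asboolP; split => //; have d0' : d%:R != 0 :> C by rewrite pnatr_eq0 -lt0n.
  rewrite e mulrCA mulfV // mulr1; apply: integral_add; first exact: algint_int.
  by apply: integral_mul; [exact: algint_int|exact: algint_sq].
case: (ex_minnP exN) => N /asboolP[N0 hN] Nmin; exists N; split => // N' N'0 hN'.
by apply: Nmin; apply/asboolP.
Qed.

(** If p did not divide N, then x, the quotient of the algebraic integer N x by N, would be
    p-integral. *)
Lemma denominator_dvd p x N : prime p -> nonres M p -> LL x -> ~ Op sq p x ->
  is_denominator x N -> (p %| N)%N.
Proof.
move=> pp nr hx nO [N0 hN _]; apply: contraT => pN; case: nO.
have hNx : LL (N%:R * x) by apply: LLM => //; exact: LL_nat.
have := integral_Op sqE pp nr hNx hN => hO.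
have N0' : N%:R != 0 :> C by rewrite pnatr_eq0 -lt0n.
rewrite -[x](mulKf N0'); apply: (OpM sqE pp) => //; exact: Op_invn.
Qed.

Definition ev_p (Q : nat -> Prop) : Prop := exists P : nat, forall p, prime p -> nonres M p -> (P < p)%N -> Q p.
Lemma ev_pI Q Q' : ev_p Q -> ev_p Q' -> ev_p (fun p => Q p /\ Q' p).
Proof.
move=> [P h] [P' h']; exists (maxn P P') => p pp nr; rewrite gtn_max => /andP[h1 h2].
by split; [exact: h|exact: h'].
Qed.
Lemma ev_Op x : LL x -> ev_p (fun p => Op sq p x).
Proof.
move=> [a [b [d [d0 e]]]]; exists d => p pp nr dp; exists a, b, d; split => //.
by rewrite gtnNdvd.
Qed.
Lemma ndvd_big p (n : int) : n != 0 -> (absz n < p)%N -> ~~ (p%:Z %| n)%Z.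
Proof. by move=> n0 np; rewrite dvdzE /= gtnNdvd // absz_gt0. Qed.

Lemma norm_Up p (a b : int) (d : nat) : prime p -> nonres M p -> (0 < d < p)%N ->
  ~~ (p%:Z %| b)%Z \/ ~~ (p%:Z %| a)%Z -> Up sq p ((a%:~R + b%:~R * sq) / d%:R).
Proof.
move=> pp nr /andP[d0 dp] hb; have hn : ~~ (p%:Z %| a ^+ 2 - M * b ^+ 2)%Z.
  by apply/negP => /(nonres_norm pp nr)[h1 h2]; case: hb => /negP; apply.
split; first by exists a, b, d; split => //; rewrite gtnNdvd.
exists (d%:R * ((a%:~R - b%:~R * sq) * ((a ^+ 2 - M * b ^+ 2)%:~R)^-1)).
  apply: (OpM sqE pp); first exact: Op_nat.
  apply: (OpM sqE pp); last exact: Op_invz.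
  by apply: (OpB pp); [exact: Op_int|apply: (OpM sqE pp); [exact: Op_int|exact: Op_sq]].
exact: (norm_inv sqE hn d0).
Qed.
Lemma ev_Up x : LL x -> x != 0 -> ev_p (fun p => Up sq p x).
Proof.
move=> [a [b [d [d0 e]]]] x0; exists (absz a + absz b + d)%N => p pp nr hp; rewrite e.
apply: norm_Up => //; first by apply/andP; split => //; lia.
have [b0|b0] := eqVneq b 0; last by left; apply: ndvd_big => //; lia.
right; apply: ndvd_big; last lia.
by apply: contraNneq x0 => a0; rewrite e a0 b0 mul0r addr0 mul0r.
Qed.

Definition irr x : Prop := exists (a b : int) (d : nat),
  [/\ (0 < d)%N, b != 0 & x = (a%:~R + b%:~R * sq) / d%:R].
(** One bound on p works for all m: adding an integer leaves b unchanged, and p > |b| does not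
    divide it, hence does not divide the norm. This is where r must be irrational. *)
Lemma ev_irr x : irr x -> ev_p (fun p => forall m : nat, Up sq p (m%:R + x)).
Proof.
move=> [a [b [d [d0 b0 e]]]]; exists (absz b + d)%N => p pp nr hp m.
have d0' : d%:R != 0 :> C by rewrite pnatr_eq0 -lt0n.
have -> : m%:R + x = ((m%:Z * d%:Z + a)%:~R + b%:~R * sq) / d%:R.
  rewrite intrD intrM e -[(d%:Z)%:~R]/(d%:R : C) -[(m%:Z)%:~R]/(m%:R : C); by field.
apply: norm_Up => //; first by apply/andP; split => //; lia.
by left; apply: ndvd_big => //; lia.
Qed.
Lemma ev_coefs (n : nat) (P : fps C) : deg_le n P -> (forall i, LL (P i)) ->
  ev_p (fun p => forall i, Op sq p (P i)).
Proof.
move=> hd hL; suff [B hB] : ev_p (fun p => forall i, (i < n.+1)%N -> Op sq p (P i)).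
  exists B => p pp nr hp i; have [h|h] := ltnP i n.+1; first exact: hB.
  by rewrite hd //; exact: Op0.
elim: n.+1 => [|m [B hB]]; first by exists 0%N.
have [B' hB'] := ev_Op (hL m); exists (maxn B B') => p pp nr; rewrite gtn_max => /andP[h1 h2] i.
rewrite ltnS leq_eqVlt => /orP[/eqP ->|hi]; [exact: hB'|exact: hB].
Qed.
Lemma irr_addrat x y : irr x -> (exists s : rat, y = ratr s) -> irr (y + x).
Proof.
move=> [a [b [d [d0 b0 ->]]]] [s ->].
have d0' : d%:R != 0 :> C by rewrite pnatr_eq0 -lt0n.
pose d' := absz (denq s); have h' : (0 < d')%N by rewrite absz_gt0 denq_neq0.
have h'' : d'%:R != 0 :> C by rewrite pnatr_eq0 -lt0n.
exists (numq s * d%:Z + a * d'%:Z), (b * d'%:Z), (d * d')%N; split.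
- by rewrite muln_gt0 d0.
- by rewrite mulf_neq0 //; lia.
have -> : ratr s = (numq s)%:~R / d'%:R :> C.
  by rewrite /ratr; congr (_ / _); rewrite -[RHS]/((d'%:Z)%:~R) /d' absz_denq.
rewrite intrD !intrM natrM -[(d%:Z)%:~R]/(d%:R : C) -[(d'%:Z)%:~R]/(d'%:R : C).
by field; rewrite d0' h''.
Qed.
Lemma irrN x : irr x -> irr (- x).
Proof.
move=> [a [b [d [d0 b0 ->]]]]; exists (- a), (- b), d; split => //; first by rewrite oppr_eq0.
by rewrite !mulrNz mulNr -opprD mulNr.
Qed.
Lemma irr_LL x : irr x -> LL x.
Proof. by move=> [a [b [d [d0 b0 ->]]]]; exists a, b, d. Qed.

Lemma Qadj_LL p : prime p -> nonres M p -> forall x, Qadj sq x -> LL x.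
Proof.
move=> pp nr; have key (P : {poly rat}) : LL (map_poly ratr P).[sq].
  elim/poly_ind: P => [|P c IH]; first by rewrite map_poly0 horner0; exact: LL0.
  rewrite rmorphD rmorphM /= map_polyX map_polyC hornerMXaddC.
  by apply: LLD; [apply: LLM => //; exact: LL_sq|exact: LL_rat].
by move=> x [P [D [_ ->]]]; apply: LLM => //; exact: (LLV pp nr).
Qed.

Lemma Qadj_self z : Qadj z z.
Proof.
by exists 'X, 1; rewrite map_polyX rmorph1 hornerX hornerC oner_neq0 divr1.
Qed.
Lemma Qadj_rat (s : rat) x : Qadj (ratr s) x -> exists q : rat, x = ratr q.
Proof.
move=> [P [D [_ ->]]]; exists (P.[s] / D.[s]).
by rewrite !horner_map /= fmorph_div.
Qed.
(** With b = 0 both basis vectors would be rational numbers q0 and q1, related by q1 e0 - q0 e1 =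
    0. *)
Lemma Qdim2_irr r : LL r -> Qdim (Qadj r) 2 -> irr r.
Proof.
move=> [a [b [d [d0 e]]]] [ee [h1 h2]]; exists a, b, d; split => //.
apply/eqP => b0; have rE : r = ratr (a%:~R / d%:R).
  by rewrite e b0 mul0r addr0 fmorph_div rmorph_int rmorph_nat.
have two (F : 'I_2 -> C) : \sum_(i < 2) F i = F 0 + F 1.
  by rewrite !big_ord_recl big_ord0 addr0; congr (F _ + F _); exact/val_inj.
have inQ (i : 'I_2) : exists q : rat, ee i = ratr q.
  apply: (@Qadj_rat (a%:~R / d%:R)); rewrite -rE; apply/h1; exists (\row_j (j == i)%:R).
  rewrite (bigD1 i) //= mxE eqxx rmorph1 mul1r big1 ?addr0 // => j ji.
  by rewrite mxE (negbTE ji) rmorph0 mul0r.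
have [q0 e0] := inQ 0; have [q1 e1] := inQ 1.
have z0 : \sum_(i < 2) ratr ((0 : 'rV[rat]_2) 0 i) * ee i = 0.
  by rewrite big1 // => i _; rewrite mxE rmorph0 mul0r.
have h3 : \row_(j < 2) (if j == 0 then q1 else - q0) = 0.
  by apply: h2; rewrite z0 two !mxE /= e0 e1 rmorphN; ring.
have h := (fun j => congr1 (fun s : 'rV[rat]_2 => s 0 j) h3); have := h 0; have := h 1; rewrite !mxE /= => /eqP; rewrite oppr_eq0 => /eqP q00 q10.
have h4 : \row_(j < 2) (j == 0)%:R = 0 :> 'rV[rat]_2.
  by apply: h2; rewrite z0 two !mxE /= e0 e1 q00 q10 rmorph0 !mulr0 addr0.
by have := congr1 (fun s : 'rV[rat]_2 => s 0 0) h4; rewrite !mxE /= => /eqP; rewrite oner_eq0.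
Qed.
End Eventually.

(** * From q-series to x-series at a large inert prime *)

Section PIntegral.
Variable R : realType.
Local Notation C := (CC R).
Local Notation e2 := (e2 R).
Local Notation xs := (xs R).
Local Notation ys := (ys R).
Local Notation gs := (gs R).
Local Notation phiV := (phiV R).
Variables (M : int) (sq : C).
Hypothesis sqE : sq ^+ 2 = M%:~R.

Section FixedPrime.
Variable p : nat.
Hypothesis pp : prime p.
Local Notation Op := (Op sq p).
Local Notation fi := (fint Op p).
Let O0 := Op0 sq pp. Let O1 := Op1 sq pp. Let OD := @OpD R sq p pp. Let ON := @OpN R sq p. Let OM := OpM sqE pp.

Lemma fi_M (a b : fps C) : fi a -> fi b -> fi (a * b). Proof. exact: fintM. Qed.
Lemma fi_D (a b : fps C) : fi a -> fi b -> fi (a + b). Proof. exact: fintD. Qed.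
Lemma fi_N (a : fps C) : fi a -> fi (- a). Proof. exact: fintN. Qed.
Lemma fi_X (a : fps C) n : fi a -> fi (a ^+ n). Proof. exact: fintX. Qed.
Lemma fi_cst x : Op x -> fi (fcst x). Proof. exact: fint_cst. Qed.
Lemma fi_1 : fi 1. Proof. exact: (fi_cst O1). Qed.
Lemma fi_fX : fi (fX C). Proof. by move=> [|[|n]] _; rewrite /fX //=. Qed.
Lemma fi_exp (a : fps C) : fi a -> fi (fexp a).
Proof.
apply: fint_exp => // n hn; apply: Op_invn => //; by rewrite gtnNdvd.
Qed.
Lemma fi_e2 : fi e2.
Proof.
move=> [|n] _; first exact: O1.
by rewrite /e2 /=; apply: OM; [apply: ON; exact: Op_nat|exact: Op_nat].
Qed.
Lemma fi_gs : fi gs.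
Proof.
apply: fi_D; first by apply: fi_N; exact: fi_e2.
apply: fi_M; first by rewrite -fcst_nat; apply: fi_cst; exact: Op_nat.
move=> n hn; rewrite /dbl; case: ifP => _ //; apply: fi_e2.
by have := odd_double_half n; rewrite -addnn; lia.
Qed.
Lemma fi_xs : fi xs.
Proof.
apply: fi_M; first exact: fi_fX.
by apply: fi_exp; apply: fi_D; [exact: fi_gs|apply: fi_N; exact: fi_1].
Qed.
Lemma fi_ys : fi ys.
Proof. by apply: fi_exp; apply: fi_D; [exact: fi_gs|apply: fi_N; exact: fi_e2]. Qed.
Lemma fi_phiV k : Op (k%:~R / 12%:R) -> fi (phiV k).
Proof.
move=> h; apply: fi_exp; apply: fi_N; apply: fi_M; first exact: fi_cst.
by apply: fi_D; [exact: fi_e2|apply: fi_N; exact: fi_1].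
Qed.
Lemma fi_psiV l : Op l -> fi (psiV l).
Proof.
move=> h; apply: fi_exp; apply: fi_N; apply: fi_M; first exact: fi_cst.
by apply: fi_D; [exact: fi_gs|apply: fi_N; exact: fi_1].
Qed.
End FixedPrime.

Section Component.
Variables (u v : int) (l0 l1 r rb : C) (g g' P1 P2 zeta : fps C) (k : int) (i s n : nat) (p0 : nat).
Hypothesis pp0 : prime p0.
Hypothesis nr0 : nonres M p0.
Hypothesis v1 : 1 < v.
Hypothesis uv : coprimez u v.
Hypothesis l01 : l0 - l1 = u%:~R / v%:~R.
Hypothesis l0_rat : exists q : rat, l0 = ratr q.
Hypothesis l1_rat : exists q : rat, l1 = ratr q.
Hypothesis r_irr : irr sq r.
Hypothesis rb_irr : irr sq rb.
Hypothesis g_0 : g 0%N = 1.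
Hypothesis g_S : forall m, m.+1%:R * (m.+1%:R + (l0 - l1)) * g m.+1
  = - 64%:R * ((m%:R + (l0 + r)) * (m%:R + (l0 + rb))) * g m.
Hypothesis g'_0 : g' 0%N = 1.
Hypothesis g'_S : forall m, m.+1%:R * (m.+1%:R + (l1 - l0)) * g' m.+1
  = - 64%:R * ((m%:R + (l1 + r)) * (m%:R + (l1 + rb))) * g' m.
Let v0 : v%:~R != 0 :> C. Proof. by rewrite intr_eq0; lia. Qed.

Lemma LL_g' m : LL sq (g' m).
Proof.
have Ll0 : LL sq l0 by have [q ->] := l0_rat; exact: LL_rat.
have Ll1 : LL sq l1 by have [q ->] := l1_rat; exact: LL_rat.
have Lr := irr_LL r_irr; have Lrb := irr_LL rb_irr.
elim: m => [|m IH]; first by rewrite g'_0; exact: LL1.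
have h1 : m.+1%:R != 0 :> C by rewrite pnatr_eq0.
have h2 : m.+1%:R + (l1 - l0) != 0 :> C.
  have -> : m.+1%:R + (l1 - l0) = (m.+1%:Z * v - u)%:~R / v%:~R :> C.
    by rewrite -opprB l01 intrB intrM -[(m.+1%:Z)%:~R]/(m.+1%:R : C); field.
  rewrite mulf_neq0 ?invr_eq0 // intr_eq0.
  by have := uv_ndvd (- m.+1%:Z) v1 uv; apply: contraNneq => e; rewrite mulNr; lia.
have -> : g' m.+1 = - 64%:R * ((m%:R + (l1 + r)) * (m%:R + (l1 + rb))) * g' m * (m.+1%:R * (m.+1%:R + (l1 - l0)))^-1.
  by rewrite -g'_S [_ * g' _]mulrC mulfK // mulf_neq0.
apply: (LLM sqE); last first.
  apply: (LLV sqE pp0 nr0); apply: (LLM sqE); first exact: LL_nat.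
  apply: LLD; first exact: LL_nat.
  by apply: LLD => //; exact: LLN.
apply: (LLM sqE) => //; apply: (LLM sqE); first by apply: LLN; exact: LL_nat.
by apply: (LLM sqE); apply: LLD; try exact: LL_nat; exact: LLD.
Qed.

Hypothesis dP1 : deg_le n P1.
Hypothesis dP2 : deg_le n P2.
Hypothesis LP1 : forall j, LL sq (P1 j).
Hypothesis LP2 : forall j, LL sq (P2 j).
Hypothesis Y0 : Ysum P1 P2 g' l1 != 0.
Hypothesis zE : zeta * gs ^+ i * ys ^+ s * (phiV k * psiV l0) = fcomp xs (Ysum P1 P2 g l0).

(** If all coefficients of [zeta] below p were p-integral, so would be those of the left side of
    [zE], all of its other factors being so. Unitriangularity then carries this over to the
    x-series, against the failure at j + t < p. *)
Theorem component_nonint : exists Pb : nat, forall p, Sset M u v p -> (Pb < p)%N ->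
  exists m, (m < p)%N /\ ~ Op sq p (zeta m).
Proof.
have [t Yt] : exists t, Ysum P1 P2 g' l1 t != 0.
  apply: contrapT => h; case/eqP: Y0; apply/funext => m; rewrite fzeroE.
  by apply/eqP; apply: contrapT => h'; apply: h; exists m; apply/negP.
have Ll1 : LL sq l1 by have [q ->] := l1_rat; exact: LL_rat.
have Ll0 : LL sq l0 by have [q ->] := l0_rat; exact: LL_rat.
have LY : LL sq (Ysum P1 P2 g' l1 t).
  rewrite YsumE; elim/big_ind: _ => [|x y hx hy|j _]; [exact: LL0|exact: LLD|].
  apply: (LLM sqE); last exact: LL_g'.
  by apply: LLD => //; apply: (LLM sqE) => //; apply: LLD => //; exact: LL_nat.
have Lk : LL sq (k%:~R / 12%:R).
  by exists k, 0, 12%N; split=> //; rewrite mul0r addr0.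
have [B hB] := ev_pI (ev_Up sqE LY Yt) (ev_pI (ev_Op M Lk) (ev_pI (ev_Op M Ll0) (ev_pI (ev_Op M Ll1)
  (ev_pI (ev_irr sqE (irr_addrat r_irr l0_rat)) (ev_pI (ev_irr sqE (irr_addrat rb_irr l0_rat))
  (ev_pI (ev_coefs M dP1 LP1) (ev_coefs M dP2 LP2))))))).
(* Beyond the finitely many exceptional primes collected in B, p must exceed 2|u| + v + (t + 2) v,
   which makes j positive and j + t smaller than p. *)
exists (B + 2 * absz u + absz v + (t + 2) * absz v)%N => p [pp podd nr pu] hp.
have hBp : (B < p)%N by lia.
have [UY [kO [hO0 [hO1 [Ur [Urb [hP1 hP2]]]]]]] := hB p pp nr hBp.
have [jz hj] : exists jz : int, jz * v + u = p%:Z.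
  have : (v %| p%:Z - u)%Z by rewrite -eqz_mod_dvd; apply/eqP.
  by move/dvdzP => [q e]; exists q; lia.
have jz0 : 0 < jz by nia.
have [j ej] : exists j : nat, jz = j%:Z by exists (absz jz); lia.
rewrite ej in hj.
have pbig : (2 * `|u| + v + (t%:Z + 2) * v < p%:Z)%R.
  have e1 : `|u| = (absz u)%:Z by lia.
  have e2 : v = (absz v)%:Z by lia.
  rewrite e1 e2; lia.
apply: contrapT => h; have OZ m : (m < p)%N -> Op sq p (zeta m).
  by move=> hm; apply: contrapT => h'; apply: h; exists m.
have g'_S' m : m.+1%:R * (m.+1%:R - u%:~R / v%:~R) * g' m.+1
  = - 64%:R * ((m%:R + (l0 + r - u%:~R / v%:~R)) * (m%:R + (l0 + rb - u%:~R / v%:~R))) * g' m.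
  rewrite -l01; have := g'_S m.
  have -> : m.+1%:R + (l1 - l0) = m.+1%:R - (l0 - l1) by ring.
  move=> ->; ring.
have g_S' m : m.+1%:R * (m.+1%:R + u%:~R / v%:~R) * g m.+1
  = - 64%:R * ((m%:R + (l0 + r)) * (m%:R + (l0 + rb))) * g m by rewrite -l01.
have jt : (j + t < p)%N.
  suff : j%:Z + t%:Z < p%:Z by lia.
  clear -hj hp jz0 v1; nia.
have := @nonintegral R M sq sqE p pp nr podd u v (l0 + r) (l0 + rb) l0 l1 g g' P1 P2 j t
  v1 uv l01 g_0 g_S' g'_0 g'_S' hj pbig Ur Urb hO0 hO1 hP1 hP2 UY.
apply; have f1 := fi_xs pp.
apply: (fint_decomp (Op0 sq pp) (Op1 sq pp) (@OpD R sq p pp) (@OpN R sq p) (OpM sqE pp) (xs_0 R) (xs_1 R) f1 _ jt).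
rewrite -zE; apply: (fi_M pp); last by apply: (fi_M pp); [exact: fi_phiV|exact: fi_psiV].
apply: (fi_M pp); last by apply: (fi_X pp); exact: fi_ys.
by apply: (fi_M pp); [exact: OZ|apply: (fi_X pp); exact: fi_gs].
Qed.
End Component.
End PIntegral.

(** * Series with coefficients in the quadratic field *)

Section LSeries.
Variable R : realType.
Local Notation C := (CC R).
Local Notation e2 := (e2 R).
Local Notation xs := (xs R).
Local Notation ys := (ys R).
Local Notation gs := (gs R).
Local Notation hs := (hs R).
Local Notation phiV := (phiV R).
Variables (M : int) (sq : C).
Hypothesis sqE : sq ^+ 2 = M%:~R.
Variable p : nat.
Hypothesis pp : prime p.
Hypothesis nr : nonres M p.
Local Notation LL := (LL sq).
Implicit Types a b c d : fps C.

Definition LS a : Prop := forall N, fint LL N a.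
Let L0 := LL0 sq. Let L1 := LL1 sq. Let LD := @LLD R sq. Let LN := @LLN R sq. Let LM := LLM sqE.

Lemma LSP a : LS a <-> forall n, LL (a n).
Proof. by split=> [h n|h N n _ //]; exact: (h n.+1 n). Qed.
Lemma LS_M a b : LS a -> LS b -> LS (a * b). Proof. by move=> ha hb N; exact: (fintM L0 LD LM (ha N) (hb N)). Qed.
Lemma LS_D a b : LS a -> LS b -> LS (a + b). Proof. by move=> ha hb N; exact: (fintD LD (ha N) (hb N)). Qed.
Lemma LS_N a : LS a -> LS (- a). Proof. by move=> ha N; exact: (fintN LN (ha N)). Qed.
Lemma LS_X a n : LS a -> LS (a ^+ n). Proof. by move=> ha N; exact: (fintX L0 L1 LD LM n (ha N)). Qed.
Lemma LS_cst x : LL x -> LS (fcst x). Proof. by move=> hx N; exact: (fint_cst L0). Qed.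
Lemma LS_1 : LS 1. Proof. exact: (LS_cst L1). Qed.
Lemma LS_fX : LS (fX C). Proof. by move=> N [|[|n]] _; rewrite /fX /=. Qed.
Lemma LS_theta a : LS a -> LS (theta a). Proof. by move=> ha N; exact: (fint_theta L0 L1 LD LM (ha N)). Qed.
Lemma LS_exp a : LS a -> LS (fexp a).
Proof.
move=> ha N; apply: (fint_exp L0 L1 LD LM) (ha N) => n _.
by apply: (LLV sqE pp nr); exact: LL_nat.
Qed.
Lemma LS_e2 : LS e2.
Proof.
apply/LSP => -[|n]; first exact: L1.
by rewrite /e2 /=; apply: LM; [apply: LN; exact: LL_nat|exact: LL_nat].
Qed.
Lemma LS_gs : LS gs.
Proof.
apply: LS_D; first by apply: LS_N; exact: LS_e2.
apply: LS_M; first by rewrite -fcst_nat; apply: LS_cst; exact: LL_nat.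
by apply/LSP => n; rewrite /dbl; case: ifP => _ //; apply/LSP: (n./2); exact: LS_e2.
Qed.
Lemma LS_hs : LS hs.
Proof. by apply: LS_exp; apply: LS_D; [exact: LS_gs|apply: LS_N; exact: LS_1]. Qed.
Lemma LS_xs : LS xs. Proof. by apply: LS_M; [exact: LS_fX|exact: LS_hs]. Qed.
Lemma LS_ys : LS ys.
Proof. by apply: LS_exp; apply: LS_D; [exact: LS_gs|apply: LS_N; exact: LS_e2]. Qed.
Lemma LS_phiV k : LS (phiV k).
Proof.
apply: LS_exp; apply: LS_N; apply: LS_M.
  apply: LS_cst; apply: LM; first exact: LL_int.
  by apply: (LLV sqE pp nr); exact: LL_nat.
by apply: LS_D; [exact: LS_e2|apply: LS_N; exact: LS_1].
Qed.
Lemma LS_psiV l : LL l -> LS (psiV l).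
Proof.
move=> h; apply: LS_exp; apply: LS_N; apply: LS_M; first exact: LS_cst.
by apply: LS_D; [exact: LS_gs|apply: LS_N; exact: LS_1].
Qed.
Lemma LS_decomp c : LS (fcomp xs c) -> LS c.
Proof.
by move=> h N; exact: (fint_decomp L0 L1 LD LN LM (xs_0 R) (xs_1 R) (@LS_xs N) (h N)).
Qed.
Lemma LS_div d a : d 0%N != 0 -> LS d -> LS (d * a) -> LS a.
Proof.
move=> d0 /LSP hd /LSP h; apply/LSP => n; elim/ltn_ind: n => n IH.
have -> : a n = (d 0%N)^-1 * ((d * a) n - \sum_(i < n) d i.+1 * a (n - i.+1)%N).
  by rewrite fmulEn big_ord_recl subn0 addrK mulKf.
apply: LM; first exact: (LLV sqE pp nr).
apply: LD => //; apply: LN; elim/big_ind: _ => // i _; apply: LM => //; apply: IH.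
by have := ltn_ord i; lia.
Qed.
(** Cramer's rule for series. The determinant need not be constant: a nonzero constant term allows
    division within the field. *)
Lemma LS_solve (P1 P2 g0 d0 g1 d1 : fps C) : (g0 * d1 - g1 * d0) 0%N != 0 ->
  LS g0 -> LS d0 -> LS g1 -> LS d1 -> LS (P1 * g0 + P2 * d0) -> LS (P1 * g1 + P2 * d1) ->
  LS P1 /\ LS P2.
Proof.
move=> D0 hg0 hd0 hg1 hd1 h0 h1.
have hD : LS (g0 * d1 - g1 * d0) by apply: LS_D; [exact: LS_M|apply: LS_N; exact: LS_M].
split; apply: (LS_div D0 hD).
  have -> : (g0 * d1 - g1 * d0) * P1 = (P1 * g0 + P2 * d0) * d1 - (P1 * g1 + P2 * d1) * d0 by ring.
  by apply: LS_D; [exact: LS_M|apply: LS_N; exact: LS_M].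
have -> : (g0 * d1 - g1 * d0) * P2 = (P1 * g1 + P2 * d1) * g0 - (P1 * g0 + P2 * d0) * g1 by ring.
by apply: LS_D; [exact: LS_M|apply: LS_N; exact: LS_M].
Qed.
End LSeries.

(** * Growth of the transform of Z by S *)

Section Growth.
Variable R : realType.
Local Notation C := (CC R).
Implicit Types (h : C -> C) (w : C).

(** In contrast with [cuspg], h is a function of w itself, not of -1/w, and is bounded only from
    some height on. This accommodates the powers of w in the slash action. *)
Definition far h : Prop := exists K s t0 : R, [/\ 0 <= K, 1 / 2 <= t0 &
  forall w, t0 <= im w -> `|re w| <= 1 -> nm (h w) <= K * expR (s * im w)].
Lemma farM h h' : far h -> far h' -> far (fun w => h w * h' w).
Proof.
move=> [K [s [t [K0 t0 H]]]] [K' [s' [t' [K0' t0' H']]]].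
exists (K * K'), (s + s'), (t + t'); split; [exact: mulr_ge0|lra|move=> w hw hr].
have -> : K * K' * expR ((s + s') * im w) = K * expR (s * im w) * (K' * expR (s' * im w)).
  by rewrite mulrDl expRD; ring.
rewrite nmM; apply: ler_pM; rewrite ?nm_ge0 ?H ?H' //; lra.
Qed.
Lemma eq_far h h' : (forall w, 1 / 2 <= im w -> h w = h' w) -> far h -> far h'.
Proof.
move=> e [K [s [t [K0 t0 H]]]]; exists K, s, t; split=> // w hw hr.
by rewrite -e ?H //; lra.
Qed.
Lemma far_cst z : far (fun=> z).
Proof. by exists (nm z), 0, (1 / 2); split=> [||w _ _]; rewrite ?nm_ge0 // mul0r expR0 mulr1. Qed.
Lemma farX h n : far h -> far (fun w => h w ^+ n).
Proof.
move=> hh; elim: n => [|n IH]; first exact: (far_cst 1).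
by apply: (@eq_far (fun w => h w * h w ^+ n)) (farM hh IH) => w _; rewrite exprS.
Qed.
Lemma far_w : far id.
Proof.
exists 3, 1, (1 / 2); split=> // w hw hr; rewrite mul1r.
apply: (@le_trans _ _ (3 * im w)); last by rewrite ler_pM2l // le_expR.
apply: ler_sq; first lra.
by apply: le_trans (nm_strip hw hr) _; rewrite exprMn; nra.
Qed.
Lemma far_inv : far (fun w => w^-1).
Proof. by exists 2, 0, (1 / 2); split=> // w hw _; rewrite mul0r expR0 mulr1; exact: inv_strip. Qed.
Lemma far_expz (k : int) : far (fun w => w ^ k).
Proof.
case: k => n; first by apply: eq_far (farX n far_w) => w _.
by apply: (@eq_far (fun w => (w^-1) ^+ n.+1)) (farX n.+1 far_inv) => w _; rewrite exprVn.
Qed.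
Lemma far_qpow (nu : C) : far (fun w => qpow nu (- w^-1)).
Proof.
exists (expR (2 * pi * (nm nu * 2))), 0, (1 / 2); split=> [||w hw _] //.
rewrite mul0r expR0 mulr1 /qpow -mulrA -/(ee _) nm_ee ler_expR -mulrN.
apply: ler_wpM2l; first by rewrite mulr_ge0 // pi_ge0.
apply: le_trans (ler_norm _) _; rewrite normrN; apply: le_trans (im_le _) _.
by rewrite nmM nmN ler_wpM2l ?nm_ge0 //; exact: inv_strip.
Qed.
Lemma far_xs : far (fun w => ev (xs R) (- w^-1)).
Proof.
have [k [K [k0 K0 hx]]] := xs_S_bounds R; exists K, pi, (1 / 2); split=> // [|w hw _]; first exact: ltW.
by have [_ h _] := hx w hw.
Qed.
Lemma far_poly h (K y0 : R) N : (forall w : C, `|re w| <= 1 -> y0 <= im w -> nm (h w) <= K * im w ^+ N) -> far h.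
Proof.
move=> H; exists `|K|, N%:R, (1 / 2 + `|y0|); split; [by []|by rewrite lerDl|move=> w hw hr].
have y0w : y0 <= im w by have := ler_norm y0; lra.
have iw : 0 <= im w by have := normr_ge0 y0; lra.
apply: le_trans (H w hr y0w) _.
apply: (@le_trans _ _ (`|K| * im w ^+ N)); first by apply: ler_wpM2r; [exact: exprn_ge0|exact: ler_norm].
apply: ler_wpM2l => //; rewrite expRM_natl; apply: lerXn2r; rewrite ?nnegrE ?expR_ge0 //.
exact: le_expR.
Qed.
End Growth.

(** * Forms of the theorem *)
Section FormsOfRho.
Variable R : realType.
Local Notation C := (CC R).
Implicit Types (rho : 'M[int]_2 -> 'M[C]_2) (F Z : C -> 'cV[C]_2) (nu : 'I_2 -> C).

Lemma sum2E (V : nmodType) (f : 'I_2 -> V) : \sum_i f i = f 0 + f 1.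
Proof. by rewrite !big_ord_recl big_ord0 addr0; congr (f _ + f _); exact/val_inj. Qed.

Lemma ord2P (i j k : 'I_2) : i != j -> k = i \/ k = j.
Proof.
by case: i j k => [[|[|?]] ?] [[|[|?]] ?] [[|[|?]] ?] // _; [left|right|right|left]; exact/val_inj.
Qed.

Lemma sum_pair (V : nmodType) (f : 'I_2 -> V) (i j : 'I_2) : i != j -> \sum_k f k = f i + f j.
Proof.
move=> ij; rewrite sum2E; have [e0|e0] := ord2P 0 ij; have [e1|e1] := ord2P 1 ij.
- by have := e1; rewrite -e0.
- by rewrite e0 e1.
- by rewrite e0 e1 addrC.
- by have := e1; rewrite -e0.
Qed.

Definition eqvar k rho F : Prop := forall g, Gamma02 g -> forall tau, upper tau ->
  slash k F g tau = rho g *m F tau.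

Lemma fam_law_of k rho nu F (b : 'I_2 -> fps C) : eqvar k rho F ->
  (forall i tau, upper tau -> F tau i 0 = qev (nu i) (b i) tau) -> fam_law rho nu k b.
Proof.
move=> hF hE g tau hg ht i; have hs := Gamma02_SL2Z hg; have hm := upper_moebius hs ht.
rewrite -hE // -[LHS](mxE matrix_key (fun x y => jj g tau ^ (-k) * F (moebius g tau) x y) i 0).
have := congr1 (fun A : 'cV[C]_2 => A i 0) (hF g hg tau ht).
rewrite /slash !mxE -/(jj g tau) => ->; apply: eq_bigr => j _; by rewrite hE.
Qed.

Lemma eqvar_conj k rho F (E : 'M[C]_2) : E \in unitmx -> eqvar k rho F ->
  eqvar k (fun g => E *m rho g *m invmx E) (fun tau => E *m F tau).
Proof.
move=> uE hF g hg tau ht; have := hF g hg tau ht; rewrite /slash scalemxAr => ->.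
by rewrite -!mulmxA mulKmx.
Qed.

(** Otherwise the line of the vector E^-1 e_i would be stable under rho. *)
Lemma irreducible_entry rho rho' (E : 'M[C]_2) (i j : 'I_2) : irreducible_rep rho -> E \in unitmx ->
  (forall g, rho' g = E *m rho g *m invmx E) -> i != j ->
  ~ (forall g, Gamma02 g -> rho' g j i = 0).
Proof.
move=> [_ hW] uE e ij h; pose w : 'cV[C]_2 := invmx E *m delta_mx i 0.
have w0 : w != 0.
  apply/eqP => /(congr1 (mulmx E)); rewrite mulmxA mulmxV // mul1mx mulmx0.
  by move/matrixP/(_ i 0); rewrite !mxE !eqxx => /eqP; rewrite oner_eq0.
have inv g : Gamma02 g -> forall x, x \in <[w]>%VS -> rho g *m x \in <[w]>%VS.
  move=> hg x /vlineP[s ->]; rewrite -scalemxAr; apply/memvZ/vlineP; exists (rho' g i i).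
  have -> : rho g *m w = invmx E *m (rho' g *m delta_mx i 0).
    by rewrite e /w !mulmxA mulVmx // mul1mx.
  rewrite /w scalemxAr; congr (_ *m _); apply/matrixP => x' y; rewrite ord1 !mxE (sum_pair _ ij) !mxE !eqxx.
  rewrite [j == i]eq_sym (negbTE ij) /= mulr0 addr0 mulr1.
  by have [->|->] := ord2P x' ij; rewrite ?eqxx ?mulr1 // h // [j == i]eq_sym (negbTE ij) mulr0.
have [h0|h1] := hW _ inv.
  by move: (memv_line w); rewrite h0 memv0 (negbTE w0).
have := dim_vline w; rewrite h1 w0 dimvf /dim /= => /eqP.
by [].
Qed.

Lemma leading_normalized F (X : 'M[C]_2) nu (lam : 'I_2 -> C) (E : 'M[C]_2) :
  (forall i, leading_term (component (fun tau => X *m F tau) i) (nu i) (lam i)) ->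
  E = diag_mx (\row_(i < 2) (lam i)^-1) *m X ->
  exists a : 'I_2 -> fps C, [/\ forall i, conv (a i), forall i, a i 0%N = 1 &
    forall i tau, upper tau -> (E *m F tau) i 0 = qev (nu i) (a i) tau].
Proof.
move=> hl eE; have [c hc] := @choice _ _ (fun i (c : fps C) =>
    qexpansion (component (fun tau => X *m F tau) i) (nu i) c /\ c 0%N = lam i) (fun i => proj2 (hl i)).
have hcv i := qexpansionP (proj1 (hc i)).
exists (fun i => fcst (lam i)^-1 * c i); split=> [i|i|i tau ht].
- by apply: convZ; case: (hcv i).
- by rewrite fcstME (proj2 (hc i)) mulVf //; case: (hl i).
have [h1 h2] := hcv i; rewrite eE -mulmxA mul_diag_mx mxE mxE /qev evZ // mulrCA -h2 //.
Qed.

(** The equation is linear and is known for the components of F, which are combinations of the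
    normalized ones with matrix E^-1. Invertibility isolates each residual, and a series is
    determined by its values. *)
Lemma formal_ode_of k (a b c : C) F (E : 'M[C]_2) nu (s : 'I_2 -> fps C) :
  (forall i, modular_ode k a b c (component F i)) -> E \in unitmx -> (forall i, conv (s i)) ->
  (forall i tau, upper tau -> (E *m F tau) i 0 = qev (nu i) (s i) tau) ->
  forall i, formal_ode k (nu i) a b c (s i).
Proof.
move=> hF uE hs hE; pose V := invmx E.
have hD i := conv_Dk k (nu i) (hs i); have hDD i := conv_Dk (k + 2) (nu i) (hD i).
have FE j tau : upper tau -> component F j tau = \sum_i V j i * qev (nu i) (s i) tau.
  move=> ht; have -> : component F j tau = (V *m (E *m F tau)) j 0 by rewrite mulKmx.
  by rewrite mxE; apply: eq_bigr => i _; rewrite hE.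
pose o i : fps C := Dk (k + 2) (nu i) (Dk k (nu i) (s i)) + fcst a * (gs R * Dk k (nu i) (s i))
    + (fcst b * gs R ^+ 2 + fcst c * e4 R) * s i.
have c4 := conv_e4 (R := R); have cg := conv_gs (R := R).
have cc : conv (fcst b * gs R ^+ 2 + fcst c * e4 R).
  by apply: convD; apply: convZ => //; exact: convX.
have cgD i : conv (fcst a * (gs R * Dk k (nu i) (s i))) by apply: convZ; exact: convM.
have co i : conv (o i).
  by apply: convD; [apply: convD|apply: convM].
have h tau : upper tau -> V *m (\col_i qev (nu i) (o i) tau) = 0.
  move=> ht; apply/matrixP => j y; rewrite ord1 !mxE.
  have h1 w : upper w -> serreD k (component F j) w = \sum_i V j i * qev (nu i) (Dk k (nu i) (s i)) w.
    by move=> hw; exact: (serre_comb hs (FE j) k hw).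
  have h2 := serre_comb hD h1 (k + 2) ht.
  have := hF j tau ht; rewrite h2 h1 // FE // -[Gform tau]ev_gs // -ev_e4 // => e.
  rewrite -[RHS]e !mulr_sumr -!big_split /=; apply: eq_bigr => i _; rewrite mxE /qev /o.
  rewrite (evD (convD (hDD i) (cgD i)) (convM cc (hs i)) ht) (evD (hDD i) (cgD i) ht).
  rewrite (evM cc (hs i) ht) (evZ _ (convM cg (hD i)) ht) (evM cg (hD i) ht).
  rewrite (evD (convZ b (convX 2 cg)) (convZ c c4) ht) (evZ b (convX 2 cg) ht) (evZ c c4 ht) (evX 2 cg ht).
  by ring.
move=> i; apply: (ev_inj (co i) (conv_cst 0)) => tau ht; rewrite ev0.
have /matrixP/(_ i 0) : \col_i qev (nu i) (o i) tau = 0.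
  by rewrite -[LHS](mulKVmx uE) h // mulmx0.
by rewrite !mxE /qev => /eqP; rewrite mulf_eq0 (negbTE (qpow_neq0 _ _)) => /eqP.
Qed.

Lemma ev_ex_neq0 (b : fps C) : conv b -> b != 0 -> exists2 tau, upper tau & ev b tau != 0.
Proof.
move=> hb /eqP b0; apply: contrapT => h; apply: b0; apply: (ev_inj hb (conv_cst 0)) => tau ht.
rewrite ev0; apply/eqP; apply: contrapT => /negP h'; by apply: h; exists tau.
Qed.

Lemma Tmat_Tn : Tmat = Tn 1.
Proof. by apply: mat2P; rewrite !mk2E mxE. Qed.
Lemma Gamma02_T : Gamma02 Tmat.
Proof. by rewrite Tmat_Tn; split; [exact: SL2Z_Tn|rewrite mk2E]. Qed.

(** T multiplies q^nu by e(nu) and fixes the series in q; at a point where this series does not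
    vanish the two eigenvalues can be compared. *)
Lemma T_exponent k rho nu (b : 'I_2 -> fps C) (d : 'I_2 -> C) i : fam_law rho nu k b ->
  conv (b i) -> b i != 0 -> rho Tmat = diag_mx (\row_j d j) -> ee (nu i) = d i.
Proof.
move=> hl hb b0 hd; have [tau ht e0] := ev_ex_neq0 hb b0.
have := hl Tmat tau Gamma02_T ht i; rewrite hd {1 2}Tmat_Tn moebius_Tn jj_Tn exp1rz mul1r.
rewrite (bigD1 i) //= big1 ?addr0 => [|j ji]; last by rewrite !mxE eq_sym (negbTE ji) mul0r.
rewrite !mxE eqxx /qev ev_period mulr1n mulrA => /(mulIf e0).
rewrite /qpow mulrDr cexpD mulr1 mulrC => /(mulIf (cexp_neq0 _)).
by [].
Qed.
End FormsOfRho.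

(** * Aligning the exponents of Z with those of F *)

Section Twisting.
Variable R : realType.
Local Notation C := (CC R).
Implicit Types (rho : 'M[int]_2 -> 'M[C]_2) (F Z : C -> 'cV[C]_2) (nu : 'I_2 -> C).

Lemma toC_le (x y : R) : toC x <= toC y :> C -> x <= y.
Proof. by move=> h; rewrite -lecR. Qed.

Lemma conj_diag (E X A : 'M[C]_2) (x d : 'rV[C]_2) : X \in unitmx -> (forall i, x 0 i != 0) ->
  E = diag_mx x *m X -> X *m A *m invmx X = diag_mx d ->
  E \in unitmx /\ E *m A *m invmx E = diag_mx d.
Proof.
move=> uX x0 eE h; have uE : E \in unitmx.
  rewrite eE unitmx_mul uX andbT unitmxE det_diag unitfE.
  by apply/prodf_neq0 => i _.
split => //; apply: (canLR (mulmxK uE)).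
have -> : E *m A = diag_mx x *m (X *m A *m invmx X *m X) by rewrite mulmxKV // eE mulmxA.
by rewrite h eE !mulmxA diag_mxC.
Qed.

Lemma conj_pow1 (E A : 'M[C]_2) (d : 'rV[C]_2) n i : E \in unitmx -> A ^+ n = 1 ->
  E *m A *m invmx E = diag_mx d -> d 0 i ^+ n = 1.
Proof.
move=> uE An h; have h' : diag_mx d ^+ n = E *m A ^+ n *m invmx E.
  elim: n {An} => [|n IH]; first by rewrite !expr0 mulmx1 mulmxV.
  by rewrite !exprSr IH -h -!mulmxE !mulmxA mulmxKV.
have -> : d 0 i ^+ n = (diag_mx d ^+ n) i i; last by rewrite h' An mulmx1 mulmxV // mxE eqxx.
suff -> : diag_mx d ^+ n = diag_mx (\row_j d 0 j ^+ n) by rewrite !mxE eqxx.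
elim: n {An h'} => [|n IH].
  by apply/matrixP => a b; rewrite expr0 !mxE expr0.
rewrite exprSr IH -mulmxE mulmx_diag; congr diag_mx.
by apply/rowP => j; rewrite !mxE exprSr.
Qed.

Lemma root1_rational (x : C) n : (0 < n)%N -> ee x ^+ n = 1 -> exists q : rat, x = ratr q.
Proof.
move=> n0; rewrite -eeM => /cexp_eq1[k hk]; exists (k%:~R / n%:R).
have h : n%:R != 0 :> C by rewrite pnatr_eq0 -lt0n.
rewrite rmorphM fmorphV /= ratr_int ratr_nat -hk; by field.
Qed.

Section Twist.
Variables (k : int) (rho : 'M[int]_2 -> 'M[C]_2) (nu mu : 'I_2 -> C) (Z : C -> 'cV[C]_2)
  (z : 'I_2 -> fps C) (n0 : nat) (m : 'I_2 -> nat).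
Hypothesis hZ : eqvar k rho Z.
Hypothesis hz : forall i, conv (z i).
Hypothesis zE : forall i tau, upper tau -> Z tau i 0 = qev (mu i) (z i) tau.
Hypothesis mE : forall i, nu i + (m i)%:R = mu i + n0%:R.

(* x^n0 Z_i without its factor q^(nu_i) *)
Definition twist (i : 'I_2) : fps C := fX C ^+ m i * hs R ^+ n0 * z i.

Lemma conv_twist i : conv (twist i).
Proof. by apply: convM => //; apply: convM; apply: convX; [exact: conv_fX|exact: conv_hs]. Qed.

Lemma twistE i tau : upper tau -> qev (nu i) (twist i) tau = ev (xs R) tau ^+ n0 * Z tau i 0.
Proof.
move=> ht; have hh := conv_hs (R := R); have hf := conv_fX (R := R).
rewrite zE // /qev /twist (evM (convM (convX (m i) hf) (convX n0 hh)) (hz i) ht).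
rewrite (evM (convX (m i) hf) (convX n0 hh) ht) (evX (m i) hf ht) (evX n0 hh ht) ev_fX (ev_xsE ht) [(ee tau * _) ^+ n0]exprMn.
have : qpow (nu i) tau * ee tau ^+ m i = qpow (mu i) tau * ee tau ^+ n0.
  by rewrite -!qpowE -!qpowD mE.
move: (ee tau ^+ m i) (ee tau ^+ n0) => x y e; rewrite mulrA mulrA e; ring.
Qed.

Lemma twist_law : fam_law rho nu k twist.
Proof.
apply: (@fam_law_of _ k rho nu (fun tau => ev (xs R) tau ^+ n0 *: Z tau)) => [g hg tau ht|i tau ht].
  have := @hZ g hg tau ht; rewrite /slash xs_law // scalerA [_ ^ (- k) * _]mulrC -scalerA => ->.
  by rewrite scalemxAr.
by rewrite mxE twistE.
Qed.

(** The moderate growth of Z slashed by S is transferred to the series by factors that grow at most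
    exponentially: w^k, x^n0 and q^(-nu) at -1/w, the last of which is bounded. *)
Lemma cuspg_twist i : holomorphic_at_cusps k Z -> cuspg (ev (twist i)).
Proof.
move=> /(_ Smat SL2Z_S i)[K [y0 [N [y00 H]]]].
apply: cuspg_far; first exact: conv_twist.
pose h w := component (slash k Z Smat) i w.
have fh : far h.
  apply: (@far_poly _ _ K y0 N) => w hr hw; apply: toC_le; rewrite -normE; exact: H.
have [K' [s [t0 [_ _ H']]]] : far (fun w => ev (twist i) (- w^-1)); last by exists K', s, t0.
apply: eq_far (farM (farM (far_qpow (- nu i)) (farX n0 (far_xs R))) (farM (far_expz R k) fh)) => w hw.
have ht : upper w by rewrite /upper; lra.
have w0 : w != 0 by apply: contraTneq ht => ->; rewrite /upper im0 ltxx.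
have hS := upperS ht; have := twistE i hS; rewrite /qev.
move=> /(congr1 (fun x => qpow (- nu i) (- w^-1) * x)); rewrite mulrA -qpowD addNr qpow0 mul1r => ->.
rewrite /h /component /slash mxE moebius_S -/(jj Smat w) jj_S.
have : w ^ k * w ^ (- k) = 1 by rewrite -expfzDr // subrr expr0z.
by move: (w ^ k) (w ^ (- k)) => x y xy; rewrite -!mulrA [x * (y * _)]mulrA xy mul1r.
Qed.
End Twist.
End Twisting.

(** * A component with denominators at large inert primes *)

Section Core.
Variable R : realType.
Local Notation C := (CC R).
Local Notation xs := (xs R).
Local Notation ys := (ys R).
Local Notation gs := (gs R).
Local Notation phiV := (phiV R).
Variables (M : int) (sq : C).
Hypothesis sqE : sq ^+ 2 = M%:~R.
Variables (rho : 'M[int]_2 -> 'M[C]_2) (k : int) (l : 'I_2 -> C) (a : 'I_2 -> fps C) (A B c0 r : C).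
Local Notation nu := (fun i : 'I_2 => k%:~R / 12%:R + l i).
Hypothesis ode : forall i, formal_ode k (nu i) A B c0 (a i).
Hypothesis ha : forall i, conv (a i).
Hypothesis a_0 : forall i, a i 0%N = 1.
Hypothesis law : fam_law rho nu k a.
Hypothesis r_root : r ^+ 2 - (A + 3%:R^-1) * r + B + 4%:R * c0 = 0.
Hypothesis l_rat : forall i, exists q : rat, l i = ratr q.
Hypothesis r_irr : irr sq r.
Variables (kz : int) (zeta : 'I_2 -> fps C).
Hypothesis hz : forall i, conv (zeta i).
Hypothesis lawz : fam_law rho nu kz zeta.
Hypothesis gz : forall i, cuspg (ev (zeta i)).
Hypothesis z0 : forall i, zeta i != 0.
Hypothesis zLS : forall i, LS sq (zeta i).
Variables (i j : 'I_2) (u v : int) (p0 : nat).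
Hypothesis ij : i != j.
Hypothesis v1 : 1 < v.
Hypothesis uv : coprimez u v.
Hypothesis lij : l i - l j = u%:~R / v%:~R.
Hypothesis pp0 : prime p0.
Hypothesis nr0 : nonres M p0.

(** The other root of the equation of r. *)
Let rb := A + 3%:R^-1 - r.

Lemma l_neq (i' j' : 'I_2) : i' != j' -> l i' != l j'.
Proof.
have v0 : v%:~R != 0 :> C by rewrite intr_eq0; lia.
have u0 : u%:~R != 0 :> C.
  by rewrite intr_eq0; have := uv_ndvd 0 v1 uv; rewrite mul0r add0r.
have h : l i != l j by rewrite -subr_eq0 lij mulf_neq0 ?invr_eq0.
move=> ij'; have [ei|ei] := ord2P i' ij; have [ej|ej] := ord2P j' ij.
- by move: ij'; rewrite ei ej eqxx.
- by rewrite ei ej.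
- by rewrite ei ej eq_sym.
- by move: ij'; rewrite ei ej eqxx.
Qed.
Let l01 : l 0 != l 1 := l_neq (isT : 0 != 1 :> 'I_2).

Lemma A_pair : A = 6%:R^-1 - l i - l j.
Proof.
rewrite (A_val ode a_0 l01) -!addrA -!opprD; congr (_ - _).
by rewrite -[RHS](sum_pair l ij) sum2E.
Qed.

Lemma rb_irr : irr sq rb.
Proof.
apply: irr_addrat; first exact: irrN.
have [q1 e1] := l_rat i; have [q2 e2] := l_rat j; exists (6%:R^-1 - q1 - q2 + 3%:R^-1).
by rewrite A_pair e1 e2 !rmorphD !rmorphN /= !fmorphV /= !ratr_nat.
Qed.

Section Hypergeometric.
Variable gam : 'I_2 -> fps C.
Hypothesis gamE : forall i', phiV k * a i' * psiV (l i') = fcomp xs (gam i').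

Lemma gam_0 i' : gam i' 0%N = 1.
Proof.
have := congr1 (fun s : fps C => s 0%N) (gamE i').
by rewrite !fmul0 a_0 /phiV /psiV !fexp_0 !mulr1 /fcomp big_ord1 expr0 foneE mulr1.
Qed.

(** The left quadratic vanishes at l_i, and its other root is l_j because A = 1/6 - l_i - l_j; the
    right one factors through r + rb = A + 1/3 and r rb = B + 4 c0. *)
Lemma gam_S (i' j' : 'I_2) n : i' != j' -> n.+1%:R * (n.+1%:R + (l i' - l j')) * gam i' n.+1
  = - 64%:R * ((n%:R + (l i' + r)) * (n%:R + (l i' + rb))) * gam i' n.
Proof.
move=> ij'; have id2 := e4g4y_id ode ha a_0 l01 law.
have h0 := hyp_rec0 (ode i') (g6y_id R) id2 (gamE i').
have := hyp_recS (ode i') (g6y_id R) id2 (gamE i') n.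
move: h0; rewrite gam_0 mulr1 => h0.
have eA : A = 6%:R^-1 - l i' - l j'.
  by rewrite (A_val ode a_0 l01) -!addrA -!opprD -(sum_pair l ij') sum2E.
have -> : (n.+1%:R + l i') ^+ 2 + (A - 6%:R^-1) * (n.+1%:R + l i') + B + c0
    = n.+1%:R * (n.+1%:R + (l i' - l j')) + (l i' ^+ 2 + (A - 6%:R^-1) * l i' + B + c0).
  by rewrite eA; ring.
rewrite h0 addr0 => ->; congr (_ * _ * _).
have eB : B + 4%:R * c0 = r * rb.
  by apply/eqP; rewrite -subr_eq0 -r_root /rb; apply/eqP; ring.
by rewrite -addrA eB /rb; ring.
Qed.
End Hypergeometric.

Lemma core_nonint : exists Pb : nat, forall p, Sset M u v p -> (Pb < p)%N ->
  exists m, (m < p)%N /\ ~ Op sq p (zeta i m).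
Proof.
have [gam gamE] : exists gam : 'I_2 -> fps C, forall i', phiV k * a i' * psiV (l i') = fcomp xs (gam i').
  have h i' := fcomp_surj (xs_0 R) (xs_1 R) (phiV k * a i' * psiV (l i')).
  by have [g hg] := choice h; exists g => i'; rewrite hg.
have [n1 [s [n [P1 [P2 [dP1 dP2 e1 e2]]]]]] :=
  hauptmodul_decomp ode ha a_0 l01 law hz lawz gz (ex_intro _ i (z0 i)).
have dec i' := component_decomp ode a_0 l01 e1 e2 (gamE i').
have ji : j != i by rewrite eq_sym.
have lji : l j - l i = (- u)%:~R / v%:~R by rewrite -opprB lij mulrNz mulNr.
have uv' : coprimez (- u) v by rewrite /coprimez gcdNz.
have Lgi : LS sq (gam i).
  apply/LSP; exact: (LL_g' sqE pp0 nr0 v1 uv' lji (l_rat j) (l_rat i) r_irr rb_irr (gam_0 gamE i) (fun m => gam_S gamE m ij)).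
have Lgj : LS sq (gam j).
  apply/LSP; exact: (LL_g' sqE pp0 nr0 v1 uv lij (l_rat i) (l_rat j) r_irr rb_irr (gam_0 gamE j) (fun m => gam_S gamE m ji)).
have Ll i' : LL sq (l i') by have [q ->] := l_rat i'; exact: LL_rat.
pose T i' := theta (gam i') + fcst (l i') * gam i'.
have LT i' : LS sq (gam i') -> LS sq (T i').
  move=> h; apply: LS_D; first exact: (LS_theta sqE).
  by apply: (LS_M sqE) => //; exact: LS_cst.
have LY i' : LS sq (P1 * gam i' + P2 * T i').
  apply: (LS_decomp sqE pp0 nr0); rewrite -dec.
  apply: (LS_M sqE); last first.
    apply: (LS_M sqE); first exact: (LS_phiV sqE pp0 nr0).
    exact: (LS_psiV sqE pp0 nr0).
  apply: (LS_M sqE); last by apply: (LS_X sqE); exact: (LS_ys sqE pp0 nr0).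
  by apply: (LS_M sqE) => //; apply: (LS_X sqE); exact: (LS_gs sqE).
have T0 i' : T i' 0%N = l i'.
  by rewrite /T faddE theta0E fcstME (gam_0 gamE) mulr1 add0r.
(* The coefficients of P1 and P2 are in Q(sqrt M) because those of both components of the form are;
   the determinant has constant term l_j - l_i. *)
have [LP1 LP2] : LS sq P1 /\ LS sq P2.
  apply: (LS_solve sqE pp0 nr0 _ Lgi (LT i Lgi) Lgj (LT j Lgj) (LY i) (LY j)).
  by rewrite fsubE !fmul0 !T0 !(gam_0 gamE) !mul1r subr_eq0 l_neq.
have Y0 : Ysum P1 P2 (gam j) (l j) != 0.
  apply/eqP => e; have := dec j; rewrite -/(T j) -[P1 * _ + _]/(Ysum P1 P2 (gam j) (l j)) e.
  rewrite -[0 in RHS](subrr 1) (fcompD xs) (fcompN (xs_0 R)) subrr.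
  have -> : zeta j * gs ^+ n1 * ys ^+ s * (phiV k * psiV (l j)) = (gs ^+ n1 * ys ^+ s * (phiV k * psiV (l j))) * zeta j by ring.
  move=> /fcancel; rewrite !fmul0 !fexp0 gs_0 /ys /phiV /psiV !fexp_0 !expr1n !mulr1 oner_eq0.
  by move=> /(_ isT) h; move: (z0 j); rewrite h eqxx.
apply: (component_nonint sqE pp0 nr0 v1 uv lij (l_rat i) (l_rat j) r_irr rb_irr (gam_0 gamE i)
  (fun m => gam_S gamE m ij) (gam_0 gamE j) (fun m => gam_S gamE m ji) dP1 dP2 _ _ Y0 (dec i)).
  exact/LSP.
exact/LSP.
Qed.
End Core.

(** * From non-integrality to denominators *)

Section Denominators.
Variable R : realType.
Local Notation C := (CC R).

Lemma infinite_gt (S : set nat) K : infinite_set S -> exists2 p, S p & (K < p)%N.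
Proof.
move=> hS; apply: contrapT => h; apply: hS; apply: (sub_finite_set _ (finite_II K.+1)) => p Sp /=.
by rewrite ltnS leqNgt; apply/negP => hp; apply: h; exists p.
Qed.

Lemma denominators_of_nonint (M u v : int) (sq : C) (c : nat -> C) : sq ^+ 2 = M%:~R ->
  infinite_set (Sset M u v) -> (forall n, LL sq (c n)) ->
  (exists Pb : nat, forall p, Sset M u v p -> (Pb < p)%N -> exists n, ~ Op sq p (c n)) ->
  large_primes_divide_denominators (Sset M u v) c /\ unbounded_denominators c.
Proof.
move=> sqE hS hc [Pb hP].
have large p : Sset M u v p -> (Pb < p)%N -> exists n N : nat, is_denominator (c n) N /\ (p %| N)%N.
  move=> Sp hp; have [n hn] := hP p Sp hp; case: (Sp) => pp _ nr _.
  have [N hN] := denominator_ex sqE (hc n); exists n, N; split=> //.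
  exact: (denominator_dvd sqE pp nr (hc n) hn hN).
split; first by exists Pb.
move=> K; have [p Sp hp] := infinite_gt (maxn Pb K) hS; move: hp; rewrite gtn_max => /andP[h1 h2].
have [n [N [hN pN]]] := large p Sp h1; exists n, N; split=> //.
by apply: leq_trans h2 (dvdn_leq _ pN); case: hN.
Qed.
End Denominators.

Theorem theorem5p35 (R : realType) (rho : 'M[int]_2 -> 'M[CC R]_2)
  (rho_irr : irreducible_rep rho)
  (rhoT_fin : exists n : nat, (0 < n)%N /\ rho Tmat ^+ n = 1)
  (* minimal weight form and its differential equation *)
  (k0 : int) (k0_min : minimal_weight rho k0)
  (F : CC R -> 'cV[CC R]_2) (F_mod : modform k0 rho F) (F_neq0 : nonzeroH F)
  (a b c : CC R) (F_ode : forall i : 'I_2, modular_ode k0 a b c (component F i))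
  (r : CC R) (r_root : r ^+ 2 - (a + 3%:R^-1) * r + b + 4%:R * c = 0)
  (* diagonalization and normalization *)
  (X : 'M[CC R]_2) (X_unit : X \in unitmx)
  (m : 'I_2 -> CC R) (m_le : `|m 0| <= `|m 1|)
  (X_diag : X *m rho Tmat *m invmx X
            = diag_mx (\row_(i < 2) cexp (twopii R * m i)))
  (l lambda : 'I_2 -> CC R)
  (XF_lead : forall i : 'I_2,
     leading_term (component (fun tau => X *m F tau) i)
                  (k0%:~R / 12%:R + l i) (lambda i))
  (E : 'M[CC R]_2) (E_def : E = diag_mx (\row_(i < 2) (lambda i)^-1) *m X)
  (rho' : 'M[int]_2 -> 'M[CC R]_2)
  (rho'_def : forall g, rho' g = E *m rho g *m invmx E)
  (* arithmetic data *)
  (c_rat : exists x : rat, c = ratr x)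
  (r_deg2 : Qdim (Qadj r) 2)
  (A B : CC R) (A_def : A = r + l 0) (B_def : B = r + l 1)
  (u v : int) (v_gt1 : 1 < v) (uv_coprime : coprimez u v)
  (AB_uv : A - B = u%:~R / v%:~R)
  (M : int) (M_sqf : squarefree M) (M_def : Qadj r = Qadj (sqrtC M%:~R))
  (* the form Z and the expansions of its components *)
  (k : int) (Z : CC R -> 'cV[CC R]_2) (Z_mod : modform k rho' Z)
  (Z_neq0 : nonzeroH Z)
  (mu : 'I_2 -> CC R) (z : 'I_2 -> nat -> CC R)
  (Z_exp : forall i : 'I_2, qexpansion (component Z i) (mu i) (z i))
  (Z_coef : forall (i : 'I_2) (n : nat), Qadj (sqrtC M%:~R) (z i n)) :
  (infinite_set (Sset M u v) ->
     large_primes_divide_denominators (Sset M u v) (z 0) /\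
     unbounded_denominators (z 0)) /\
  (infinite_set (Sset M (- u) v) ->
     large_primes_divide_denominators (Sset M (- u) v) (z 1) /\
     unbounded_denominators (z 1)).

Proof.
set sq := sqrtC M%:~R in Z_coef M_def.
have sqE : sq ^+ 2 = M%:~R by exact: sqrtCK.
pose nu i := k0%:~R / 12%:R + l i; pose d i := cexp (twopii R * m i).
have lam0 i : (\row_(i < 2) (lambda i)^-1) 0 i != 0.
  by rewrite mxE invr_eq0; case: (XF_lead i).
have [uE dE] := conj_diag X_unit lam0 E_def X_diag.
have [s [hs s_0 sE]] := leading_normalized XF_lead E_def.
have ode := formal_ode_of F_ode uE hs sE.
have eqF : eqvar k0 rho' (fun tau => E *m F tau).
  by case: F_mod => _ hF _ g hg tau ht; rewrite rho'_def; exact: (eqvar_conj uE hF hg ht).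
have law : fam_law rho' nu k0 s := fam_law_of eqF sE.
have rT : rho' Tmat = diag_mx (\row_i d i) by rewrite rho'_def dE.
have s0 i : s i != 0.
  by apply/eqP => /(congr1 (fun b : fps (CC R) => b 0%N)); rewrite s_0 fzeroE => /eqP; rewrite oner_eq0.
have nud i : ee (nu i) = d i := T_exponent law (hs i) (s0 i) rT.
have l_rat i : exists q : rat, l i = ratr q.
  have [n [n0 Tn]] := rhoT_fin; have := conj_pow1 i uE Tn dE; rewrite mxE -/(d i) -nud.
  move=> /(root1_rational n0)[q hq]; exists (q - k0%:~R / 12%:R).
  by rewrite rmorphB /= -hq fmorph_div /= ratr_int ratr_nat /nu addrAC subrr add0r.
case: Z_mod => _ eqZ cuspZ; have hzz i := qexpansionP (Z_exp i).
have hz i : conv (z i) by case: (hzz i).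
have zE i tau : upper tau -> Z tau i 0 = qev (mu i) (z i) tau by case: (hzz i) => _; apply.
have zlaw : fam_law rho' mu k z := fam_law_of eqZ zE.
(* If one component vanished, the transformation law at a point where the other does not would force
   an off-diagonal entry of [rho'] to be zero on the whole group. *)
have z0 i : (z i : fps (CC R)) != 0.
  apply/eqP => zi; have [j ij] : exists j : 'I_2, j != i.
    by case: (ord2P i (isT : 0 != 1 :> 'I_2)) => ->; [exists 1|exists 0].
  apply: (irreducible_entry rho_irr uE rho'_def ij) => g hg.
  have [tau [ht Zt]] := Z_neq0; have Zi w : upper w -> Z w i 0 = 0.
    by move=> hw; rewrite zE // zi /qev ev0 mulr0.
  have := congr1 (fun V : 'cV_2 => V i 0) (eqZ g hg tau ht).
  rewrite /slash !mxE Zi; last exact: (upper_moebius (Gamma02_SL2Z hg) ht).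
  rewrite mulr0 (sum_pair _ ij) Zi // mulr0 addr0 => /esym/eqP; rewrite mulf_eq0 => /orP[/eqP //|/eqP Zj].
  case/eqP: Zt; apply/matrixP => x y; rewrite ord1 mxE.
  by case: (ord2P x ij) => ->; rewrite ?Zi.
(* Both q^mu_i and q^nu_i have multiplier d_i under T, so the exponents differ by an integer. *)
have /choice[n nE] : forall i, exists n : int, mu i = nu i + n%:~R.
  move=> i; have : ee (mu i - nu i) = 1.
    by rewrite eeD eeN (T_exponent zlaw (hz i) (z0 i) rT) nud divff // cexp_neq0.
  by move=> /cexp_eq1[e he]; exists e; rewrite -he addrC subrK.
(* Large enough for both exponents n0 + n_i of q in the twist to be nonnegative. *)
pose n0 := (absz (n 0%R) + absz (n 1%R))%N; pose e i := absz (n0%:Z + n i).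
have eE i : nu i + (e i)%:R = mu i + n0%:R.
  have h : (e i)%:Z = n0%:Z + n i.
    by rewrite /e /n0; case: (ord2P i (isT : 0 != 1 :> 'I_2)) => ->; lia.
  by rewrite nE -[(e i)%:R]/((e i)%:Z%:~R) h intrD -[(n0%:Z)%:~R]/(n0%:R : CC R) addrA addrAC.
pose zeta := twist z n0 e.
have hzeta i : conv (zeta i) := conv_twist n0 e hz i.
have zlaw' : fam_law rho' nu k zeta := twist_law eqZ hz zE eE.
have zcusp i : cuspg (ev (zeta i)) := cuspg_twist hz zE eE i cuspZ.
have zeta0 i : zeta i != 0.
  have [tau ht h] := ev_ex_neq0 (hz i) (z0 i); apply: contra_neq h => h.
  have := twistE hz zE eE i ht; rewrite -/zeta h zE // /qev ev0 mulr0 => /esym.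
  move: (qpow_neq0 (mu i) tau) (expf_neq0 n0 (ev_xs_neq0 ht)).
  by move: (qpow _ _) (_ ^+ n0) => x y /negbTE hx /negbTE hy /eqP; rewrite !mulf_eq0 hx hy => /eqP.
(* Stated for an ordered pair of components: exchanging them changes the sign of l_i - l_j, hence u
   into -u. *)
have main (i j : 'I_2) (w : int) : i != j -> coprimez w v -> l i - l j = w%:~R / v%:~R ->
    infinite_set (Sset M w v) ->
    large_primes_divide_denominators (Sset M w v) (z i) /\ unbounded_denominators (z i).
  (* An element p0 of S is an inert prime; it makes all norms of nonzero elements nonzero, which the
     arithmetic of [LL] requires. *)
  move=> ij wv lij hS; have [p0 [pp0 _ nr0 _] _] := infinite_gt 0 hS.
  have zL i' : LS sq (z i') by apply/LSP => t; exact: (Qadj_LL sqE pp0 nr0).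
  have zLS i' : LS sq (zeta i').
    apply: (LS_M sqE) => //; apply: (LS_M sqE); apply: (LS_X sqE); first exact: LS_fX.
    exact: (LS_hs sqE pp0 nr0).
  have r_irr : irr sq r.
    apply: Qdim2_irr r_deg2; apply: (Qadj_LL sqE pp0 nr0); rewrite -M_def; exact: Qadj_self.
  apply: (denominators_of_nonint sqE hS); first exact/LSP.
  have [Pb hP] := core_nonint sqE ode hs s_0 law r_root l_rat r_irr hzeta zlaw' zcusp zeta0 zLS
    ij v_gt1 wv lij pp0 nr0.
  exists Pb => p Sp hp; have [t [tp ht]] := hP p Sp hp; case: Sp => pp _ _ _.
  (* The twist multiplies z by q^e (x/q)^n0, which is p-integral below index p; so a p-integral z
     would give a p-integral [zeta] up to there, and t < p. *)
  apply: contrapT => h; apply: ht; have : fint (Op sq p) p (zeta i); last by apply.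
  apply: (fi_M sqE pp); last by move=> t' _; apply: contrapT => h'; apply: h; exists t'.
  apply: (fi_M sqE pp); apply: (fi_X sqE pp); first exact: fi_fX.
  by apply: (fi_exp sqE pp); apply: (fi_D pp); [exact: (fi_gs sqE pp)|apply: fi_N; exact: (fi_1 sq pp)].
have l01 : l 0 - l 1 = u%:~R / v%:~R by rewrite -AB_uv A_def B_def; ring.
split; first exact: (main 0 1).
apply: (main 1 0) => //; first by rewrite /coprimez gcdNz.
by rewrite -opprB l01 mulrNz mulNr.
Qed.
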